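(* Let $\mathcal M=\langle M,<,+,\dots\rangle$ be a (sufficiently) saturated semibounded o-minimal expansion of an ordered group, and $\mathcal C$ the class of all tall grids. Let $\mathcal E=\{E_b\}_{b\in I}$ be a definable family of relations $E_b\subseteq\prod_{i\in[r]}M^{d_i}$. Then $Zar^\infty(\mathcal E,\mathcal C)$ holds: there is $\alpha\in\mathbb R_{>0}$ such that for every $b\in I$, if $E_b$ contains no infinite grid belonging to $\mathcal C$, then $|E_b\cap B|\le\alpha\,\delta(B)$ for every finite $B\in\mathcal C$.
   Context: ''Definable'' means with parameters. A map $f$ is linear if $f(x+t)-f(x)=f(y+t)-f(y)$ whenever defined; a partial endomorphism is a linear map $f:(-c,c)\to M$ with $f(0)=0$; $\Lambda$ is the set of $\emptyset$-definable partial endomorphisms and $\mathcal B$ the collection of bounded definable sets. $\mathcal M$ is semibounded if every definable set is definable in $\langle M,<,+,0,\{\lambda\}_{\lambda\in\Lambda},\{B\}_{B\in\mathcal B}\rangle$. An open interval $I\subseteq M$ is short if a real closed field with universe $I$ is definable; an element $a\in M$ is short if $a=0$ or $(0,|a|)$ is short; a tuple $a\in M^k$ is short if $|a_1|+\dots+|a_k|$ is short, and tall otherwise. A grid $B=B_1\times\dots\times B_r$ ($B_i\subseteq M^{d_i}$) is tall if for every $i$ and all distinct $x,y\in B_i$, $x-y$ is tall; it is finite/infinite if each $B_i$ is. $\delta(B)=\sum_{1\le i_1<\dots<i_{r-1}\le r}\prod_{j=1}^{r-1}|B_{i_j}|$. *)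

(* Defs.v *)
From Stdlib Require Import List Reals.
From Stdlib Require ClassicalEpsilon.
From mathcomp Require ssralg ssrnum.
Import ListNotations.

(* Function symbols (e.g. +, 0) are represented by their graphs; this  *)
(* changes neither definable sets nor the cardinality of the language. *)
(* A relation symbol is interpreted as a predicate on lists (tuples);   *)
(* its arity is implicit in the interpretation.                         *)

Record structure := Structure {
  carrier : Type;
  rsym : Type;
  rinterp : rsym -> list carrier -> Prop }.

Inductive formula (S : Type) : Type :=
  | Feq : nat -> nat -> formula S
  | Frel : S -> list nat -> formula S
  | Fnot : formula S -> formula S
  | Fand : formula S -> formula S -> formula S
  | Fex : formula S -> formula S.         (* binds de Bruijn variable 0 *)

Arguments Feq {S}. Arguments Frel {S}. Arguments Fnot {S}.
Arguments Fand {S}. Arguments Fex {S}.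

Definition scons {A : Type} (a : A) (e : nat -> A) : nat -> A :=
  fun i => match i with 0 => a | S j => e j end.

Fixpoint sat (M : structure) (phi : formula (rsym M)) (e : nat -> carrier M) : Prop :=
  match phi with
  | Feq i j => e i = e j
  | Frel r vs => rinterp M r (map e vs)
  | Fnot psi => ~ sat M psi e
  | Fand psi chi => sat M psi e /\ sat M chi e
  | Fex psi => exists a, sat M psi (scons a e)
  end.

(* environment: the tuple x occupies variables 0..|x|-1, parameters after *)
Definition glue {A : Type} (x : list A) (p : nat -> A) : nat -> A :=
  fun i => match nth_error x i with Some a => a | None => p (i - length x) end.

Definition definable (M : structure) (n : nat) (X : list (carrier M) -> Prop) : Prop :=
  (forall x, X x -> length x = n) /\
  exists (phi : formula (rsym M)) (p : nat -> carrier M),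
    forall x, length x = n -> (X x <-> sat M phi (glue x p)).

Definition zdefinable (M : structure) (n : nat) (X : list (carrier M) -> Prop) : Prop :=
  (forall x, X x -> length x = n) /\
  exists (phi : formula (rsym M)),
    forall (p : nat -> carrier M) x, length x = n -> (X x <-> sat M phi (glue x p)).

(* kappa-saturation for kappa = (|L| + aleph_0)^+, in the equivalent form:
   every family of at most |L|+aleph_0 definable (with parameters) subsets of M
   with the finite intersection property has nonempty intersection. *)
Definition saturated (M : structure) : Prop :=
  forall (J : Type) (g : J -> (nat + rsym M)%type),
    (forall j1 j2, g j1 = g j2 -> j1 = j2) ->
    forall X : J -> list (carrier M) -> Prop,
      (forall j, definable M 1 (X j)) ->
      (forall js : list J, exists a, forall j, In j js -> X j [a]) ->
      exists a, forall j, X j [a].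

Record ogroup_data (M : structure) := OGroupData {
  olt : carrier M -> carrier M -> Prop;
  oadd : carrier M -> carrier M -> carrier M;
  ozero : carrier M;
  oopp : carrier M -> carrier M }.

Arguments olt {M}. Arguments oadd {M}. Arguments ozero {M}. Arguments oopp {M}.

Definition graph_lt {M} (G : ogroup_data M) : list (carrier M) -> Prop :=
  fun l => exists a b, l = [a; b] /\ olt G a b.
Definition graph_add {M} (G : ogroup_data M) : list (carrier M) -> Prop :=
  fun l => exists a b, l = [a; b; oadd G a b].
Definition graph_zero {M} (G : ogroup_data M) : list (carrier M) -> Prop :=
  fun l => l = [ozero G].

(* M is an expansion of the ordered group (M,<,+,0): (M,<,+,0) is an ordered
   group and <, +, 0 are in the language (i.e. 0-definable). *)
Definition is_ogroup_expansion (M : structure) (G : ogroup_data M) : Prop :=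
  (forall a, ~ olt G a a) /\
  (forall a b c, olt G a b -> olt G b c -> olt G a c) /\
  (forall a b, olt G a b \/ a = b \/ olt G b a) /\
  (forall a b c, oadd G a (oadd G b c) = oadd G (oadd G a b) c) /\
  (forall a, oadd G a (ozero G) = a /\ oadd G (ozero G) a = a) /\
  (forall a, oadd G a (oopp G a) = ozero G /\ oadd G (oopp G a) a = ozero G) /\
  (forall a b c, olt G a b -> olt G (oadd G a c) (oadd G b c) /\
                              olt G (oadd G c a) (oadd G c b)) /\
  zdefinable M 2 (graph_lt G) /\
  zdefinable M 3 (graph_add G) /\
  zdefinable M 1 (graph_zero G).

(* o-minimality: every definable subset of M is a finite union of points and
   open intervals with endpoints in M ∪ {±∞} (None = ∓∞). *)
Inductive piece (A : Type) :=
  | Ppoint : A -> piece A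
  | Pint : option A -> option A -> piece A.
Arguments Ppoint {A}. Arguments Pint {A}.

Definition in_piece {M} (G : ogroup_data M) (P : piece (carrier M)) (a : carrier M) : Prop :=
  match P with
  | Ppoint c => a = c
  | Pint lo hi =>
      match lo with None => True | Some l => olt G l a end /\
      match hi with None => True | Some h => olt G a h end
  end.

Definition o_minimal (M : structure) (G : ogroup_data M) : Prop :=
  forall X, definable M 1 X ->
    exists Ps : list (piece (carrier M)),
      forall a, X [a] <-> exists P, In P Ps /\ in_piece G P a.

Definition osub {M} (G : ogroup_data M) a b := oadd G a (oopp G b).

(* the interval (-c, c), c ∈ M ∪ {∞} (None = ∞) *)
Definition in_sym_int {M} (G : ogroup_data M) (c : option (carrier M)) (x : carrier M) :=
  match c with None => True | Some c => olt G (oopp G c) x /\ olt G x c end.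

Definition partial_endo {M} (G : ogroup_data M) (c : option (carrier M))
    (f : carrier M -> carrier M) : Prop :=
  match c with None => True | Some c => olt G (ozero G) c end /\
  f (ozero G) = ozero G /\
  forall x y t, in_sym_int G c x -> in_sym_int G c y ->
    in_sym_int G c (oadd G x t) -> in_sym_int G c (oadd G y t) ->
    osub G (f (oadd G x t)) (f x) = osub G (f (oadd G y t)) (f y).

Definition pgraph {M} (G : ogroup_data M) (c : option (carrier M))
    (f : carrier M -> carrier M) : list (carrier M) -> Prop :=
  fun l => exists x, l = [x; f x] /\ in_sym_int G c x.

Definition in_Lambda {M} (G : ogroup_data M) (R : list (carrier M) -> Prop) : Prop :=
  exists c f, partial_endo G c f /\ zdefinable M 2 (pgraph G c f) /\ R = pgraph G c f.

Definition bounded_definable {M} (G : ogroup_data M) (R : list (carrier M) -> Prop) : Prop :=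
  exists n, definable M n R /\
  exists lo hi, forall x, R x -> forall a, In a x -> olt G lo a /\ olt G a hi.

Definition reduct_rel {M} (G : ogroup_data M) (R : list (carrier M) -> Prop) : Prop :=
  R = graph_lt G \/ R = graph_add G \/ R = graph_zero G \/
  in_Lambda G R \/ bounded_definable G R.

Definition semibounded_reduct {M} (G : ogroup_data M) : structure :=
  {| carrier := carrier M;
     rsym := { R : list (carrier M) -> Prop | reduct_rel G R };
     rinterp := fun R l => proj1_sig R l |}.

Definition semibounded (M : structure) (G : ogroup_data M) : Prop :=
  forall n X, definable M n X -> definable (semibounded_reduct G) n X.

(* The open interval (a,b) is short: a real closed field with universe (a,b)
   is definable, i.e. there is a real closed field K and a bijection
   h : K -> (a,b) such that the field operations transported by h
   are definable (with parameters) in M. *)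
Module RCFpart.
From mathcomp Require Import ssreflect ssrfun ssrbool ssralg ssrnum.
Local Open Scope ring_scope.
Definition short_interval {M} (G : ogroup_data M) (a b : carrier M) : Prop :=
  exists (K : rcfType) (h : K -> carrier M),
    (forall u v, h u = h v -> u = v) /\
    (forall x, olt G a x /\ olt G x b <-> exists u, h u = x) /\
    definable M 3 (fun l => exists u v, l = (h u :: h v :: h (u + v) :: nil)%list) /\
    definable M 3 (fun l => exists u v, l = (h u :: h v :: h (u * v) :: nil)%list).
End RCFpart.
Notation short_interval := RCFpart.short_interval.

Definition oabs {M} (G : ogroup_data M) (a : carrier M) : carrier M :=
  ClassicalEpsilon.epsilon (inhabits a)
    (fun b => (olt G a (ozero G) /\ b = oopp G a) \/ (~ olt G a (ozero G) /\ b = a)).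

Definition short_elt {M} (G : ogroup_data M) (a : carrier M) : Prop :=
  a = ozero G \/ short_interval G (ozero G) (oabs G a).

Definition sum_abs {M} (G : ogroup_data M) (x : list (carrier M)) : carrier M :=
  fold_right (fun a s => oadd G (oabs G a) s) (ozero G) x.

Definition short_tuple {M} (G : ogroup_data M) (x : list (carrier M)) : Prop :=
  short_elt G (sum_abs G x).

Definition tall_tuple {M} (G : ogroup_data M) (x : list (carrier M)) : Prop :=
  ~ short_tuple G x.

Definition tsub {M} (G : ogroup_data M) (x y : list (carrier M)) : list (carrier M) :=
  map (fun p => osub G (fst p) (snd p)) (combine x y).

Definition tall_set {M} (G : ogroup_data M) (B : list (carrier M) -> Prop) : Prop :=
  forall x y, B x -> B y -> x <> y -> tall_tuple G (tsub G x y).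

Definition finite_set {A : Type} (B : A -> Prop) : Prop :=
  exists l : list A, forall x, B x -> In x l.

Fixpoint choices {A : Type} (ls : list (list A)) : list (list A) :=
  match ls with
  | [] => [[]]
  | l :: ls' => flat_map (fun x => map (cons x) (choices ls')) l
  end.

Fixpoint prod_nat (l : list nat) : nat :=
  match l with [] => 1 | n :: l' => n * prod_nat l' end.

(* δ(B) = Σ_j Π_{i ≠ j} |B_i|  (= Σ over (r-1)-subsets of [r]) *)
Fixpoint delta_aux (pre : list nat) (l : list nat) : nat :=
  match l with
  | [] => 0
  | n :: l' => prod_nat (pre ++ l') + delta_aux (pre ++ [n]) l'
  end.
Definition delta (sizes : list nat) : nat := delta_aux [] sizes.

(* Main.v *)
(** Call e > 0 tall if (0, e) is not short. On a subinterval of length e / 2^n, a definable function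
on an interval of length e is affine, strictly convex or strictly concave. If f is strictly convex,
the differences of its slopes, as germs modulo negligible germs and with composition as product,
generate an ordered ring whose fraction field is real closed and definable on an interval, so the
interval is short. Hence definable functions are affine on smaller tall intervals and, by induction
on the dimension, on smaller tall boxes.

Let q be tall and small compared with the gaps of a finite tall grid B. Discard from E_b the points
having a block over which no coordinate projection of the fiber contains an interval of length q. By
uniform finiteness each such step removes O(delta(B)) points of B. If a point survives more steps
than there are coordinates, E_b contains an affine sheet over a tall box, of maximal dimension with
respect to the remaining number of steps. Maximality forces, for every block, a direction of the
sheet contained in that block, and moving along these directions gives an infinite tall grid. *)

(* The group carries no multiplication, so a slope cannot be a quotient: it appears only as the germ
   at 0+ of an increment, and everything about it is a comparison of increments for all small [x].
   The obstacle is that such germs may have incomparable sizes. A convex function is therefore first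
   restricted to an interval where each gap between slopes dominates some gap at every other point;
   there a germ counts as zero when it lies below all gaps, and suprema of parameters solve the
   equations that make the germs a field. No dimension theory is used. A function on a box is made
   affine one coordinate at a time, by definable choice and the one-variable case, and sizes survive
   because only finitely many halvings are spent and half of a tall element is tall. Sheets are
   graphs over pivot coordinates, and the number of pivots replaces dimension. It is at most m, the
   number of coordinates of the grid, so m + 1 stages always leave a number of pivots that can no
   longer be raised. The bound for one stage is uniform because the number of breakpoints of the
   fibers is bounded, by saturation. *)
Require Import Defs.
From Stdlib Require Import FinFun List Arith Lia ZArith Classical ClassicalEpsilon.
From Stdlib Require Import FunctionalExtensionality PropExtensionality.
From HB Require Import structures.
From mathcomp Require Import ssreflect.
From mathcomp Require all_boot all_order all_algebra boolp generic_quotient ring lra.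
Import ListNotations.

(** * Definable sets and functions *)

Section Definability.
Context {M : structure}.
Notation T := (carrier M).
Notation env := (nat -> T).

Definition eshift (e : env) : env := fun i => e (S i).

Definition renv (r : nat -> nat + T) (e : env) : env :=
  fun i => match r i with inl j => e j | inr c => c end.

(* Definability with parameters of a predicate on assignments: the variables of
   the formula are filled either with coordinates of the assignment or with
   parameters. *)
Definition Def (P : env -> Prop) : Prop :=
  exists (phi : formula (rsym M)) (r : nat -> nat + T),
    forall e, P e <-> sat M phi (renv r e).

(** The value is compared with coordinate 0 and the arguments are shifted by one, which is the shape
    that [def_ex] asks for when a term is replaced by a quantified variable. *)
Definition DT (t : env -> T) : Prop := Def (fun e => e 0 = t (eshift e)).

Lemma sat_ext phi : forall e e' : env,
  (forall i, e i = e' i) -> sat M phi e <-> sat M phi e'.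
Proof.
elim: phi => [i j|r vs|p IH|p IHp q IHq|p IH] e e' H /=.
- by rewrite !H.
- by have -> : map e vs = map e' vs by apply: map_ext.
- by rewrite (IH _ _ H).
- by rewrite (IHp _ _ H) (IHq _ _ H).
- by split=> -[a Ha]; exists a; move: Ha; rewrite (IH (scons a e) (scons a e')) //; case=> /=.
Qed.

Definition up (f : nat -> nat) (i : nat) : nat :=
  match i with 0 => 0 | S j => S (f j) end.

Fixpoint ren {S : Type} (f : nat -> nat) (phi : formula S) : formula S :=
  match phi with
  | Feq i j => Feq (f i) (f j)
  | Frel r vs => Frel r (map f vs)
  | Fnot p => Fnot (ren f p)
  | Fand p q => Fand (ren f p) (ren f q)
  | Fex p => Fex (ren (up f) p)
  end.

Lemma sat_ren phi : forall f (e : env),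
  sat M (ren f phi) e <-> sat M phi (fun i => e (f i)).
Proof.
elim: phi => [i j|r vs|p IH|p IHp q IHq|p IH] f e //=.
- by rewrite map_map.
- by rewrite IH.
- by rewrite IHp IHq.
- by split=> -[a Ha]; exists a; move: Ha; rewrite IH;
  rewrite (sat_ext p (fun i => scons a e (up f i)) (scons a (fun i => e (f i)))) //; case.
Qed.

Lemma Def_ext (P Q : env -> Prop) : (forall e, P e <-> Q e) -> Def P -> Def Q.
Proof. by move=> H [phi [r Hr]]; exists phi, r => e; rewrite -H. Qed.

Lemma def_not P : Def P -> Def (fun e => ~ P e).
Proof. by move=> [phi [r H]]; exists (Fnot phi), r => e /=; rewrite H. Qed.

Lemma def_and P Q : Def P -> Def Q -> Def (fun e => P e /\ Q e).
Proof.
move=> [p [r H]] [q [s K]].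
(* The two formulas fill their variables differently, so the first is moved to the even variables
   and the second to the odd ones. *)
exists (Fand (ren (fun i => 2 * i) p) (ren (fun i => 2 * i + 1) q)),
  (fun i => if Nat.even i then r (Nat.div2 i) else s (Nat.div2 i)) => e /=.
rewrite H K !sat_ren.
rewrite (sat_ext p _ (renv r e)); last first.
  by move=> i; rewrite /renv -[i + (i + 0)]/(2 * i) Nat.even_mul Nat.div2_double.
rewrite (sat_ext q _ (renv s e)) //.
by move=> i; rewrite /renv -[i + (i + 0)]/(2 * i) Nat.even_add Nat.even_mul
  Nat.add_1_r Nat.div2_succ_double.
Qed.

Lemma def_or P Q : Def P -> Def Q -> Def (fun e => P e \/ Q e).
Proof.
move=> HP HQ; apply: (Def_ext (fun e => ~ (~ P e /\ ~ Q e))); first by move=> e; tauto.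
by apply/def_not/def_and; apply: def_not.
Qed.

Lemma def_imp P Q : Def P -> Def Q -> Def (fun e => P e -> Q e).
Proof.
move=> HP HQ; apply: (Def_ext (fun e => ~ (P e /\ ~ Q e))); first by move=> e; tauto.
by apply/def_not/def_and => //; apply: def_not.
Qed.

Lemma def_iff P Q : Def P -> Def Q -> Def (fun e => P e <-> Q e).
Proof. by move=> HP HQ; apply: def_and; apply: def_imp. Qed.

Lemma def_ex (Q : env -> T -> Prop) :
  Def (fun e => Q (eshift e) (e 0)) -> Def (fun e => exists a, Q e a).
Proof.
move=> [p [r H]].
(* Every variable of the formula that reads coordinate 0 is merged into the bound variable; the
   other variables move up by one. *)
exists (Fex (ren (fun i => match r i with inl 0 => 0 | _ => S i end) p)),
  (fun i => match r i with inl (S j) => inl j | x => x end) => e /=.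
have X a : Q e a <-> sat M p (renv r (scons a e)) by rewrite -H.
split=> -[a Ha]; exists a; move: Ha; rewrite X sat_ren; apply sat_ext => i;
  by rewrite /renv; case Er: (r i) => [[|j]|c] //=; rewrite Er.
Qed.

Lemma def_all (Q : env -> T -> Prop) :
  Def (fun e => Q (eshift e) (e 0)) -> Def (fun e => forall a, Q e a).
Proof.
move=> H; apply: (Def_ext (fun e => ~ exists a, ~ Q e a)).
  by move=> e; split=> [K a|K [a Ha]]; [apply: NNPP => L; apply: K; exists a|apply: Ha].
by apply: def_not; apply: def_ex; apply: def_not.
Qed.

Lemma def_const (P : Prop) : Def (fun _ => P).
Proof.
case: (classic P) => H.
- by exists (Feq 0 0), inl => e /=; tauto.
- by exists (Fnot (Feq 0 0)), inl => e /=; tauto.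
Qed.

Lemma def_ren P (r : nat -> nat + T) : Def P -> Def (fun e => P (renv r e)).
Proof.
move=> [p [s H]]; exists p, (fun i => match s i with inl j => r j | x => x end) => e.
by rewrite H; apply sat_ext => i; rewrite /renv; case: (s i).
Qed.

Lemma dt_var i : DT (fun e => e i).
Proof. by exists (Feq 0 1), (fun j => inl (match j with 0 => 0 | _ => S i end)) => e. Qed.

Lemma dt_const c : DT (fun _ => c).
Proof. by exists (Feq 0 1), (fun j => match j with 0 => inl 0 | _ => inr c end) => e. Qed.

(** A crude bound above all variables that are read: sums serve as maxima, and under [Fex] the shift
    is ignored because it only lowers the variables. *)
Fixpoint mv {A : Type} (phi : formula A) : nat :=
  match phi with
  | Feq i j => S (i + j)
  | Frel r vs => S (list_sum vs)
  | Fnot p => mv p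
  | Fand p q => mv p + mv q
  | Fex p => mv p
  end.

Lemma sat_dep phi : forall e e' : env,
  (forall i, i < mv phi -> e i = e' i) -> sat M phi e <-> sat M phi e'.
Proof.
elim: phi => [i j|r vs|p IH|p IHp q IHq|p IH] e e' H /=; simpl in H.
- by rewrite !H //; lia.
- suff -> : map e vs = map e' vs by [].
  apply: map_ext_in => a Ha; apply: H.
  suff : a <= list_sum vs by lia.
  by elim: vs Ha => //= b l IH [->|/IH]; lia.
- by rewrite (IH _ _ H).
- by rewrite (IHp e e') ?(IHq e e') // => i Hi; apply: H; lia.
- by split=> -[a Ha]; exists a; move: Ha; rewrite (IH (scons a e) (scons a e')) //;
    case=> //= n Hn; apply: H; lia.
Qed.

(** A formula reads finitely many variables. This is what allows substitution into infinitely many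
    coordinates to be done one coordinate at a time in [def_sub]. *)
Lemma def_dep P : Def P ->
  exists n, forall e e' : env, (forall i, i < n -> e i = e' i) -> P e <-> P e'.
Proof.
move=> [p [r H]].
exists (S (list_sum (map (fun i => match r i with inl j => j | _ => 0 end) (seq 0 (mv p))))).
move=> e e' K; rewrite !H; apply: sat_dep => i Hi; rewrite /renv.
case Er: (r i) => [j|//]; apply: K.
suff : j <= list_sum (map (fun i => match r i with inl j => j | _ => 0 end) (seq 0 (mv p))) by lia.
have : In i (seq 0 (mv p)) by apply/in_seq; lia.
elim: (seq 0 (mv p)) => //= b l IH [Hb|/IH]; last by lia.
by rewrite Hb Er; lia.
Qed.

Lemma dt_shift t : DT t -> DT (fun e => t (eshift e)).
Proof.
move=> H.
apply: (Def_ext _ _ _ (def_ren _ (fun i => match i with 0 => inl 0 | S j => inl (S (S j)) end) H)).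
by move=> e.
Qed.

Lemma def_sub P (s : nat -> env -> T) :
  Def P -> (forall i, DT (s i)) -> Def (fun e => P (fun i => s i e)).
Proof.
move=> HP Hs; have [n Hn] := def_dep _ HP.
(* Variables and constants are substituted by renaming. The induction is on a bound [k] beyond which
   all terms are of this kind; the others are removed one by one by quantifying their value. *)
pose simple (t : env -> T) := exists x : nat + T, forall e, t e = match x with inl j => e j | inr c => c end.
suff C : forall k Q w, Def Q -> (forall i, DT (w i)) -> (forall i, k <= i -> simple (w i)) ->
    Def (fun e => Q (fun i => w i e)).
  apply: (Def_ext (fun e => P (fun i => (if i <? n then s i else fun e => e 0) e))).
    move=> e; apply: Hn => i Hi.
    by have -> : (i <? n) = true by apply/Nat.ltb_lt.
  apply: (C n P (fun i => if i <? n then s i else fun e => e 0)) => // i.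
    by case: (i <? n) => //; apply: dt_var.
  by move=> /Nat.ltb_ge ->; exists (inl 0).
elim=> [|k IH] Q w HQ Hw Hk.
- have F i : exists x : nat + T, forall e, w i e = match x with inl j => e j | inr c => c end.
    by apply: Hk; lia.
  pose r i := proj1_sig (constructive_indefinite_description _ (F i)).
  apply: (Def_ext _ _ _ (def_ren _ r HQ)) => e.
  suff -> : renv r e = (fun i => w i e) by [].
  apply: functional_extensionality => i; rewrite /renv /r.
  by case: constructive_indefinite_description => x Hx /=; rewrite Hx.
- apply: (Def_ext (fun e => exists a, a = w k e /\ Q (fun i => if i =? k then a else w i e))).
    move=> e.
    have X : (fun i => if i =? k then w k e else w i e) = (fun i => w i e).
      by apply: functional_extensionality => i; case: (Nat.eqb_spec i k) => [->|].
    by split=> [[a [-> H]]|H]; [rewrite -X|exists (w k e); rewrite X].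
  apply: def_ex; apply: def_and; first exact: Hw.
  pose w' i (e : env) := if i =? k then e 0 else w i (eshift e).
  apply: (IH Q w') => // i.
    rewrite /w'; case: (i =? k); first exact: dt_var.
    exact: dt_shift.
  move=> Hi; rewrite /w'; case: (Nat.eqb_spec i k) => [_|Hne]; first by exists (inl 0).
  have [|[j|c] Hx] := Hk i; first by lia.
    by exists (inl (S j)) => e; rewrite Hx.
  by exists (inr c) => e; rewrite Hx.
Qed.

Definition dp1 (R : T -> Prop) := Def (fun e => R (e 0)).
Definition dp2 (R : T -> T -> Prop) := Def (fun e => R (e 0) (e 1)).
Definition dp3 (R : T -> T -> T -> Prop) := Def (fun e => R (e 0) (e 1) (e 2)).
Definition dp4 (R : T -> T -> T -> T -> Prop) := Def (fun e => R (e 0) (e 1) (e 2) (e 3)).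
Definition df1 (f : T -> T) := dp2 (fun y x => y = f x).
Definition df2 (f : T -> T -> T) := dp3 (fun y x z => y = f x z).
Definition df3 (f : T -> T -> T -> T) := dp4 (fun y x z w => y = f x z w).

Definition sel (a b c d : env -> T) (i : nat) : env -> T :=
  match i with 0 => a | 1 => b | 2 => c | _ => d end.

Lemma dt_sel a b c d : DT a -> DT b -> DT c -> DT d -> forall i, DT (sel a b c d i).
Proof. by move=> ? ? ? ? [|[|[|i]]]. Qed.

Lemma def_p1 R a : dp1 R -> DT a -> Def (fun e => R (a e)).
Proof. by move=> H Ha; exact (def_sub (fun e => R (e 0)) (sel a a a a) H (dt_sel a a a a Ha Ha Ha Ha)). Qed.
Lemma def_p2 R a b : dp2 R -> DT a -> DT b -> Def (fun e => R (a e) (b e)).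
Proof. by move=> H Ha Hb; exact (def_sub (fun e => R (e 0) (e 1)) (sel a b b b) H (dt_sel a b b b Ha Hb Hb Hb)). Qed.
Lemma def_p3 R a b c : dp3 R -> DT a -> DT b -> DT c -> Def (fun e => R (a e) (b e) (c e)).
Proof. by move=> H Ha Hb Hc; exact (def_sub (fun e => R (e 0) (e 1) (e 2)) (sel a b c c) H (dt_sel a b c c Ha Hb Hc Hc)). Qed.
Lemma def_p4 R a b c d : dp4 R -> DT a -> DT b -> DT c -> DT d ->
  Def (fun e => R (a e) (b e) (c e) (d e)).
Proof. by move=> H Ha Hb Hc Hd; exact (def_sub (fun e => R (e 0) (e 1) (e 2) (e 3)) (sel a b c d) H (dt_sel a b c d Ha Hb Hc Hd)). Qed.

Lemma dt_f1 f a : df1 f -> DT a -> DT (fun e => f (a e)).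
Proof.
move=> H Ha.
exact (def_p2 (fun y x => y = f x) (fun e => e 0) (fun e => a (eshift e)) H (dt_var 0) (dt_shift _ Ha)).
Qed.
Lemma dt_f2 f a b : df2 f -> DT a -> DT b -> DT (fun e => f (a e) (b e)).
Proof.
move=> H Ha Hb.
exact (def_p3 (fun y x z => y = f x z) (fun e => e 0) (fun e => a (eshift e)) (fun e => b (eshift e)) H
  (dt_var 0) (dt_shift _ Ha) (dt_shift _ Hb)).
Qed.
Lemma dt_f3 f a b c : df3 f -> DT a -> DT b -> DT c -> DT (fun e => f (a e) (b e) (c e)).
Proof.
move=> H Ha Hb Hc.
exact (def_p4 (fun y x z w => y = f x z w) (fun e => e 0) (fun e => a (eshift e)) (fun e => b (eshift e)) (fun e => c (eshift e)) H
  (dt_var 0) (dt_shift _ Ha) (dt_shift _ Hb) (dt_shift _ Hc)).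
Qed.
Lemma dt_sub F (s : nat -> env -> T) : DT F -> (forall i, DT (s i)) -> DT (fun e => F (fun i => s i e)).
Proof.
move=> HF Hs.
refine (def_sub _ (fun i e => match i with 0 => e 0 | S j => s j (eshift e) end) HF _).
by case=> [|i]; [exact: dt_var|apply: dt_shift].
Qed.
Lemma df1_DT f : df1 f <-> DT (fun e => f (e 0)).
Proof. by []. Qed.

Lemma def_eq a b : DT a -> DT b -> Def (fun e => a e = b e).
Proof. by apply: (def_p2 (fun x y => x = y)); exists (Feq 0 1), inl => e. Qed.

Lemma definable_Def n X : definable M n X -> Def (fun e => X (map e (seq 0 n))).
Proof.
move=> [_ [phi [p H]]].
exists phi, (fun i => if i <? n then inl i else inr (p (i - n))) => e.
rewrite H ?length_map ?length_seq //; apply sat_ext => i; rewrite /glue /renv.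
rewrite nth_error_map length_map length_seq.
case: (Nat.ltb_spec i n) => Hi; last by rewrite (proj2 (nth_error_None _ _)) // length_seq.
by rewrite (nth_error_nth' _ 0) ?length_seq // seq_nth.
Qed.

Lemma Def_definable n P d : Def P ->
  definable M n (fun l => length l = n /\ P (fun i => nth i l d)).
Proof.
move=> [phi [r H]]; split=> [x []//|].
(* The tuple occupies the variables below [n]; variable [n] is a parameter equal to the default [d],
   read by coordinates outside the tuple, and the constant at [i] sits at [n + S i]. *)
exists (ren (fun i => match r i with inl j => if j <? n then j else n | inr _ => n + S i end) phi),
  (fun i => match i with 0 => d | S j => match r j with inl _ => d | inr c => c end end) => x Hx.
rewrite sat_ren H.
have X : forall i, glue x (fun i => match i with 0 => d | S j => match r j with inl _ => d | inr c => c end end)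
   (match r i with inl j => if j <? n then j else n | inr _ => n + S i end)
   = renv r (fun i => nth i x d) i.
  move=> i; rewrite /renv /glue; case Er: (r i) => [j|c].
    case: (Nat.ltb_spec j n) => Hj; first by rewrite (nth_error_nth' _ d) ?Hx.
    by rewrite (proj2 (nth_error_None _ _)) ?Hx // Nat.sub_diag nth_overflow ?Hx.
  rewrite (proj2 (nth_error_None _ _)); last by rewrite Hx; lia.
  by rewrite Hx (_ : n + S i - n = S i) ?Er //; lia.
by rewrite (sat_ext _ _ _ X); tauto.
Qed.

End Definability.

(** * Order and group structure *)

Record omg := Omg {
  om_M : structure;
  om_G : ogroup_data om_M;
  om_grp : is_ogroup_expansion om_M om_G;
  om_omin : o_minimal om_M om_G;
  om_sat : saturated om_M }.

Declare Scope og_scope.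
Delimit Scope og_scope with og.
Definition ole {M} (G : ogroup_data M) x y := ~ olt G y x.

Section Basics.
Context {OS : omg}.
Local Notation M := (om_M OS).
Local Notation G := (om_G OS).
Local Notation T := (carrier (om_M OS)).
Local Notation env := (nat -> carrier (om_M OS)).
Local Notation "0" := (ozero G) : og_scope.
Local Notation "x + y" := (oadd G x y) : og_scope.
Local Notation "- x" := (oopp G x) : og_scope.
Local Notation "x - y" := (osub G x y) : og_scope.
Local Notation "x < y" := (olt G x y) : og_scope.
Local Notation "x <= y" := (ole G x y) : og_scope.
Local Notation "x < y < z" := (olt G x y /\ olt G y z) : og_scope.
Local Notation "x <= y <= z" := (ole G x y /\ ole G y z) : og_scope.
Local Notation "x < y <= z" := (olt G x y /\ ole G y z) : og_scope.
Local Notation "x <= y < z" := (ole G x y /\ olt G y z) : og_scope.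
Local Open Scope og_scope.

Lemma lt_irr (a : T) : ~ a < a. Proof. by case: (om_grp OS) => H _; apply: H. Qed.
Lemma lt_tr (b a c : T) : a < b -> b < c -> a < c.
Proof. by case: (om_grp OS) => _ [H _]; apply: H. Qed.
Lemma lt_tot (a b : T) : a < b \/ a = b \/ b < a.
Proof. by case: (om_grp OS) => _ [_ [H _]]; apply: H. Qed.
Lemma addA (a b c : T) : a + (b + c) = a + b + c.
Proof. by case: (om_grp OS) => _ [_ [_ [H _]]]; apply: H. Qed.
Lemma add0 (a : T) : a + 0 = a.
Proof. by case: (om_grp OS) => _ [_ [_ [_ [H _]]]]; case: (H a). Qed.
Lemma add0l (a : T) : 0 + a = a.
Proof. by case: (om_grp OS) => _ [_ [_ [_ [H _]]]]; case: (H a). Qed.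
Lemma addN (a : T) : a + - a = 0.
Proof. by case: (om_grp OS) => _ [_ [_ [_ [_ [H _]]]]]; case: (H a). Qed.
Lemma addNl (a : T) : - a + a = 0.
Proof. by case: (om_grp OS) => _ [_ [_ [_ [_ [H _]]]]]; case: (H a). Qed.
Lemma lt_addr (c a b : T) : a < b -> a + c < b + c.
Proof. by case: (om_grp OS) => _ [_ [_ [_ [_ [_ [H _]]]]]] L; case: (H a b c L). Qed.
Lemma lt_addl (c a b : T) : a < b -> c + a < c + b.
Proof. by case: (om_grp OS) => _ [_ [_ [_ [_ [_ [H _]]]]]] L; case: (H a b c L). Qed.

Lemma zdef_def n X : zdefinable M n X -> definable M n X.
Proof. by move=> [H [phi K]]; split=> //; exists phi, (fun _ => 0) => x Hx; apply: K. Qed.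

Lemma dp_lt : dp2 (olt G).
Proof.
case: (om_grp OS) => _ [_ [_ [_ [_ [_ [_ [/zdef_def /definable_Def H _]]]]]]].
apply: Def_ext H => e /=; split=> [[a [b [[-> ->] L]]]|L] //.
by exists (e 0%nat), (e 1%nat).
Qed.
Lemma df_add : df2 (oadd G).
Proof.
case: (om_grp OS) => _ [_ [_ [_ [_ [_ [_ [_ [/zdef_def /definable_Def H _]]]]]]]].
have := def_ren _ (fun i => match i with O => inl 1%nat | 1%nat => inl 2%nat | _ => inl 0%nat end) H.
apply: Def_ext => e /=; rewrite /renv /=; split=> [[a [b [-> -> ->]]]|->] //.
by exists (e 1%nat), (e 2%nat).
Qed.

Lemma def_lt a b : DT a -> DT b -> Def (fun e => olt G (a e) (b e)).
Proof. exact: (def_p2 _ _ _ dp_lt). Qed.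
Lemma def_le a b : DT a -> DT b -> Def (fun e => ole G (a e) (b e)).
Proof. by move=> *; apply: def_not; apply: def_lt. Qed.
Lemma dt_add a b : DT a -> DT b -> DT (fun e => oadd G (a e) (b e)).
Proof. exact: (dt_f2 _ _ _ df_add). Qed.

Lemma le_lt_tr (b a c : T) : a <= b -> b < c -> a < c.
Proof. by move=> H L; case: (lt_tot a b) => [K|[->|/H]] //; apply: lt_tr L. Qed.
Lemma lt_le_tr (b a c : T) : a < b -> b <= c -> a < c.
Proof. by move=> L H; case: (lt_tot b c) => [K|[<-|/H]] //; apply: lt_tr K. Qed.
Lemma ltW (a b : T) : a < b -> a <= b.
Proof. by move=> L K; apply: (lt_irr a); apply: lt_tr K. Qed.
Lemma leR (a : T) : a <= a. Proof. exact: lt_irr. Qed.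
Lemma le_tr (b a c : T) : a <= b -> b <= c -> a <= c.
Proof. by move=> H K L; apply: K; apply: lt_le_tr H. Qed.
Lemma nle (a b : T) : ~ a <= b <-> b < a.
Proof. by split=> [/NNPP|H /(_ H)]. Qed.
Lemma le_anti (a b : T) : a <= b -> b <= a -> a = b.
Proof. by move=> H K; case: (lt_tot a b) => [/K|[->|/H]]. Qed.
Lemma lt_le_dec (a b : T) : a < b \/ b <= a.
Proof. by case: (classic (a < b)) => H; [left|right]. Qed.
Lemma le_eqlt (a b : T) : a <= b -> a = b \/ a < b.
Proof. by move=> H; case: (lt_tot a b) => [|[|/H]]; tauto. Qed.

(** The form in which o-minimality is used: membership can change only at listed points. The tested
    interval is closed, so isolated points and endpoints must be listed too. *)
Definition bps (S : T -> Prop) (Ls : list T) : Prop :=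
  forall x y, x <= y -> (forall l, In l Ls -> ~ (x <= l <= y)) -> S x <-> S y.

Lemma omin_bp S : dp1 S -> exists Ls, bps S Ls.
Proof.
move=> HS.
have [Ps HPs] := om_omin OS _ (Def_definable 1 _ 0 HS).
have {}HPs a : S a <-> exists P, In P Ps /\ in_piece G P a by rewrite -HPs /=; tauto.
pose ends (P : piece T) := match P with Ppoint c => [c]
  | Pint lo hi => (match lo with Some l => [l] | None => [] end) ++
                  (match hi with Some l => [l] | None => [] end) end.
exists (flat_map ends Ps) => x y Lxy HL.
suff X P : In P Ps -> in_piece G P x <-> in_piece G P y.
  by rewrite !HPs; split=> -[P [HP KP]]; exists P; split=> //; apply/(X P HP).
move=> HP.
have {}HL l : In l (ends P) -> ~ (x <= l <= y).
  by move=> Hl; apply: HL; apply/in_flat_map; exists P.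
have cmp l : In l (ends P) -> (l < x <-> l < y) /\ (x < l <-> y < l) /\ x <> l /\ y <> l.
  move=> /HL H; case: (lt_le_dec l x) => Hx.
    have Hy := lt_le_tr _ _ _ Hx Lxy.
    have := ltW _ _ Hx; have := ltW _ _ Hy; rewrite /ole => A B.
    split=> //; split; first by tauto.
    by split=> E; [rewrite E in Hx; case: (lt_irr l)|rewrite E in Hy; case: (lt_irr l)].
  case: (lt_le_dec y l) => Hy; last by case: H.
  have Hx' := le_lt_tr _ _ _ Lxy Hy.
  have := ltW _ _ Hx'; have := ltW _ _ Hy; rewrite /ole => A B.
  split; first by tauto.
  split=> //.
  by split=> E; [rewrite E in Hx'; case: (lt_irr l)|rewrite E in Hy; case: (lt_irr l)].
case: P {HP HL} cmp => [c|lo hi] cmp /=.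
  by have [|_ [_ [A B]]] := cmp c; [left|split].
have A : match lo with None => True | Some l => l < x end <-> match lo with None => True | Some l => l < y end.
  by case: lo cmp => [l|] cmp //; have [|? _] := cmp l; [left|].
have B : match hi with None => True | Some l => x < l end <-> match hi with None => True | Some l => y < l end.
  case: hi cmp => [l|] cmp //; have [|_ [? _]] := cmp l; last by [].
  by apply/in_app_iff; right; left.
by rewrite A B.
Qed.

(** When [P] has no largest element and its complement no smallest one, the listed points can be
    pushed out of the interval from [h] to [x] one by one: a point on either side of the cut is
    passed without crossing the cut. *)
Lemma narrow (P : T -> Prop) Ls :
  (forall x y, P y -> x <= y -> P x) ->
  (forall l, P l -> exists l', l < l' /\ P l') ->
  (forall l, ~ P l -> exists l', l' < l /\ ~ P l') ->
  forall h x, P h -> ~ P x -> exists h' x',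
    h <= h' /\ x' <= x /\ P h' /\ ~ P x' /\ forall l, In l Ls -> ~ (h' <= l <= x').
Proof.
move=> Dn U L; elim: Ls => [|a Ls IH] h x Ph Px.
  by exists h, x; split; [exact: leR|split; [exact: leR|]].
have [h1 [x1 [H1 [H2 [P1 [P2 H3]]]]]] := IH h x Ph Px.
have lt12 : h1 < x1 by apply/nle => K; apply: P2; apply: Dn K.
case: (classic (P a)) => Pa.
- have [l [al Pl]] := U a Pa.
  have [m [hm [am Pm]]] : exists m, h1 <= m /\ a < m /\ P m.
    case: (lt_le_dec h1 l) => K; first by exists l; split; [exact: ltW|].
    by exists h1; split; [exact: leR|split=> //; apply: lt_le_tr al _].
  exists m, x1; split; first by apply: le_tr hm.
  do 3!split=> //; move=> l0 [<-|Hl] [A B]; first exact: A.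
  by apply: (H3 l0 Hl); split=> //; apply: le_tr A.
- have [l [al Pl]] := L a Pa.
  have [m [hm [am Pm]]] : exists m, m <= x1 /\ m < a /\ ~ P m.
    case: (lt_le_dec l x1) => K; first by exists l; split; [exact: ltW|].
    by exists x1; split; [exact: leR|split=> //; apply: le_lt_tr al].
  exists h1, m; do 2!(split; first by [|apply: le_tr H2]).
  do 2!split=> //; move=> l0 [<-|Hl] [A B]; first exact: B.
  by apply: (H3 l0 Hl); split=> //; apply: le_tr hm.
Qed.

(** A gap would leave room to avoid all breakpoints of [P] by [narrow], while [P] still changes on
    the remaining interval. Realised cuts are the source of all suprema below. *)
Lemma dcut (P : T -> Prop) h x : dp1 P -> (forall x y, P y -> x <= y -> P x) -> P h -> ~ P x ->
  (exists m, P m /\ forall l, m < l -> ~ P l) \/ (exists m, ~ P m /\ forall l, l < m -> P l).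
Proof.
move=> dP Dn Ph Px; apply: NNPP => K.
have [Ls HLs] := omin_bp P dP.
have [||h' [x' [_ [_ [Ph' [Px' HL]]]]]] := narrow P Ls Dn _ _ h x Ph Px.
- move=> l Pl; apply: NNPP => N; apply: K; left; exists l; split=> // l' ll' Pl'; apply: N.
  by exists l'.
- move=> l Pl; apply: NNPP => N; apply: K; right; exists l; split=> // l' ll'.
  by apply: NNPP => Pl'; apply: N; exists l'.
have lt12 : h' < x' by apply/nle => L; apply: Px'; apply: Dn L.
by apply: Px'; apply/(HLs h' x' (ltW _ _ lt12) HL).
Qed.

Lemma oppK (a : T) : - - a = a.
Proof. by rewrite -[LHS]add0 -(addNl a) addA addNl add0l. Qed.
Lemma addI (a b c : T) : a + b = a + c -> b = c.
Proof. by move=> E; rewrite -(add0l b) -(addNl a) -addA E addA addNl add0l. Qed.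
Lemma oppD' (a b : T) : - (a + b) = - b + - a.
Proof. by apply: (addI (a + b)); rewrite addN addA -(addA a) addN add0 addN. Qed.

Fixpoint nsm (n : nat) (x : T) : T := match n with 0%nat => 0 | S n => nsm n x + x end.

(** Each interval from [a n] to [b n] contains a breakpoint, and these increase strictly with [n],
    so a finite list cannot supply them. *)
Lemma bps_finite (U : T -> Prop) Ls (a b : nat -> T) :
  bps U Ls -> (forall n, a n <= b n) -> (forall n, b n < a (S n)) ->
  ~ forall n, U (a n) /\ ~ U (b n).
Proof.
move=> HL ab ba H.
have W n : exists l, In l Ls /\ a n <= l <= b n.
  apply: NNPP => N; case: (H n) => A B; apply: B; apply/(HL (a n) (b n)) => // l Hl K.
  by apply: N; exists l.
pose l n := proj1_sig (constructive_indefinite_description _ (W n)).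
have Hl n : In (l n) Ls /\ a n <= l n <= b n.
  by rewrite /l; case: constructive_indefinite_description.
have inc n m : (n < m)%nat -> l n < l m.
  elim: m => [|m IH] K; first by lia.
  have s : l m < l (S m).
    by case: (Hl m) => _ [_ A]; case: (Hl (S m)) => _ [B _]; apply: lt_le_tr B;
       apply: le_lt_tr (ba m).
  case: (Nat.eq_dec n m) => [->//|?].
  by apply: lt_tr s; apply: IH; lia.
have inj : Injective l.
  by move=> n m E; case: (Nat.lt_trichotomy n m) => [/inc|[//|/inc]]; rewrite E => /lt_irr.
have := NoDup_incl_length (Injective_map_NoDup inj (seq_NoDup (S (length Ls)) 0)).
move=> /(_ Ls); rewrite length_map length_seq => K.
suff : (S (length Ls) <= length Ls)%nat by lia.
by apply: K => x /in_map_iff [n [<- _]]; case: (Hl n).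
Qed.

Lemma lt0N (a : T) : 0 < a -> - a < 0.
Proof. by move=> /(lt_addr (- a)); rewrite addN add0l. Qed.
Lemma lt_sub0 (a b : T) : a < b <-> 0 < b + - a.
Proof.
split=> [/(lt_addr (- a))|/(lt_addr a)]; first by rewrite addN.
by rewrite -addA addNl add0 add0l.
Qed.

(** [H] is convex, since otherwise the points [n y] and [n y + x] would alternate in and out of it.
    A convex subgroup containing [h > 0] has no endpoint, because adding or subtracting [h] would
    move it. *)
Lemma subgroup_all (H : T -> Prop) h : dp1 H -> H 0 -> (forall x y, H x -> H y -> H (x + - y)) ->
  H h -> 0 < h -> forall x, 0 < x -> H x.
Proof.
move=> dH H0 Hs Hh h0.
have HN x : H x -> H (- x) by move=> Hx; rewrite -(add0l (- x)); apply: Hs.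
have HD x y : H x -> H y -> H (x + y) by move=> Hx /HN Hy; rewrite -(oppK y); apply: Hs.
have conv x y : H y -> 0 < x -> x < y -> H x.
  move=> Hy x0 xy; apply: NNPP => Hx; have [Ls HLs] := omin_bp _ dH.
  have Hn n : H (nsm n y) by elim: n => //= n IH; apply: HD.
  apply: (bps_finite H Ls (fun n => nsm n y) (fun n => nsm n y + x) HLs).
  - by move=> n; apply: ltW; rewrite -{1}(add0 (nsm n y)); apply: lt_addl.
  - by move=> n /=; apply: lt_addl.
  - move=> n; split=> // K; apply: Hx.
    by rewrite -(add0l x) -(addNl (nsm n y)) -addA; apply: HD => //; apply: HN.
move=> x x0; apply: NNPP => Hx.
pose P y := y <= 0 \/ H y /\ 0 < y.
have dP : dp1 P.
  apply: def_or; first by apply: def_le; [apply: dt_var|apply: dt_const].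
  by apply: def_and => //; apply: def_lt; [apply: dt_const|apply: dt_var].
have Dn u v : P v -> u <= v -> P u.
  move=> Pv uv; case: (lt_le_dec 0 u) => u0; last by left.
  right; split=> //; case: Pv => [v0|[Hv v0]]; first by case: (le_tr _ _ _ uv v0).
  by case: (le_eqlt _ _ uv) => [->//|]; apply: conv.
have Ph : P h by right.
have Px : ~ P x by case=> [|[]].
case: (dcut P h x dP Dn Ph Px) => [[m [Pm Um]]|[m [Pm Lm]]].
- have hm : h <= m by move=> /Um /(_ Ph).
  have m0 := lt_le_tr _ _ _ h0 hm.
  case: Pm => [//|[Hm _]]; apply: (Um (m + h)); first by rewrite -{1}(add0 m); apply: lt_addl.
  right; split; first exact: HD.
  by apply: lt_tr m0 _; rewrite -{1}(add0 m); apply: lt_addl.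
- have hm : h < m by apply/nle => K; apply: Pm; apply: Dn K.
  have m0 := lt_tr _ _ _ h0 hm.
  have Hm : ~ H m by move=> K; apply: Pm; right.
  have A : 0 < m + - h := proj1 (lt_sub0 _ _) hm.
  have B : m + - h < m by rewrite -{2}(add0 m); apply: lt_addl; apply: lt0N.
  case: (Lm _ B) => [//|[K _]].
  by apply: Hm; rewrite -(add0 m) -(addNl h) addA; apply: HD.
Qed.

(** The elements commuting with a positive [y] form a definable subgroup that contains [y], hence
    all positive elements. *)
Lemma addC (a b : T) : a + b = b + a.
Proof.
have pos x y : 0 < x -> 0 < y -> x + y = y + x.
  move=> x0 y0; apply: (subgroup_all (fun x => x + y = y + x) y) => //.
  - by apply: def_eq; apply: dt_add; (apply: dt_var || apply: dt_const).
  - by rewrite add0 add0l.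
  - move=> u v Hu Hv.
    have Hv' : - v + y = y + - v.
      by apply: (addI v); rewrite addA addN add0l addA Hv -addA addN add0.
    by rewrite -addA Hv' addA Hu addA.
have posN x y : x + y = y + x -> - x + y = y + - x.
  by move=> E; apply: (addI x); rewrite addA addN add0l addA E -addA addN add0.
have opp0 x : x < 0 -> 0 < - x by move=> /lt_sub0; rewrite add0l.
have half x y : 0 < y -> x + y = y + x.
  move=> y0; case: (lt_tot 0 x) => [x0|[<-|x0]]; first exact: pos; first by rewrite add0 add0l.
  by rewrite -(oppK x); apply: posN; apply: pos => //; apply: opp0.
case: (lt_tot 0 b) => [b0|[<-|b0]]; first exact: half; first by rewrite add0 add0l.
by rewrite -(oppK b); symmetry; apply: posN; symmetry; apply: half; apply: opp0.
Qed.
Lemma oppD (a b : T) : - (a + b) = - a + - b.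
Proof. by rewrite oppD' addC. Qed.
Lemma addCA (a b c : T) : a + (b + c) = b + (a + c).
Proof. by rewrite !addA (addC a). Qed.
Lemma addACA (a b c d : T) : (a + b) + (c + d) = (a + c) + (b + d).
Proof. by rewrite -!addA (addCA b). Qed.
Lemma opp0 : - (0 : T) = 0.
Proof. by rewrite -[LHS]add0 addNl. Qed.
Lemma dt_opp a : DT a -> DT (fun e => - (a e)).
Proof.
apply: dt_f1; apply: (Def_ext (fun e => e 0%nat + e 1%nat = 0)).
  move=> e; split=> [E|->]; last by rewrite addNl.
  by apply: (addI (e 1%nat)); rewrite addN addC.
by apply: def_eq; [apply: dt_add; apply: dt_var|apply: dt_const].
Qed.
Lemma dt_sb a b : DT a -> DT b -> DT (fun e => a e - b e).
Proof. by move=> *; apply: dt_add => //; apply: dt_opp. Qed.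

(** The doubles form a definable subgroup; that they are closed under differences uses
    commutativity. *)
Lemma half_ex (x : T) : exists y, y + y = x.
Proof.
have pos z : 0 < z -> exists y, y + y = z.
  move=> z0; apply: (subgroup_all (fun x => exists y, y + y = x) (z + z)) => //.
  - apply: (def_ex (fun e y => y + y = e 0%nat)); apply: def_eq; last exact: (dt_var 1).
    by apply: dt_add; exact: (dt_var 0).
  - by exists 0; rewrite add0.
  - by move=> u v [u' <-] [v' <-]; exists (u' + - v'); rewrite oppD addACA.
  - by exists z.
  - by apply: (lt_tr z) => //; rewrite -{1}(add0 z); apply: lt_addl.
case: (lt_tot 0 x) => [|[<-|x0]]; [exact: pos|by exists 0; rewrite add0|].
have [|y E] := pos (- x); first by move: x0 => /lt_sub0; rewrite add0l.
by exists (- y); rewrite -oppD E oppK.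
Qed.

Definition hf (x : T) : T := proj1_sig (constructive_indefinite_description _ (half_ex x)).
Lemma hfE (x : T) : hf x + hf x = x.
Proof. by rewrite /hf; case: constructive_indefinite_description. Qed.
End Basics.

(** * Fourier-Motzkin elimination *)

Inductive gx := GV (n : nat) | GO | GA (a b : gx) | GN (a : gx) | GS (a b : gx).

Fixpoint ladd (c d : list Z) : list Z :=
  match c, d with [], _ => d | _, [] => c | x :: c, y :: d => Z.add x y :: ladd c d end.

Fixpoint lvar (n : nat) : list Z :=
  match n with O => [1%Z] | S n => 0%Z :: lvar n end.

Fixpoint lin (g : gx) : list Z :=
  match g with
  | GV n => lvar n | GO => [] | GA a b => ladd (lin a) (lin b)
  | GN a => map Z.opp (lin a) | GS a b => ladd (lin a) (map Z.opp (lin b))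
  end.

Inductive ck := KEq | KLe | KLt.
Definition cst := (ck * list Z)%type.
Definition cf (i : nat) (c : cst) : Z := nth i (snd c) 0%Z.
Definition kadd (a b : ck) : ck :=
  match a, b with KEq, k | k, KEq => k | KLe, KLe => KLe | _, _ => KLt end.
Definition is_eq (c : cst) := match fst c with KEq => true | _ => false end.
Definition lin_comb (a : Z) (p : list Z) (b : Z) (n : list Z) : list Z :=
  ladd (map (Z.mul a) p) (map (Z.mul b) n).
(** When the coefficients of variable [i] have opposite signs, a positive combination cancels them;
    when they have equal signs this still works if [p] is an equality, which may be negated.
    Otherwise [0 = 0] is returned, so that the result is always a consequence. *)
Definition comb (i : nat) (p n : cst) : cst :=
  let a := Z.abs (cf i n) in let b := Z.abs (cf i p) in
  if Z.ltb (cf i p * cf i n) 0 then (kadd (fst p) (fst n), lin_comb a (snd p) b (snd n))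
  else if andb (is_eq p) (negb (Z.eqb (cf i p) 0)) then (fst n, lin_comb a (map Z.opp (snd p)) b (snd n))
  else (KEq, []).
(* The second component records the original inequalities used; by Kohler's
   criterion a constraint using too many of them is redundant. *)
Definition wc := (cst * N)%type.
Fixpoint popc (p : positive) : nat := match p with xH => 1 | xO p => popc p | xI p => S (popc p) end.
Definition card (n : N) : nat := match n with N0 => 0 | Npos p => popc p end.
Definition useful (c : cst) : bool :=
  match fst c with KLt => true | _ => negb (forallb (Z.eqb 0) (snd c)) end.
(** An equality that mentions the variable is used as a substitution; it multiplies no constraints
    and does not count as an elimination. Otherwise all pairs of opposite sign are combined, and
    after [S k] such eliminations a new constraint built from more than [S (S k)] originals is
    dropped. *)
Definition step (i k : nat) (cs : list wc) : nat * list wc :=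
  let zs := filter (fun c => Z.eqb (cf i (fst c)) 0) cs in
  let ns := filter (fun c => negb (Z.eqb (cf i (fst c)) 0)) cs in
  match find (fun c => is_eq (fst c)) ns with
  | Some q => (k, zs ++ filter (fun c => useful (fst c)) (map (fun n => (comb i (fst q) (fst n), snd n)) ns))
  | None =>
      let ps := filter (fun c => Z.ltb 0 (cf i (fst c))) ns in
      let ms := filter (fun c => Z.ltb (cf i (fst c)) 0) ns in
      (S k, zs ++ filter (fun c => andb (useful (fst c)) (Nat.leb (card (snd c)) (S (S k))))
        (flat_map (fun p => map (fun n => (comb i (fst p) (fst n), N.lor (snd p) (snd n))) ms) ps))
  end.
(** Only guides the order of elimination: substitutions by an equality come first, then the variable
    with the fewest pairs to combine. *)
Definition cost (i : nat) (cs : list wc) : nat :=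
  if existsb (fun c => andb (is_eq (fst c)) (negb (Z.eqb (cf i (fst c)) 0))) cs then 0
  else S (length (filter (fun c => Z.ltb 0 (cf i (fst c))) cs) * length (filter (fun c => Z.ltb (cf i (fst c)) 0) cs)).
Fixpoint pick (vs : list nat) (cs : list wc) : option (nat * nat) :=
  match vs with
  | [] => None
  | i :: vs => match pick vs cs with
    | None => Some (i, cost i cs)
    | Some (j, c) => let d := cost i cs in if Nat.leb d c then Some (i, d) else Some (j, c)
    end
  end.
Fixpoint refute (n : nat) (vs : list nat) (k : nat) (cs : list wc) : bool :=
  match n with
  | O => existsb (fun c => match fst (fst c) with KLt => forallb (Z.eqb 0) (snd (fst c)) | _ => false end) cs
  | S n => match pick vs cs with
    | None => refute n [] k cs
    | Some (i, _) => let r := step i k cs in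
        refute n (filter (fun j => negb (Nat.eqb i j)) vs) (fst r) (snd r)
    end
  end.
Fixpoint label (p : positive) (cs : list cst) : list wc :=
  match cs with
  | [] => []
  | c :: cs => if is_eq c then (c, N0) :: label p cs else (c, Npos p) :: label (xO p) cs
  end.
Definition mk (k : ck) (a b : gx) : cst := (k, lin (GS b a)).

Section Olra.
Context {OS : omg}.
Local Notation M := (om_M OS).
Local Notation G := (om_G OS).
Local Notation T := (carrier (om_M OS)).
Local Notation env := (nat -> carrier (om_M OS)).
Local Notation "0" := (ozero G) : og_scope.
Local Notation "x + y" := (oadd G x y) : og_scope.
Local Notation "- x" := (oopp G x) : og_scope.
Local Notation "x - y" := (osub G x y) : og_scope.
Local Notation "x < y" := (olt G x y) : og_scope.
Local Notation "x <= y" := (ole G x y) : og_scope.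
Local Notation "x < y < z" := (olt G x y /\ olt G y z) : og_scope.
Local Notation "x <= y <= z" := (ole G x y /\ ole G y z) : og_scope.
Local Notation "x < y <= z" := (olt G x y /\ ole G y z) : og_scope.
Local Notation "x <= y < z" := (ole G x y /\ olt G y z) : og_scope.
Local Open Scope og_scope.

Lemma nsmD m n (x : T) : nsm (m + n) x = nsm m x + nsm n x.
Proof. by elim: n => [|n IH]; rewrite ?Nat.add_0_r ?Nat.add_succ_r /= ?add0 // IH addA. Qed.
Lemma nsm_add n (x y : T) : nsm n (x + y) = nsm n x + nsm n y.
Proof. by elim: n => [|n IH] /=; rewrite ?add0 // IH addACA. Qed.
Lemma nsm0 n : nsm n (0 : T) = 0.
Proof. by elim: n => [|n IH] //=; rewrite IH add0. Qed.
Lemma nsmM m n (x : T) : nsm (m * n) x = nsm m (nsm n x).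
Proof. by elim: m => [|m IH] //=; rewrite Nat.add_comm nsmD IH. Qed.
Lemma nsm_gt0 n (x : T) : 0 < x -> 0 < nsm (S n) x.
Proof.
move=> x0; elim: n => [|n IH]; first by rewrite /= add0l.
by apply: (lt_tr (nsm (S n) x)) => //=; rewrite -{1}[nsm n x + x]add0; apply: lt_addl.
Qed.
Lemma nsm_ge0 n (x : T) : 0 <= x -> 0 <= nsm n x.
Proof.
move=> /le_eqlt [<-|x0]; first by rewrite nsm0; apply: leR.
by case: n => [|n]; [apply: leR|apply: ltW; apply: nsm_gt0].
Qed.

Definition zsm (z : Z) (x : T) : T := nsm (Z.to_nat z) x + - nsm (Z.to_nat (- z)) x.
Lemma zsmE (a b : nat) x : zsm (Z.of_nat a - Z.of_nat b) x = nsm a x + - nsm b x.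
Proof.
rewrite /zsm; case: (Nat.le_gt_cases b a) => H.
- have -> : Z.to_nat (- (Z.of_nat a - Z.of_nat b)) = O by lia.
  have {2}-> : a = Nat.add (Z.to_nat (Z.of_nat a - Z.of_nat b)) b by lia.
  by rewrite nsmD -addA addN opp0.
- have -> : Z.to_nat (Z.of_nat a - Z.of_nat b) = O by lia.
  have {2}-> : b = Nat.add (Z.to_nat (- (Z.of_nat a - Z.of_nat b))) a by lia.
  by rewrite nsmD oppD (addC (- _)) addA addN.
Qed.
Lemma zsmP z : exists a b, z = (Z.of_nat a - Z.of_nat b)%Z.
Proof. by exists (Z.to_nat z), (Z.to_nat (- z)); lia. Qed.
Lemma zsmD y z x : zsm (y + z) x = zsm y x + zsm z x.
Proof.
have [a [b ->]] := zsmP y; have [c [d ->]] := zsmP z.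
have -> : (Z.of_nat a - Z.of_nat b + (Z.of_nat c - Z.of_nat d) =
  Z.of_nat (a + c) - Z.of_nat (b + d))%Z by lia.
by rewrite !zsmE !nsmD oppD addACA.
Qed.
Lemma zsm0 x : zsm 0 x = 0. Proof. by rewrite /zsm /= opp0 add0. Qed.
Lemma zsm1 x : zsm 1 x = x. Proof. by rewrite /zsm /= opp0 add0 add0l. Qed.
Lemma zsmN z x : zsm (- z) x = - zsm z x.
Proof. by apply: (addI (zsm z x)); rewrite -zsmD addN Z.add_opp_diag_r zsm0. Qed.
Lemma nsmN n (x : T) : nsm n (- x) = - nsm n x.
Proof. by apply: (addI (nsm n x)); rewrite -nsm_add !addN nsm0. Qed.
Lemma zsmM n z x : zsm (Z.of_nat n * z) x = nsm n (zsm z x).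
Proof.
have [a [b ->]] := zsmP z; rewrite Z.mul_sub_distr_l -!Nat2Z.inj_mul !zsmE.
by rewrite nsm_add nsmN !nsmM.
Qed.

Fixpoint den (l : list T) (g : gx) : T :=
  match g with
  | GV n => nth n l 0 | GO => 0 | GA a b => den l a + den l b
  | GN a => - den l a | GS a b => den l a - den l b
  end.

Fixpoint lev (c : list Z) (l : list T) : T :=
  match c, l with z :: c, x :: l => zsm z x + lev c l | _, _ => 0 end.

Lemma lev_add c d l : lev (ladd c d) l = lev c l + lev d l.
Proof.
elim: c d l => [|x c IH] [|y d] [|a l] //=; rewrite ?add0 ?add0l //.
by rewrite zsmD IH addACA.
Qed.
Lemma lev_opp c l : lev (map Z.opp c) l = - lev c l.
Proof. by elim: c l => [|x c IH] [|a l] //=; rewrite ?opp0 // zsmN IH oppD. Qed.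
Lemma lev_mul n c l : lev (map (Z.mul (Z.of_nat n)) c) l = nsm n (lev c l).
Proof. by elim: c l => [|x c IH] [|a l]; rewrite /= ?nsm0 // zsmM IH nsm_add. Qed.
Lemma den_lin l g : den l g = lev (lin g) l.
Proof.
elim: g => [n||a IHa b IHb|a IHa|a IHa b IHb] //=.
- elim: n l => [|n IH] [|a l] //=; first by rewrite zsm1 add0.
  by rewrite zsm0 add0l IH.
- by rewrite lev_add IHa IHb.
- by rewrite lev_opp IHa.
- by rewrite lev_add lev_opp IHa IHb.
Qed.

Definition kval (k : ck) (x : T) : Prop :=
  match k with KEq => 0 = x | KLe => 0 <= x | KLt => 0 < x end.
Definition holds (l : list T) (c : cst) : Prop := kval (fst c) (lev (snd c) l).

Lemma kadd_ok a b x y : kval a x -> kval b y -> kval (kadd a b) (x + y).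
Proof.
have L (u v : T) : 0 <= v -> u <= u + v.
  by move=> Hv /(lt_addl (- u)); rewrite addA addNl add0l => /Hv.
have S (u v : T) : 0 < v -> u < u + v.
  by move=> /(lt_addl u); rewrite add0.
case: a; case: b => /= Hx Hy; rewrite -?Hx -?Hy ?add0 ?add0l //.
- exact: le_tr Hx (L _ _ Hy).
- exact: le_lt_tr Hx (S _ _ Hy).
- exact: lt_le_tr Hx (L _ _ Hy).
- exact: lt_tr Hx (S _ _ Hy).
Qed.
Lemma kval_mul k n x : (0 < n)%nat -> kval k x -> kval k (nsm n x).
Proof.
case: n => [|n] Hn; first by lia.
case: k => /= [<-||]; [by rewrite nsm0 add0|exact: (nsm_ge0 (S n))|exact: nsm_gt0].
Qed.

Lemma comb_ok i p n l : holds l p -> holds l n -> holds l (comb i p n).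
Proof.
case: p n => [kp p] [kn n]; rewrite /holds /comb /is_eq /cf /lin_comb /= => Hp Hn.
have nn z : Z.abs z = Z.of_nat (Z.to_nat (Z.abs z)) by lia.
case: (Z.ltb_spec (nth i p 0%Z * nth i n 0%Z) 0) => S.
  have [p0 n0] : nth i p 0%Z <> 0%Z /\ nth i n 0%Z <> 0%Z by split=> E; rewrite E in S; lia.
  rewrite /= (nn (nth i n 0%Z)) (nn (nth i p 0%Z)) lev_add !lev_mul.
  by apply: kadd_ok; apply: kval_mul => //; lia.
case: kp Hp => //=; case: (Z.eqb_spec (nth i p 0%Z) 0) => //= p0 E.
rewrite (nn (nth i n 0%Z)) (nn (nth i p 0%Z)) lev_add !lev_mul lev_opp -E opp0 nsm0 add0l.
by apply: kval_mul => //; lia.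
Qed.

Definition wholds l (w : wc) := holds l (fst w).
Lemma step_ok i k cs l : Forall (wholds l) cs -> Forall (wholds l) (snd (step i k cs)).
Proof.
move=> /Forall_forall H; apply/Forall_forall => c; rewrite /step.
have F P d : In d (filter P cs) -> wholds l d by move=> /filter_In [/H].
case E: find => [q|] /=.
  have [/F Hq _] := find_some _ _ E.
  move=> /in_app_iff [/F//|/filter_In [/in_map_iff [x [<- /F Hx]] _]].
  exact: comb_ok.
move=> /in_app_iff [/F//|/filter_In [/in_flat_map [p [/filter_In [/F Hp _] ]] K _]].
move: K => /in_map_iff [x [<- /filter_In [/F Hx _]]].
exact: comb_ok.
Qed.

(** Only soundness is proved: each derived constraint is a consequence, so the strict constraint
    with zero coefficients that ends the search contradicts irreflexivity. What is dropped on the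
    way does not matter. *)
Lemma refute_ok n vs k cs l : Forall (wholds l) cs -> refute n vs k cs = true -> False.
Proof.
elim: n vs k cs => [|n IH] vs k cs H /=; last first.
  by case: (pick vs cs) => [[i c]|]; apply: IH => //; apply: step_ok.
move=> /existsb_exists [[[kk c] h] [Hc]] /=; case: kk Hc => // Hc F.
move/Forall_forall: H => /(_ _ Hc); rewrite /wholds /holds /=.
suff -> : lev c l = 0 by apply: lt_irr.
elim: c l F {Hc} => [|z c IHc] [|a l] // F.
case: (andb_prop _ _ F) => F1 /IHc E; rewrite /= E.
by rewrite -(proj1 (Z.eqb_eq _ _) F1) zsm0 add0.
Qed.

Definition decide n (cs : list cst) : bool := refute n (seq 0 n) 0 (label 1 cs).
Lemma decide_ok n cs l : Forall (holds l) cs -> decide n cs = true -> False.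
Proof.
move=> H; apply: (refute_ok _ _ _ _ l).
elim: cs 1%positive H => [|c cs IH] p H /=; first by constructor.
by inversion H; case: (is_eq c); constructor=> //; apply: IH.
Qed.

Lemma mk_lt l a b : den l a < den l b -> holds l (mk KLt a b).
Proof. by move=> H; rewrite /holds /mk /fst /snd -den_lin; apply (proj1 (lt_sub0 _ _)). Qed.
Lemma mk_le l a b : den l a <= den l b -> holds l (mk KLe a b).
Proof.
move=> /le_eqlt [E|/mk_lt H]; last exact: ltW.
by rewrite /holds /mk /fst /snd -den_lin /= E /osub addN; apply: leR.
Qed.
Lemma mk_eq l a b : den l a = den l b -> holds l (mk KEq a b).
Proof. by move=> E; rewrite /holds /mk /fst /snd -den_lin /= E /osub addN. Qed.

Lemma lt_by_contra (a b : T) : (b <= a -> False) -> a < b.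
Proof. by move/NNPP. Qed.
Lemma eq_by_contra (a b : T) : (a < b -> False) -> (b < a -> False) -> a = b.
Proof. by move=> H K; apply: le_anti. Qed.
End Olra.

Ltac og_mem x l :=
  lazymatch l with nil => constr:(false) | x :: _ => constr:(true) | _ :: ?l => og_mem x l end.
Ltac og_atoms G t l :=
  lazymatch t with
  | oadd G ?a ?b => let l := og_atoms G a l in og_atoms G b l
  | osub G ?a ?b => let l := og_atoms G a l in og_atoms G b l
  | oopp G ?a => og_atoms G a l
  | ozero G => l
  | _ => let b := og_mem t l in lazymatch b with true => l | false => constr:(t :: l) end
  end.
Ltac og_idx x l :=
  lazymatch l with x :: _ => constr:(O) | _ :: ?l => let n := og_idx x l in constr:(S n) end.
Ltac og_reify G t l :=
  lazymatch t with
  | oadd G ?a ?b => let a := og_reify G a l in let b := og_reify G b l in constr:(GA a b)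
  | osub G ?a ?b => let a := og_reify G a l in let b := og_reify G b l in constr:(GS a b)
  | oopp G ?a => let a := og_reify G a l in constr:(GN a)
  | ozero G => constr:(GO)
  | _ => let n := og_idx t l in constr:(GV n)
  end.

(* Marks the hypotheses already collected, so that the loops below terminate. *)
Inductive og_mark (P : Prop) : Prop := OGM : P -> og_mark P.

Ltac og_hf1 X x :=
  lazymatch goal with
  | K : og_mark (oadd _ (@hf X x) (@hf X x) = x) |- _ => fail
  | _ => let K := fresh "HF" in pose proof (OGM _ (@hfE X x)) as K
  end.
(** To the procedure [hf x] is an atom, so the equation that characterises it is added for each
    occurrence. *)
Ltac og_hf :=
  repeat match goal with
  | H : context [@hf ?X ?x] |- _ => og_hf1 X x
  | |- context [@hf ?X ?x] => og_hf1 X x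
  end;
  repeat match goal with K : og_mark _ |- _ => destruct K as [K] end.

Ltac og_hyps :=
  repeat match goal with
  | H : _ /\ _ |- _ => destruct H
  | H : ~ olt ?G ?a ?b |- _ => change (ole G b a) in H
  | H : ~ ole _ ?a ?b |- _ => apply NNPP in H
  end.

Ltac og_mark_hyps G :=
  repeat match goal with
  | H : olt G ?a ?b |- _ => apply OGM in H
  | H : ole G ?a ?b |- _ => apply OGM in H
  | H : @eq (carrier _) ?a ?b |- _ => apply OGM in H
  end.
Ltac og_goal_atoms G Q l :=
  lazymatch Q with
  | og_mark (olt G ?a ?b) -> ?Q => let l := og_atoms G a l in let l := og_atoms G b l in og_goal_atoms G Q l
  | og_mark (ole G ?a ?b) -> ?Q => let l := og_atoms G a l in let l := og_atoms G b l in og_goal_atoms G Q l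
  | og_mark (?a = ?b) -> ?Q => let l := og_atoms G a l in let l := og_atoms G b l in og_goal_atoms G Q l
  | _ => l
  end.
Ltac og_run X G l cs pf :=
  lazymatch goal with
  | |- og_mark (olt G ?a ?b) -> _ =>
      let a' := og_reify G a l in let b' := og_reify G b l in
      let H := fresh "H" in intros [H];
      let cs' := constr:(mk KLt a' b' :: cs) in
      let pf' := constr:(@Forall_cons _ (@holds X l) (mk KLt a' b') cs (@mk_lt X l a' b' H) pf) in
      og_run X G l cs' pf'
  | |- og_mark (ole G ?a ?b) -> _ =>
      let a' := og_reify G a l in let b' := og_reify G b l in
      let H := fresh "H" in intros [H];
      let cs' := constr:(mk KLe a' b' :: cs) in
      let pf' := constr:(@Forall_cons _ (@holds X l) (mk KLe a' b') cs (@mk_le X l a' b' H) pf) in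
      og_run X G l cs' pf'
  | |- og_mark (?a = ?b) -> _ =>
      let a' := og_reify G a l in let b' := og_reify G b l in
      let H := fresh "H" in intros [H];
      let cs' := constr:(mk KEq a' b' :: cs) in
      let pf' := constr:(@Forall_cons _ (@holds X l) (mk KEq a' b') cs (@mk_eq X l a' b' H) pf) in
      og_run X G l cs' pf'
  | |- False =>
      let n := eval cbv in (length l) in
      exact (@decide_ok X n cs l pf (@eq_refl bool true <: decide n cs = true))
  end.
Ltac og_go X :=
  let G := constr:(om_G X) in
  og_mark_hyps G;
  repeat match goal with H : og_mark _ |- _ => revert H end;
  lazymatch goal with |- ?Q =>
    let l := og_goal_atoms G Q (@nil (carrier (om_M X))) in
    og_run X G l (@nil cst) (@Forall_nil _ (@holds X l))
  end.
Ltac og_false :=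
  og_hf; og_hyps;
  match goal with
  | H : olt (om_G ?X) _ _ |- _ => og_go X
  | H : ole (om_G ?X) _ _ |- _ => og_go X
  end.
Ltac olra1 :=
  lazymatch goal with
  | |- olt _ _ _ => apply lt_by_contra; intro; og_false
  | |- ole _ _ _ => intro; og_false
  | |- ~ _ => intro; og_false
  | |- @eq (carrier _) _ _ => apply eq_by_contra; intro; og_false
  | |- _ => exfalso; og_false
  end.
(** Linear arithmetic over the ordered group: the negated goal is refuted together with the linear
    hypotheses, and an equality is proved by excluding both strict inequalities. *)
Ltac olra :=
  intros; repeat match goal with |- _ /\ _ => split end; olra1.

Section HfDef.
Context {OS : omg}.
Local Notation M := (om_M OS).
Local Notation G := (om_G OS).
Local Notation T := (carrier (om_M OS)).
Local Notation env := (nat -> carrier (om_M OS)).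
Local Notation "0" := (ozero G) : og_scope.
Local Notation "x + y" := (oadd G x y) : og_scope.
Local Notation "- x" := (oopp G x) : og_scope.
Local Notation "x - y" := (osub G x y) : og_scope.
Local Notation "x < y" := (olt G x y) : og_scope.
Local Notation "x <= y" := (ole G x y) : og_scope.
Local Notation "x < y < z" := (olt G x y /\ olt G y z) : og_scope.
Local Notation "x <= y <= z" := (ole G x y /\ ole G y z) : og_scope.
Local Notation "x < y <= z" := (olt G x y /\ ole G y z) : og_scope.
Local Notation "x <= y < z" := (ole G x y /\ olt G y z) : og_scope.
Local Open Scope og_scope.
Lemma dt_hf (a : env -> T) : DT a -> DT (fun e => hf (a e)).
Proof.
apply: dt_f1; apply: (Def_ext (fun e => oadd G (e 0%nat) (e 0%nat) = e 1%nat)).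
  by move=> e; split=> [E|->]; [olra|rewrite hfE].
by apply: def_eq; [apply: dt_add|]; apply: dt_var.
Qed.

Definition upd (e : env) (j : nat) (v : T) : env := fun i => if Nat.eqb i j then v else e i.
Lemma upd_eq e j v : upd e j v j = v. Proof. by rewrite /upd Nat.eqb_refl. Qed.
Lemma upd_ne e j v i : i <> j -> upd e j v i = e i. Proof. by rewrite /upd => /Nat.eqb_neq ->. Qed.
Lemma upd_id e j : upd e j (e j) = e.
Proof. by apply: functional_extensionality => i; rewrite /upd; case: (Nat.eqb_spec i j) => [->|]. Qed.
Lemma upd_upd e j v v' : upd (upd e j v) j v' = upd e j v'.
Proof. by apply: functional_extensionality => i; rewrite /upd; case: (Nat.eqb_spec i j). Qed.
Lemma dt_comp F (s : env -> env) : DT F -> (forall i, DT (fun e => s e i)) -> DT (fun e => F (s e)).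
Proof. by move=> dF ds; apply: (dt_sub F (fun i e => s e i)). Qed.
Lemma def_comp W (s : env -> env) : Def W -> (forall i, DT (fun e => s e i)) -> Def (fun e => W (s e)).
Proof. by move=> dF ds; apply: (def_sub W (fun i e => s e i)). Qed.
Lemma dt_upd (s : env -> env) p (t : env -> T) : (forall i, DT (fun e => s e i)) -> DT t ->
  forall i, DT (fun e => upd (s e) p (t e) i).
Proof. by move=> ds dt i; rewrite /upd; case: Nat.eqb. Qed.
Lemma dt_scons (t : env -> T) (s : env -> env) : DT t -> (forall i, DT (fun e => s e i)) ->
  forall i, DT (fun e => scons (t e) (s e) i).
Proof. by move=> dt ds [|i] //=; apply: ds. Qed.
End HfDef.

(** Definability is read off the syntax of a predicate. Functions and predicates named by variables
    need their definability among the hypotheses, which is why proofs introduce facts such as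
    [df_sl] just before calling [ddef]. *)
Ltac dstep :=
  lazymatch goal with
  | |- DT (fun _ => ?c) => apply (dt_const c)
  | |- Def (fun _ => ?P) => apply (def_const P)
  | |- DT (fun e => e ?i) => apply (dt_var i)
  | |- DT (fun e => oadd _ (@?a e) (@?b e)) => apply (dt_add a b)
  | |- DT (fun e => osub _ (@?a e) (@?b e)) => apply (dt_sb a b)
  | |- DT (fun e => oopp _ (@?a e)) => apply (dt_opp a)
  | |- DT (fun e => hf (@?a e)) => apply (dt_hf a)
  | |- Def (fun e => @?A e /\ @?B e) => apply (def_and A B)
  | |- Def (fun e => @?A e \/ @?B e) => apply (def_or A B)
  | |- Def (fun e => @?A e <-> @?B e) => apply (def_iff A B)
  | |- Def (fun e => ~ @?A e) => apply (def_not A)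
  | |- Def (fun e => olt _ (@?a e) (@?b e)) => apply (def_lt a b)
  | |- Def (fun e => ole _ (@?a e) (@?b e)) => apply (def_le a b)
  | |- Def (fun e => @eq _ (@?a e) (@?b e)) => apply (def_eq a b)
  | |- Def (fun e => exists x : carrier _, @?Q e x) => apply (def_ex Q)
  | |- Def (fun e => forall x : carrier _, @?Q e x) => apply (def_all Q)
  | |- Def (fun e => @?A e -> @?B e) => apply (def_imp A B)
  | |- dp1 _ => unfold dp1 | |- dp2 _ => unfold dp2 | |- dp3 _ => unfold dp3 | |- dp4 _ => unfold dp4
  | |- df1 _ => unfold df1 | |- df2 _ => unfold df2 | |- df3 _ => unfold df3
  | |- _ =>
      match goal with
      | H : df1 ?f |- DT (fun e => ?f (@?a e)) => apply (dt_f1 f a H)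
      | H : df2 ?f |- DT (fun e => ?f (@?a e) (@?b e)) => apply (dt_f2 f a b H)
      | H : df3 ?f |- DT (fun e => ?f (@?a e) (@?b e) (@?c e)) => apply (dt_f3 f a b c H)
      | H : dp1 ?f |- Def (fun e => ?f (@?a e)) => apply (def_p1 f a H)
      | H : dp2 ?f |- Def (fun e => ?f (@?a e) (@?b e)) => apply (def_p2 f a b H)
      | H : dp3 ?f |- Def (fun e => ?f (@?a e) (@?b e) (@?c e)) => apply (def_p3 f a b c H)
      | H : dp4 ?f |- Def (fun e => ?f (@?a e) (@?b e) (@?c e) (@?d e)) => apply (def_p4 f a b c d H)
      | H : DT ?F |- DT (fun e => ?F (@?s e)) => apply (dt_comp F s H)
      | H : Def ?F |- Def (fun e => ?F (@?s e)) => apply (def_comp F s H)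
      | |- forall i, DT (fun e => upd (@?s e) ?p (@?t e) i) => apply (dt_upd s p t)
      | |- forall i, DT (fun e => scons (@?t e) (@?s e) i) => apply (dt_scons t s)
      | |- forall i, DT _ => intro; first [apply dt_var | apply dt_const]
      end
  end; cbv beta delta [eshift].
Ltac ddef := intros; cbv beta delta [eshift]; repeat dstep.

(** * Real closed fields from rings of scalars *)

Module ScalarRing.
Import all_boot all_order all_algebra boolp generic_quotient ring lra.
Set Implicit Arguments. Unset Strict Implicit. Unset Printing Implicit Defensive.
Import Order.TTheory GRing.Theory Num.Theory.
Local Open Scope ring_scope.

(** * Real closedness from suprema of polynomial sublevel sets *)

Section RealClosed.
Variable K : realFieldType.

(** Induction on the polynomial by the product rule; on the unit interval the factor [x] is at most
    one. Over an arbitrary ordered field this replaces continuity in the root argument. *)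
Lemma poly_lip01 (p : {poly K}) : exists2 k, 0 < k & forall x y, 0 <= x <= 1 -> 0 <= y <= 1 ->
  `|p.[y] - p.[x]| <= k * `|y - x|.
Proof.
elim/poly_ind: p => [|p c [k k0 IH]].
  by exists 1 => // x y _ _; rewrite !horner0 subrr normr0 mul1r.
have B x : 0 <= x <= 1 -> `|p.[x]| <= `|p.[0]| + k.
  move=> Hx; have H := IH 0 x; have := ler_normD p.[0] (p.[x] - p.[0]).
  rewrite addrC subrK => /le_trans; apply; rewrite lerD2l (le_trans (H _ _)) // ?lexx ?ler01 //.
  by rewrite subr0 ger_pMr // ger0_norm //; case/andP: Hx.
exists (k + (`|p.[0]| + k)); first by rewrite addr_gt0 // ltr_wpDl.
move=> x y Hx Hy; rewrite !hornerMXaddC.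
have -> : p.[y] * y + c - (p.[x] * x + c) = y * (p.[y] - p.[x]) + p.[x] * (y - x) by ring.
apply: le_trans (ler_normD _ _) _; rewrite !normrM (mulrDl k) lerD //; last by apply: ler_wpM2r (B _ Hx).
rewrite -[leRHS]mul1r ler_pM // ?IH // ger0_norm; by case/andP: Hy.
Qed.

(** Suprema are asked only for sublevel sets on the unit interval: its scalars will be points of a
    definable interval, so for these sets o-minimality can provide them. *)
Hypothesis complete : forall p : {poly K}, p.[0] <= 0 -> exists s, [/\ 0 <= s <= 1,
  forall t, 0 <= t <= 1 -> p.[t] <= 0 -> t <= s &
  forall t, t < s -> exists t', [/\ 0 <= t' <= 1, t < t' & p.[t'] <= 0]].

Lemma real_closed_of_complete : Num.real_closed_axiom K.
Proof.
move=> p a b ab /andP[pa pb].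
pose q := p \Po (a%:P + (b - a) *: 'X).
have qE t : q.[t] = p.[a + (b - a) * t] by rewrite horner_comp !hornerE.
have [|s [/andP[s0 s1] up dn]] := @complete q; first by rewrite qE mulr0 addr0.
exists (a + (b - a) * s); first by apply/andP; split; nra.
have [k k0 L] := poly_lip01 q.
have q1 : 0 <= q.[1] by rewrite qE mulr1 addrC subrK.
rewrite /root -qE; case: (ltgtP q.[s] 0) => // H; exfalso.
- have s1' : s < 1 by rewrite lt_neqAle s1 andbT; apply/eqP => E; rewrite E in H; lra.
  pose d := - q.[s] / k; have d0 : 0 < d by rewrite divr_gt0 // oppr_gt0.
  pose t := Num.min 1 (s + d).
  have st : s < t by rewrite lt_min s1' ltrDl.
  have t1 : t <= 1 by rewrite ge_min lexx.
  have td : t <= s + d by rewrite ge_min lexx orbT.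
  have kd : k * d = - q.[s] by rewrite /d mulrCA mulfV ?mulr1 // gt_eqF.
  have := L s t; rewrite s0 s1 t1 (le_trans s0 (ltW st)) => /(_ isT isT) Hl.
  have := ler_norm (q.[t] - q.[s]); rewrite (gtr0_norm (x := t - s)) ?subr_gt0 // in Hl.
  move=> Hn; have : q.[t] <= 0 by nra.
  by move=> /(up t); rewrite t1 (le_trans s0 (ltW st)) => /(_ isT); lra.
- pose d := q.[s] / k; have d0 : 0 < d by rewrite divr_gt0.
  have kd : k * d = q.[s] by rewrite /d mulrCA mulfV ?mulr1 // gt_eqF.
  have [|t [Ht tt qt]] := dn (s - d); first by lra.
  have ts := up t Ht qt.
  have := L t s Ht; rewrite s0 s1 => /(_ isT) Hl.
  have := ler_norm (q.[s] - q.[t]); rewrite (ger0_norm (x := s - t)) ?subr_ge0 // in Hl.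
  by move=> Hn; nra.
Qed.

End RealClosed.

Lemma rcf_of_complete (K : realFieldType) : Num.real_closed_axiom K ->
  exists (L : rcfType) (e : K -> L), [/\ bijective e, e 1 = 1, {morph e : a b / a + b}, {morph e : a b / a * b} & {mono e : a b / a < b}].
Proof.
move=> H; pose L : rcfType := HB.pack (Num.RealField.sort K) (Num.RealField_isClosed.Build K H).
exists L, (id : K -> L); split=> //; by exists id.
Qed.

(** * The ordered fraction field of a ring with a positive cone *)

Section FractionField.
Variables (A0 : comNzRingType) (pos : A0 -> Prop).
(** A copy of the ring, so that the unit and integral domain instances built from the positive cone
    are not attached to [A0] itself. *)
Definition frac_dom : Type := A0.
HB.instance Definition _ := GRing.ComNzRing.on frac_dom.
Let A : comNzRingType := frac_dom.
Hypotheses (posD : forall a b, pos a -> pos b -> pos (a + b))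
  (posM : forall a b, pos a -> pos b -> pos (a * b))
  (pos0 : ~ pos 0) (pos_tot : forall a, a = 0 \/ pos a \/ pos (- a)).

Let unitA := [pred x : A | `[< exists y, y * x = 1 >]].
Let invA (x : A) : A := if asboolP (exists y, y * x = 1) is ReflectT H then sval (cid H) else x.
Fact mulVA : {in unitA, left_inverse 1 invA *%R}.
Proof. by move=> x; rewrite inE => /asboolP H; rewrite /invA; case: asboolP => // H'; case: cid. Qed.
Fact unitPlA x y : y * x = 1 -> unitA x.
Proof. by move=> H; apply/asboolP; exists y. Qed.
Fact invA_out : {in [predC unitA], invA =1 id}.
Proof. by move=> x; rewrite !inE => /asboolP H; rewrite /invA; case: asboolP. Qed.
HB.instance Definition _ := GRing.ComNzRing_hasMulInverse.Build frac_dom mulVA unitPlA invA_out.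
Fact integralA (x y : A) : x * y = 0 -> (x == 0) || (y == 0).
Proof.
case: (pos_tot x) => [->|Hx]; first by rewrite eqxx.
case: (pos_tot y) => [->|Hy]; first by rewrite eqxx orbT.
move=> E; case: pos0; case: Hx Hy => [Hx|Hx] [Hy|Hy]; have := posM Hx Hy.
- by rewrite E.
- by rewrite mulrN E oppr0.
- by rewrite mulNr E oppr0.
- by rewrite mulrNN E.
Qed.
HB.instance Definition _ := GRing.ComUnitRing_isIntegral.Build frac_dom integralA.
Definition AI : idomainType := frac_dom.
Let F := {fraction AI}.
Let io (a : A) : F := tofrac (a : AI).
Definition fpos (x : F) := exists a b : A, [/\ pos a, pos b & x = io a / io b].
Let pos_neq0 a : pos a -> io a != 0.
Proof. by move=> Ha; rewrite /io tofrac_eq0; apply/eqP => E; case: pos0; rewrite -E. Qed.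
Let ioD a b : io (a + b) = io a + io b. Proof. exact: tofracD. Qed.
Let ioM a b : io (a * b) = io a * io b. Proof. exact: tofracM. Qed.
Let ioN a : io (- a) = - io a. Proof. exact: tofracN. Qed.
Lemma fposD x y : fpos x -> fpos y -> fpos (x + y).
Proof.
case=> a [b [Ha Hb ->]] [c [d [Hc Hd ->]]]; exists (a * d + c * b), (b * d); split; auto.
by rewrite addf_div ?pos_neq0 // ioD !ioM.
Qed.
Lemma fposM x y : fpos x -> fpos y -> fpos (x * y).
Proof.
case=> a [b [Ha Hb ->]] [c [d [Hc Hd ->]]]; exists (a * c), (b * d); split; auto.
by rewrite mulf_div !ioM.
Qed.
Lemma fpos0 : ~ fpos 0.
Proof.
case=> a [b [Ha Hb /esym/eqP]]; rewrite mulf_eq0 invr_eq0.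
by rewrite (negbTE (pos_neq0 Ha)) (negbTE (pos_neq0 Hb)).
Qed.
Lemma pi_frac (r : {ratio AI}) : (\pi_F r)%qT * io \d_r = io \n_r.
Proof.
rewrite /io; unlock FracField.tofrac; rewrite -[LHS]FracField.pi_mul.
have d0 := denom_ratioP r.
apply/eqmodP; rewrite /= FracField.equivfE /FracField.mulf !numden_Ratio ?oner_neq0 ?mulf_neq0 ?oner_neq0 ?mulr1 //.
by rewrite mulrC.
Qed.
(** The sign of a denominator can be moved to the numerator, since a nonzero denominator or its
    opposite is positive. *)
Lemma frac_rep (x : F) : exists a b : A, pos b /\ x = io a / io b.
Proof.
elim/quotW: x => r.
have d0 : \d_r != 0 by apply: denom_ratioP.
have d1 : io \d_r != 0 by rewrite /io tofrac_eq0.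
have E : (\pi_F r)%qT = io \n_r / io \d_r by rewrite -(pi_frac r) mulfK.
case: (pos_tot \d_r) => [E0|[Hd|Hd]].
- by rewrite E0 eqxx in d0.
- by exists \n_r, \d_r.
- by exists (- \n_r), (- \d_r); split=> //; rewrite !ioN invrN mulrNN E.
Qed.
Lemma fpos_tot x : x = 0 \/ fpos x \/ fpos (- x).
Proof.
have [a [b [Hb ->]]] := frac_rep x; case: (pos_tot a) => [->|[Ha|Ha]].
- by left; rewrite /io tofrac0 mul0r.
- by right; left; exists a, b.
- by right; right; exists (- a), b; split=> //; rewrite ioN mulNr.
Qed.

Let flt (x y : F) := `[< fpos (y - x) >].
Let fle (x y : F) := (x == y) || flt x y.
Let fnorm (x : F) := if flt x 0 then - x else x.
Fact flt_add x y : flt 0 x -> flt 0 y -> flt 0 (x + y).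
Proof. by rewrite /flt !subr0 => /asboolP Hx /asboolP Hy; apply/asboolP/fposD. Qed.
Fact flt_mul x y : flt 0 x -> flt 0 y -> flt 0 (x * y).
Proof. by rewrite /flt !subr0 => /asboolP Hx /asboolP Hy; apply/asboolP/fposM. Qed.
Fact flt_ngt x : flt 0 x -> ~~ flt x 0.
Proof.
rewrite /flt subr0 sub0r => /asboolP Hx; apply/asboolP => Hy.
by case: fpos0; rewrite -(subrr x); apply: fposD.
Qed.
Fact flt_sub x y : flt 0 (y - x) = flt x y. Proof. by rewrite /flt subr0. Qed.
Fact flt_total x : x != 0 -> flt 0 x || flt x 0.
Proof.
rewrite /flt subr0 sub0r; case: (fpos_tot x) => [->|[H|H]]; rewrite ?eqxx // => _.
  by apply/orP; left; apply/asboolP.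
by apply/orP; right; apply/asboolP.
Qed.
Fact fnormN x : fnorm (- x) = fnorm x.
Proof.
rewrite /fnorm; case: (eqVneq x 0) => [->|x0]; first by rewrite !oppr0.
have E : flt (- x) 0 = flt 0 x by rewrite /flt opprK subr0 add0r.
rewrite E; have := flt_total x0; case H: (flt 0 x) => /=.
  by rewrite (negbTE (flt_ngt H)) opprK.
by move=> ->.
Qed.
Fact fge0_norm x : fle 0 x -> fnorm x = x.
Proof.
rewrite /fle /fnorm => /orP[/eqP <-|/flt_ngt /negbTE -> //].
by case: ifP => // _; rewrite oppr0.
Qed.
Fact fle_def x y : fle x y = (x == y) || flt x y. Proof. by []. Qed.
Definition frac_sort : Type := F.
HB.instance Definition _ := GRing.Field.on frac_sort.
HB.instance Definition _ := Num.IntegralDomain_isLtReal.Build frac_sort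
  flt_add flt_mul flt_ngt flt_sub flt_total fnormN fge0_norm fle_def.
Lemma frac_field : exists (K : realFieldType) (e : A0 -> K),
  [/\ e 1 = 1, {morph e : a b / a + b}, {morph e : a b / a * b}, forall a, 0 < e a <-> pos a &
    forall u, exists a b, pos b /\ u = e a / e b].
Proof.
exists frac_sort, io; split; [exact: tofrac1|exact: ioD|exact: ioM| |exact: frac_rep].
move=> a; split=> [|Ha]; last first.
  apply/asboolP; exists a, 1; split=> //.
    case: (pos_tot 1) => [/eqP|[//|H]]; first by rewrite oner_eq0.
    by have := posM H H; rewrite mulrNN mulr1.
  by rewrite subr0 /io tofrac1 divr1.
move=> /asboolP; rewrite subr0; case: (pos_tot a) => [->|[//|H]].
  by rewrite /io tofrac0 => /fpos0.
move=> Ha; have Hb : fpos (io (- a)).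
  exists (- a), 1; split=> //.
    case: (pos_tot 1) => [/eqP|[//|H']]; first by rewrite oner_eq0.
    by have := posM H' H'; rewrite mulrNN mulr1.
  by rewrite /io tofrac1 divr1.
case: fpos0; rewrite -(subrr (io a)) -ioN; exact: fposD.
Qed.
End FractionField.

(* J is a unit interval of scalars, acting on V by R; v |-> the operator sending one to v makes V a ring. *)
Section RingOfScalars.
Variables (V : zmodType) (J : Type) (R : J -> V -> V) (j0 j1 : J) (mid mul : J -> J -> J) (one : V).
Hypotheses (RD : forall x u v, R x (u + v) = R x u + R x v)
  (R0 : forall v, R j0 v = 0) (R1 : forall v, R j1 v = v)
  (Rmid : forall x y v, R (mid x y) v *+ 2 = R x v + R y v)
  (Rmul : forall x y v, R (mul x y) v = R y (R x v))
  (Rinj : forall x y, R x one = R y one -> x = y)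
  (V2 : forall v : V, v *+ 2 = 0 -> v = 0)
  (span : forall v, exists n x y, v = (R x one - R y one) *+ 2 ^ n)
  (mulC : forall x y, mul x y = mul y x)
  (one0 : one <> 0).

(** [J] is only a unit interval, so a general scalar is a difference of two elements of [J] scaled
    by a power of two. *)
Definition isop (p : V -> V) := exists n x y, forall v, p v = (R x v - R y v) *+ 2 ^ n.

Let R00 x : R x 0 = 0.
Proof. by apply: (addIr (R x 0)); rewrite -RD !add0r. Qed.
Let RN x v : R x (- v) = - R x v.
Proof. by apply/eqP; rewrite -addr_eq0 -RD addNr R00. Qed.
Let RM x v n : R x (v *+ n) = R x v *+ n.
Proof. by elim: n => [|n IH]; rewrite ?mulr0n ?R00 // !mulrS RD IH. Qed.
Let Rhalf x v : R (mid x j0) v *+ 2 = R x v.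
Proof. by rewrite Rmid R0 addr0. Qed.

(** Halving both elements of [J] raises the exponent, which gives the summands of a sum a common
    exponent. *)
Lemma isopS p n x y : (forall v, p v = (R x v - R y v) *+ 2 ^ n) -> forall m, (n <= m)%N ->
  exists x y, forall v, p v = (R x v - R y v) *+ 2 ^ m.
Proof.
move=> H; elim=> [|m IH]; first by rewrite leqn0 => /eqP n0; exists x, y => v; rewrite H n0.
rewrite leq_eqVlt => /orP[/eqP<-|]; first by exists x, y.
rewrite ltnS => /IH [x' [y' H']]; exists (mid x' j0), (mid y' j0) => v.
by rewrite H' expnS mulrnA [(R _ _ - _) *+ 2]mulrnBl !Rhalf.
Qed.
Lemma isopD p q : isop p -> isop q -> isop (fun v => p v + q v).
Proof.
case=> n [x [y H]] [m [z [w H']]].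
have [x1 [y1 E1]] := isopS H (leq_maxl n m); have [z1 [w1 E2]] := isopS H' (leq_maxr n m).
exists (maxn n m).+1, (mid x1 z1), (mid y1 w1) => v.
rewrite E1 E2 expnS mulrnA [(R _ _ - _) *+ 2]mulrnBl !Rmid -mulrnDl; congr (_ *+ _).
by rewrite opprD addrACA.
Qed.
Lemma isopN p : isop p -> isop (fun v => - p v).
Proof. by case=> n [x [y H]]; exists n, y, x => v; rewrite H -mulNrn opprB. Qed.
Lemma isopM k p : isop p -> isop (fun v => p v *+ k).
Proof.
move=> H; elim: k => [|k IH]; last by have := isopD H IH; congr isop; apply/funext => v; rewrite mulrS.
by exists 0%N, j0, j0 => v; rewrite subrr mul0rn.
Qed.
Lemma isopR x : isop (R x).
Proof. by exists 0%N, x, j0 => v; rewrite R0 subr0. Qed.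
Lemma isop_linD p u v : isop p -> p (u + v) = p u + p v.
Proof. by case=> n [x [y H]]; rewrite !H !RD -mulrnDl opprD addrACA. Qed.
Lemma isop_linN p u : isop p -> p (- u) = - p u.
Proof. by case=> n [x [y H]]; rewrite !H !RN -mulNrn opprD. Qed.
Lemma isop_linM p u n : isop p -> p (u *+ n) = p u *+ n.
Proof. by case=> m [x [y H]]; rewrite !H !RM -mulrnBl mulrnAC. Qed.
Lemma isop_comp p q : isop p -> isop q -> isop (p \o q).
Proof.
move=> Hp [n [x [y H]]].
have Hx z : isop (p \o R z).
  case: Hp => m [x' [y' H']]; exists m, (mul z x'), (mul z y') => v /=.
  by rewrite H' !Rmul.
have := isopM (2 ^ n) (isopD (Hx x) (isopN (Hx y))); congr isop; apply/funext => v /=.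
by rewrite H (isop_linM _ _ Hp) (isop_linD _ _ Hp) (isop_linN _ Hp).
Qed.
Lemma V2n n (v : V) : v *+ 2 ^ n = 0 -> v = 0.
Proof. by elim: n v => [|n IH] v //; rewrite expnS mulrnA => /IH /V2. Qed.
(** The difference of two operators again has the form of [isop]; since [V] has no 2-torsion, its
    vanishing at [one] makes the two elements of [J] equal. Hence vectors correspond to operators,
    and composition becomes the product of [V]. *)
Lemma isop_inj p q : isop p -> isop q -> p one = q one -> p = q.
Proof.
move=> Hp Hq E; have [n [x [y H]]] := isopD Hp (isopN Hq).
have xy : x = y.
  apply: Rinj; apply/eqP; rewrite -subr_eq0; apply/eqP; apply: (@V2n n).
  by rewrite -H E subrr.
by apply/funext => v; apply/eqP; rewrite -subr_eq0 H xy subrr mul0rn.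
Qed.
Lemma op_ex w : exists p, isop p /\ p one = w.
Proof. by have [n [x [y ->]]] := span w; exists (fun v => (R x v - R y v) *+ 2 ^ n); split=> //; exists n, x, y. Qed.
Definition op w := sval (cid (op_ex w)).
Let opP w : isop (op w). Proof. by rewrite /op; case: cid => p []. Qed.
Let op1 w : op w one = w. Proof. by rewrite /op; case: cid => p []. Qed.
Definition rmul v w := op w v.

Lemma opE p : isop p -> op (p one) = p.
Proof. by move=> Hp; apply: isop_inj; rewrite ?op1. Qed.
Lemma op_R x : op (R x one) = R x. Proof. exact: opE (isopR x). Qed.
Lemma rmulR x y : rmul (R x one) (R y one) = R (mul x y) one.
Proof. by rewrite /rmul op_R Rmul. Qed.
Lemma rmulC : commutative rmul.
Proof.
have H x y v : R x (R y v) = R y (R x v) by rewrite -!Rmul mulC.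
have H' p q : isop p -> isop q -> p \o q = q \o p.
  move=> Hp [n [x [y E]]]; apply/funext => v /=; rewrite !E (isop_linM _ _ Hp) (isop_linD _ _ Hp) (isop_linN _ Hp).
  case: Hp => m [x' [y' E']]; rewrite !E' ![R _ (_ *+ _)]RM !RD !RN !(H x) !(H y).
  by rewrite -!mulrnBl.
move=> v w; rewrite /rmul -{1}(op1 v) -{2}(op1 w).
by have := H' _ _ (opP v) (opP w) => /(congr1 (@^~ one)) /=.
Qed.
Lemma rmulA : associative rmul.
Proof.
move=> u v w; rewrite /rmul -{1}(op1 v) -[op w (op v one)]/((op w \o op v) one).
by rewrite opE //; apply: isop_comp.
Qed.
Lemma rmul1 : left_id one rmul. Proof. by move=> v; rewrite /rmul op1. Qed.
Lemma rmulDl : left_distributive rmul +%R.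
Proof. by move=> u v w; rewrite /rmul (isop_linD _ _ (opP w)). Qed.
Fact one_neq0 : one != 0. Proof. exact/eqP. Qed.

Definition scalar_sort : Type := V.
HB.instance Definition _ := GRing.Zmodule.on scalar_sort.
HB.instance Definition _ := GRing.Zmodule_isComNzRing.Build scalar_sort rmulA rmulC rmul1 rmulDl one_neq0.
Definition scalar_ring : comNzRingType := scalar_sort.

Variable lt : J -> J -> Prop.
Hypotheses (lt_irr : forall x, ~ lt x x) (lt_tot : forall x y, lt x y \/ x = y \/ lt y x)
  (lt_sub : forall x y, lt y x -> exists2 z, lt j0 z & R z one = R x one - R y one)
  (mid_pos : forall x y, lt j0 x -> (y = j0 \/ lt j0 y) -> lt j0 (mid x y))
  (mul_pos : forall x y, lt j0 x -> lt j0 y -> lt j0 (mul x y)).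
Definition spos (v : V) := exists n z, lt j0 z /\ v = R z one *+ 2 ^ n.
Lemma spos0 : ~ spos 0.
Proof.
case=> n [z [z0 /esym /V2n E]]; apply: (@lt_irr j0).
by rewrite -{2}(@Rinj z j0) // E R0.
Qed.
Lemma spos_tot v : v = 0 \/ spos v \/ spos (- v).
Proof.
have [n [x [y ->]]] := span v; case: (lt_tot x y) => [L|[->|L]].
- right; right; have [z z0 E] := lt_sub L; exists n, z; split=> //.
  by rewrite E -mulNrn opprB.
- by left; rewrite subrr mul0rn.
- by right; left; have [z z0 E] := lt_sub L; exists n, z; rewrite E.
Qed.
Lemma sposS n z : lt j0 z -> forall m, (n <= m)%N -> exists2 w, lt j0 w & R z one *+ 2 ^ n = R w one *+ 2 ^ m.
Proof.
move=> z0; elim=> [|m IH]; first by rewrite leqn0 => /eqP ->; exists z.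
rewrite leq_eqVlt => /orP[/eqP<-|]; first by exists z.
rewrite ltnS => /IH [w w0 ->]; exists (mid w j0); first by apply: mid_pos; auto.
by rewrite expnS mulrnA Rhalf.
Qed.
Lemma sposD u v : spos u -> spos v -> spos (u + v).
Proof.
case=> n [x [x0 ->]] [m [y [y0 ->]]].
have [x1 x10 ->] := sposS x0 (leq_maxl n m); have [y1 y10 ->] := sposS y0 (leq_maxr n m).
exists (maxn n m).+1, (mid x1 y1); split; first by apply: mid_pos; auto.
by rewrite expnS mulrnA Rmid mulrnDl.
Qed.
Lemma sposM (u v : scalar_ring) : spos u -> spos v -> spos (u * v).
Proof.
case=> n [x [x0 ->]] [m [y [y0 ->]]]; exists (m + n)%N, (mul x y); split; first exact: mul_pos.
rewrite expnD mulrnA -rmulR.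
exact: (etrans (mulrnAl (R x one : scalar_ring) _ _) (congr1 (fun v => v *+ 2 ^ n) (mulrnAr (R x one : scalar_ring) _ _))).
Qed.

Hypotheses (lt_min : forall x, ~ lt x j0) (lt_max : forall x, ~ lt j1 x).
(** Quotients that are at most one already exist in [J]; this makes [J] the whole unit interval of
    the fraction field. *)
Hypothesis divis : forall x y, lt j0 x -> lt j0 y -> x = y \/ lt x y -> exists z, mul z y = x.

Section DMaps.
Variables (E : Type) (D : (E -> J) -> Prop).
Hypotheses (D_const : forall x, D (fun=> x)) (D_mid : forall X Y, D X -> D Y -> D (fun e => mid (X e) (Y e)))
  (D_mul : forall X Y, D X -> D Y -> D (fun e => mul (X e) (Y e))).
(** [V] is not given as a definable set, so a family of vectors counts as definable when it is a
    scaled difference of two definable families in [J]. Sums and products keep this form. *)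
Definition dmap (F : E -> V) := exists n X Y, [/\ D X, D Y & forall e, F e = (R (X e) one - R (Y e) one) *+ 2 ^ n].
Lemma dmap_const v : dmap (fun=> v).
Proof. by have [n [x [y ->]]] := span v; exists n, (fun=> x), (fun=> y). Qed.
Lemma dmap_var X : D X -> dmap (fun e => R (X e) one).
Proof. by move=> DX; exists 0%N, X, (fun=> j0); split=> // e; rewrite R0 subr0. Qed.
Lemma dmap_up n m F X Y : D X -> D Y -> (forall e, F e = (R (X e) one - R (Y e) one) *+ 2 ^ n) -> (n <= m)%N ->
  exists X Y, [/\ D X, D Y & forall e, F e = (R (X e) one - R (Y e) one) *+ 2 ^ m].
Proof.
move=> DX DY H; elim: m => [|m IH]; first by rewrite leqn0 => /eqP n0; exists X, Y; split=> // e; rewrite H n0.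
rewrite leq_eqVlt => /orP[/eqP<-|]; first by exists X, Y.
rewrite ltnS => /IH [X' [Y' [DX' DY' H']]]; exists (fun e => mid (X' e) j0), (fun e => mid (Y' e) j0); split; auto.
by move=> e; rewrite H' expnS mulrnA [(R _ _ - _) *+ 2]mulrnBl !Rhalf.
Qed.
Lemma dmapD F F' : dmap F -> dmap F' -> dmap (fun e => F e + F' e).
Proof.
case=> n [X [Y [DX DY H]]] [m [X' [Y' [DX' DY' H']]]].
have [X1 [Y1 [DX1 DY1 E1]]] := dmap_up DX DY H (leq_maxl n m).
have [X2 [Y2 [DX2 DY2 E2]]] := dmap_up DX' DY' H' (leq_maxr n m).
exists (maxn n m).+1, (fun e => mid (X1 e) (X2 e)), (fun e => mid (Y1 e) (Y2 e)); split; auto => e.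
rewrite E1 E2 expnS mulrnA [(R _ _ - _) *+ 2]mulrnBl !Rmid -mulrnDl; congr (_ *+ _).
by rewrite opprD addrACA.
Qed.
Lemma dmapN F : dmap F -> dmap (fun e => - F e).
Proof. by case=> n [X [Y [DX DY H]]]; exists n, Y, X; split=> // e; rewrite H -mulNrn opprB. Qed.
Lemma rmulBB x y z w : rmul (R x one - R y one) (R z one - R w one) =
  (R (mid (mul x z) (mul y w)) one - R (mid (mul x w) (mul y z)) one) *+ 2.
Proof.
rewrite mulrnBl !Rmid -!rmulR.
have H (p q r t : scalar_ring) : (p - q) * (r - t) = p * r + q * t - (p * t + q * r) by ring.
exact: H.
Qed.
Lemma dmapM F F' : dmap F -> dmap F' -> dmap (fun e => rmul (F e) (F' e)).
Proof.
case=> n [X [Y [DX DY H]]] [m [X' [Y' [DX' DY' H']]]].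
exists (m + n).+1, (fun e => mid (mul (X e) (X' e)) (mul (Y e) (Y' e))), (fun e => mid (mul (X e) (Y' e)) (mul (Y e) (X' e))).
split; auto => e; rewrite H H' expnS mulrnA -rmulBB expnD mulrnA.
set p := R _ _ - _; set q := R _ _ - _.
exact: (etrans (mulrnAl (p : scalar_ring) _ _) (congr1 (fun v => v *+ 2 ^ n) (mulrnAr (p : scalar_ring) _ _))).
Qed.
End DMaps.

Lemma spos_lt n x y : spos ((R x one - R y one) *+ 2 ^ n) <-> lt y x.
Proof.
have L z w m : lt w z -> spos ((R z one - R w one) *+ 2 ^ m).
  by move=> /lt_sub [v v0 <-]; exists m, v.
split; last exact: L.
case: (lt_tot x y) => [H|[->|//]]; last by rewrite subrr mul0rn => /spos0.
by move=> Hp; case: spos0; have := sposD Hp (@L _ _ n H); rewrite -mulrnDl addrA subrK subrr mul0rn.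
Qed.

Variable D : (J -> J) -> Prop.
Hypotheses (D_const : forall x, D (fun=> x)) (D_id : D id)
  (D_mid : forall X Y, D X -> D Y -> D (fun e => mid (X e) (Y e)))
  (D_mul : forall X Y, D X -> D Y -> D (fun e => mul (X e) (Y e)))
  (D_sup : forall X Y, D X -> D Y -> ~ lt (Y j0) (X j0) -> exists s, (forall t, ~ lt (Y t) (X t) -> ~ lt s t) /\
     forall t, lt t s -> exists t', lt t t' /\ ~ lt (Y t') (X t')).

Theorem scalar_rcf : exists (K : rcfType) (e : V -> K),
  [/\ e one = 1, {morph e : a b / a + b}, (forall a b, e (rmul a b) = e a * e b),
    forall a, 0 < e a <-> spos a & forall u, 0 <= u <= 1 -> exists x, u = e (R x one)].
Proof.
have [K [e [e1 eD eM eP eF]]] := @frac_field scalar_ring spos sposD sposM spos0 spos_tot.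
have e0 : e 0 = 0 by apply: (addIr (e 0)); rewrite -eD !add0r.
have eN a : e (- a) = - e a by apply/eqP; rewrite -addr_eq0 -eD addNr e0.
have eMn a n : e (a *+ n) = e a *+ n by elim: n => [|n IH]; rewrite ?mulr0n // !mulrS eD IH.
have ltE x y : lt x y <-> e (R x one) < e (R y one).
  have L z w : lt z w -> e (R z one) < e (R w one).
    move=> /lt_sub [v v0 E]; rewrite -subr_gt0 -eN -eD; apply/eP; rewrite -E.
    by exists 0%N, v.
  split; first exact: L.
  by case: (lt_tot x y) => [//|[->|/L H]]; rewrite ?ltxx // ltNge (ltW H).
have leE x y : e (R x one) <= e (R y one) -> x = y \/ lt x y.
  by case: (lt_tot x y) => [?|[?|/ltE H]]; [right|left|rewrite leNgt H].
have io01 x : 0 <= e (R x one) <= 1.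
  have E0 : e (R j0 one) = 0 by rewrite R0.
  have E1 : e (R j1 one) = 1 by rewrite R1.
  by rewrite !leNgt -E0 -E1; apply/andP; split; apply/negP => /ltE; [apply: lt_min|apply: lt_max].
(* Numerator and denominator are brought to a common power of two, after which their quotient is an
   element of [J] by [divis]. *)
have onto (u : K) : 0 <= u <= 1 -> exists x, u = e (R x one).
  case/andP; rewrite le_eqVlt => /orP[/eqP <- _|u0 u1]; first by exists j0; rewrite R0 e0.
  have [a [b [Hb E]]] := eF u.
  have b0 : 0 < e b by apply/eP.
  have Ha : spos a by apply/eP; rewrite -(mulfVK (lt0r_neq0 b0) (e a)) -E mulr_gt0.
  case: Ha Hb E b0 => n [z [z0 ->]] [m [w [w0 ->]]].
  have [x x0 ->] := sposS z0 (leq_maxl n m); have [y y0 ->] := sposS w0 (leq_maxr n m).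
  set N := maxn n m; rewrite !eMn => E b0.
  have N0 : (0 < 2 ^ N)%N by rewrite expn_gt0.
  have y1 : 0 < e (R y one) by rewrite -(pmulrn_lgt0 _ N0).
  have xy : e (R x one) <= e (R y one).
    by move: u1; rewrite E ler_pdivrMr // mul1r ler_pMn2r.
  have [v Hv] := divis x0 y0 (leE _ _ xy).
  exists v; rewrite E -Hv -rmulR eM -mulrnAr mulfK // gt_eqF //.
(* The coefficients are fractions. Multiplying by a positive common denominator turns [p] into a
   definable family of vectors with the same signs. *)
have dp (p : {poly K}) : exists F q, [/\ dmap D F, spos q & forall t, e (F t) = e q * p.[e (R t one)]].
  elim/poly_ind: p => [|p c [F [q [dF D0 E]]]].
    exists (fun=> 0), one; split=> // [||t]; [exact: dmap_const|by apply/eP; rewrite e1|].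
    by rewrite e0 horner0 mulr0.
  have [a [b [Hb ->]]] := eF c; have b0 : 0 < e b by apply/eP.
  exists (fun t => rmul (rmul (F t) (R t one)) b + rmul a q), (rmul q b); split.
  - apply: (dmapD D_const D_mid (dmapM D_mid D_mul (dmapM D_mid D_mul dF (dmap_var D_const D_id)) (dmap_const D_const _))).
    exact: (dmapM D_mid D_mul (dmap_const D_const _) (dmap_const D_const _)).
  - by apply/eP; rewrite eM mulr_gt0 //; apply/eP.
  - move=> t; rewrite eD !eM E hornerMXaddC; field; exact: lt0r_neq0.
have sup (p : {poly K}) : p.[0] <= 0 -> exists s, [/\ 0 <= s <= 1,
  forall t, 0 <= t <= 1 -> p.[t] <= 0 -> t <= s &
  forall t, t < s -> exists t', [/\ 0 <= t' <= 1, t < t' & p.[t'] <= 0]].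
  have [F [q [[n [X [Y [DX DY XY]]]] D0 E]]] := dp p; have De : 0 < e q by apply/eP.
  have FE t : ~ lt (Y t) (X t) <-> p.[e (R t one)] <= 0.
    rewrite leNgt -(pmulr_rgt0 _ De) -E XY -(spos_lt n); split=> [H|/negP H /eP] //.
    by apply/negP => /eP.
  move=> p0; have [|s [up dn]] := D_sup DX DY; first by apply/FE; rewrite R0 e0.
  exists (e (R s one)); split=> // [t|t ts].
    move=> /onto [x ->] /FE /up H; rewrite leNgt; by apply/negP => /ltE.
  case: (ltP t 0) => [t0|t0]; first by exists 0; rewrite lexx ler01; split.
  have [|x tx] := onto t; first by rewrite t0 (le_trans (ltW ts)) //; case/andP: (io01 s).
  have [|y [xy Hy]] := dn x; first by apply/ltE; rewrite -tx.
  by exists (e (R y one)); split=> //; [rewrite tx; apply/ltE|apply/FE].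
have [L [i [[i' i1K i2K] i1 iD iM iL]]] := rcf_of_complete (real_closed_of_complete sup).
have i0 : i 0 = 0 by apply: (addIr (i 0)); rewrite -iD !add0r.
exists L, (i \o e); split=> /=.
- by rewrite e1 i1.
- by move=> a b; rewrite -iD; congr (i _); apply: eD.
- by move=> a b; rewrite -iM; congr (i _); apply: eM.
- by move=> a; rewrite -i0 iL; apply: eP.
- move=> u Hu; have [|x E] := onto (i' u); last by exists x; rewrite -E i2K.
  by rewrite !leNgt -!iL i2K i0 i1 -!leNgt.
Qed.

Definition numer x := R x one + R x one - one.
Definition denom x := rmul (R x one) (one - R x one).
(* The field is carried to the open unit interval by x |-> (2x-1)/(x(1-x)). *)
Theorem scalar_interval : exists (K : rcfType) (h : K -> J),
  [/\ injective h, forall x, lt j0 x /\ lt x j1 <-> exists u, h u = x,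
    forall x y z, lt j0 x /\ lt x j1 -> lt j0 y /\ lt y j1 -> lt j0 z /\ lt z j1 ->
      (exists u v, [/\ x = h u, y = h v & z = h (u + v)]) <->
      rmul (rmul (numer x) (denom y)) (denom z) + rmul (rmul (numer y) (denom x)) (denom z)
        = rmul (rmul (numer z) (denom x)) (denom y) &
    forall x y z, lt j0 x /\ lt x j1 -> lt j0 y /\ lt y j1 -> lt j0 z /\ lt z j1 ->
      (exists u v, [/\ x = h u, y = h v & z = h (u * v)]) <->
      rmul (rmul (numer x) (numer y)) (denom z) = rmul (rmul (numer z) (denom x)) (denom y)].
Proof.
have [K [e [e1 eD eM eP onto]]] := scalar_rcf.
have e0 : e 0 = 0 by apply: (addIr (e 0)); rewrite -eD !add0r.
have eN a : e (- a) = - e a by apply/eqP; rewrite -addr_eq0 -eD addNr e0.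
have e_inj a b : e a = e b -> a = b.
  move=> E; apply/eqP; rewrite -subr_eq0; apply/eqP.
  have E0 : e (a - b) = 0 by rewrite eD eN E subrr.
  case: (spos_tot (a - b)) => [//|[/eP|/eP]]; rewrite ?eN E0 ?oppr0 ltxx //.
pose i x := e (R x one).
have i0 : i j0 = 0 by rewrite /i R0.
have i1 : i j1 = 1 by rewrite /i R1.
have ltE x y : lt x y <-> i x < i y.
  by rewrite -(spos_lt 0) /= -eP eD eN subr_gt0.
have i01 x : lt j0 x /\ lt x j1 <-> 0 < i x < 1.
  by split=> [[/ltE H1 /ltE H2]|/andP[H1 H2]]; [rewrite -i0 -i1 H1|split; apply/ltE; rewrite ?i0 ?i1].
have i_inj x y : i x = i y -> x = y by move=> /e_inj /Rinj.
pose th (x : K) := (2 * x - 1) / (x * (1 - x)).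
have th_onto u : exists x, 0 < x < 1 /\ th x = u.
  (* A root in the open unit interval solves [th x = u]. The values at 0 and 1 are -1 and 1, so
     neither endpoint is a root. *)
  pose p : {poly K} := 2 *: 'X - 1 - u *: ('X * (1 - 'X)).
  have pE x : p.[x] = 2 * x - 1 - u * (x * (1 - x)) by rewrite /p !hornerE.
  have [|x /andP[x0 x1]] := @poly_ivt K p 0 1 ler01; first by rewrite !pE; apply/andP; split; lra.
  move=> /rootP; rewrite pE => E.
  have x0' : 0 < x by rewrite lt_neqAle x0 andbT; apply/eqP => H; rewrite -H in E; lra.
  have x1' : x < 1 by rewrite lt_neqAle x1 andbT; apply/eqP => H; rewrite H in E; lra.
  exists x; split; first by rewrite x0'.
  have d0 : x * (1 - x) != 0 by rewrite mulf_neq0 // gt_eqF // subr_gt0.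
  by apply: (mulIf d0); rewrite /th mulfVK //; lra.
have th_inj x y : 0 < x < 1 -> 0 < y < 1 -> th x = th y -> x = y.
  move=> /andP[x0 x1] /andP[y0 y1] E; apply/eqP; rewrite -subr_eq0; apply/eqP.
  have dx : x != 0 by rewrite gt_eqF.
  have dy : y != 0 by rewrite gt_eqF.
  have dx1 : 1 - x != 0 by rewrite gt_eqF // subr_gt0.
  have dy1 : 1 - y != 0 by rewrite gt_eqF // subr_gt0.
  (* The second factor is positive on the open unit interval. *)
  have H : (x - y) * (x * y + (1 - x) * (1 - y)) = 0.
    have -> : (x - y) * (x * y + (1 - x) * (1 - y)) = (th x - th y) * (x * (1 - x) * y * (1 - y)).
      by rewrite /th; field; rewrite dx dy dx1 dy1.
    by rewrite E subrr mul0r.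
  move/eqP: H; rewrite mulf_eq0 => /orP[/eqP //|/eqP H].
  by exfalso; nra.
have ex u : exists x, (lt j0 x /\ lt x j1) /\ th (i x) = u.
  have [x [Hx E]] := th_onto u; have [|z Ez] := onto x; first by case/andP: Hx => ? ?; rewrite !ltW.
  by exists z; rewrite i01 /i -Ez.
pose h u := sval (cid (ex u)).
have hP u : lt j0 (h u) /\ lt (h u) j1 by rewrite /h; case: cid => x [].
have hE u : th (i (h u)) = u by rewrite /h; case: cid => x [].
have hK x : lt j0 x /\ lt x j1 -> h (th (i x)) = x.
  by move=> Hx; apply: i_inj; apply: th_inj; rewrite ?hE //; apply/i01.
have nE x : e (numer x) = 2 * i x - 1 by rewrite /numer !eD eN e1 /i; ring.
have dE x : e (denom x) = i x * (1 - i x) by rewrite /denom eM eD eN e1.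
have d0 x : lt j0 x /\ lt x j1 -> e (denom x) != 0.
  by move=> /i01 /andP[H1 H2]; rewrite dE mulf_neq0 // gt_eqF // subr_gt0.
have thE x : th (i x) = e (numer x) / e (denom x) by rewrite nE dE.
have eM3 p q r : e (rmul (rmul p q) r) = e p * e q * e r by rewrite !eM.
exists K, h; split.
- by move=> u v E; rewrite -(hE u) -(hE v) E.
- by move=> x; split=> [/hK <-|[u <-]] //; eexists.
- move=> x y z Hx Hy Hz; have [dx dy dz] := And3 (d0 x Hx) (d0 y Hy) (d0 z Hz).
  have -> : (exists u v, [/\ x = h u, y = h v & z = h (u + v)]) <-> th (i x) + th (i y) = th (i z).
    split=> [[u [v [-> -> ->]]]|E]; first by rewrite !hE.
    by exists (th (i x)), (th (i y)); rewrite E !hK.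
  rewrite !thE; split=> [E|/(congr1 e)].
    apply: e_inj; rewrite eD !eM3.
    have -> : e (numer x) * e (denom y) * e (denom z) + e (numer y) * e (denom x) * e (denom z) =
      (e (numer x) / e (denom x) + e (numer y) / e (denom y)) * (e (denom x) * e (denom y) * e (denom z)) by field; rewrite ?dx ?dy ?dz.
    by rewrite E; field; rewrite ?dx ?dy ?dz.
  rewrite eD !eM3 => E.
  have -> : e (numer x) / e (denom x) + e (numer y) / e (denom y) =
    (e (numer x) * e (denom y) * e (denom z) + e (numer y) * e (denom x) * e (denom z)) / (e (denom x) * e (denom y) * e (denom z)) by field; rewrite ?dx ?dy ?dz.
  by rewrite E; field; rewrite ?dx ?dy ?dz.
- move=> x y z Hx Hy Hz; have [dx dy dz] := And3 (d0 x Hx) (d0 y Hy) (d0 z Hz).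
  have -> : (exists u v, [/\ x = h u, y = h v & z = h (u * v)]) <-> th (i x) * th (i y) = th (i z).
    split=> [[u [v [-> -> ->]]]|E]; first by rewrite !hE.
    by exists (th (i x)), (th (i y)); rewrite E !hK.
  rewrite !thE; split=> [E|/(congr1 e)].
    apply: e_inj; rewrite !eM3.
    have -> : e (numer x) * e (numer y) * e (denom z) = (e (numer x) / e (denom x) * (e (numer y) / e (denom y))) * (e (denom x) * e (denom y) * e (denom z)) by field; rewrite ?dx ?dy ?dz.
    by rewrite E; field; rewrite ?dx ?dy ?dz.
  rewrite !eM3 => E.
  have -> : e (numer x) / e (denom x) * (e (numer y) / e (denom y)) = (e (numer x) * e (numer y) * e (denom z)) / (e (denom x) * e (denom y) * e (denom z)) by field; rewrite ?dx ?dy ?dz.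
  by rewrite E; field; rewrite ?dx ?dy ?dz.
Qed.
End RingOfScalars.

End ScalarRing.

Section Ominimal.
Context {OS : omg}.
Local Notation M := (om_M OS).
Local Notation G := (om_G OS).
Local Notation T := (carrier (om_M OS)).
Local Notation env := (nat -> carrier (om_M OS)).
Local Notation "0" := (ozero G) : og_scope.
Local Notation "x + y" := (oadd G x y) : og_scope.
Local Notation "- x" := (oopp G x) : og_scope.
Local Notation "x - y" := (osub G x y) : og_scope.
Local Notation "x < y" := (olt G x y) : og_scope.
Local Notation "x <= y" := (ole G x y) : og_scope.
Local Notation "x < y < z" := (olt G x y /\ olt G y z) : og_scope.
Local Notation "x <= y <= z" := (ole G x y /\ ole G y z) : og_scope.
Local Notation "x < y <= z" := (olt G x y /\ ole G y z) : og_scope.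
Local Notation "x <= y < z" := (ole G x y /\ olt G y z) : og_scope.
Local Open Scope og_scope.

(** * One-variable definable sets *)

Definition omin (x y : T) : T := epsilon (inhabits x) (fun z => (x <= y /\ z = x) \/ (y < x /\ z = y)).
Lemma ominP x y : (x <= y /\ omin x y = x) \/ (y < x /\ omin x y = y).
Proof.
have := epsilon_spec (inhabits x) (fun z => (x <= y /\ z = x) \/ (y < x /\ z = y)).
by apply; case: (lt_le_dec y x) => H; [exists y; right|exists x; left].
Qed.
Lemma omin_lel x y : omin x y <= x. Proof. by case: (ominP x y) => -[H ->]; olra. Qed.
Lemma omin_ler x y : omin x y <= y. Proof. by case: (ominP x y) => -[H ->]; olra. Qed.
Lemma omin_gt z x y : z < x -> z < y -> z < omin x y. Proof. by case: (ominP x y) => -[H ->]. Qed.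

Lemma rgerm (U : T -> Prop) a b : dp1 U -> a < b ->
  exists c, a < c <= b /\ ((forall x, a < x < c -> U x) \/ (forall x, a < x < c -> ~ U x)).
Proof.
move=> dU ab; have [Ls HLs] := omin_bp U dU.
have [c [[ac cb] Hc]] : exists c, a < c <= b /\ forall l, In l Ls -> a < l -> c <= l.
  elim: Ls {HLs} => [|l Ls [c [[ac cb] IH]]]; first by exists b; split; [olra|].
  case: (lt_le_dec a l) => al; last by exists c; split=> // l' [<-|/IH//]; olra.
  exists (omin c l); have A := omin_lel c l; have B := omin_ler c l; split.
    by split; [apply: omin_gt|olra].
  by move=> l' [<-//|/IH K] L; have := K L; olra.
exists c; split=> //.
have K x y : a < x < c -> a < y < c -> x <= y -> U x <-> U y.
  move=> Hx Hy xy; apply: HLs => // l Hl L.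
  have := Hc l Hl; case: (lt_le_dec a l) => al; last by olra.
  by move=> /(_ al); olra.
have K' x y : a < x < c -> a < y < c -> U x <-> U y.
  move=> Hx Hy; case: (lt_le_dec x y) => L; first by apply: K => //; olra.
  by apply iff_sym; apply: K.
have mid : a < hf (a + c) < c by olra.
case: (classic (U (hf (a + c)))) => Um; [left|right] => x Hx; first by apply/(K' x _ Hx mid).
by move/(K' x _ Hx mid).
Qed.

Lemma lgerm (U : T -> Prop) a b : dp1 U -> a < b ->
  exists c, a <= c < b /\ ((forall x, c < x < b -> U x) \/ (forall x, c < x < b -> ~ U x)).
Proof.
move=> dU ab; have [||c [Hc K]] := rgerm (fun x => U (- x)) (- b) (- a); [by ddef|by olra|].
exists (- c); split; first by olra.
by case: K => K; [left|right] => x Hx; rewrite -(oppK x); apply: K; olra.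
Qed.

(** This is [e / 2^n]. Lengths of subintervals are kept in this form because half of a tall element
    is tall, so the loss is harmless. *)
Fixpoint hfn (n : nat) (e : T) : T := match n with O => e | S n => hf (hfn n e) end.
Lemma hfn_pos n e : 0 < e -> 0 < hfn n e.
Proof. by move=> e0; elim: n => //= n IH; olra. Qed.
Lemma hfn_le n e : 0 < e -> hfn n e <= e.
Proof. by move=> e0; elim: n => [|n IH] /=; [olra|have := hfn_pos n e e0; olra]. Qed.
Lemma hfn_add m n e : hfn m (hfn n e) = hfn (m + n) e.
Proof. by elim: m => //= m ->. Qed.

(** Each point costs at most one halving, because it misses one of the two open halves. *)
Lemma avoid_list Ls a e : 0 < e -> exists n a', a <= a' /\ a' + hfn n e <= a + e /\
  forall l, In l Ls -> ~ (a' < l < a' + hfn n e).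
Proof.
move=> e0; elim: Ls => [|l Ls [n [a' [H1 [H2 H3]]]]]; first by exists O, a => /=; split; [olra|split; [olra|]].
have p := hfn_pos n e e0.
case: (lt_le_dec l (a' + hfn (S n) e)) => L.
  exists (S n), (a' + hfn (S n) e); split; first by move: L => /=; olra.
  split; first by move=> /=; olra.
  move=> l' [<-|/H3 K] K'; first by olra.
  by apply: K; move: K' => /=; olra.
exists (S n), a'; split=> //; split; first by move=> /=; olra.
move=> l' [<-|/H3 K] K'; first by olra.
by apply: K; move: K' => /=; olra.
Qed.

Lemma bps_const (U : T -> Prop) Ls a b : bps U Ls -> (forall l, In l Ls -> ~ (a < l < b)) ->
  (forall x, a < x < b -> U x) \/ (forall x, a < x < b -> ~ U x).
Proof.
move=> HLs HL.
have K x y : a < x < b -> a < y < b -> x <= y -> U x <-> U y.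
  by move=> Hx Hy xy; apply: HLs => // l Hl L; apply: (HL l Hl); olra.
case: (classic (exists x, a < x < b /\ U x)) => [[x [Hx Ux]]|N]; last first.
  by right=> x Hx Ux; apply: N; exists x.
left=> y Hy; case: (lt_le_dec x y) => L; first by apply/(K x y) => //; olra.
by apply/(K y x).
Qed.

Lemma const_sub (U : T -> Prop) a e : dp1 U -> 0 < e ->
  exists n a', a <= a' /\ a' + hfn n e <= a + e /\
   ((forall x, a' < x < a' + hfn n e -> U x) \/ (forall x, a' < x < a' + hfn n e -> ~ U x)).
Proof.
move=> /omin_bp [Ls HLs] e0; have [n [a' [H1 [H2 H3]]]] := avoid_list Ls a e e0.
by exists n, a'; do 2!split=> //; apply: bps_const HLs H3.
Qed.

Lemma sup_ex (U : T -> Prop) x0 b : dp1 U -> U x0 -> (forall u, U u -> u <= b) ->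
  exists s, (forall u, U u -> u <= s) /\ (forall t, t < s -> exists u, U u /\ t < u).
Proof.
move=> dU U0 Ub; pose P y := exists u, U u /\ y <= u.
case: (classic (P b)) => [[u [Uu bu]]|Pb].
  exists b; split=> // t tb; exists u; split=> //; olra.
have dP : dp1 P by rewrite /P; ddef.
have Dn x y : P y -> x <= y -> P x by move=> [u [Uu yu]] xy; exists u; split=> //; olra.
have P0 : P x0 by exists x0; split=> //; olra.
case: (dcut P x0 b dP Dn P0 Pb).
- move=> [m [[u [Uu mu]] H]]; exists m; split=> [v Uv|t tm]; last by exists u; split=> //; olra.
  by move=> K; apply: (H v) => //; exists v; split=> //; olra.
- move=> [m [N H]]; exists m; split=> [v Uv K|t tm].
    by apply: N; exists v; split=> //; olra.
  have [|u [Uu L]] := H (hf (t + m)); first by olra.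
  by exists u; split=> //; olra.
Qed.

Lemma inf_ex (U : T -> Prop) x0 b : dp1 U -> U x0 -> (forall u, U u -> b <= u) ->
  exists s, (forall u, U u -> s <= u) /\ (forall t, s < t -> exists u, U u /\ u < t).
Proof.
move=> dU U0 Ub; have [|||s [H1 H2]] := sup_ex (fun x => U (- x)) (- x0) (- b).
- by ddef.
- by rewrite oppK.
- by move=> u /Ub; olra.
exists (- s); split=> [u Uu|t Ht].
  by have := H1 (- u); rewrite oppK => /(_ Uu); olra.
by have [|u [Uu L]] := H2 (- t); [olra|exists (- u); split=> //; olra].
Qed.

(** The points up to which the relation holds form an initial segment, and the local hypothesis
    would carry the relation past its endpoint given by [dcut]. It is used for equality, for
    equivalence, for the order and for orders of germs. *)
Lemma loc_mono (R : T -> T -> Prop) f a b : dp2 R -> df1 f -> (forall x y z, R x y -> R y z -> R x z) ->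
  (forall x, a < x < b -> exists d, 0 < d /\ forall t, 0 < t < d ->
     (a < x - t -> R (f (x - t)) (f x)) /\ (x + t < b -> R (f x) (f (x + t)))) ->
  forall x y, a < x -> x < y -> y < b -> R (f x) (f y).
Proof.
move=> dR df tr L x y ax xy yb.
pose P z := z <= x \/ forall w, x < w <= z -> R (f x) (f w).
apply: NNPP => N.
have Px : P x by left; olra.
have Py : ~ P y by case=> [|H]; [olra|apply: N; apply: H; olra].
have dP : dp1 P by rewrite /P; ddef.
have Dn u v : P v -> u <= v -> P u.
  move=> [H|H] uv; first by left; olra.
  by right=> w Hw; apply: H; olra.
case: (dcut P x y dP Dn Px Py) => [[m [Pm H]]|[m [Pm H]]].
- have xm : x <= m by move=> /H /(_ Px).
  have my : m < y by apply/nle => K; apply: Py; apply: Dn K.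
  have [|d [d0 Hd]] := L m; first by olra.
  have Hm : forall w, x < w <= m -> R (f x) (f w) by case: Pm => // K w; olra.
  set t := omin (hf d) (hf (y - m)).
  have t0 : 0 < t by apply: omin_gt; olra.
  have t1 := omin_lel (hf d) (hf (y - m)); have t2 := omin_ler (hf d) (hf (y - m)); rewrite -/t in t1 t2.
  apply: (H (m + t)); first by olra.
  right=> w Hw; case: (lt_le_dec m w) => mw; last by apply: Hm; olra.
  have [|_ K] := Hd (w - m); first by olra.
  have E : m + (w - m) = w by olra.
  rewrite E in K; case: (le_eqlt _ _ xm) => [->|xm']; first by apply: K; olra.
  by apply: (tr _ (f m)); [apply: Hm; olra|apply: K; olra].
- have xm : x < m by apply/nle => K; apply: Pm; apply: Dn K.
  have my : m <= y by move=> /H.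
  have [|d [d0 Hd]] := L m; first by olra.
  apply: Pm; right=> w Hw; case: (lt_le_dec w m) => wm.
    by have [|K|K] := H (hf (w + m)); [olra|olra|apply: K; olra].
  have -> : w = m by olra.
  set t := omin (hf d) (hf (m - x)).
  have t0 : 0 < t by apply: omin_gt; olra.
  have t1 := omin_lel (hf d) (hf (m - x)); have t2 := omin_ler (hf d) (hf (m - x)); rewrite -/t in t1 t2.
  have [|K _] := Hd t; first by olra.
  apply: (tr _ (f (m - t))); last by apply: K; olra.
  by have [|K'|K'] := H (m - t); [olra|olra|apply: K'; olra].
Qed.

Lemma conn (U : T -> Prop) a b : dp1 U ->
  (forall x, a < x < b -> exists d, 0 < d /\ forall y, a < y < b -> x - d < y < x + d -> U y <-> U x) ->
  forall x y, a < x < b -> a < y < b -> U x <-> U y.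
Proof.
move=> dU L.
have H x y : a < x -> x < y -> y < b -> U x <-> U y.
  apply: (loc_mono (fun x y => U x <-> U y) (fun x => x)); [by ddef|by ddef|by tauto|].
  move=> z Hz; have [d [d0 Hd]] := L z Hz; exists d; split=> // t Ht; split=> K; last first.
    by apply iff_sym; apply: Hd; olra.
  by apply: Hd; olra.
move=> x y Hx Hy; case: (lt_tot x y) => [K|[->//|K]]; first by apply: H; olra.
by apply iff_sym; apply: H; olra.
Qed.

Lemma def_exk k (P : env -> Prop) : Def P ->
  Def (fun e => exists e' : env, P (fun i => if i <? k then e' i else e i)).
Proof.
elim: k => [|k IH] HP.
  by apply: Def_ext HP => e; split=> [H|[_]//]; exists e.
pose s (i : nat) (e : env) := if i =? k then e 0%nat else e (S i).
have H : Def (fun e => exists a, exists e' : env,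
    P (fun i => if i <? k then e' i else (if i =? k then a else e i))).
  apply: def_ex; rewrite /eshift.
  apply: (def_sub (fun e => exists e' : env, P (fun i => if i <? k then e' i else e i)) s (IH HP)).
  by move=> i; rewrite /s; case: (i =? k); apply: dt_var.
apply: Def_ext H => e; split=> [[a [e' H]]|[e' H]].
  exists (fun i => if i =? k then a else e' i).
  move: H; congr (P _); apply: functional_extensionality => i.
  case: (Nat.ltb_spec i k); case: (Nat.eqb_spec i k); case: (Nat.ltb_spec i (S k)) => //; lia.
exists (e' k), e'; move: H; congr (P _); apply: functional_extensionality => i.
case: (Nat.ltb_spec i k); case: (Nat.eqb_spec i k) => [->|]; case: Nat.ltb_spec => //; lia.
Qed.

(** Saturation is given for subsets of the line. The last coordinate is realised first, against the
    projections of the sets [D n], and the rest follows by induction. *)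
Lemma sat_env k : forall D : nat -> env -> Prop,
  (forall n, Def (D n)) -> (forall n e, D (S n) e -> D n e) ->
  (forall n (e e' : env), (forall i, (i < k)%nat -> e i = e' i) -> D n e -> D n e') ->
  (forall n, exists e, D n e) -> exists e, forall n, D n e.
Proof.
elim: k => [|k IH] D dD dec dep ne.
  have [e _] := ne O; exists e => n; have [e' He'] := ne n.
  by apply: (dep n e') => // i; lia.
have dec' n m e : (n <= m)%nat -> D m e -> D n e.
  elim: m => [|m IHm] Hm Dm; first by have -> : n = O by lia.
  case: (Nat.eq_dec n (S m)) => [->//|?]; apply: IHm; [lia|exact: dec].
pose ext a (e : env) : env := fun i => if i <? k then e i else a.
pose Y n a := exists e, D n (ext a e).
pose X n (l : list T) := length l = 1%nat /\ Y n (nth 0 l 0).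
have inj : forall i j : nat, @inl nat (rsym M) i = inl j -> i = j by move=> i j [].
have [n|js|a Ha] := om_sat OS nat (fun n => inl n) inj X.
- apply: (Def_definable 1 (fun e => Y n (e 0%nat)) 0).
  have := def_exk k _ (dD n) => /(def_ren _ (fun i => inl O)); apply: Def_ext => e.
  by rewrite /Y /ext /renv.
- have [m Hm] : exists m, forall j, In j js -> (j <= m)%nat.
    exists (list_sum js) => j; elim: js => //= a l IHl [->|/IHl]; lia.
  have [e He] := ne m; exists (e k) => j Hj; split=> //=; exists e.
  apply: (dep j e); last by apply: (dec' j m) => //; apply: Hm.
  by move=> i Hi; rewrite /ext; case: Nat.ltb_spec => // ?; congr e; lia.
have [||||e He] := IH (fun n e => D n (ext a e)).
- move=> n; have := def_sub _ (fun i e => if i <? k then e i else a) (dD n); apply=> i.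
  by case: (i <? k); [apply: dt_var|apply: dt_const].
- by move=> n e; apply: dec.
- move=> n e e' H; apply: dep => i Hi; rewrite /ext; case: Nat.ltb_spec => // ?; exact: H.
- by move=> n; case: (Ha n).
by exists (ext a e).
Qed.

Lemma away Ls (x c : T) : 0 < c -> ~ In x Ls ->
  exists d, 0 < d <= c /\ forall l, In l Ls -> l <= x - d \/ x + d <= l.
Proof.
move=> c0; elim: Ls => [|l Ls IH] N; first by exists c; split=> //; olra.
have [|d [d0 Hd]] := IH; first by move=> K; apply: N; right.
case: (lt_tot l x) => [L|[E|L]]; last 2 first.
- by case: N; left.
- have A := omin_lel d (l - x); have B := omin_ler d (l - x).
  have C : 0 < omin d (l - x) by apply: omin_gt; olra.
  exists (omin d (l - x)); split; first by olra.
  by move=> l' [<-|/Hd [?|?]]; [right|left|right]; olra.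
- have A := omin_lel d (x - l); have B := omin_ler d (x - l).
  have C : 0 < omin d (x - l) by apply: omin_gt; olra.
  exists (omin d (x - l)); split; first by olra.
  by move=> l' [<-|/Hd [?|?]]; [left|left|right]; olra.
Qed.

(** * Uniform finiteness *)

Section UniformFiniteness.
Variable W : env -> Prop.
Hypothesis dW : Def W.

Definition jump (e : env) (x : T) := forall d, 0 < d -> exists y,
  x - d < y < x + d /\ ~ (W (scons y e) <-> W (scons x e)).
(** Having [n] jumps is written as a chain of quantifiers, so that it is a definable condition on
    [e] for each [n]. *)
Fixpoint chn (n : nat) (e : env) (lo : T) : Prop :=
  match n with O => True | S n => exists x, lo < x /\ jump e x /\ chn n e x end.
Definition Dn (n : nat) (e : env) := match n with O => True | S n => exists lo, jump e lo /\ chn n e lo end.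

Lemma def_jump : Def (fun e => jump (fun i => e (S i)) (e 0%nat)).
Proof.
by rewrite /jump; ddef.
Qed.
Lemma def_chn n : Def (fun e => chn n (fun i => e (S i)) (e 0%nat)).
Proof.
elim: n => [|n IH] /=; first by ddef.
ddef; first exact: (def_ren _ (fun i => match i with O => inl O | S j => inl (S (S j)) end) def_jump).
exact: (def_ren _ (fun i => match i with O => inl O | S j => inl (S (S j)) end) IH).
Qed.
Lemma def_D n : Def (Dn n).
Proof. by case: n => [|n]; rewrite /Dn; ddef; (exact: def_jump || exact: def_chn). Qed.
Lemma chn_dec n e lo : chn (S n) e lo -> chn n e lo.
Proof.
elim: n lo => [|n IH] lo //= [x [H1 [H2 H3]]]; exists x; do 2!split=> //; exact: IH.
Qed.
Lemma D_dep : exists k, forall n (e e' : env), (forall i, (i < k)%nat -> e i = e' i) -> Dn n e -> Dn n e'.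
Proof.
have [k Hk] := def_dep _ dW; exists k => n e e' H.
have X x : W (scons x e) <-> W (scons x e').
  by apply: Hk => -[|i] //= Hi; apply: H; lia.
have B x : jump e x <-> jump e' x.
  by split=> K d d0; have [y [Hy Ky]] := K d d0; exists y; split=> //; move: Ky; rewrite !X.
have C m lo : chn m e lo <-> chn m e' lo.
  by elim: m lo => //= m IH lo; split=> -[x [H1 [/B H2 /IH H3]]]; exists x.
by case: n => //= n [lo [/B H1 /C H2]]; exists lo.
Qed.
Lemma chn_list n e lo : chn n e lo ->
  exists L, length L = n /\ NoDup L /\ forall x, In x L -> lo < x /\ jump e x.
Proof.
elim: n lo => [|n IH] lo /=; first by exists []; split=> //; split; [constructor|].
move=> [x [lx [bx /IH [L [H1 [H2 H3]]]]]]; exists (x :: L); split; first by rewrite /= H1.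
split; first by constructor=> // /H3 [] /lt_irr.
by move=> y [<-//|/H3 [K1 K2]]; split=> //; apply: lt_tr K1.
Qed.
Lemma list_chn n e lo L : length L = n -> NoDup L -> (forall x, In x L -> lo < x /\ jump e x) -> chn n e lo.
Proof.
elim: n lo L => [|n IH] lo L //= HL ND HB.
have [m [Hm Km]] : exists m, In m L /\ forall x, In x L -> m <= x.
  case: L HL {ND HB} => [|a L _] //.
  elim: L => [|b L [m [Hm Km]]]; first by exists a; split; [left|move=> x [<-|//]; exact: leR].
  case: (lt_le_dec b m) => C.
    exists b; split; first by right; left.
    by move=> x [<-|[<-|Hx]]; [have := Km a (or_introl eq_refl); olra|exact: leR|have := Km x (or_intror Hx); olra].
  exists m; split; first by case: Hm => [->|Hm]; [left|right; right].
  by move=> x [<-|[<-|Hx]] //; [apply: Km; left|apply: Km; right].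
have [L1 [L2 EL]] := in_split _ _ Hm; exists m.
have [? ?] := HB m Hm; do 2!split=> //; apply: (IH m (L1 ++ L2)).
- by move: HL; rewrite EL !length_app /=; lia.
- by rewrite EL in ND; apply: NoDup_remove_1 ND.
- move=> x Hx; have xL : In x L by rewrite EL; apply/in_app_iff; move/in_app_iff: Hx => [|]; [left|right; right].
  have [_ ?] := HB x xL; split=> //.
  case: (le_eqlt _ _ (Km x xL)) => // E; subst x.
  by rewrite EL in ND; case: (NoDup_remove_2 _ _ _ ND).
Qed.

Lemma bps_jump e Ls x c : 0 < c -> bps (fun x => W (scons x e)) Ls -> jump e x -> In x Ls.
Proof.
move=> c0 HLs bx; apply: NNPP => N.
have [d [[d0 _] Hd]] := away Ls x c c0 N; have [y [Hy Ky]] := bx d d0; apply: Ky.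
case: (lt_le_dec x y) => L; last by apply: HLs => // l /Hd [?|?]; olra.
by apply iff_sym; apply: HLs => [|l /Hd [?|?]]; olra.
Qed.

Lemma jump_bps e Ls : (forall x, jump e x -> In x Ls) -> bps (fun x => W (scons x e)) Ls.
Proof.
move=> HLs x y xy N.
have L z : x <= z <= y -> exists d, 0 < d /\ forall w, z - d < w < z + d -> W (scons w e) <-> W (scons z e).
  move=> Hz; apply: NNPP => K; apply: (N z); last by [].
  apply: HLs => d d0; apply: NNPP => K'; apply: K; exists d; split=> // w Hw.
  by apply: NNPP => K2; apply: K'; exists w.
case: (le_eqlt _ _ xy) => [->//|lt].
have [dx [dx0 Hx]] := L x (conj (leR _) xy); have [dy [dy0 Hy]] := L y (conj xy (leR _)).
set a := omin (x + hf dx) (hf (x + y)); set b := hf (hf dy + hf dy).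
have a1 := omin_lel (x + hf dx) (hf (x + y)); have a2 := omin_ler (x + hf dx) (hf (x + y)).
have a3 : x < a by apply: omin_gt; olra.
rewrite -/a in a1 a2.
set c := omin (hf dy) (hf (y - x)).
have c1 := omin_lel (hf dy) (hf (y - x)); have c2 := omin_ler (hf dy) (hf (y - x)).
have c3 : 0 < c by apply: omin_gt; olra.
rewrite -/c in c1 c2.
have E1 : W (scons a e) <-> W (scons x e) by apply: Hx; olra.
have E2 : W (scons (y - c) e) <-> W (scons y e) by apply: Hy; olra.
rewrite -E1 -E2.
have dU : dp1 (fun x => W (scons x e)).
  rewrite /dp1; exact: (def_sub W (fun i d => match i with O => d 0%nat | S j => e j end) dW
    (fun i => match i with O => dt_var 0 | S j => dt_const _ end)).
apply: (conn (fun x => W (scons x e)) x y dU); [|by olra|by olra].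
move=> z Hz; have [|d [d0 Hd]] := L z; first by olra.
by exists d; split=> // w _ /Hd.
Qed.

(** If fibers had arbitrarily many jumps, saturation would give one with infinitely many, against
    o-minimality. The positive [c] is there because jumps are detected in neighbourhoods, which the
    trivial group does not have. *)
Lemma uniform_bps c : 0 < c -> exists N, forall e, exists Ls, (length Ls <= N)%nat /\ bps (fun x => W (scons x e)) Ls.
Proof.
move=> c0; have dU e : dp1 (fun x => W (scons x e)).
  rewrite /dp1; exact: (def_sub W (fun i d => match i with O => d 0%nat | S j => e j end) dW
    (fun i => match i with O => dt_var 0 | S j => dt_const _ end)).
have [N HN] : exists N, forall e, ~ Dn N e.
  apply: NNPP => K; have [k Hk] := D_dep.
  have [|n|e He] := sat_env k Dn def_D _ Hk.
  - by move=> [|n] e //= [lo [H1 /chn_dec H2]]; case: n H2 => [|n] // H2; exists lo.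
  - by apply: NNPP => K'; apply: K; exists n => e De; apply: K'; exists e.
  have [Ls HLs] := omin_bp _ (dU e).
  have [lo [_ /chn_list [L [H1 [H2 H3]]]]] := He (S (S (length Ls))).
  have := NoDup_incl_length H2 (fun x Hx => bps_jump e Ls x c c0 HLs (proj2 (H3 x Hx))).
  by lia.
exists N => e; have [Ls0 HLs0] := omin_bp _ (dU e).
have [Ls [ND HLs]] : exists Ls, NoDup Ls /\ forall x, In x Ls <-> jump e x.
  have H := fun x => bps_jump e Ls0 x c c0 HLs0.
  have [L [ND HL]] : exists L, NoDup L /\ forall x, In x L <-> (In x Ls0 /\ jump e x).
    elim: Ls0 {HLs0 H} => [|a Ls0 [L [ND HL]]]; first by exists []; split; [constructor|move=> x /=; tauto].
    case: (classic (jump e a /\ ~ In a L)) => [[ba na]|K].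
      exists (a :: L); split; first by constructor.
      by move=> x /=; rewrite HL; split=> [[<-|]|[[<-|] ?]]; tauto.
    exists L; split=> // x /=; rewrite HL; split; first by tauto.
    move=> [[Ea|?] bx]; last by tauto.
    by subst x; apply: NNPP => K'; apply: K; split=> // /HL; tauto.
  by exists L; split=> // x; rewrite HL; split=> [[]//|b]; split=> //; apply: H.
exists Ls; split; last by apply: jump_bps => x /HLs.
case: (Nat.le_gt_cases (length Ls) N) => // lt; exfalso.
case: N HN lt => [|N] HN lt; first by apply: (HN e).
have [L [H1 [H2 H3]]] : exists L, length L = S N /\ NoDup L /\ forall x, In x L -> jump e x.
  exists (firstn (S N) Ls); split; first by rewrite firstn_length_le; lia.
  have E := firstn_skipn (S N) Ls; split; first by apply: (NoDup_app_remove_r _ (skipn (S N) Ls)); rewrite E.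
  by move=> x Hx; apply/HLs; rewrite -E; apply/in_app_iff; left.
have [lo Hlo] : exists lo, forall x, In x L -> lo < x.
  elim: (L) => [|a l [lo IH]]; first by exists c.
  exists (omin lo (a - c)); have A := omin_lel lo (a - c); have B := omin_ler lo (a - c).
  by move=> x [<-|/IH]; olra.
have /= [x [_ [H4 H5]]] := list_chn (S N) e lo L H1 H2 (fun x Hx => conj (Hlo x Hx) (H3 x Hx)).
by apply: (HN e); exists x.
Qed.
End UniformFiniteness.

Lemma list_lb (f : T -> T) L c : 0 < c -> (forall x, In x L -> 0 < f x) ->
  exists d, 0 < d <= c /\ forall x, In x L -> d <= f x.
Proof.
move=> c0; elim: L => [|a L IH] H; first by exists c; split=> //; olra.
have [|d [d0 Hd]] := IH; first by move=> x Hx; apply: H; right.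
have A := omin_lel d (f a); have B := omin_ler d (f a).
have C : 0 < omin d (f a) by apply: omin_gt; [olra|apply: H; left].
exists (omin d (f a)); split; first by olra.
by move=> x [<-//|/Hd]; olra.
Qed.

(** For every [d] the set where [f] is at least [d] has at most [N] breakpoints, by uniform
    finiteness. With [d] at most the values of [f] at [N + 1] points, one of these is not a
    breakpoint, and the bound holds around it. *)
Lemma loc_bounded_below f a b : df1 f -> a < b -> (forall x, a < x < b -> 0 < f x) ->
  exists d a' b', 0 < d /\ a <= a' /\ a' < b' /\ b' <= b /\ forall x, a' < x < b' -> d <= f x.
Proof.
move=> df ab fp; pose W (e : env) := a < e 0%nat < b /\ e 1%nat <= f (e 0%nat).
have dW : Def W by rewrite /W; ddef.
have ba : 0 < b - a by olra.
have [N HN] := uniform_bps W dW (b - a) ba.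
pose x i := a + hfn (S i) (b - a).
have Hx i : a < x i < b by have := hfn_pos i _ ba; have := hfn_le i _ ba; rewrite /x /=; olra.
have dec i j : (i < j)%nat -> x j < x i.
  elim: j => [|j IH] H; first by lia.
  have s : x (S j) < x j by have := hfn_pos j _ ba; rewrite /x /=; olra.
  case: (Nat.eq_dec i j) => [->//|?]; apply: lt_tr s (IH _); lia.
have inj : Injective x.
  by move=> i j E; case: (Nat.lt_trichotomy i j) => [/dec|[//|/dec]]; rewrite E => /lt_irr.
pose L := map x (seq 0 (S N)).
have HL y : In y L -> a < y < b by move=> /in_map_iff [i [<- _]].
have [d [d0 Hd]] := list_lb f L (b - a) ba (fun y Hy => fp y (HL y Hy)).
have [Ls [lL HLs]] := HN (fun _ => d).
have [y [yL yN]] : exists y, In y L /\ ~ In y Ls.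
  apply: NNPP => K; have := NoDup_incl_length (Injective_map_NoDup inj (seq_NoDup (S N) 0)).
  move=> /(_ Ls); rewrite length_map length_seq -/L => K'; suff : (S N <= length Ls)%nat by lia.
  by apply: K' => z Hz; apply: NNPP => K2; apply: K; exists z.
have [ay yb] := HL y yL.
have m0 : 0 < omin (y - a) (b - y) by apply: omin_gt; olra.
have [d' [[d'0 dy] Hd']] := away Ls y _ m0 yN.
have m1 := omin_lel (y - a) (b - y); have m2 := omin_ler (y - a) (b - y).
exists d, (y - d'), (y + d'); do 4!(split; first by olra).
have Wy : W (scons y (fun _ => d)) by split=> //=; apply: Hd.
move=> z Hz; suff : W (scons z (fun _ => d)) by case.
case: (lt_le_dec y z) => K.
  by apply/(HLs y z) => // [|l /Hd' [?|?]]; olra.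
by apply/(HLs z y) => // l /Hd' [?|?]; olra.
Qed.

(** * Definable choice *)

Section Choice.
Definition issup (Q : T -> Prop) s := (forall t, Q t -> t <= s) /\ (forall t, t < s -> exists u, Q u /\ t < u).
Definition ispinf (U : T -> Prop) m :=
  (forall x, 0 < x -> U x -> m <= x) /\ (forall t, m < t -> exists x, 0 < x /\ U x /\ x < t).
Definition run (c : T) (U : T -> Prop) m t := 0 < t /\ t <= c /\ forall x, m < x < m + t -> U x.
(** A canonical element of the positive part: its infimum [m] when this belongs to it, otherwise the
    middle of the initial interval to the right of [m], cut off at length [c]. *)
Definition chP (c : T) (U : T -> Prop) y := exists m, ispinf U m /\
  ((0 < m /\ U m /\ y = m) \/ (~ (0 < m /\ U m) /\ exists s, issup (run c U m) s /\ y = m + hf s)).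
Definition ch (c : T) (U : T -> Prop) y :=
  (U 0 /\ y = 0) \/ (~ U 0 /\ (exists x, 0 < x /\ U x) /\ chP c U y) \/
  (~ U 0 /\ ~ (exists x, 0 < x /\ U x) /\ chP c (fun x => U (- x)) (- y)).

Lemma issup_uniq Q s t : issup Q s -> issup Q t -> s = t.
Proof.
move=> [A B] [A' B']; case: (lt_tot s t) => [/B'|[//|/B]] [u [Hu L]].
  by have := A u Hu; olra.
by have := A' u Hu; olra.
Qed.
Lemma ispinf_uniq U s t : ispinf U s -> ispinf U t -> s = t.
Proof.
move=> [A B] [A' B']; case: (lt_tot s t) => [/B|[//|/B']] [u [u0 [Hu L]]].
  by have := A' u u0 Hu; olra.
by have := A u u0 Hu; olra.
Qed.
Lemma chP_uniq c U y z : chP c U y -> chP c U z -> y = z.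
Proof.
move=> [m [Hm H]] [m' [Hm' H']]; have E := ispinf_uniq _ _ _ Hm Hm'; subst m'.
case: H => [[m0 [Um ->]]|[K [s [Hs ->]]]]; case: H' => [[m0' [Um' ->]]|[K' [s' [Hs' ->]]]] //; try tauto.
by rewrite (issup_uniq _ _ _ Hs Hs').
Qed.
Lemma chP_ok c U : 0 < c -> dp1 U -> (exists x, 0 < x /\ U x) -> exists y, chP c U y /\ 0 < y /\ U y.
Proof.
move=> c0 dU [x0 [x00 Ux0]].
have [||u [? ?]|m [H1 H2]] := inf_ex (fun x => 0 < x /\ U x) x0 0; [by ddef|by []|by olra|].
have Hm : ispinf U m.
  split=> [x ? ?|t /H2 [u [[? ?] ?]]]; [exact: H1|by exists u].
have m0 : 0 <= m by move=> /H2 [u [[? _] ?]]; olra.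
case: (classic (0 < m /\ U m)) => [[mp Um]|N]; first by exists m; split=> //; exists m; split=> //; left.
have [|d [[md dc] [K|K]]] := rgerm U m (m + c) dU; first by olra.
- have rd : run c U m (d - m) by do 2!(split; first by olra); move=> x Hx; apply: K; olra.
  have [||u [_ [? _]]|s [S1 S2]] := sup_ex (run c U m) (d - m) c; [by rewrite /run; ddef|by []|by []|].
  have s0 : 0 < s by have := S1 _ rd; case: rd; olra.
  have [|u [[u0 [uc Hu]] su]] := S2 (hf s); first by olra.
  exists (m + hf s); split; last by split; [olra|apply: Hu; olra].
  by exists m; split=> //; right; split=> //; exists s.
- exfalso; have [x [x0' [Ux xd]]] := proj2 Hm d md.
  have := proj1 Hm x x0' Ux => /le_eqlt [E|mx]; first by subst x; apply: N.
  by apply: (K x).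
Qed.

Lemma ch_uniq c U y z : ch c U y -> ch c U z -> y = z.
Proof.
move=> [[? ->]|[[? [? H]]|[? [? H]]]] [[? ->]|[[? [? H']]|[? [? H']]]] //; try tauto.
  exact: chP_uniq H H'.
by have := chP_uniq _ _ _ _ H H'; olra.
Qed.
Lemma ch_ok c U : 0 < c -> dp1 U -> (exists x, U x) -> exists y, ch c U y /\ U y.
Proof.
move=> c0 dU [x Ux]; case: (classic (U 0)) => U0; first by exists 0; split=> //; left.
case: (classic (exists x, 0 < x /\ U x)) => [P|N].
  by have [y [H1 [H2 H3]]] := chP_ok c U c0 dU P; exists y; split=> //; right; left.
have [||y [H1 [H2 H3]]] := chP_ok c (fun x => U (- x)) c0; first by ddef.
  case: (lt_tot 0 x) => [L|[E|L]]; [by case: N; exists x|by subst x|].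
  by exists (- x); rewrite oppK; split=> //; olra.
by exists (- y); split=> //; right; right; rewrite oppK.
Qed.

(** The point [ch] picks from a fiber is characterised by a formula and unique by [ch_uniq], so the
    graph of the choice function is definable. *)
Lemma def_choice (W : env -> Prop) : Def W ->
  exists F, DT F /\ forall e, (exists x, W (scons x e)) -> W (scons (F e) e).
Proof.
move=> dW; case: (classic (exists c : T, 0 < c)) => [[c c0]|triv]; last first.
  (* In the trivial group 0 is the only point. *)
  exists (fun _ => 0); split; first exact: dt_const.
  move=> e [x Hx]; suff <- : x = 0 by [].
  case: (lt_tot 0 x) => [L|[//|L]]; first by case: triv; exists x.
  by case: triv; exists (- x); olra.
pose F e := epsilon (inhabits 0) (ch c (fun x => W (scons x e))).
have dU e : dp1 (fun x => W (scons x e)).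
  rewrite /dp1; exact: (def_sub W (fun i d => match i with O => d 0%nat | S j => e j end) dW
    (fun i => match i with O => dt_var 0 | S j => dt_const _ end)).
have HF e : (exists x, W (scons x e)) -> ch c (fun x => W (scons x e)) (F e) /\ W (scons (F e) e).
  move=> ex; have [y [Hy Wy]] := ch_ok c _ c0 (dU e) ex.
  have HF : ch c (fun x => W (scons x e)) (F e) by apply: epsilon_spec; exists y.
  by split=> //; rewrite (ch_uniq _ _ _ _ HF Hy).
(* [F] is arbitrary over empty fibers; fixing the value 0 there makes the graph definable. *)
pose F' e := epsilon (inhabits 0) (fun y => ((exists x, W (scons x e)) /\ y = F e) \/ (~ (exists x, W (scons x e)) /\ y = 0)).
have F'1 e : (exists x, W (scons x e)) -> F' e = F e.
  move=> ex; have := epsilon_spec (inhabits 0) (fun y => ((exists x, W (scons x e)) /\ y = F e) \/ (~ (exists x, W (scons x e)) /\ y = 0)).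
  by case=> [|[]|[]] //; exists (F e); left.
have F'0 e : ~ (exists x, W (scons x e)) -> F' e = 0.
  move=> ex; have := epsilon_spec (inhabits 0) (fun y => ((exists x, W (scons x e)) /\ y = F e) \/ (~ (exists x, W (scons x e)) /\ y = 0)).
  by case=> [|[]|[]] //; exists 0; right.
exists F'; split; last by move=> e ex; rewrite F'1 //; case: (HF e ex).
apply: (Def_ext (fun e => ((exists x, W (scons x (fun i => e (S i)))) /\ ch c (fun x => W (scons x (fun i => e (S i)))) (e 0%nat))
   \/ (~ (exists x, W (scons x (fun i => e (S i)))) /\ e 0%nat = 0))).
  move=> e; rewrite -/(eshift e); split=> [[[ex H]|[N ->]]|E].
  - by rewrite F'1 //; apply: ch_uniq H (proj1 (HF _ ex)).
  - by rewrite F'0.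
  - case: (classic (exists x, W (scons x (eshift e)))) => ex; [left|right]; split=> //.
      by rewrite E F'1 //; case: (HF _ ex).
    by rewrite E F'0.
rewrite /ch /chP /ispinf /issup /run.
by ddef.
Qed.
End Choice.

(** * Affine and convex functions *)

(** Properties of germs at 0+. On definable properties [ev] behaves like an ultrafilter, by
    [ev_dich]. *)
Definition ev (P : T -> Prop) := exists d, 0 < d /\ forall x, 0 < x < d -> P x.

Lemma ev_and P Q : ev P -> ev Q -> ev (fun x => P x /\ Q x).
Proof.
move=> [d [d0 Hd]] [c [c0 Hc]]; exists (omin d c); split; first exact: omin_gt.
have := omin_lel d c; have := omin_ler d c => A B x Hx.
by split; [apply: Hd|apply: Hc]; olra.
Qed.
Lemma ev_imp (P Q : T -> Prop) : (forall x, 0 < x -> P x -> Q x) -> ev P -> ev Q.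
Proof. by move=> H [d [d0 Hd]]; exists d; split=> // x Hx; apply: H; [olra|apply: Hd]. Qed.
Lemma ev_all (P : T -> Prop) c : 0 < c -> (forall x, 0 < x -> P x) -> ev P.
Proof. by move=> c0 H; exists c; split=> // x [x0 _]; apply: H. Qed.
Lemma ev_lt c : 0 < c -> ev (fun x => x < c).
Proof. by move=> c0; exists c; split=> // x []. Qed.
Lemma ev_dich P c : 0 < c -> dp1 P -> ev P \/ ev (fun x => ~ P x).
Proof.
move=> c0 dP; have [d [Hd [K|K]]] := rgerm P 0 c dP c0; [left|right]; exists d; split=> //; olra.
Qed.
Lemma ev_ex P : ev P -> exists x, 0 < x /\ P x.
Proof. by move=> [d [d0 Hd]]; exists (hf d); split; [olra|apply: Hd; olra]. Qed.
Lemma def_ev (P : env -> T -> Prop) : Def (fun e => P (fun i => e (S i)) (e 0%nat)) -> Def (fun e => ev (P e)).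
Proof.
move=> H; rewrite /ev; ddef.
exact: (def_ren _ (fun i => match i with O => inl O | S j => inl (S (S j)) end) H).
Qed.

(** A definable choice of the threshold is bounded below on some subinterval by
    [loc_bounded_below]. *)
Lemma unif_ev (Q : T -> T -> Prop) a b : dp2 Q -> a < b -> (forall x, a < x < b -> ev (Q x)) ->
  exists a' b' d, a <= a' /\ a' < b' /\ b' <= b /\ 0 < d /\
    forall x t, a' < x < b' -> 0 < t < d -> Q x t.
Proof.
move=> dQ ab H; pose W (e : env) := 0 < e 0%nat /\ forall t, 0 < t < e 0%nat -> Q (e 1%nat) t.
have dW : Def W by rewrite /W; ddef.
have [F [dF HF]] := def_choice W dW.
pose f x := F (fun _ => x).
have df : df1 f by apply/df1_DT; apply: (dt_sub F (fun _ e => e 0%nat)) => // i; apply: dt_var.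
have fp x : a < x < b -> 0 < f x /\ forall t, 0 < t < f x -> Q x t.
  by move=> /H [d [d0 Hd]]; apply: (HF (fun _ => x)); exists d.
have [d [a' [b' [d0 [A [B [C K]]]]]]] := loc_bounded_below f a b df ab (fun x Hx => proj1 (fp x Hx)).
exists a', b', d; do 4!split=> //; move=> x t Hx Ht.
have := K x Hx => L; apply: (proj2 (fp x _)); olra.
Qed.

(** By [const_sub] the set or its complement fills an interval of length [e / 2^n], and the
    complement of a dense set cannot. *)
Lemma loc_long (P : T -> Prop) a e : dp1 P -> 0 < e ->
  (forall a' b', a <= a' -> a' < b' -> b' <= a + e -> exists x, a' < x < b' /\ P x) ->
  exists n a', a <= a' /\ a' + hfn n e <= a + e /\ forall x, a' < x < a' + hfn n e -> P x.
Proof.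
move=> dP e0 H; have [n [a' [A [B [K|K]]]]] := const_sub P a e dP e0; exists n, a'; do 2!split=> //.
exfalso; have p := hfn_pos n e e0.
by have [||x [Hx Px]] := H a' (a' + hfn n e) A; [olra|olra|apply: (K x)].
Qed.

Definition affine_on (f : T -> T) a b := forall x y t, a < x < b -> a < y < b ->
  a < x + t < b -> a < y + t < b -> f (x + t) - f x = f (y + t) - f y.
Definition convex_on (f : T -> T) a b := forall s h x, 0 < h -> 0 < x -> a < s -> s + h + x < b ->
  f (s + h) + f (s + x) < f (s + h + x) + f s.

(** By hypothesis [f u + f v] depends only on [u + v], and [x + t] and [y] have the same sum as
    [y + t] and [x]. *)
Lemma jensen_aff f a b : (forall x t, 0 < t -> a < x - t -> x + t < b -> f (x + t) + f (x - t) = f x + f x) ->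
  affine_on f a b.
Proof.
move=> H x y t Hx Hy Hxt Hyt.
have J u v : a < u < b -> a < v < b -> f u + f v = f (hf (u + v)) + f (hf (u + v)).
  have K u' v' : u' < v' -> a < u' < b -> a < v' < b -> f u' + f v' = f (hf (u' + v')) + f (hf (u' + v')).
    move=> uv Hu Hv; have := H (hf (u' + v')) (hf (v' - u')).
    have -> : hf (u' + v') + hf (v' - u') = v' by olra.
    have -> : hf (u' + v') - hf (v' - u') = u' by olra.
    by move=> <-; olra.
  move=> Hu Hv; case: (lt_tot u v) => [L|[->|L]]; first exact: K.
    by have -> : hf (v + v) = v by olra.
  by have := K v u L Hv Hu; rewrite addC (addC u).
have := J _ _ Hxt Hy; have := J _ _ Hyt Hx.
have -> : x + t + y = y + t + x by olra.
by olra.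
Qed.

Lemma loc_aff f a b : df1 f -> (forall x, a < x < b -> exists d, 0 < d /\ affine_on f (x - d) (x + d)) ->
  affine_on f a b.
Proof.
move=> df L.
(* Germs of increments to the right agree everywhere by connectedness; [G2] compares left with right
   increments; with both, [P] moves a fixed increment [t] along the interval. *)
have G1 x y : a < x < b -> a < y < b -> ev (fun t => f (y + t) - f y = f (x + t) - f x).
  move=> Hx Hy; have d1 : dp1 (fun y => ev (fun t => f (y + t) - f y = f (x + t) - f x)).
    by apply: (def_ev (fun e t => f (e 0%nat + t) - f (e 0%nat) = f (x + t) - f x)); ddef.
  apply/(conn _ a b d1 _ y x Hy Hx); last first.
    by apply: (ev_all _ (b - a)) => //; olra.
  move=> z Hz; have [d [d0 Hd]] := L z Hz; exists (hf d); split; first by olra.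
  move=> w Hw Kw.
  have E : ev (fun t => f (w + t) - f w = f (z + t) - f z).
    by apply: ev_imp (ev_lt (hf d) ltac:(olra)) => t t0 td; apply: Hd; olra.
  by split=> K; apply: ev_imp (ev_and _ _ E K) => t _ []; olra.
have G2 x : a < x < b -> ev (fun t => f x - f (x - t) = f (x + t) - f x).
  move=> Hx; have [d [d0 Hd]] := L x Hx.
  apply: ev_imp (ev_lt (hf d) ltac:(olra)) => t t0 td.
  have := Hd (x - t) x t; have -> : x - t + t = x by olra.
  by apply; olra.
have P x y t : 0 < t -> a < x -> x < y -> y + t < b -> f (x + t) - f x = f (y + t) - f y.
  move=> t0 ax xy yb; pose g x := f (x + t) - f x.
  apply: (loc_mono (fun u v => u = v) g a (b - t)); [by ddef|by rewrite /g; ddef|by move=> ? ? ? -> ->| |by []|by []|by olra].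
  move=> z Hz.
  have H1 := G1 z (z + t) ltac:(olra) ltac:(olra); have H2 := G2 z ltac:(olra); have H3 := G2 (z + t) ltac:(olra).
  have [d [d0 Hd]] := ev_and _ _ H1 (ev_and _ _ H2 H3); exists d; split=> // s Hs.
  have [K1 [K2 K3]] := Hd s Hs; rewrite /g; split=> _.
    (have -> : z - s + t = z + t - s by olra); olra.
  (have -> : z + s + t = z + t + s by olra); olra.
have P' x y t : 0 < t -> a < x < b -> a < y < b -> x + t < b -> y + t < b -> f (x + t) - f x = f (y + t) - f y.
  move=> t0 Hx Hy Hxt Hyt; case: (lt_tot x y) => [K|[->//|K]]; first by apply: P; olra.
  by symmetry; apply: P; olra.
move=> x y t Hx Hy Hxt Hyt; case: (lt_tot 0 t) => [t0|[<-|t0]]; first by apply: P'; olra.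
  by rewrite !add0; olra.
have := P' (x + t) (y + t) (- t).
have -> : x + t + - t = x by olra.
have -> : y + t + - t = y by olra.
by move=> K; have := K ltac:(olra) Hxt Hyt ltac:(olra) ltac:(olra); olra.
Qed.

(** Let [l] and [r] be the limits of [U] on the two sides of a missing point [z]. If [l < r], points
    of [U] close to them have a midpoint strictly between. If both equal [z], then [U] contains
    points at equal small distances on the two sides of [z]. *)
Lemma mid_closed (U : T -> Prop) p q : dp1 U -> p < q -> U p -> U q ->
  (forall u v, p <= u <= q -> p <= v <= q -> U u -> U v -> U (hf (u + v))) ->
  forall x, p <= x <= q -> U x.
Proof.
move=> dU pq Up Uq H z Hz; apply: NNPP => Nz.
have [|||l [l1 l2]] := sup_ex (fun u => p <= u <= z /\ U u) p z.
- by ddef.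
- by split=> //; olra.
- by move=> u; olra.
have [|||r [r1 r2]] := inf_ex (fun u => z <= u <= q /\ U u) q z.
- by ddef.
- by split=> //; olra.
- by move=> u; olra.
have lz : l <= z by move=> /l2 [u [[Hu _] K]]; olra.
have rz : z <= r by move=> /r2 [u [[Hu _] K]]; olra.
case: (lt_le_dec l r) => lr.
  have [|u [[Hu Uu] ul]] := l2 (l - hf (r - l)); first by olra.
  have [|v [[Hv Uv] vr]] := r2 (r + hf (r - l)); first by olra.
  have ul' := l1 u (conj Hu Uu); have vr' := r1 v (conj Hv Uv).
  have Um : U (hf (u + v)) by apply: H => //; olra.
  case: (lt_le_dec (hf (u + v)) z) => K.
    have pm : p <= hf (u + v) by olra.
    by have := l1 (hf (u + v)) (conj (conj pm (ltW _ _ K)) Um); olra.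
  have mq : hf (u + v) <= q by olra.
  by have := r1 (hf (u + v)) (conj (conj K mq) Um); olra.
have [El Er] : l = z /\ r = z by olra.
subst l r.
have pz : p < z by case: (le_eqlt _ _ (proj1 Hz)) => // E; subst z.
have zq : z < q by case: (le_eqlt _ _ (proj2 Hz)) => // E; subst z.
have [c [Hc [K|K]]] := lgerm U p z dU pz; last first.
  have [|u [[Hu Uu] ul]] := l2 c; first by olra.
  by apply: (K u) => //; split=> //; case: (le_eqlt _ _ (proj2 Hu)) => // E; subst u.
have [c' [Hc' [K'|K']]] := rgerm U z q dU zq; last first.
  have [|u [[Hu Uu] ul]] := r2 c'; first by olra.
  by apply: (K' u) => //; split=> //; case: (le_eqlt _ _ (proj1 Hu)) => // E; subst u.
pose t := omin (hf (z - c)) (hf (c' - z)).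
have t0 : 0 < t by apply: omin_gt; olra.
have t1 := omin_lel (hf (z - c)) (hf (c' - z)); have t2 := omin_ler (hf (z - c)) (hf (c' - z)).
rewrite -/t in t1 t2.
apply: Nz; have -> : z = hf ((z - t) + (z + t)) by olra.
by apply: H; [olra|olra|apply: K; olra|apply: K'; olra].
Qed.

(** The times [t] at which [f (m + t) + f (m - t)] stays below its value at [t2] are closed under
    midpoints, so [mid_closed] makes this sum increase with [t]. Convexity compares two pairs of
    points with the same midpoint. *)
Lemma midconv_conv f a b : df1 f ->
  (forall x t, 0 < t -> a < x - t -> x + t < b -> f x + f x < f (x + t) + f (x - t)) -> convex_on f a b.
Proof.
move=> df H.
have J u v : u < v -> a < u -> v < b -> f (hf (u + v)) + f (hf (u + v)) < f u + f v.
  move=> uv Hu Hv; have := H (hf (u + v)) (hf (v - u)).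
  have -> : hf (u + v) + hf (v - u) = v by olra.
  have -> : hf (u + v) - hf (v - u) = u by olra.
  by move=> K; have := K ltac:(olra) ltac:(olra) ltac:(olra); olra.
have K m t1 t2 : 0 <= t1 <= t2 -> a < m - t2 -> m + t2 < b -> f (m + t1) + f (m - t1) <= f (m + t2) + f (m - t2).
  move=> Ht Ha Hb; case: (le_eqlt _ _ (proj2 Ht)) => [->|lt12]; first by olra.
  pose U t := f (m + t) + f (m - t) <= f (m + t2) + f (m - t2).
  apply: (mid_closed U 0 t2); rewrite /U; [by ddef|by olra| |by olra| |by olra].
    have := H m t2 ltac:(olra) Ha Hb; have -> : m + 0 = m by olra.
    (have -> : m - 0 = m by olra); olra.
  move=> u v Hu Hv Uu Uv.
  have J' u' v' : u' < v' -> 0 <= u' <= t2 -> 0 <= v' <= t2 ->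
    f (m + hf (u' + v')) + f (m + hf (u' + v')) < f (m + u') + f (m + v') /\
    f (m - hf (u' + v')) + f (m - hf (u' + v')) < f (m - u') + f (m - v').
    move=> uv' Hu' Hv'; split.
      have := J (m + u') (m + v') ltac:(olra) ltac:(olra) ltac:(olra).
      by have -> : hf (m + u' + (m + v')) = m + hf (u' + v') by olra.
    have := J (m - v') (m - u') ltac:(olra) ltac:(olra) ltac:(olra).
    (have -> : hf (m - v' + (m - u')) = m - hf (u' + v') by olra); olra.
  case: (lt_tot u v) => [L|[E|L]].
  - by have := J' u v L Hu Hv; olra.
  - by subst v; have -> : hf (u + u) = u by olra.
  - by have := J' v u L Hv Hu; rewrite (addC v u); olra.
have K' m t1 t2 : 0 <= t1 < t2 -> a < m - t2 -> m + t2 < b -> f (m + t1) + f (m - t1) < f (m + t2) + f (m - t2).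
  move=> Ht Ha Hb; have A := K m t1 (hf (t1 + t2)) ltac:(olra) ltac:(olra) ltac:(olra).
  have B := K m t1 t2 ltac:(olra) Ha Hb.
  have C := J (m + t1) (m + t2) ltac:(olra) ltac:(olra) ltac:(olra).
  have D := J (m - t2) (m - t1) ltac:(olra) ltac:(olra) ltac:(olra).
  move: C D; have -> : hf (m + t1 + (m + t2)) = m + hf (t1 + t2) by olra.
  (have -> : hf (m - t2 + (m - t1)) = m - hf (t1 + t2) by olra); olra.
have L s h x : 0 < x <= h -> a < s -> s + h + x < b -> f (s + h) + f (s + x) < f (s + h + x) + f s.
  move=> Hx Hs Hb; have := K' (s + hf (h + x)) (hf (h - x)) (hf (h + x)) ltac:(olra) ltac:(olra) ltac:(olra).
  have -> : s + hf (h + x) + hf (h - x) = s + h by olra.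
  have -> : s + hf (h + x) - hf (h - x) = s + x by olra.
  have -> : s + hf (h + x) + hf (h + x) = s + h + x by olra.
  by have -> : s + hf (h + x) - hf (h + x) = s by olra.
move=> s h x h0 x0 Hs Hb; case: (lt_le_dec h x) => C; last by apply: L.
have := L s x h ltac:(olra) Hs ltac:(olra).
(have -> : s + x + h = s + h + x by olra); olra.
Qed.

(** [G1] and [G2] say that small right and left increments grow along the interval. Applied at [z]
    and [z + h], they show that the increment over the fixed length [h] grows locally, which
    [loc_mono] makes global. *)
Lemma loc_conv f a b : df1 f -> (forall x, a < x < b -> exists d, 0 < d /\ convex_on f (x - d) (x + d)) ->
  convex_on f a b.
Proof.
move=> df L.
have cv x d s h y : convex_on f (x - d) (x + d) -> 0 < h -> 0 < y -> x - d < s -> s + h + y < x + d ->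
   f (s + h) + f (s + y) < f (s + h + y) + f s by move=> H *; apply: H.
have G1 x y : a < x -> x < y -> y < b -> ev (fun t => f (x + t) - f x < f (y + t) - f y).
  apply: (loc_mono (fun x y => ev (fun t => f (x + t) - f x < f (y + t) - f y)) (fun x => x)).
  - by apply: (def_ev (fun e t => f (e 0%nat + t) - f (e 0%nat) < f (e 1%nat + t) - f (e 1%nat))); ddef.
  - by ddef.
  - by move=> u v w H1 H2; apply: ev_imp (ev_and _ _ H1 H2) => t _; olra.
  move=> z Hz; have [d [d0 Hd]] := L z Hz; exists (hf d); split=> [|t Ht]; first by olra.
  split=> _; apply: ev_imp (ev_lt (hf d) ltac:(olra)) => s s0 sd.
    have := cv z d (z - t) t s Hd ltac:(olra) ltac:(olra) ltac:(olra) ltac:(olra).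
    have -> : z - t + t = z by olra.
    by olra.
  have := cv z d z t s Hd ltac:(olra) ltac:(olra) ltac:(olra) ltac:(olra).
  by olra.
have G2 x y : a < x -> x < y -> y < b -> ev (fun t => f x - f (x - t) < f y - f (y - t)).
  apply: (loc_mono (fun x y => ev (fun t => f x - f (x - t) < f y - f (y - t))) (fun x => x)).
  - by apply: (def_ev (fun e t => f (e 0%nat) - f (e 0%nat - t) < f (e 1%nat) - f (e 1%nat - t))); ddef.
  - by ddef.
  - by move=> u v w H1 H2; apply: ev_imp (ev_and _ _ H1 H2) => t _; olra.
  move=> z Hz; have [d [d0 Hd]] := L z Hz; exists (hf d); split=> [|t Ht]; first by olra.
  split=> _; apply: ev_imp (ev_lt (hf d) ltac:(olra)) => s s0 sd.
    have := cv z d (z - t - s) t s Hd ltac:(olra) ltac:(olra) ltac:(olra) ltac:(olra).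
    have -> : z - t - s + t = z - s by olra.
    have -> : z - t - s + s = z - t by olra.
    have -> : z - s + s = z by olra.
    by olra.
  have := cv z d (z - s) t s Hd ltac:(olra) ltac:(olra) ltac:(olra) ltac:(olra).
  have -> : z - s + s = z by olra.
  have -> : z - s + t + s = z + t by olra.
  have -> : z + t - s = z - s + t by olra.
  by olra.
move=> s h x h0 x0 Hs Hb; pose p s := f (s + h) - f s.
suff : p s < p (s + x).
  by rewrite /p; (have -> : s + x + h = s + h + x by olra); olra.
apply: (loc_mono (olt G) p a (b - h)); [exact: dp_lt|by rewrite /p; ddef|by move=> u v w; olra| |by []|by olra|by olra].
move=> z Hz; have [d [d0 Hd]] := ev_and _ _ (G1 z (z + h) ltac:(olra) ltac:(olra) ltac:(olra))
                                            (G2 z (z + h) ltac:(olra) ltac:(olra) ltac:(olra)).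
exists d; split=> // t Ht; have [K1 K2] := Hd t Ht; rewrite /p; split=> _.
  (have -> : z - t + h = z + h - t by olra); olra.
(have -> : z + t + h = z + h + t by olra); olra.
Qed.

(** For each [x] the sign of the symmetric second difference is constant for small [t], and which
    sign occurs is constant in [x] on a subinterval. Uniformity in [t] holds on a dense family of
    subintervals, so the local property holds on a long interval by [loc_long]. *)
Lemma trichotomy f a e : df1 f -> 0 < e -> exists n a', a <= a' /\ a' + hfn n e <= a + e /\
  (affine_on f a' (a' + hfn n e) \/ convex_on f a' (a' + hfn n e) \/
   convex_on (fun x => - f x) a' (a' + hfn n e)).
Proof.
move=> df e0.
have conv g c l : df1 g -> 0 < l -> (forall x, c < x < c + l -> ev (fun t => g x + g x < g (x + t) + g (x - t))) ->
  exists n a', c <= a' /\ a' + hfn n l <= c + l /\ convex_on g a' (a' + hfn n l).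
  move=> dg l0 H; pose P x := exists d, 0 < d /\ convex_on g (x - d) (x + d).
  have dP : dp1 P by rewrite /P /convex_on; ddef.
  have [|n [a' [A [B C]]]] := loc_long P c l dP l0; last by exists n, a'; do 2!split=> //; apply: loc_conv.
  move=> u v cu uv vl.
  have [||u' [v' [d [A [B [C [d0 K]]]]]]] := unif_ev (fun x t => g x + g x < g (x + t) + g (x - t)) u v _ uv.
  - by ddef.
  - by move=> x Hx; apply: H; olra.
  pose r := hf (omin d (v' - u')).
  have r0 : 0 < omin d (v' - u') by apply: omin_gt; olra.
  have r1 := omin_lel d (v' - u'); have r2 := omin_ler d (v' - u').
  exists (u' + r); split; first by rewrite /r; olra.
  exists r; split; first by rewrite /r; olra.
  by apply: midconv_conv => // x t t0 H1 H2; apply: K; rewrite /r in H1 H2; olra.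
pose Pp x := ev (fun t => f x + f x < f (x + t) + f (x - t)).
pose Pn x := ev (fun t => - f x + - f x < - f (x + t) + - f (x - t)).
have dPp : dp1 Pp by apply: (def_ev (fun e t => f (e 0%nat) + f (e 0%nat) < f (e 0%nat + t) + f (e 0%nat - t))); ddef.
have dPn : dp1 Pn by apply: (def_ev (fun e t => - f (e 0%nat) + - f (e 0%nat) < - f (e 0%nat + t) + - f (e 0%nat - t))); ddef.
have [n1 [a1 [A1 [B1 [K1|K1]]]]] := const_sub Pp a e dPp e0.
  have [n [a' [A [B C]]]] := conv f a1 _ df (hfn_pos n1 _ e0) K1.
  by exists (n + n1)%nat, a'; rewrite -hfn_add; split; [olra|split; [olra|tauto]].
have p1 := hfn_pos n1 e e0.
have [n2 [a2 [A2 [B2 [K2|K2]]]]] := const_sub Pn a1 _ dPn p1.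
  have [|n [a' [A [B C]]]] := conv (fun x => - f x) a2 _ _ (hfn_pos n2 _ p1) K2; first by ddef.
  by exists (n + (n2 + n1))%nat, a'; rewrite -!hfn_add; split; [olra|split; [olra|tauto]].
have p2 := hfn_pos n2 _ p1.
pose P x := exists d, 0 < d /\ affine_on f (x - d) (x + d).
have dP : dp1 P by rewrite /P /affine_on; ddef.
have [|n [a' [A [B C]]]] := loc_long P a2 _ dP p2; last first.
  exists (n + (n2 + n1))%nat, a'; rewrite -!hfn_add; split; [olra|split; [olra|left]].
  exact: loc_aff.
move=> u v cu uv vl.
have [||u' [v' [d [A [B [C [d0 K]]]]]]] := unif_ev (fun x t => f (x + t) + f (x - t) = f x + f x) u v _ uv.
- by ddef.
- move=> x Hx; have N1 : ~ Pp x by apply: K1; olra.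
  have N2 : ~ Pn x by apply: K2; olra.
  have [|//|E1] := ev_dich (fun t => f x + f x < f (x + t) + f (x - t)) e e0; first by ddef.
  have [|//|E2] := ev_dich (fun t => - f x + - f x < - f (x + t) + - f (x - t)) e e0; first by ddef.
  by apply: ev_imp (ev_and _ _ E1 E2) => t _ [L1 L2]; olra.
pose r := hf (omin d (v' - u')).
have r0 : 0 < omin d (v' - u') by apply: omin_gt; olra.
have r1 := omin_lel d (v' - u'); have r2 := omin_ler d (v' - u').
exists (u' + r); split; first by rewrite /r; olra.
exists r; split; first by rewrite /r; olra.
by apply: jensen_aff => x t t0 H1 H2; apply: K; rewrite /r in H1 H2; olra.
Qed.

(** Take a step from [s] whose increment is within [c] of the infimum [l] of the small increments
    from [s]. Its first half already contributes at least [l] and its second half at least [c]. *)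
Lemma no_uniform_jump f s s' c d : df1 f -> s < s' -> 0 < c -> 0 < d ->
  ~ forall t x, s <= t -> 0 < x < d -> t + x <= s' -> c <= f (t + x) - f t.
Proof.
move=> df ss' c0 d0 H.
set k := omin d (s' - s).
have k0 : 0 < k by apply: omin_gt; olra.
have k1 := omin_lel d (s' - s); have k2 := omin_ler d (s' - s); rewrite -/k in k1 k2.
have [||v [x [Hx ->]]|l [l1 l2]] := inf_ex (fun v => exists x, 0 < x < k /\ v = f (s + x) - f s) (f (s + hf k) - f s) c.
- by ddef.
- by exists (hf k); split=> //; olra.
- by apply: H; olra.
have [|v [[x [Hx ->]] vl]] := l2 (l + c); first by olra.
have A := l1 (f (s + hf x) - f s) (ex_intro _ (hf x) (conj (conj _ _) eq_refl)).
have B := H (s + hf x) (hf x) ltac:(olra) ltac:(olra) ltac:(olra).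
move: B; have -> : s + hf x + hf x = s + x by olra.
have := A ltac:(olra) ltac:(olra); olra.
Qed.

Lemma rloc_mono r c d : df1 r -> (forall z, c < z < d -> ev (fun t => r z <= r (z + t))) ->
  (forall z u, c < z < d -> 0 < u -> ev (fun t => r (z - t) < r z + u)) ->
  forall x y, c < x -> x < y -> y < d -> r x <= r y.
Proof.
move=> dr L1 L2 x y cx xy yd N.
pose P z := z <= x \/ forall w, x < w <= z -> r x <= r w.
have Px : P x by left; olra.
have Py : ~ P y by case=> [|H]; [olra|have := H y ltac:(olra); olra].
have dP : dp1 P by rewrite /P; ddef.
have Dn u v : P v -> u <= v -> P u.
  move=> [H|H] uv; first by left; olra.
  by right=> w Hw; apply: H; olra.
case: (dcut P x y dP Dn Px Py) => [[m [Pm H]]|[m [Pm H]]].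
- have xm : x <= m by move=> /H /(_ Px).
  have my : m < y by apply/nle => K; apply: Py; apply: Dn K.
  have Hm : forall w, x <= w <= m -> r x <= r w.
    move=> w Hw; case: (le_eqlt _ _ (proj1 Hw)) => [->|?]; first by olra.
    by case: Pm => [?|K]; [olra|apply: K; olra].
  have [e [e0 He]] := L1 m ltac:(olra).
  apply: (H (m + hf e)); first by olra.
  right=> w Hw; case: (lt_le_dec m w) => mw; last by apply: Hm; olra.
  have := He (w - m) ltac:(olra); have -> : m + (w - m) = w by olra.
  by have := Hm m ltac:(olra); olra.
- have xm : x < m by apply/nle => K; apply: Pm; apply: Dn K.
  have my : m <= y by move=> /H.
  apply: Pm; right=> w Hw; case: (lt_le_dec w m) => wm.
    by have [|K|K] := H (hf (w + m)); [olra|olra|apply: K; olra].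
  have -> : w = m by olra.
  move=> K; have [e [e0 He]] := ev_and _ _ (L2 m (r x - r m) ltac:(olra) ltac:(olra)) (ev_lt (m - x) ltac:(olra)).
  have [A B] := He (hf e) ltac:(olra).
  have [|K'|K'] := H (m - hf e); [olra|olra|].
  by have := K' (m - hf e) ltac:(olra); olra.
Qed.

(** The comparison of germs integrates to [p y - p x <= g h y - g h x] for each [h]. As [h] tends to
    0 the right side becomes arbitrarily small, while the left side is positive and fixed. *)
Lemma no_infinitesimal (p : T -> T) (g : T -> T -> T) c d k : df1 p -> df2 g -> c < d -> 0 < k ->
  (forall s x, c < s -> 0 < x -> s + x < d -> p s < p (s + x)) ->
  (forall s u, c < s < d -> 0 < u -> ev (fun t => p s - u < p (s - t))) ->
  (forall h s u, 0 < h < k -> c < s < d -> 0 < u -> ev (fun t => g h (s - t) < g h s + u)) ->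
  (forall s u, c < s < d -> 0 < u -> ev (fun h => - u < g h s < u)) ->
  ~ forall s h, c < s < d -> 0 < h < k -> ev (fun x => p (s + x) - p s < g h (s + x) - g h s).
Proof.
move=> dp dg cd k0 inc cp cg sm H.
have R h x y : 0 < h < k -> c < x -> x < y -> y < d -> p y - p x <= g h y - g h x.
  move=> Hh cx xy yd; pose r s := g h s - p s.
  suff : r x <= r y by rewrite /r; olra.
  apply: (rloc_mono r c d) => //.
  - by rewrite /r; ddef.
  - by move=> z Hz; apply: ev_imp (H z h Hz Hh) => t t0; rewrite /r; olra.
  - move=> z u Hz u0; apply: ev_imp (ev_and _ _ (cp z (hf u) Hz ltac:(olra)) (cg h z (hf u) Hh Hz ltac:(olra))) => t t0.
    by rewrite /r; olra.
pose x := hf (c + hf (c + d)); pose y := hf (c + d).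
have [Hx [Hy xy]] : c < x < d /\ c < y < d /\ x < y by rewrite /x /y; olra.
have I := inc x (y - x) ltac:(olra) ltac:(olra) ltac:(olra).
have E : x + (y - x) = y by olra.
rewrite E in I; set u := hf (p y - p x).
have u0 : 0 < u by rewrite /u; olra.
have [h [h0 [[A B] C]]] := ev_ex _ (ev_and _ _ (ev_and _ _ (sm x u Hx u0) (sm y u Hy u0)) (ev_lt k k0)).
have := R h x y (conj h0 C) ltac:(olra) xy ltac:(olra).
by move: A B; rewrite /u; olra.
Qed.

Section Convex.
Variables (f : T -> T) (a b : T).
Hypotheses (df : df1 f) (cvx : convex_on f a b).

(** As a germ in [x] this is the slope at [s + h] minus the slope at [s]; it is symmetric in [h] and
    [x], and additive over adjacent intervals in [h]. *)
Definition dd (s h x : T) := f (s + h + x) - f (s + h) - (f (s + x) - f s).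

Lemma dd_pos s h x : 0 < h -> 0 < x -> a < s -> s + h + x < b -> 0 < dd s h x.
Proof. by move=> h0 x0 A B; have := cvx s h x h0 x0 A B; rewrite /dd; olra. Qed.
Lemma dd_sym s h x : dd s h x = dd s x h.
Proof. by rewrite /dd; (have -> : s + x + h = s + h + x by olra); olra. Qed.
Lemma dd_add s h k x : dd s (h + k) x = dd s h x + dd (s + h) k x.
Proof. by rewrite /dd; (have -> : s + (h + k) = s + h + k by olra); olra. Qed.
Lemma dd_ge0 s h x : 0 <= h -> 0 <= x -> a < s -> s + h + x < b -> 0 <= dd s h x.
Proof.
move=> h0 x0 A B; case: (le_eqlt _ _ h0) => [<-|h1]; first by rewrite /dd !add0; olra.
case: (le_eqlt _ _ x0) => [<-|x1]; first by rewrite /dd !add0; olra.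
by apply: ltW; apply: dd_pos.
Qed.
Lemma dd_le s h k x : 0 <= h <= k -> 0 <= x -> a < s -> s + k + x < b -> dd s h x <= dd s k x.
Proof.
move=> Hh x0 A B; have -> : k = h + (k - h) by olra.
by rewrite dd_add; have := dd_ge0 (s + h) (k - h) x ltac:(olra) x0 ltac:(olra) ltac:(olra); olra.
Qed.

(** Convexity passes an upward jump of size [u] at [s] to every point further right, and a downward
    one to every point further left; [no_uniform_jump] excludes both. *)
Lemma cont_r s u : a < s < b -> 0 < u -> ev (fun x => - u < f (s + x) - f s < u).
Proof.
move=> Hs u0.
have b0 : 0 < b - s by olra.
have [|E1|E1] := ev_dich (fun x => f (s + x) - f s < u) _ b0; [by ddef| |]; last first.
  exfalso; have [d [d0 Hd]] := E1.
  apply: (no_uniform_jump f s (hf (s + b)) u d) => //; first by olra.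
  move=> t x st Hx tb; have K := Hd x Hx.
  case: (le_eqlt _ _ st) => [<-|st']; first by olra.
  have := cvx s (t - s) x ltac:(olra) ltac:(olra) ltac:(olra).
  have -> : s + (t - s) = t by olra.
  by move=> K'; have := K' ltac:(olra); olra.
have [|E2|E2] := ev_dich (fun x => - u < f (s + x) - f s) _ b0; [by ddef| |]; last first.
  exfalso; have [d [d0 Hd]] := ev_and _ _ E2 (ev_lt _ b0).
  apply: (no_uniform_jump (fun x => - f x) (hf (a + s)) s u d) => //; [by ddef|by olra|].
  move=> t x st Hx tb; have [K K2] := Hd x Hx.
  have := cvx t (s - t) x ltac:(olra) ltac:(olra) ltac:(olra).
  have -> : t + (s - t) = s by olra.
  by move=> K'; have := K' ltac:(olra); olra.
by apply: ev_imp (ev_and _ _ E1 E2) => x _ [].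
Qed.
Lemma cont_l s u : a < s < b -> 0 < u -> ev (fun x => - u < f (s - x) - f s < u).
Proof.
move=> Hs u0.
have b0 : 0 < hf (s - a) by olra.
have [|E1|E1] := ev_dich (fun x => f s - f (s - x) < u) _ b0; [by ddef| |]; last first.
  exfalso; have [d [d0 Hd]] := ev_and _ _ E1 (ev_lt _ b0).
  apply: (no_uniform_jump f s (hf (s + b)) u d) => //; first by olra.
  move=> t x st Hx tb; have [K K2] := Hd x Hx.
  have := cvx (s - x) (t - s + x) x ltac:(olra) ltac:(olra) ltac:(olra).
  have -> : s - x + (t - s + x) = t by olra.
  have -> : s - x + x = s by olra.
  by move=> K'; have := K' ltac:(olra); olra.
have [|E2|E2] := ev_dich (fun x => - u < f s - f (s - x)) _ b0; [by ddef| |]; last first.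
  exfalso; have [d [d0 Hd]] := ev_and _ _ E2 (ev_lt _ b0).
  apply: (no_uniform_jump (fun x => - f x) (hf (a + s)) s u d) => //; [by ddef|by olra|].
  move=> t x st Hx tb; have [K K2] := Hd x Hx.
  case: (le_eqlt _ _ tb) => [E|tb'].
    have -> : t = s - x by olra.
    have -> : s - x + x = s by olra.
    by olra.
  have := cvx t (s - x - t) x ltac:(olra) ltac:(olra) ltac:(olra).
  have -> : t + (s - x - t) = s - x by olra.
  have -> : s - x + x = s by olra.
  by move=> K'; have := K' ltac:(olra); olra.
by apply: ev_imp (ev_and _ _ E1 E2) => x _ []; olra.
Qed.

(** Failure of comparability: some gap of slopes at [s] is smaller than all gaps at [u]. [N2] is the
    same failure between the right and the left side of one point. *)
Definition N1 s u := exists h, 0 < h /\ s + h < b /\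
  forall h', 0 < h' -> u + h' < b -> ev (fun x => dd s h x < dd u h' x).
Definition N2 u := exists h, 0 < h /\ u + h < b /\
  forall h', 0 < h' -> a < u - h' -> ev (fun x => dd u h x < dd (u - h') h' x).

Lemma dp_N1 : dp2 N1.
Proof.
rewrite /N1 /dd; ddef.
apply: (def_ev (fun e x => f (e 2%nat + e 1%nat + x) - f (e 2%nat + e 1%nat) - (f (e 2%nat + x) - f (e 2%nat)) <
  f (e 3%nat + e 0%nat + x) - f (e 3%nat + e 0%nat) - (f (e 3%nat + x) - f (e 3%nat)))); by ddef.
Qed.
Lemma dp_N2 : dp1 N2.
Proof.
rewrite /N2 /dd; ddef.
apply: (def_ev (fun e x => f (e 2%nat + e 1%nat + x) - f (e 2%nat + e 1%nat) - (f (e 2%nat + x) - f (e 2%nat)) <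
  f (e 2%nat - e 0%nat + e 0%nat + x) - f (e 2%nat - e 0%nat + e 0%nat) -
  (f (e 2%nat - e 0%nat + x) - f (e 2%nat - e 0%nat)))); by ddef.
Qed.

Lemma cont_dd s h u : 0 < h -> a < s -> s + h < b -> 0 < u ->
  ev (fun t => - u < (f (s - t + h) - f (s - t)) - (f (s + h) - f s) < u).
Proof.
move=> h0 A B u0.
have K1 := cont_l s (hf u) ltac:(olra) ltac:(olra); have K2 := cont_l (s + h) (hf u) ltac:(olra) ltac:(olra).
apply: ev_imp (ev_and _ _ K1 K2) => t t0; have -> : s + h - t = s - t + h by olra.
by olra.
Qed.

(** Once [unif_ev] has made [h] independent of [s], the increment over [h] at [s] and the increments
    over [h'] at [s + y] satisfy the hypotheses of [no_infinitesimal]. *)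
Lemma no_N1 y c d : c < d -> a <= c -> d <= b -> a <= c + y -> d + y <= b ->
  ~ forall s, c < s < d -> N1 s (s + y).
Proof.
move=> cd ac db acy dyb H.
pose Q s h := s + h < b /\ forall h', 0 < h' -> s + y + h' < b -> ev (fun x => dd s h x < dd (s + y) h' x).
have dQ : dp2 Q.
  rewrite /Q /dd; ddef.
  apply: (def_ev (fun e x => f (e 1%nat + e 2%nat + x) - f (e 1%nat + e 2%nat) - (f (e 1%nat + x) - f (e 1%nat)) <
  f (e 1%nat + y + e 0%nat + x) - f (e 1%nat + y + e 0%nat) - (f (e 1%nat + y + x) - f (e 1%nat + y)))); by ddef.
have [|c' [d' [h0 [C1 [C2 [C3 [h00 HQ]]]]]]] := unif_ev Q c d dQ cd.
  move=> s Hs; have [h [hp [hb K]]] := H s Hs.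
  exists h; split=> // k Hk; split; first by olra.
  move=> h' h'0 h'b; apply: ev_imp (ev_and _ _ (K h' h'0 h'b) (ev_lt (b - s - h) ltac:(olra))) => x x0 [L xb].
  by apply: le_lt_tr L; apply: dd_le; olra.
set h := hf h0; set e := hf (c' + d').
have he : c' < e < d' by rewrite /e; olra.
have hh : 0 < h < h0 by rewrite /h; olra.
set p := fun s => f (s + h) - f s; set g := fun h' s => f (s + y + h') - f (s + y).
have b1 : forall s, c' < s < d' -> s + h < b by move=> s Hs; case: (HQ s h Hs hh).
apply: (no_infinitesimal p g c' e (hf (d' - e))).
- by rewrite /p; ddef.
- by rewrite /g; ddef.
- by olra.
- by olra.
- move=> s x cs x0 sx; have := cvx s h x ltac:(olra) x0 ltac:(olra) ltac:(have := b1 (s + x) ltac:(olra); olra).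
  by rewrite /p; (have -> : s + x + h = s + h + x by olra); olra.
- move=> s u Hs u0; have := cont_dd s h u ltac:(olra) ltac:(olra) (b1 s ltac:(olra)) u0.
  by apply: ev_imp => t t0; rewrite /p; olra.
- move=> h' s u Hh Hs u0; have := cont_dd (s + y) h' u ltac:(olra) ltac:(olra) ltac:(olra) u0.
  apply: ev_imp => t t0; rewrite /g; have -> : s + y - t = s - t + y by olra.
  by olra.
- by move=> s u Hs u0; have := cont_r (s + y) u ltac:(olra) u0; apply: ev_imp => t t0; rewrite /g.
- move=> s h' Hs Hh; have [_ K] := HQ s h ltac:(olra) hh.
  have := K h' ltac:(olra) ltac:(olra); apply: ev_imp => x x0; rewrite /dd /p /g.
  have -> : s + x + h = s + h + x by olra.
  have -> : s + x + y + h' = s + y + h' + x by olra.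
  have -> : s + x + y = s + y + x by olra.
  by olra.
Qed.

Lemma no_N2 c d : c < d -> a <= c -> d <= b -> ~ forall s, c < s < d -> N2 s.
Proof.
move=> cd ac db H.
pose Q s h := s + h < b /\ forall h', 0 < h' -> a < s - h' -> ev (fun x => dd s h x < dd (s - h') h' x).
have dQ : dp2 Q.
  rewrite /Q /dd; ddef.
  apply: (def_ev (fun e x => f (e 1%nat + e 2%nat + x) - f (e 1%nat + e 2%nat) - (f (e 1%nat + x) - f (e 1%nat)) <
  f (e 1%nat - e 0%nat + e 0%nat + x) - f (e 1%nat - e 0%nat + e 0%nat) - (f (e 1%nat - e 0%nat + x) - f (e 1%nat - e 0%nat)))); by ddef.
have [|c' [d' [h0 [C1 [C2 [C3 [h00 HQ]]]]]]] := unif_ev Q c d dQ cd.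
  move=> s Hs; have [h [hp [hb K]]] := H s Hs.
  exists h; split=> // k Hk; split; first by olra.
  move=> h' h'0 h'b; apply: ev_imp (ev_and _ _ (K h' h'0 h'b) (ev_lt (b - s - h) ltac:(olra))) => x x0 [L xb].
  by apply: le_lt_tr L; apply: dd_le; olra.
set h := hf h0; set e := hf (c' + d').
have he : c' < e < d' by rewrite /e; olra.
have hh : 0 < h < h0 by rewrite /h; olra.
set p := fun s => f (s + h) - f s; set g := fun h' s => f s - f (s - h').
have b1 : forall s, c' < s < d' -> s + h < b by move=> s Hs; case: (HQ s h Hs hh).
apply: (no_infinitesimal p g e d' (hf (e - c'))).
- by rewrite /p; ddef.
- by rewrite /g; ddef.
- by olra.
- by olra.
- move=> s x cs x0 sx; have := cvx s h x ltac:(olra) x0 ltac:(olra) ltac:(have := b1 (s + x) ltac:(olra); olra).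
  by rewrite /p; (have -> : s + x + h = s + h + x by olra); olra.
- move=> s u Hs u0; have := cont_dd s h u ltac:(olra) ltac:(olra) (b1 s ltac:(olra)) u0.
  by apply: ev_imp => t t0; rewrite /p; olra.
- move=> h' s u Hh Hs u0; have := cont_dd (s - h') h' u ltac:(olra) ltac:(olra) ltac:(olra) u0.
  apply: ev_imp => t t0; rewrite /g; have -> : s - h' - t + h' = s - t by olra.
  have -> : s - h' - t = s - t - h' by olra.
  by (have -> : s - h' + h' = s by olra); olra.
- by move=> s u Hs u0; have := cont_l s u ltac:(olra) u0; apply: ev_imp => t t0; rewrite /g; olra.
- move=> s h' Hs Hh; have [_ K] := HQ s h ltac:(olra) hh.
  have := K h' ltac:(olra) ltac:(olra); apply: ev_imp => x x0; rewrite /dd /p /g.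
  have -> : s + x + h = s + h + x by olra.
  have -> : s - h' + h' = s by olra.
  have -> : s + x - h' = s - h' + x by olra.
  by olra.
Qed.

Definition G1 s u := forall h, 0 < h -> s + h < b ->
  exists h', 0 < h' /\ u + h' < b /\ ev (fun x => dd u h' x <= dd s h x).
Lemma G1E s u : a < s < b -> a < u < b -> ~ N1 s u -> G1 s u.
Proof.
move=> Hs Hu N h h0 hb; apply: NNPP => K; apply: N; exists h; do 2!split=> //.
move=> h' h'0 h'b; have [|//|E] := ev_dich (fun x => dd s h x < dd u h' x) (b - s) ltac:(olra).
  by rewrite /dd; ddef.
by case: K; exists h'; do 2!split=> //.
Qed.
Lemma G1_tr u s v : G1 s u -> G1 u v -> G1 s v.
Proof.
move=> A B h h0 hb; have [h1 [h10 [h1b E1]]] := A h h0 hb; have [h2 [h20 [h2b E2]]] := B h1 h10 h1b.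
by exists h2; do 2!split=> //; apply: ev_imp (ev_and _ _ E1 E2) => x _ []; olra.
Qed.
Lemma dp_G1 : dp2 G1.
Proof.
rewrite /G1 /dd; ddef.
apply: (def_ev (fun e x => f (e 3%nat + e 0%nat + x) - f (e 3%nat + e 0%nat) - (f (e 3%nat + x) - f (e 3%nat)) <=
  f (e 2%nat + e 1%nat + x) - f (e 2%nat + e 1%nat) - (f (e 2%nat + x) - f (e 2%nat)))); by ddef.
Qed.

Definition nice u := ~ N2 u /\ exists d, 0 < d /\ forall v, a < v < b -> u - d < v < u + d -> G1 u v /\ G1 v u.

Lemma dp_nice : dp1 nice.
Proof. by have := dp_N2; have := dp_G1; rewrite /nice; ddef. Qed.

(** Each way in which [nice] can fail is excluded on intervals by [no_N1] or [no_N2]. Five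
    successive subintervals discard them: [N2], and [N1] between [u] and [u + y] or [u - y] in both
    orders. *)
Lemma nice_dense c d : a <= c -> c < d -> d <= b -> exists u, c < u < d /\ nice u.
Proof.
move=> ac cd db.
have dc : 0 < d - c by olra.
have dN := dp_N1.
have none (P : T -> Prop) c' d' : dp1 P -> c < d' -> c <= c' -> c' < d' -> d' <= d ->
    (forall c2 d2, c <= c2 -> c2 < d2 -> d2 <= d -> ~ forall s, c2 < s < d2 -> P s) ->
    exists c2 d2, c' <= c2 /\ c2 < d2 /\ d2 <= d' /\ forall s, c2 < s < d2 -> ~ P s.
  move=> dP _ H1 H2 H3 N.
  have l0 : 0 < d' - c' by olra.
  have [n [c2 [A [B [K|K]]]]] := const_sub P c' (d' - c') dP l0; have p := hfn_pos n _ l0.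
    by case: (N c2 (c2 + hfn n (d' - c'))) => //; olra.
  by exists c2, (c2 + hfn n (d' - c')); do 3!(split; first by olra).
pose A1 u := ev (fun y => N1 u (u + y)); pose A2 u := ev (fun y => N1 (u + y) u).
pose A3 u := ev (fun y => N1 u (u - y)); pose A4 u := ev (fun y => N1 (u - y) u).
have dA1 : dp1 A1 by apply: (def_ev (fun e y => N1 (e 0%nat) (e 0%nat + y))); ddef.
have dA2 : dp1 A2 by apply: (def_ev (fun e y => N1 (e 0%nat + y) (e 0%nat))); ddef.
have dA3 : dp1 A3 by apply: (def_ev (fun e y => N1 (e 0%nat) (e 0%nat - y))); ddef.
have dA4 : dp1 A4 by apply: (def_ev (fun e y => N1 (e 0%nat - y) (e 0%nat))); ddef.
(* If the failure holds for all small [y] at every [s], then a single [y] serves on a subinterval,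
   chosen with room for [s + y] and [s - y]. *)
have noA (Q : T -> T -> Prop) : dp2 Q ->
  (forall c2 d2 y, c <= c2 -> c2 < d2 -> d2 <= d -> 0 < y -> c < c2 - y -> d2 + y < d -> ~ forall s, c2 < s < d2 -> Q s y) ->
  forall c2 d2, c <= c2 -> c2 < d2 -> d2 <= d -> ~ forall s, c2 < s < d2 -> ev (Q s).
  move=> dQ N c2 d2 H1 H2 H3 K.
  have [c3 [d3 [e [I1 [I2 [I3 [e0 He]]]]]]] := unif_ev Q c2 d2 dQ H2 K.
  pose l := hf (hf (d3 - c3)); set y := hf (omin e l).
  have l0 : 0 < l by rewrite /l; olra.
  have y0 : 0 < omin e l by apply: omin_gt.
  have y1 := omin_lel e l; have y2 := omin_ler e l.
  apply: (N (c3 + l) (d3 - l) y); rewrite /y; [olra|rewrite /l; olra|olra|olra|olra|olra|].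
  by move=> s Hs; apply: He; olra.
have [|c1 [d1 [I1 [I2 [I3 K0]]]]] := none N2 c d dp_N2 cd (leR _) cd (leR _).
  by move=> c2 d2 *; apply: no_N2 => //; olra.
have [|c2 [d2 [J1 [J2 [J3 K1]]]]] := none A1 c1 d1 dA1 ltac:(olra) ltac:(olra) I2 ltac:(olra).
  apply: (noA (fun u y => N1 u (u + y))); first by ddef.
  by move=> c2 d2 y *; apply: (no_N1 y); olra.
have [|c3 [d3 [J4 [J5 [J6 K2]]]]] := none A2 c2 d2 dA2 ltac:(olra) ltac:(olra) J2 ltac:(olra).
  apply: (noA (fun u y => N1 (u + y) u)); first by ddef.
  move=> c3 d3 y ? ? ? ? ? ? K; apply: (no_N1 (- y) (c3 + y) (d3 + y)); [olra..|].
  move=> s Hs; have := K (s - y) ltac:(olra); have -> : s - y + y = s by olra.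
  by have -> : s + - y = s - y by olra.
have [|c4 [d4 [J7 [J8 [J9 K3]]]]] := none A3 c3 d3 dA3 ltac:(olra) ltac:(olra) J5 ltac:(olra).
  apply: (noA (fun u y => N1 u (u - y))); first by ddef.
  by move=> c4 d4 y *; apply: (no_N1 (- y)); olra.
have [|c5 [d5 [Ja [Jb [Jc K4]]]]] := none A4 c4 d4 dA4 ltac:(olra) ltac:(olra) J8 ltac:(olra).
  apply: (noA (fun u y => N1 (u - y) u)); first by ddef.
  move=> c5 d5 y ? ? ? ? ? ? K; apply: (no_N1 y (c5 - y) (d5 - y)); [olra..|].
  move=> s Hs; have := K (s + y) ltac:(olra); have -> : s + y - y = s by olra.
  by [].
exists (hf (c5 + d5)); set u := hf _.
have Hu : c5 < u < d5 by rewrite /u; olra.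
split; first by olra.
split; first by apply: K0; olra.
have D1 : ev (fun y => ~ N1 u (u + y)).
  by have [|/K1 []|//] := ev_dich (fun y => N1 u (u + y)) _ dc; [ddef|olra].
have D2 : ev (fun y => ~ N1 (u + y) u).
  by have [|/K2 []|//] := ev_dich (fun y => N1 (u + y) u) _ dc; [ddef|olra].
have D3 : ev (fun y => ~ N1 u (u - y)).
  by have [|/K3 []|//] := ev_dich (fun y => N1 u (u - y)) _ dc; [ddef|olra].
have D4 : ev (fun y => ~ N1 (u - y) u).
  by have [|/K4 []|//] := ev_dich (fun y => N1 (u - y) u) _ dc; [ddef|olra].
have [e [e0 He]] := ev_and _ _ (ev_and _ _ D1 D2) (ev_and _ _ D3 D4).
exists e; split=> // v Hv Kv; case: (lt_tot u v) => [L|[E|L]].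
- have [[H1 H2] _] := He (v - u) ltac:(olra); have E : u + (v - u) = v by olra.
  by rewrite E in H1 H2; split; apply: G1E => //; olra.
- by subst v; split=> h h0 hb; exists h; do 2!split=> //; apply: (ev_all _ _ dc) => x _; olra.
- have [_ [H1 H2]] := He (u - v) ltac:(olra); have E : u - (u - v) = v by olra.
  by rewrite E in H1 H2; split; apply: G1E => //; olra.
Qed.
End Convex.

(* On [(a, b)] all gaps between one-sided slopes of [f] are of comparable size. *)
Definition tame (f : T -> T) a b := convex_on f a b /\
  (forall s u h, a < s -> 0 < h -> s + h < b -> a < u < b ->
     exists h', 0 < h' /\ u + h' < b /\ ev (fun x => dd f u h' x <= dd f s h x)) /\
  (forall s u h, a < s -> 0 < h -> s + h < b -> a < u < b ->
     exists h', 0 < h' /\ a < u - h' /\ ev (fun x => dd f (u - h') h' x <= dd f s h x)).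

Lemma convex_sub f a b a' b' : convex_on f a b -> a <= a' -> b' <= b -> convex_on f a' b'.
Proof. by move=> H A B s h x h0 x0 K L; apply: H => //; olra. Qed.

(** [nice] makes gaps at nearby points comparable and [G1] is transitive, so connectedness compares
    all points. Gaps to the left of [u] are reached through the failure of [N2] at [u]. *)
Lemma convex_tame f a e : df1 f -> 0 < e -> convex_on f a (a + e) ->
  exists n a', a <= a' /\ a' + hfn n e <= a + e /\ tame f a' (a' + hfn n e).
Proof.
move=> df e0 cvx.
have [|n [a' [A [B K]]]] := loc_long (nice f a (a + e)) a e (dp_nice f a (a + e) df) e0.
  exact: nice_dense.
have p := hfn_pos n e e0; have [b' Eb'] : exists b', b' = a' + hfn n e by exists (a' + hfn n e).
rewrite -Eb' in B K.
exists n, a'; rewrite -Eb'; do 2!split=> //; split; first by apply: convex_sub cvx _ _; olra.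
have G u v : a' < u < b' -> a' < v < b' -> G1 f (a + e) u v.
  move=> Hu Hv; pose U w := G1 f (a + e) u w /\ G1 f (a + e) w u.
  have dG := dp_G1 f (a + e) df.
  have dU : dp1 U by rewrite /U; ddef.
  suff : U v by case.
  apply/(conn U a' b' dU _ v u Hv Hu); last first.
    by split=> h h0 hb; exists h; do 2!split=> //; apply: (ev_all _ _ e0) => x _; olra.
  move=> z Hz; have [_ [d [d0 Hd]]] := K z Hz; exists d; split=> // y Hy Ky.
  have [H1 H2] := Hd y ltac:(olra) Ky.
  by split=> -[L1 L2]; split; [apply: G1_tr L1 _|apply: G1_tr L2|apply: G1_tr L1 _|apply: G1_tr L2].
have R s u h : a' < s -> 0 < h -> s + h < b' -> a' < u < b' ->
     exists h', 0 < h' /\ u + h' < b' /\ ev (fun x => dd f u h' x <= dd f s h x).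
  move=> As h0 sh Hu; have [|h' [h'0 [h'b E]]] := G s u ltac:(olra) Hu h h0; first by olra.
  pose k := omin h' (hf (b' - u)).
  have k0 : 0 < k by apply: omin_gt; olra.
  have k1 := omin_lel h' (hf (b' - u)); have k2 := omin_ler h' (hf (b' - u)); rewrite -/k in k1 k2.
  exists k; do 2!(split; first by olra).
  apply: ev_imp (ev_and _ _ E (ev_lt (a + e - u - h') ltac:(olra))) => x x0 [E1 E2].
  by apply: le_tr E1; apply: (dd_le f a (a + e)) => //; olra.
split=> // s u h As h0 sh Hu.
have [h1 [h10 [h1b E1]]] := R s u h As h0 sh Hu.
have [N _] := K u Hu.
have [h2 [h20 [h2b E2]]] : exists h', 0 < h' /\ a < u - h' /\ ev (fun x => dd f (u - h') h' x <= dd f u h1 x).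
  apply: NNPP => K'; apply: N; exists h1; do 2!(split; first by olra).
  move=> h' h'0 h'b; have [|//|E] := ev_dich (fun x => dd f u h1 x < dd f (u - h') h' x) _ e0.
    by rewrite /dd; ddef.
  by case: K'; exists h'; do 2!split=> //.
pose k := omin h2 (hf (u - a')).
have k0 : 0 < k by apply: omin_gt; olra.
have k1 := omin_lel h2 (hf (u - a')); have k2 := omin_ler h2 (hf (u - a')); rewrite -/k in k1 k2.
exists k; do 2!(split; first by olra).
apply: ev_imp (ev_and _ _ (ev_and _ _ E1 E2) (ev_lt (b' - u) ltac:(olra))) => x x0 [[L1 L2] xb].
apply: le_tr L1; apply: le_tr L2.
have E : h2 = (h2 - k) + k by olra.
rewrite {2}E dd_add.
have -> : u - h2 + (h2 - k) = u - k by olra.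
by have := dd_ge0 f a (a + e) cvx (u - h2) (h2 - k) x ltac:(olra) ltac:(olra) ltac:(olra) ltac:(olra); olra.
Qed.

(** * The field of slopes of a convex function *)

Fixpoint dbl (n : nat) (v : T) := match n with O => v | S n => dbl n v + dbl n v end.
Lemma dblD n (x y : T) : dbl n (x + y) = dbl n x + dbl n y.
Proof. by elim: n => //= n ->; rewrite addACA. Qed.

Lemma fun_of_rel2 (D : T -> T -> Prop) (Q : T -> T -> T -> Prop) : dp2 D -> dp3 Q ->
  (forall x y, D x y -> exists z, Q z x y) -> (forall x y z w, D x y -> Q z x y -> Q w x y -> z = w) ->
  exists F, df2 F /\ forall x y, D x y -> Q (F x y) x y.
Proof.
move=> dD dQ ex un.
have H x y : exists z, (D x y /\ Q z x y) \/ (~ D x y /\ z = 0).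
  by case: (classic (D x y)) => [Hd|N]; [have [z Hz] := ex x y Hd; exists z; left|exists 0; right].
pose F x y := proj1_sig (constructive_indefinite_description _ (H x y)).
have FP x y : (D x y /\ Q (F x y) x y) \/ (~ D x y /\ F x y = 0).
  by rewrite /F; case: constructive_indefinite_description.
exists F; split; last by move=> x y Hd; case: (FP x y) => [[]|[]].
apply: (Def_ext (fun e => (D (e 1%nat) (e 2%nat) /\ Q (e 0%nat) (e 1%nat) (e 2%nat)) \/ (~ D (e 1%nat) (e 2%nat) /\ e 0%nat = 0))); last by ddef.
move=> e; case: (FP (e 1%nat) (e 2%nat)) => [[H1 H2]|[N E]]; split.
- by case=> [[_ K]|[]//]; apply: un K H2.
- by move=> ->; left.
- by case=> [[]//|[_ ->]].
- by move=> ->; right.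
Qed.

Section Slopes.
Variables (f : T -> T) (a b u0 C : T).
Hypotheses (df : df1 f) (tm : tame f a b) (au : a < u0) (C0 : 0 < C) (ub : u0 + C < b).
Let cvx : convex_on f a b := proj1 tm.
(** The length left for the increment [x]: for [c] up to [C] and [x] below [B] the points used by
    [sl] stay below [b]. *)
Let B := b - u0 - C.
Let B0 : 0 < B. Proof. by rewrite /B; olra. Qed.

(* The difference of the slopes of f at u0 + c and at u0, as a germ at 0+. These germs modulo
   negligible ones are the scalars of the field; their product is composition, normalised by sl C. *)
Definition sl (c x : T) := dd f u0 c x.
Notation k := sl.

Lemma df_sl : df2 k. Proof. by rewrite /sl /dd; ddef. Qed.

Lemma sl0 x : k 0 x = 0. Proof. by rewrite /sl /dd !add0; olra. Qed.
Lemma slx0 c : k c 0 = 0. Proof. by rewrite /sl /dd !add0; olra. Qed.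
Lemma sl_ge0 c x : 0 <= c <= C -> 0 <= x < B -> 0 <= k c x.
Proof. by move=> Hc Hx; apply: (dd_ge0 f a b) => //; rewrite /B in Hx; olra. Qed.
Lemma sl_pos c x : 0 < c <= C -> 0 < x < B -> 0 < k c x.
Proof. by move=> Hc Hx; apply: (dd_pos f a b) => //; rewrite /B in Hx; olra. Qed.
Lemma sl_le c c' x : 0 <= c <= c' -> c' <= C -> 0 <= x < B -> k c x <= k c' x.
Proof. by move=> Hc Hc' Hx; apply: (dd_le f a b) => //; rewrite /B in Hx; olra. Qed.
Lemma sl_addx c x y : k c (x + y) = k c x + dd f (u0 + x) c y.
Proof. by rewrite /sl dd_sym dd_add dd_sym (dd_sym _ _ c y). Qed.
Lemma sl_lex c x y : 0 <= c <= C -> 0 <= x <= y -> y < B -> k c x <= k c y.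
Proof.
move=> Hc Hx Hy; have -> : y = x + (y - x) by olra.
rewrite sl_addx; have := dd_ge0 f a b cvx (u0 + x) c (y - x) ltac:(olra) ltac:(olra) ltac:(olra).
by rewrite /B in Hy; move=> K; have := K ltac:(olra); olra.
Qed.
Lemma sl_ltx c x y : 0 < c <= C -> 0 <= x < y -> y < B -> k c x < k c y.
Proof.
move=> Hc Hx Hy; have -> : y = x + (y - x) by olra.
rewrite sl_addx; have := dd_pos f a b cvx (u0 + x) c (y - x) ltac:(olra) ltac:(olra) ltac:(olra).
by rewrite /B in Hy; move=> K; have := K ltac:(olra); olra.
Qed.
Lemma sl_lip c x y : 0 <= c <= C -> 0 <= x <= y -> y < B -> k c y - k c x <= k C y - k C x.
Proof.
move=> Hc Hx Hy; have -> : y = x + (y - x) by olra.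
rewrite !sl_addx; have := dd_le f a b cvx (u0 + x) c C (y - x) ltac:(olra) ltac:(olra) ltac:(olra).
by rewrite /B in Hy; move=> K; have := K ltac:(olra); olra.
Qed.

Lemma evB : ev (fun x => 0 <= x < B).
Proof. by exists B; split=> // x Hx; olra. Qed.

(** Tameness compares gaps at all points, so a gap between two scalars is measured by a gap at [u0].
    Conversely [sl_contr] and [sl_contl] find scalars within a prescribed gap on either side of
    [c]. *)
Lemma sl_gap c c' : 0 <= c < c' -> c' <= C -> exists c0, 0 < c0 <= C /\ ev (fun x => k c0 x <= k c' x - k c x).
Proof.
move=> Hc Hc'.
have [h [h0 [hb E]]] := proj1 (proj2 tm) (u0 + c) u0 (c' - c) ltac:(olra) ltac:(olra) ltac:(olra) ltac:(olra).
have m1 := omin_lel h C; have m2 := omin_ler h C; have m0 : 0 < omin h C by apply: omin_gt.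
exists (omin h C); split; first by olra.
apply: ev_imp (ev_and _ _ E (ev_and _ _ evB (ev_lt (b - u0 - h) ltac:(olra)))) => x x0 [E1 [Hx Hx']].
have -> : c' = c + (c' - c) by olra.
rewrite /sl dd_add; have := dd_le f a b cvx u0 (omin h C) h x ltac:(olra) ltac:(olra) au ltac:(olra).
by olra.
Qed.
Lemma sl_contr c c0 : 0 <= c < C -> 0 < c0 <= C -> exists c', c < c' <= C /\ ev (fun x => k c' x - k c x <= k c0 x).
Proof.
move=> Hc Hc0.
have [h [h0 [hb E]]] := proj1 (proj2 tm) u0 (u0 + c) c0 ltac:(olra) ltac:(olra) ltac:(olra) ltac:(olra).
have m1 := omin_lel h (C - c); have m2 := omin_ler h (C - c); have m0 : 0 < omin h (C - c) by apply: omin_gt; olra.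
exists (c + omin h (C - c)); split; first by olra.
apply: ev_imp (ev_and _ _ E (ev_and _ _ evB (ev_lt (b - u0 - c - h) ltac:(olra)))) => x x0 [E1 [Hx Hx']].
rewrite /sl dd_add; have := dd_le f a b cvx (u0 + c) (omin h (C - c)) h x ltac:(olra) ltac:(olra) ltac:(olra) ltac:(olra).
by rewrite /sl in E1; olra.
Qed.
Lemma sl_contl c c0 : 0 < c <= C -> 0 < c0 <= C -> exists c', 0 <= c' < c /\ ev (fun x => k c x - k c' x <= k c0 x).
Proof.
move=> Hc Hc0.
have [h [h0 [hb E]]] := proj2 (proj2 tm) u0 (u0 + c) c0 ltac:(olra) ltac:(olra) ltac:(olra) ltac:(olra).
have m1 := omin_lel h c; have m2 := omin_ler h c; have m0 : 0 < omin h c by apply: omin_gt; olra.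
set m := omin h c in m1 m2 m0 *.
exists (c - m); split; first by olra.
apply: ev_imp (ev_and _ _ E evB) => x x0 [E1 Hx].
have -> : k c x = k (c - m) x + dd f (u0 + (c - m)) m x.
  by rewrite /sl -dd_add; have -> : c - m + m = c by olra.
have E2 : h = (h - m) + m by olra.
move: E1; rewrite {2}E2 dd_add; have -> : u0 + c - h + (h - m) = u0 + (c - m) by olra.
have := dd_ge0 f a b cvx (u0 + c - h) (h - m) x ltac:(olra) ltac:(olra) hb.
rewrite /B in Hx; move=> K; have := K ltac:(olra); rewrite /sl; olra.
Qed.
(** The gap between [hf c] and [c] dominates some [sl c1]; a parameter below both [c1] and [hf c]
    then fits twice. This is what closes negligible germs under addition. *)
Lemma sl_half c : 0 < c <= C -> exists c0, 0 < c0 <= C /\ ev (fun x => k c0 x + k c0 x <= k c x).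
Proof.
move=> Hc; have [c1 [Hc1 E1]] := sl_gap (hf c) c ltac:(olra) ltac:(olra).
have m1 := omin_lel c1 (hf c); have m2 := omin_ler c1 (hf c); have m0 : 0 < omin c1 (hf c) by apply: omin_gt; olra.
set m := omin c1 (hf c) in m1 m2 m0 *.
exists m; split; first by olra.
apply: ev_imp (ev_and _ _ E1 evB) => x x0 [E Hx].
by have := sl_le m c1 x ltac:(olra) ltac:(olra) Hx; have := sl_le m (hf c) x ltac:(olra) ltac:(olra) Hx; olra.
Qed.

(** The infinitesimals to be divided out: germs below every positive scalar. *)
Definition negl (g : T -> T) := forall c, 0 < c <= C -> ev (fun x => - k c x <= g x <= k c x).
Definition sim (g g' : T -> T) := negl (fun x => g x - g' x).

Lemma negl_ext g g' : (forall x, 0 < x -> g x = g' x) -> negl g -> negl g'.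
Proof. by move=> E H c Hc; apply: ev_imp (H c Hc) => x x0; rewrite E. Qed.
Lemma negl0 : negl (fun _ => 0).
Proof. by move=> c Hc; apply: ev_imp evB => x x0 Hx; have := sl_ge0 c x ltac:(olra) Hx; olra. Qed.
Lemma neglD g g' : negl g -> negl g' -> negl (fun x => g x + g' x).
Proof.
move=> H H' c Hc; have [c0 [Hc0 E]] := sl_half c Hc.
by apply: ev_imp (ev_and _ _ E (ev_and _ _ (H c0 Hc0) (H' c0 Hc0))) => x _; olra.
Qed.
Lemma neglN g : negl g -> negl (fun x => - g x).
Proof. by move=> H c Hc; apply: ev_imp (H c Hc) => x _; olra. Qed.
Lemma negl_abs g g' : ev (fun x => (- g x <= g' x <= g x) \/ (g x <= g' x <= - g x)) -> negl g -> negl g'.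
Proof. by move=> E H c Hc; apply: ev_imp (ev_and _ _ E (H c Hc)) => x _ [[?|?] ?]; olra. Qed.
Lemma sim_refl g : sim g g.
Proof. by apply: negl_ext negl0 => x _; olra. Qed.
Lemma sim_sym g g' : sim g g' -> sim g' g.
Proof. by move=> /neglN; apply: negl_ext => x _; olra. Qed.
Lemma sim_tr g' g g'' : sim g g' -> sim g' g'' -> sim g g''.
Proof. by move=> H /(neglD _ _ H); apply: negl_ext => x _; olra. Qed.
Lemma simD g1 g1' g2 g2' : sim g1 g1' -> sim g2 g2' -> sim (fun x => g1 x + g2 x) (fun x => g1' x + g2' x).
Proof. by move=> H /(neglD _ _ H); apply: negl_ext => x _; olra. Qed.
Lemma simN g g' : sim g g' -> sim (fun x => - g x) (fun x => - g' x).
Proof. by move=> /neglN; apply: negl_ext => x _; olra. Qed.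
Lemma simB g1 g1' g2 g2' : sim g1 g1' -> sim g2 g2' -> sim (fun x => g1 x - g2 x) (fun x => g1' x - g2' x).
Proof. by move=> H H'; apply: (simD _ _ _ _ H (simN _ _ H')). Qed.
Lemma sim_hf g g' : sim g g' -> sim (fun x => hf (g x)) (fun x => hf (g' x)).
Proof.
by move=> H c Hc; apply: ev_imp (ev_and _ _ (H c Hc) evB) => x x0 [E Hx]; have := sl_ge0 c x ltac:(olra) Hx; olra.
Qed.
Lemma sim_ext g1 g1' g2 g2' : (forall x, 0 < x -> g1 x = g1' x) -> (forall x, 0 < x -> g2 x = g2' x) ->
  sim g1 g2 -> sim g1' g2'.
Proof. by move=> E E'; apply: negl_ext => x x0; rewrite E // E'. Qed.
Lemma sim_ev g g' : ev (fun x => g x = g' x) -> sim g g'.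
Proof.
move=> E c Hc; apply: ev_imp (ev_and _ _ E evB) => x x0 [-> Hx].
by have := sl_ge0 c x ltac:(olra) Hx; olra.
Qed.

Lemma sl_inj c c' : 0 <= c <= C -> 0 <= c' <= C -> sim (k c) (k c') -> c = c'.
Proof.
have L d d' : 0 <= d < d' -> d' <= C -> ~ sim (k d') (k d).
  move=> Hd Hd' S; have [c0 [Hc0 E]] := sl_gap d d' Hd Hd'.
  have [c1 [Hc1 E1]] := sl_half c0 Hc0.
  have [x [x0 [[H1 [H2 H3]] H4]]] := ev_ex _ (ev_and _ _ (ev_and _ _ E (ev_and _ _ E1 (S c1 Hc1))) (ev_lt B B0)).
  by have := sl_pos c1 x Hc1 (conj x0 H4); olra.
move=> Hc Hc' S; case: (lt_tot c c') => [K|[//|K]].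
  by case: (L c c'); [olra|olra|apply: sim_sym].
by case: (L c' c); [olra|olra|].
Qed.

(** Completeness of the scalars: [c] is the supremum of the parameters whose germ lies below [g],
    and by [sl_contr] and [sl_contl] the error on both sides is below every positive scalar. *)
Lemma sl_cut g : df1 g -> ev (fun x => 0 <= g x <= k C x) -> exists c, 0 <= c <= C /\ sim g (k c).
Proof.
move=> dg Hg; have dk := df_sl.
pose U c := 0 <= c <= C /\ ev (fun x => k c x <= g x).
have dU : dp1 U.
  by rewrite /U; ddef; apply: (def_ev (fun e x => k (e 0%nat) x <= g x)); ddef.
have U0 : U 0 by split; [olra|apply: ev_imp Hg => x _; rewrite sl0; olra].
have [|s [s1 s2]] := sup_ex U 0 C dU U0; first by move=> u []; olra.
have Hs : 0 <= s <= C.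
  split; first by apply: s1.
  by move=> /s2 [u [[? _] ?]]; olra.
exists s; split=> // c Hc.
have up : ev (fun x => g x <= k s x + k c x).
  case: (le_eqlt _ _ (proj2 Hs)) => [->|sC].
    by apply: ev_imp (ev_and _ _ Hg evB) => x _ [? Hx]; have := sl_ge0 c x ltac:(olra) Hx; olra.
  have [c' [Hc' E]] := sl_contr s c ltac:(olra) Hc.
  have [|K|K] := ev_dich (fun x => k c' x <= g x) C C0; first by ddef.
    have Uc : U c' by split=> //; olra.
    by have := s1 c' Uc; olra.
  by apply: ev_imp (ev_and _ _ E K) => x _; olra.
have dn : ev (fun x => k s x - k c x <= g x).
  case: (le_eqlt _ _ (proj1 Hs)) => [<-|s0].
    by apply: ev_imp (ev_and _ _ Hg evB) => x _ [? Hx]; rewrite sl0; have := sl_ge0 c x ltac:(olra) Hx; olra.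
  have [c' [Hc' E]] := sl_contl s c ltac:(olra) Hc.
  have [u [[Hu Eu] Lu]] := s2 c' (proj2 Hc').
  apply: ev_imp (ev_and _ _ (ev_and _ _ E Eu) evB) => x _ [[? ?] Hx].
  by have := sl_le c' u x ltac:(olra) ltac:(olra) Hx; olra.
by apply: ev_imp (ev_and _ _ up dn) => x _; olra.
Qed.

Lemma sl_contx x u : 0 <= x < B -> 0 < u -> ev (fun t => k C (x + t) < k C x + u).
Proof.
move=> Hx u_0; rewrite /B in Hx.
have K1 := cont_r f a b df cvx (u0 + C + x) (hf u) ltac:(olra) ltac:(olra).
have K2 := cont_r f a b df cvx (u0 + x) (hf u) ltac:(olra) ltac:(olra).
apply: ev_imp (ev_and _ _ K1 K2) => t t0; rewrite /sl /dd.
have -> : u0 + C + (x + t) = u0 + C + x + t by olra.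
have -> : u0 + (x + t) = u0 + x + t by olra.
by olra.
Qed.
Lemma sl_contxl x u : 0 < x < B -> 0 < u -> ev (fun t => k C x - u < k C (x - t)).
Proof.
move=> Hx u_0; rewrite /B in Hx.
have K1 := cont_l f a b df cvx (u0 + C + x) (hf u) ltac:(olra) ltac:(olra).
have K2 := cont_l f a b df cvx (u0 + x) (hf u) ltac:(olra) ltac:(olra).
apply: ev_imp (ev_and _ _ K1 K2) => t t0; rewrite /sl /dd.
have -> : u0 + C + (x - t) = u0 + C + x - t by olra.
have -> : u0 + (x - t) = u0 + x - t by olra.
by olra.
Qed.

Lemma sl_ivt x w : 0 <= x < B -> 0 <= w <= k C x -> exists y, 0 <= y <= x /\ k C y = w.
Proof.
move=> Hx Hw; have dk := df_sl.
have [|||s [s1 s2]] := sup_ex (fun y => 0 <= y <= x /\ k C y <= w) 0 x.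
- by ddef.
- by rewrite slx0; olra.
- by move=> u; olra.
have Hs : 0 <= s <= x.
  split; first by apply: s1; rewrite slx0; olra.
  by move=> /s2 [u]; olra.
exists s; split=> //.
case: (lt_tot (k C s) w) => [L|[//|L]]; exfalso.
- have sx : s < x by case: (le_eqlt _ _ (proj2 Hs)) => // E; subst s; olra.
  have [t [t0 [E1 E2]]] := ev_ex _ (ev_and _ _ (sl_contx s (w - k C s) ltac:(olra) ltac:(olra)) (ev_lt (x - s) ltac:(olra))).
  by have := s1 (s + t) ltac:(olra); olra.
- have sp : 0 < s by case: (le_eqlt _ _ (proj1 Hs)) => // E; subst s; rewrite slx0 in L; olra.
  have [t [t0 [E1 E2]]] := ev_ex _ (ev_and _ _ (sl_contxl s (k C s - w) ltac:(olra) ltac:(olra)) (ev_lt s sp)).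
  have [u [[Hu Ku] Lu]] := s2 (s - t) ltac:(olra).
  by have := sl_lex C (s - t) u ltac:(olra) ltac:(olra) ltac:(olra); olra.
Qed.

(* rho d is the compositional quotient of sl d by the unit sl C. *)
Definition rdom d x := 0 <= d <= C /\ 0 <= x < B.
Definition rho (d x : T) := epsilon (inhabits 0) (fun y => (rdom d x /\ 0 <= y <= x /\ k C y = k d x) \/ (~ rdom d x /\ y = 0)).
Lemma rho_spec d x : (rdom d x /\ 0 <= rho d x <= x /\ k C (rho d x) = k d x) \/ (~ rdom d x /\ rho d x = 0).
Proof.
have := epsilon_spec (inhabits 0) (fun y => (rdom d x /\ 0 <= y <= x /\ k C y = k d x) \/ (~ rdom d x /\ y = 0)).
apply; case: (classic (rdom d x)) => [H|N]; last by exists 0; right.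
have [Hd Hx] := H.
have [|y [Hy1 Hy2]] := sl_ivt x (k d x) Hx; last by exists y; left.
by have := sl_ge0 d x Hd Hx; have := sl_le d C x ltac:(olra) ltac:(olra) Hx; olra.
Qed.
Lemma rhoP d x : 0 <= d <= C -> 0 <= x < B -> 0 <= rho d x <= x /\ k C (rho d x) = k d x.
Proof. by move=> Hd Hx; case: (rho_spec d x) => [[_ H]//|[N _]]; case: N. Qed.
Lemma slC_inj x y : 0 <= x < B -> 0 <= y < B -> k C x = k C y -> x = y.
Proof.
move=> Hx Hy E; case: (lt_tot x y) => [L|[//|L]].
  by have := sl_ltx C x y ltac:(olra) ltac:(olra) ltac:(olra); olra.
by have := sl_ltx C y x ltac:(olra) ltac:(olra) ltac:(olra); olra.
Qed.
Lemma df_rho : df2 rho.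
Proof.
have dk := df_sl.
apply: (Def_ext (fun e => (rdom (e 1%nat) (e 2%nat) /\ 0 <= e 0%nat <= e 2%nat /\ k C (e 0%nat) = k (e 1%nat) (e 2%nat)) \/ (~ rdom (e 1%nat) (e 2%nat) /\ e 0%nat = 0))).
  move=> e; case: (rho_spec (e 1%nat) (e 2%nat)) => [[H1 [H2 H3]]|[N E]]; split.
  - case=> [[_ [K1 K2]]|[]//]; case: H1 => H11 H12; apply: slC_inj; [olra|olra|by rewrite K2].
  - by move=> ->; left.
  - by case=> [[]//|[_ ->]].
  - by move=> ->; right.
by rewrite /rdom; ddef.
Qed.
Lemma rho0 x : 0 <= x < B -> rho 0 x = 0.
Proof.
move=> Hx; have [H1 H2] := rhoP 0 x ltac:(olra) Hx.
by apply: slC_inj; [olra|olra|rewrite H2 sl0 slx0].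
Qed.
Lemma rhoC x : 0 <= x < B -> rho C x = x.
Proof.
by move=> Hx; have [H1 H2] := rhoP C x ltac:(olra) Hx; apply: slC_inj; olra.
Qed.
Lemma rho_pos d x : 0 < d <= C -> 0 < x < B -> 0 < rho d x.
Proof.
move=> Hd Hx; have [[H1 _] H2] := rhoP d x ltac:(olra) ltac:(olra).
case: (le_eqlt _ _ H1) => // E; move: H2; rewrite -E slx0.
by have := sl_pos d x Hd Hx; olra.
Qed.
Lemma rho_ev d (P : T -> Prop) : 0 < d <= C -> ev P -> ev (fun x => P (rho d x)).
Proof.
move=> Hd [e [e0 He]]; apply: ev_imp (ev_and _ _ (ev_lt e e0) evB) => x x0 [xe Hx]; apply: He.
by have := rho_pos d x Hd (conj x0 (proj2 Hx)); have [? _] := rhoP d x ltac:(olra) Hx; olra.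
Qed.

Lemma negl_rho g d : 0 <= d <= C -> g 0 = 0 -> negl g -> negl (fun x => g (rho d x)).
Proof.
move=> Hd g0 H c Hc; case: (le_eqlt _ _ (proj1 Hd)) => [<-|d0].
  apply: ev_imp evB => x x0 Hx; rewrite rho0 // g0; have := sl_ge0 c x ltac:(olra) Hx; olra.
apply: ev_imp (ev_and _ _ (rho_ev d _ (conj d0 (proj2 Hd)) (H c Hc)) evB) => x x0 [E Hx].
have [? _] := rhoP d x Hd Hx.
by have := sl_lex c (rho d x) x ltac:(olra) ltac:(olra) ltac:(olra); olra.
Qed.
Lemma sim_rho g g' d : 0 <= d <= C -> g 0 = 0 -> g' 0 = 0 -> sim g g' -> sim (fun x => g (rho d x)) (fun x => g' (rho d x)).
Proof. by move=> Hd E E' H; apply: (negl_rho (fun x => g x - g' x)) => //; rewrite E E'; olra. Qed.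

(** By convexity the increments of [sl c] in [x] are at most those of [sl C]. *)
Lemma sl_lip_sim c p q : 0 <= c <= C -> ev (fun x => 0 <= p x < B) -> ev (fun x => 0 <= q x < B) ->
  sim (fun x => k C (p x)) (fun x => k C (q x)) -> sim (fun x => k c (p x)) (fun x => k c (q x)).
Proof.
move=> Hc Ep Eq; apply: negl_abs; apply: ev_imp (ev_and _ _ Ep Eq) => x _ [Hp Hq].
case: (lt_le_dec (p x) (q x)) => L; [right|left].
  have := sl_lip c (p x) (q x) Hc ltac:(olra) ltac:(olra); have := sl_lex c (p x) (q x) Hc ltac:(olra) ltac:(olra); olra.
have := sl_lip c (q x) (p x) Hc ltac:(olra) ltac:(olra); have := sl_lex c (q x) (p x) Hc ltac:(olra) ltac:(olra); olra.
Qed.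

(** The defect of additivity is a difference of second differences in which both increments are
    small. The first increment is eventually below any fixed [h], and tameness makes the gap over a
    suitable [h] smaller than any given scalar. *)
Lemma sl_approx_add c p q : 0 <= c <= C -> ev (fun x => 0 <= p x <= x) -> ev (fun x => 0 <= q x <= x) ->
  sim (fun x => k c (p x + q x)) (fun x => k c (p x) + k c (q x)).
Proof.
move=> Hc Ep Eq.
have N s : 0 <= s <= C -> negl (fun x => dd f (u0 + s) (p x) (q x)).
  move=> Hs c0 Hc0.
  have [h [h0 [hb [e [e0 E]]]]] := proj1 (proj2 tm) u0 (u0 + s) c0 au ltac:(olra) ltac:(olra) ltac:(olra).
  have b0 : 0 < hf (b - u0 - s - h) by olra.
  apply: ev_imp (ev_and _ _ (ev_and _ _ Ep Eq) (ev_and _ _ evB (ev_and _ _ (ev_lt h h0) (ev_and _ _ (ev_lt e e0) (ev_lt _ b0))))).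
  move=> x x0 [[Hp Hq] [Hx [xh [xe xb]]]].
  have A := dd_ge0 f a b cvx (u0 + s) (p x) (q x) ltac:(olra) ltac:(olra) ltac:(olra) ltac:(olra).
  have D := dd_le f a b cvx (u0 + s) (p x) h (q x) ltac:(olra) ltac:(olra) ltac:(olra) ltac:(olra).
  have P := sl_ge0 c0 x ltac:(olra) Hx.
  case: (le_eqlt _ _ (proj1 Hq)) => [q0|q0].
    move: D A; rewrite -q0 /dd !add0; olra.
  have F := E (q x) ltac:(olra).
  by have := sl_lex c0 (q x) x ltac:(olra) ltac:(olra) ltac:(olra); rewrite /sl in P *; olra.
apply: negl_ext (neglD _ _ (N c Hc) (neglN _ (N 0 ltac:(olra)))) => x _.
rewrite sl_addx; have -> : u0 + 0 = u0 by olra.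
have E1 := dd_add f u0 c (p x) (q x); have E2 := dd_add f u0 (p x) c (q x).
rewrite (addC c (p x)) in E1; rewrite /sl; olra.
Qed.

(** Modulo negligible germs [sl C] sends [rho x + rho y] and [rho m + rho m] to the same germ, by
    additivity and the choice of [m]. Then [sl c] identifies them too, and additivity splits both
    sums. *)
Lemma rho_mid c x y m : 0 <= c <= C -> 0 <= x <= C -> 0 <= y <= C -> 0 <= m <= C ->
  sim (k m) (fun t => hf (k x t + k y t)) ->
  sim (fun t => k c (rho m t)) (fun t => hf (k c (rho x t) + k c (rho y t))).
Proof.
move=> Hc Hx Hy Hm S.
have R d : 0 <= d <= C -> ev (fun t => 0 <= rho d t <= t).
  by move=> Hd; apply: ev_imp evB => t t0 Ht; case: (rhoP d t Hd Ht).
have RB d d' : 0 <= d <= C -> 0 <= d' <= C -> ev (fun t => 0 <= rho d t + rho d' t < B).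
  move=> Hd Hd'; have B1 : 0 < hf B by olra.
  by apply: ev_imp (ev_and _ _ (ev_and _ _ (R d Hd) (R d' Hd')) (ev_lt _ B1)) => t t0; olra.
have A1 := sl_approx_add C _ _ ltac:(olra) (R x Hx) (R y Hy).
have A2 := sl_approx_add C _ _ ltac:(olra) (R m Hm) (R m Hm).
have A3 := sl_approx_add c _ _ Hc (R x Hx) (R y Hy).
have A4 := sl_approx_add c _ _ Hc (R m Hm) (R m Hm).
have E : sim (fun t => k C (rho x t + rho y t)) (fun t => k C (rho m t + rho m t)).
  apply: sim_tr A1 _; apply: sim_sym; apply: sim_tr A2 _.
  apply: (sim_tr (fun t => k m t + k m t)).
    by apply: sim_ev; apply: ev_imp evB => t t0 Ht; have [_ ->] := rhoP m t Hm Ht.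
  apply: sim_tr (simD _ _ _ _ S S) _.
  apply: sim_ev; apply: ev_imp evB => t t0 Ht.
  by have [_ ->] := rhoP x t Hx Ht; have [_ ->] := rhoP y t Hy Ht; olra.
have F := sl_lip_sim c _ _ Hc (RB _ _ Hx Hy) (RB _ _ Hm Hm) E.
have H := sim_tr _ _ _ (sim_sym _ _ A4) (sim_tr _ _ _ (sim_sym _ _ F) A3).
by have := sim_hf _ _ H; apply: sim_ext => t _; olra.
Qed.

Lemma rho_comp c d d' e : 0 <= c <= C -> 0 <= d <= C -> 0 <= d' <= C -> 0 <= e <= C ->
  sim (k e) (fun t => k d (rho d' t)) -> sim (fun t => k c (rho e t)) (fun t => k c (rho d (rho d' t))).
Proof.
move=> Hc Hd Hd' He S; apply: sl_lip_sim => //.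
- by apply: ev_imp evB => t t0 Ht; have [? _] := rhoP e t He Ht; olra.
- apply: ev_imp evB => t t0 Ht; have [? _] := rhoP d' t Hd' Ht.
  by have [? _] := rhoP d (rho d' t) Hd ltac:(olra); olra.
- apply: sim_tr (sim_tr _ _ _ _ S) _; apply: sim_ev; apply: ev_imp evB => t t0 Ht.
    by have [_ ->] := rhoP e t He Ht.
  by have [? _] := rhoP d' t Hd' Ht; have [_ ->] := rhoP d (rho d' t) Hd ltac:(olra).
Qed.

Lemma mul_ex c d : 0 <= c <= C -> 0 <= d <= C -> exists e, 0 <= e <= C /\ sim (k e) (fun t => k c (rho d t)).
Proof.
move=> Hc Hd; have dk := df_sl; have dr := df_rho.
have [||e [He S]] := sl_cut (fun t => k c (rho d t)); [by ddef| |by exists e; split=> //; apply: sim_sym].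
apply: ev_imp evB => t t0 Ht; have [? _] := rhoP d t Hd Ht.
have := sl_ge0 c (rho d t) Hc ltac:(olra).
have := sl_lex c (rho d t) t Hc ltac:(olra) ltac:(olra).
by have := sl_le c C t ltac:(olra) ltac:(olra) Ht; olra.
Qed.
Definition wle (g g' : T -> T) := forall c, 0 < c <= C -> ev (fun x => g x <= g' x + k c x).
Lemma sim_wle g g' : sim g g' -> wle g g'.
Proof. by move=> H c Hc; apply: ev_imp (H c Hc) => x _; olra. Qed.
Lemma wle_anti g g' : wle g g' -> wle g' g -> sim g g'.
Proof. by move=> H H' c Hc; apply: ev_imp (ev_and _ _ (H c Hc) (H' c Hc)) => x _; olra. Qed.
Lemma wle_tr g' g g'' : wle g g' -> wle g' g'' -> wle g g''.
Proof.
move=> H H' c Hc; have [c0 [Hc0 E]] := sl_half c Hc.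
by apply: ev_imp (ev_and _ _ E (ev_and _ _ (H c0 Hc0) (H' c0 Hc0))) => x _; olra.
Qed.
Lemma wleD g1 g1' g2 g2' : wle g1 g1' -> wle g2 g2' -> wle (fun x => g1 x + g2 x) (fun x => g1' x + g2' x).
Proof.
move=> H H' c Hc; have [c0 [Hc0 E]] := sl_half c Hc.
by apply: ev_imp (ev_and _ _ E (ev_and _ _ (H c0 Hc0) (H' c0 Hc0))) => x _; olra.
Qed.
Lemma wle_ev g g' : ev (fun x => g x <= g' x) -> wle g g'.
Proof.
move=> E c Hc; apply: ev_imp (ev_and _ _ E evB) => x _ [H Hx].
by have := sl_ge0 c x ltac:(olra) Hx; olra.
Qed.
Lemma wle_hf g g' : wle g g' -> wle (fun x => hf (g x)) (fun x => hf (g' x)).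
Proof.
move=> H c Hc; apply: ev_imp (ev_and _ _ (H c Hc) evB) => x _ [E Hx].
by have := sl_ge0 c x ltac:(olra) Hx; olra.
Qed.
Lemma wle_ext g1 g1' g2 g2' : (forall x, 0 < x -> g1 x = g1' x) -> (forall x, 0 < x -> g2 x = g2' x) ->
  wle g1 g2 -> wle g1' g2'.
Proof. by move=> E E' H c Hc; apply: ev_imp (H c Hc) => x x0; rewrite E // E'. Qed.
Definition inP x := 0 <= x <= C.
Lemma inP0 : inP 0. Proof. by rewrite /inP; olra. Qed.
Lemma inPC : inP C. Proof. by rewrite /inP; olra. Qed.
Lemma k_le x y : inP x -> inP y -> wle (k x) (k y) -> x <= y.
Proof.
rewrite /inP => Hx Hy H L; have [c0 [Hc0 E]] := sl_gap y x ltac:(olra) ltac:(olra).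
have [c1 [Hc1 E1]] := sl_half c0 Hc0.
have [z [z0 [[H1 [H2 H3]] H4]]] := ev_ex _ (ev_and _ _ (ev_and _ _ E (ev_and _ _ E1 (H c1 Hc1))) evB).
by have := sl_pos c1 z Hc1 ltac:(olra); olra.
Qed.
Lemma k_mono x y : inP x -> inP y -> x <= y -> wle (k x) (k y).
Proof. by rewrite /inP => Hx Hy L; apply: wle_ev; apply: ev_imp evB => t _; apply: sl_le; olra. Qed.
Lemma k_ge0 x : inP x -> wle (fun _ => 0) (k x).
Proof. by move=> Hx; apply: wle_ev; apply: ev_imp evB => t _; apply: sl_ge0. Qed.
(** A germ that eventually reaches [sl C] or 0 is equivalent to that end, so the bounds of [sl_cut]
    may be weakened by negligible germs. *)
Lemma k_cut g : df1 g -> wle (fun _ => 0) g -> wle g (k C) -> exists c, inP c /\ sim g (k c).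
Proof.
move=> dg H0 HC; have dk := df_sl.
have [|E1|E1] := ev_dich (fun x => k C x <= g x) C C0; first by ddef.
  by exists C; split; [apply: inPC|apply: wle_anti => //; apply: wle_ev].
have [|E2|E2] := ev_dich (fun x => g x <= 0) C C0; first by ddef.
  exists 0; split; first exact: inP0.
  apply: wle_anti; last by apply: wle_ext H0 => x _ //; rewrite sl0.
  by apply: wle_ev; apply: ev_imp E2 => x _; rewrite sl0.
by apply: sl_cut => //; apply: ev_imp (ev_and _ _ E1 E2) => x _; olra.
Qed.

(** The result is the parameter of the average of two germs, which need not be the midpoint of [x]
    and [y] in the group. *)
Lemma mid_ex : exists F, df2 F /\ forall x y, inP x /\ inP y ->
  inP (F x y) /\ sim (k (F x y)) (fun t => hf (k x t + k y t)).
Proof.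
have dk := df_sl.
apply: (fun_of_rel2 (fun x y => inP x /\ inP y) (fun m x y => inP m /\ sim (k m) (fun t => hf (k x t + k y t)))).
- by rewrite /inP; ddef.
- rewrite /inP /sim /negl; ddef.
  by apply: (def_ev (fun e t => - k (e 0%nat) t <= k (e 1%nat) t - hf (k (e 2%nat) t + k (e 3%nat) t) <= k (e 0%nat) t)); ddef.
- move=> x y [Hx Hy].
  have [||| m [Hm S]] := k_cut (fun t => hf (k x t + k y t)); first by ddef.
  + by apply: wle_ext (wle_hf _ _ (wleD _ _ _ _ (k_ge0 x Hx) (k_ge0 y Hy))) => t _ //; olra.
  + by apply: wle_ext (wle_hf _ _ (wleD _ _ _ _ (k_mono x C Hx inPC (proj2 Hx)) (k_mono y C Hy inPC (proj2 Hy)))) => t _ //; olra.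
  + by exists m; split=> //; apply: sim_sym.
- move=> x y z w _ [Hz Sz] [Hw Sw]; apply: sl_inj => //.
  exact: sim_tr Sz (sim_sym _ _ Sw).
Qed.
Definition mid := epsilon (inhabits (fun _ _ => 0)) (fun F => df2 F /\ forall x y, inP x /\ inP y ->
  inP (F x y) /\ sim (k (F x y)) (fun t => hf (k x t + k y t))).
Lemma df_mid : df2 mid. Proof. by have [] := epsilon_spec (inhabits (fun _ _ => 0)) _ mid_ex. Qed.
Lemma midP x y : inP x -> inP y -> inP (mid x y) /\ sim (k (mid x y)) (fun t => hf (k x t + k y t)).
Proof. by move=> Hx Hy; have [_ H] := epsilon_spec (inhabits (fun _ _ => 0)) _ mid_ex; apply: H. Qed.
Lemma rmul_ex : exists F, df2 F /\ forall x y, inP x /\ inP y ->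
  inP (F x y) /\ sim (k (F x y)) (fun t => k x (rho y t)).
Proof.
have dk := df_sl; have dr := df_rho.
apply: (fun_of_rel2 (fun x y => inP x /\ inP y) (fun m x y => inP m /\ sim (k m) (fun t => k x (rho y t)))).
- by rewrite /inP; ddef.
- rewrite /inP /sim /negl; ddef.
  by apply: (def_ev (fun e t => - k (e 0%nat) t <= k (e 1%nat) t - k (e 2%nat) (rho (e 3%nat) t) <= k (e 0%nat) t)); ddef.
- by move=> x y [Hx Hy]; apply: mul_ex.
- move=> x y z w _ [Hz Sz] [Hw Sw]; apply: sl_inj => //.
  exact: sim_tr Sz (sim_sym _ _ Sw).
Qed.
Definition pmul := epsilon (inhabits (fun _ _ => 0)) (fun F => df2 F /\ forall x y, inP x /\ inP y ->
  inP (F x y) /\ sim (k (F x y)) (fun t => k x (rho y t))).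
Lemma df_pmul : df2 pmul. Proof. by have [] := epsilon_spec (inhabits (fun _ _ => 0)) _ rmul_ex. Qed.
Lemma pmulP x y : inP x -> inP y -> inP (pmul x y) /\ sim (k (pmul x y)) (fun t => k x (rho y t)).
Proof. by move=> Hx Hy; have [_ H] := epsilon_spec (inhabits (fun _ _ => 0)) _ rmul_ex; apply: H. Qed.
Lemma rho0x d : inP d -> rho d 0 = 0.
Proof. by move=> Hd; have [] := rhoP d 0 Hd ltac:(olra); olra. Qed.
Lemma wle_rho g g' d : inP d -> g 0 = 0 -> g' 0 = 0 -> wle g g' -> wle (fun t => g (rho d t)) (fun t => g' (rho d t)).
Proof.
move=> Hd g0 g0' H c Hc; rewrite /inP in Hd; case: (le_eqlt _ _ (proj1 Hd)) => [<-|d0].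
  by apply: ev_imp evB => x x0 Hx; rewrite rho0 // g0 g0'; have := sl_ge0 c x ltac:(olra) Hx; olra.
apply: ev_imp (ev_and _ _ (rho_ev d _ (conj d0 (proj2 Hd)) (H c Hc)) evB) => x x0 [E Hx].
have [? _] := rhoP d x Hd Hx.
by have := sl_lex c (rho d x) x ltac:(olra) ltac:(olra) ltac:(olra); olra.
Qed.

Definition half x := mid x 0.
Lemma halfP x : inP x -> inP (half x) /\ sim (k (half x)) (fun t => hf (k x t)).
Proof.
move=> Hx; have [H S] := midP x 0 Hx inP0; split=> //.
by apply: sim_ext S => t _ //; rewrite sl0 add0.
Qed.
Lemma eq_k x y : inP x -> inP y -> sim (k x) (k y) -> x = y. Proof. exact: sl_inj. Qed.
Lemma half_le x y : inP x -> inP y -> x <= y -> half x <= half y.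
Proof.
move=> Hx Hy L; have [H1 S1] := halfP x Hx; have [H2 S2] := halfP y Hy; apply: k_le => //.
by apply: wle_tr (sim_wle _ _ S1) (wle_tr _ _ _ (wle_hf _ _ (k_mono x y Hx Hy L)) (sim_wle _ _ (sim_sym _ _ S2))).
Qed.
Lemma half_inj x y : inP x -> inP y -> half x = half y -> x = y.
Proof.
move=> Hx Hy E; have [H1 S1] := halfP x Hx; have [H2 S2] := halfP y Hy; apply: eq_k => //.
rewrite E in S1; have S := sim_tr _ _ _ (sim_sym _ _ S1) S2.
by apply: sim_ext (simD _ _ _ _ S S) => t _; olra.
Qed.
Lemma half0 : half 0 = 0.
Proof.
have [H1 S1] := halfP 0 inP0; apply: eq_k => //; first exact: inP0.
by apply: sim_ext S1 => t _ //; rewrite sl0; olra.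
Qed.
Lemma half_pos x : inP x -> 0 < x -> 0 < half x.
Proof.
move=> Hx x0; have [[H1 _] _] := halfP x Hx; case: (le_eqlt _ _ H1) => // E.
by have := half_inj x 0 Hx inP0; rewrite half0 -E => /(_ eq_refl); olra.
Qed.
Lemma half_lt x : inP x -> 0 < x -> half x < x.
Proof.
move=> Hx x0; have [H1 S1] := halfP x Hx.
have L : half x <= x.
  apply: k_le => //; apply: wle_tr (sim_wle _ _ S1) _.
  by apply: wle_ev; apply: ev_imp evB => t t0 Ht; have := sl_ge0 x t Hx Ht; olra.
case: (le_eqlt _ _ L) => // E; exfalso.
suff : x = 0 by olra.
apply: eq_k => //; first exact: inP0.
rewrite E in S1; have S := simD _ _ _ _ S1 S1.
apply: sim_ext (simB _ _ _ _ S (sim_refl (k x))) => t _; [by olra|by rewrite sl0; olra].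
Qed.
Lemma half_onto t : inP t -> t <= half C -> exists d, inP d /\ half d = t.
Proof.
move=> Ht L; have dk := df_sl; have [HC SC] := halfP C inPC.
have W := wle_tr _ _ _ (k_mono t _ Ht HC L) (sim_wle _ _ SC).
have [|||d [Hd S]] := k_cut (fun x => k t x + k t x); first by ddef.
- by apply: wle_ext (wleD _ _ _ _ (k_ge0 t Ht) (k_ge0 t Ht)) => x _ //; olra.
- by apply: wle_ext (wleD _ _ _ _ W W) => x _ //; olra.
- exists d; split=> //; have [H1 S1] := halfP d Hd; apply: eq_k => //.
  apply: sim_tr S1 _; apply: sim_ext (sim_hf _ _ (sim_sym _ _ S)) => x _ //; olra.
Qed.

(* A sup argument is needed: repeated doubling does not exhaust a non-archimedean interval. *)
Lemma doubling_induction (U : T -> Prop) : dp1 U -> ev U ->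
  (forall x, 0 < x <= C -> U (half x) -> U x) -> forall x, 0 < x <= C -> U x.
Proof.
move=> dU [e0 [e0p He]] Hd z Hz; apply: NNPP => N.
pose W t := 0 < t <= C /\ forall x, 0 < x <= t -> U x.
have dW : dp1 W by rewrite /W; ddef.
have m1 := omin_lel (hf e0) C; have m2 := omin_ler (hf e0) C; have m0 : 0 < omin (hf e0) C by apply: omin_gt; olra.
have W0 : W (omin (hf e0) C) by split; [olra|move=> x Hx; apply: He; olra].
have [|s [s1 s2]] := sup_ex W _ C dW W0; first by move=> u []; olra.
have s0 := s1 _ W0.
have sC : s <= C by move=> /s2 [u [[? _] ?]]; olra.
have Hs : inP s by rewrite /inP; olra.
have h1 := half_lt s Hs ltac:(olra); have [h2 _] := halfP s Hs; rewrite /inP in h2.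
(* [U] holds up to some [t'] above [t], hence at every [x] with [half x <= t]. The [d] with
   [half d = t] exceeds [s], since [half s < t], and this contradicts the supremum. *)
pose t := hf (half s + s).
have [t' [[Ht' Wt] tt]] := s2 t ltac:(rewrite /t; olra).
have Ht : half s < t < s by rewrite /t; olra.
have tP : inP t by rewrite /inP; olra.
have K x : 0 < x <= C -> half x <= t -> U x.
  move=> Hx L; apply: Hd => //; apply: Wt.
  by have := half_pos x ltac:(rewrite /inP; olra) ltac:(olra); olra.
case: (lt_le_dec (half C) t) => L.
  apply: N; apply: K => //.
  by have := half_le z C ltac:(rewrite /inP; olra) inPC ltac:(olra); olra.
have [d [Hdp E]] := half_onto t tP L.
have sd : s < d.
  case: (lt_le_dec s d) => // ds; have := half_le d s Hdp Hs ds; rewrite E; olra.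
have Wd : W d.
  split; first by rewrite /inP in Hdp; olra.
  move=> x Hx; rewrite /inP in Hdp; apply: K; first by olra.
  by rewrite -E; apply: half_le; rewrite /inP; olra.
by have := s1 d Wd; olra.
Qed.

Lemma pmul0 c : inP c -> pmul c 0 = 0 /\ pmul 0 c = 0.
Proof.
move=> Hc; have [H S] := pmulP c 0 Hc inP0; have [H' S'] := pmulP 0 c inP0 Hc.
split; (apply: eq_k; [done|exact: inP0|]); (apply: (sim_tr _ _ _ S) || apply: (sim_tr _ _ _ S')); apply: sim_ev; apply: ev_imp evB => t _ Ht.
  by rewrite rho0 // slx0 sl0.
by rewrite !sl0.
Qed.
Lemma pmulC1 c : inP c -> pmul c C = c /\ pmul C c = c.
Proof.
move=> Hc; have [H S] := pmulP c C Hc inPC; have [H' S'] := pmulP C c inPC Hc.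
split; (apply: eq_k; [done|done|]); (apply: (sim_tr _ _ _ S) || apply: (sim_tr _ _ _ S')); apply: sim_ev; apply: ev_imp evB => t _ Ht.
  by rewrite rhoC.
by have [_ ->] := rhoP c t Hc Ht.
Qed.
Lemma pmul_halfl c d : inP c -> inP d -> pmul (half c) d = half (pmul c d).
Proof.
move=> Hc Hd; have [Hh Sh] := halfP c Hc; have [H1 S1] := pmulP (half c) d Hh Hd; have [H2 S2] := pmulP c d Hc Hd.
have [H3 S3] := halfP _ H2; apply: eq_k => //; apply: sim_tr S1 _; apply: sim_sym; apply: sim_tr S3 _.
apply: sim_tr (sim_hf _ _ S2) _; apply: sim_sym.
by apply: (sim_rho (k (half c)) (fun t => hf (k c t))) => //; rewrite slx0 //; olra.
Qed.
Lemma pmul_halfr c d : inP c -> inP d -> pmul c (half d) = half (pmul c d).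
Proof.
move=> Hc Hd; have [Hh Sh] := midP d 0 Hd inP0; have [H1 S1] := pmulP c (half d) Hc Hh; have [H2 S2] := pmulP c d Hc Hd.
have [H3 S3] := halfP _ H2; apply: eq_k => //; apply: sim_tr S1 _; apply: sim_sym; apply: sim_tr S3 _.
apply: sim_tr (sim_hf _ _ S2) _; apply: sim_sym.
apply: sim_tr (rho_mid c d 0 (half d) Hc Hd inP0 Hh Sh) _.
by apply: sim_ev; apply: ev_imp evB => t _ Ht; rewrite (rho0 t Ht) slx0 add0.
Qed.
Lemma half_ltmono x y : inP x -> inP y -> half x < half y -> x < y.
Proof. by move=> Hx Hy L; case: (lt_le_dec x y) => // /(half_le y x Hy Hx); olra. Qed.

(** Both products are compatible with halving [d]. Their comparison is constant for small [d] by
    [ev_dich]; doubling would carry a strict inequality up to [d = C], where both products are [c],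
    and it carries the remaining equality to all [d]. *)
Lemma pmulC c d : inP c -> inP d -> pmul c d = pmul d c.
Proof.
move=> Hc; have dm := df_pmul.
have E x : 0 < x <= C -> inP x by rewrite /inP => ?; olra.
have [c1 c2] := pmulC1 c Hc.
have N1 : ~ ev (fun d => pmul c d < pmul d c).
  move=> H; suff : pmul c C < pmul C c by rewrite c1 c2; olra.
  apply: (doubling_induction (fun d => pmul c d < pmul d c)) => //; [by ddef| |by olra].
  move=> x /E Hx; rewrite pmul_halfl // pmul_halfr // => /half_ltmono; apply.
    by case: (pmulP c x).
  by case: (pmulP x c).
have N2 : ~ ev (fun d => pmul d c < pmul c d).
  move=> H; suff : pmul C c < pmul c C by rewrite c1 c2; olra.
  apply: (doubling_induction (fun d => pmul d c < pmul c d)) => //; [by ddef| |by olra].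
  move=> x /E Hx; rewrite pmul_halfl // pmul_halfr // => /half_ltmono; apply.
    by case: (pmulP x c).
  by case: (pmulP c x).
have N3 : ev (fun d => pmul c d = pmul d c).
  have [|//|H1] := ev_dich (fun d => pmul c d < pmul d c) C C0; first by ddef.
  have [|//|H2] := ev_dich (fun d => pmul d c < pmul c d) C C0; first by ddef.
  by apply: ev_imp (ev_and _ _ H1 H2) => x _; olra.
have D : forall x, 0 < x <= C -> pmul c x = pmul x c.
  apply: doubling_induction => //; first by ddef.
  move=> x /E Hx; rewrite pmul_halfl // pmul_halfr // => /half_inj; apply.
    by case: (pmulP c x).
  by case: (pmulP x c).
move=> Hd; case: (le_eqlt _ _ (proj1 Hd)) => [<-|d0]; first by have [-> ->] := pmul0 c Hc.
by apply: D; rewrite /inP in Hd; olra.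
Qed.
Lemma pmul_pos c d : inP c -> inP d -> 0 < c -> 0 < d -> 0 < pmul c d.
Proof.
move=> Hc Hd c0 d0; have dm := df_pmul.
have E x : 0 < x <= C -> inP x by rewrite /inP => ?; olra.
have [c1 c2] := pmulC1 c Hc.
have [|H|H] := ev_dich (fun d => 0 < pmul c d) C C0; first by ddef.
  apply: (doubling_induction _ _ H); [by ddef| |by rewrite /inP in Hd; olra].
  move=> x /E Hx; rewrite pmul_halfr // -{1}half0 => /half_ltmono; apply; first exact: inP0.
  by case: (pmulP c x).
exfalso; suff : pmul c C <= 0 by rewrite c1; olra.
apply: (doubling_induction (fun d => pmul c d <= 0)) => //; [by ddef| |by olra].
move=> x /E Hx; rewrite pmul_halfr //; have [H1 _] := pmulP c x Hc Hx => L L'.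
by have := half_pos _ H1 L'; olra.
Qed.
Lemma pmul_mono x y d : inP x -> inP y -> inP d -> x <= y -> pmul x d <= pmul y d.
Proof.
move=> Hx Hy Hd L; have [H1 S1] := pmulP x d Hx Hd; have [H2 S2] := pmulP y d Hy Hd.
apply: k_le => //; apply: wle_tr (sim_wle _ _ S1) (wle_tr _ _ _ _ (sim_wle _ _ (sim_sym _ _ S2))).
by apply: (wle_rho (k x) (k y)) => //; rewrite ?slx0 //; apply: k_mono.
Qed.
Lemma pmul_approx x y d c : inP x -> inP y -> inP d -> inP c -> wle (k y) (fun t => k x t + k c t) ->
  wle (k (pmul y d)) (fun t => k (pmul x d) t + k c t).
Proof.
move=> Hx Hy Hd Hc W; have [H1 S1] := pmulP x d Hx Hd; have [H2 S2] := pmulP y d Hy Hd.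
apply: wle_tr (sim_wle _ _ S2) _.
apply: wle_tr (wle_rho (k y) (fun t => k x t + k c t) d Hd _ _ W) _; rewrite ?slx0 ?add0 //.
apply: wleD; first exact: sim_wle (sim_sym _ _ S1).
apply: wle_ev; apply: ev_imp evB => t _ Ht; have [? _] := rhoP d t Hd Ht.
by apply: sl_lex => //; olra.
Qed.
(** The quotient comes from the supremum of the [z] with [pmul z y <= x], using the continuity of
    the product in [z] that [pmul_approx] expresses. *)
Lemma pdiv x y : inP x -> inP y -> x <= y -> exists z, inP z /\ pmul z y = x.
Proof.
move=> Hx Hy L; have dm := df_pmul; have [c1 c2] := pmulC1 y Hy; have [z1 z2] := pmul0 y Hy.
have Hx' := Hx; rewrite /inP in Hx'.
have [|||s [s1 s2]] := sup_ex (fun z => inP z /\ pmul z y <= x) 0 C.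
- by rewrite /inP; ddef.
- by rewrite z2; split; [apply: inP0|olra].
- by move=> u [[_ ?] _].
have Hs : inP s.
  split; first by apply: s1; rewrite z2; split; [apply: inP0|olra].
  by move=> /s2 [u [[[_ ?] _] ?]]; olra.
have [Hm _] := pmulP s y Hs Hy.
case: (lt_tot (pmul s y) x) => [K|[E|K]]; last 1 first.
- have s0 : 0 < s.
    by case: (le_eqlt _ _ (proj1 Hs)) => // E; subst s; rewrite z2 in K; olra.
  rewrite /inP in Hm Hs; have [c0 [Hc0 E]] := sl_gap x (pmul s y) ltac:(olra) ltac:(olra).
  have [s' [Hs' E']] := sl_contl s c0 ltac:(olra) Hc0.
  have [u [[Hu Ku] Lu]] := s2 s' (proj2 Hs').
  have Ps' : inP s' by rewrite /inP; olra.
  have Pc0 : inP c0 by rewrite /inP; olra.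
  (* Here the nearby [s'] solves the equation. Its product is at most [x] because some admissible
     [u] lies above [s'], and at least [x] because passing from [s'] to [s] adds at most the gap
     [c0]. *)
  exists s'; split=> //; apply: le_anti; first by have := pmul_mono s' u y Ps' Hu Hy ltac:(olra); olra.
  have [Hm' _] := pmulP s' y Ps' Hy.
  apply: k_le => //.
  have W : wle (k s) (fun t => k s' t + k c0 t) by apply: wle_ev; apply: ev_imp E' => t _; olra.
  have W1 := pmul_approx s' s y c0 Ps' Hs Hy Pc0 W.
  have W2 : wle (fun t => k x t + k c0 t) (k (pmul s y)) by apply: wle_ev; apply: ev_imp E => t _; olra.
  have W3 := wle_tr _ _ _ W2 W1.
  move=> c Hc; apply: ev_imp (W3 c Hc) => t _; olra.
- exfalso; have sC : s < C.
    by case: (le_eqlt _ _ (proj2 Hs)) => // E; subst s; rewrite c2 in K; olra.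
  rewrite /inP in Hm Hs; have [c0 [Hc0 E]] := sl_gap (pmul s y) x ltac:(olra) ltac:(olra).
  have [s' [Hs' E']] := sl_contr s c0 ltac:(olra) Hc0.
  have Ps' : inP s' by rewrite /inP; olra.
  have Pc0 : inP c0 by rewrite /inP; olra.
  have [Hm' _] := pmulP s' y Ps' Hy.
  suff : pmul s' y <= x by move=> H; have := s1 s' (conj Ps' H); olra.
  apply: k_le => //.
  have W : wle (k s') (fun t => k s t + k c0 t) by apply: wle_ev; apply: ev_imp E' => t _; olra.
  apply: wle_tr (pmul_approx s s' y c0 Hs Ps' Hy Pc0 W) _.
  by apply: wle_ev; apply: ev_imp E => t _; olra.
- by exists s.
Qed.

Lemma sim_dbl n g g' : sim g g' -> sim (fun t => dbl n (g t)) (fun t => dbl n (g' t)).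
Proof. by move=> H; elim: n => [|n IH] //=; apply: simD. Qed.
Lemma dbl0 n : dbl n 0 = 0. Proof. by elim: n => [|n IH] //=; rewrite IH add0. Qed.
Lemma dblN n x : dbl n (- x) = - dbl n x.
Proof. by elim: n => [|n IH] //=; rewrite IH; olra. Qed.
Lemma dblS n x : dbl (S n) x = dbl n (x + x).
Proof. by rewrite dblD. Qed.
(** The value at 0 is recorded because composing with [rho 0] evaluates the germ at 0. *)
Definition good (g : T -> T) := g 0 = 0 /\ exists n x y, inP x /\ inP y /\ sim g (fun t => dbl n (k x t - k y t)).
Lemma good_k x : inP x -> good (k x).
Proof.
move=> Hx; split; first exact: slx0.
exists 0%nat, x, 0; split=> //; split; first exact: inP0.
by apply: sim_ev; apply: ev_imp evB => t _ _ /=; rewrite sl0; olra.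
Qed.
Lemma goodN g : good g -> good (fun t => - g t).
Proof.
move=> [g0 [n [x [y [Hx [Hy S]]]]]]; split; first by rewrite g0; olra.
exists n, y, x; split=> //; split=> //; apply: sim_ext (simN _ _ S) => t _ //.
by rewrite -dblN; congr dbl; olra.
Qed.
Lemma good_up n m x y : inP x -> inP y -> (n <= m)%nat ->
  exists x' y', inP x' /\ inP y' /\ sim (fun t => dbl n (k x t - k y t)) (fun t => dbl m (k x' t - k y' t)).
Proof.
move=> Hx Hy; elim=> [|m' _ [x' [y' [Hx' [Hy' S]]]]]; first by exists x, y; split=> //; split=> //; apply: sim_refl.
have [H1 S1] := halfP x' Hx'; have [H2 S2] := halfP y' Hy'.
exists (half x'), (half y'); split=> //; split=> //; apply: sim_tr S _.
have S3 := sim_dbl m' _ _ (simB _ _ _ _ (simD _ _ _ _ S1 S1) (simD _ _ _ _ S2 S2)).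
apply: sim_sym; apply: sim_ext S3 => t _; first by rewrite dblS; congr dbl; olra.
by congr dbl; olra.
Qed.
Lemma goodD g g' : good g -> good g' -> good (fun t => g t + g' t).
Proof.
move=> [g0 [n [x [y [Hx [Hy S]]]]]] [g0' [m [z [w [Hz [Hw S']]]]]]; split; first by rewrite g0 g0' add0.
have [x1 [y1 [Hx1 [Hy1 E1]]]] := good_up n (Nat.max n m) x y Hx Hy (Nat.le_max_l _ _).
have [z1 [w1 [Hz1 [Hw1 E2]]]] := good_up m (Nat.max n m) z w Hz Hw (Nat.le_max_r _ _).
have [H3 S3] := midP x1 z1 Hx1 Hz1; have [H4 S4] := midP y1 w1 Hy1 Hw1.
exists (Datatypes.S (Nat.max n m)), (mid x1 z1), (mid y1 w1); split=> //; split=> //.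
apply: sim_tr (simD _ _ _ _ (sim_tr _ _ _ S E1) (sim_tr _ _ _ S' E2)) _.
have S5 := sim_dbl (Nat.max n m) _ _ (simB _ _ _ _ (simD _ _ _ _ S3 S3) (simD _ _ _ _ S4 S4)).
apply: sim_sym; apply: sim_ext S5 => t _; first by rewrite dblS; congr dbl; olra.
by rewrite -dblD; congr dbl; olra.
Qed.
Lemma good_rho g d : inP d -> good g -> good (fun t => g (rho d t)).
Proof.
move=> Hd [g0 [n [x [y [Hx [Hy S]]]]]]; split.
  by rewrite rho0x.
have [H1 S1] := pmulP x d Hx Hd; have [H2 S2] := pmulP y d Hy Hd.
exists n, (pmul x d), (pmul y d); split=> //; split=> //.
apply: sim_tr (sim_rho g (fun t => dbl n (k x t - k y t)) d Hd g0 _ S) _.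
  by rewrite !slx0; (have -> : 0 - 0 = 0 by olra); apply: dbl0.
exact: sim_dbl (simB _ _ _ _ (sim_sym _ _ S1) (sim_sym _ _ S2)).
Qed.
Lemma good_mid g x y : good g -> inP x -> inP y ->
  sim (fun t => g (rho (mid x y) t) + g (rho (mid x y) t)) (fun t => g (rho x t) + g (rho y t)).
Proof.
move=> [g0 [n [p [q [Hp [Hq S]]]]]] Hx Hy; have [Hm Sm] := midP x y Hx Hy.
have D0 : dbl n (k p 0 - k q 0) = 0 by rewrite !slx0; (have -> : 0 - 0 = 0 by olra); apply: dbl0.
have E d : inP d -> sim (fun t => g (rho d t)) (fun t => dbl n (k p (rho d t) - k q (rho d t))).
  by move=> Hd; apply: (sim_rho g (fun t => dbl n (k p t - k q t))).
apply: sim_tr (simD _ _ _ _ (E _ Hm) (E _ Hm)) _; apply: sim_sym; apply: sim_tr (simD _ _ _ _ (E _ Hx) (E _ Hy)) _; apply: sim_sym.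
have P1 := rho_mid p x y _ Hp Hx Hy Hm Sm; have P2 := rho_mid q x y _ Hq Hx Hy Hm Sm.
have P3 := sim_dbl n _ _ (simB _ _ _ _ (simD _ _ _ _ P1 P1) (simD _ _ _ _ P2 P2)).
by apply: sim_ext P3 => t _; rewrite -dblD; congr dbl; olra.
Qed.
Lemma good_mul g x y : good g -> inP x -> inP y ->
  sim (fun t => g (rho (pmul x y) t)) (fun t => g (rho x (rho y t))).
Proof.
move=> [g0 [n [p [q [Hp [Hq S]]]]]] Hx Hy; have [Hm Sm] := pmulP x y Hx Hy.
have D0 : dbl n (k p 0 - k q 0) = 0 by rewrite !slx0; (have -> : 0 - 0 = 0 by olra); apply: dbl0.
have E d : inP d -> sim (fun t => g (rho d t)) (fun t => dbl n (k p (rho d t) - k q (rho d t))).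
  by move=> Hd; apply: (sim_rho g (fun t => dbl n (k p t - k q t))).
apply: sim_tr (E _ Hm) _; apply: sim_sym.
apply: sim_tr (sim_rho (fun t => g (rho x t)) (fun t => dbl n (k p (rho x t) - k q (rho x t))) y Hy _ _ (E x Hx)) _.
- by rewrite rho0x.
- by rewrite rho0x.
have P1 := rho_comp p x y _ Hp Hx Hy Hm Sm; have P2 := rho_comp q x y _ Hq Hx Hy Hm Sm.
exact: sim_sym (sim_dbl n _ _ (simB _ _ _ _ P1 P2)).
Qed.

Import ssrfun ssrbool eqtype choice ssrnat ssralg ssrnum boolp GRing.Theory ScalarRing.
(** A class is the predicate [sim g] itself, so that equivalent germs give equal elements by
    extensionality. *)
Definition germ := {p : (T -> T) -> Prop | exists g, good g /\ p = sim g}.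
Definition cl g (Hg : good g) : germ := exist _ (sim g) (ex_intro _ g (conj Hg Logic.eq_refl)).
Definition rp (v : germ) : T -> T := proj1_sig (ClassicalEpsilon.constructive_indefinite_description _ (proj2_sig v)).
Lemma rp_good v : good (rp v).
Proof. by rewrite /rp; case: ClassicalEpsilon.constructive_indefinite_description => g []. Qed.
Lemma germ_eq (u v : germ) : proj1_sig u = proj1_sig v -> u = v.
Proof. by case: u v => [p Hp] [q Hq] /= E; subst q; congr exist; apply: Prop_irrelevance. Qed.
Lemma cl_eq g g' (Hg : good g) (Hg' : good g') : sim g g' -> cl g Hg = cl g' Hg'.
Proof.
move=> S; apply: germ_eq => /=; apply: functional_extensionality => q; apply: propositional_extensionality.
by split=> H; [apply: sim_tr (sim_sym _ _ S) H|apply: sim_tr S H].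
Qed.
Lemma cl_rp v : cl (rp v) (rp_good v) = v.
Proof. by apply: germ_eq; rewrite /rp /=; case: ClassicalEpsilon.constructive_indefinite_description => g []. Qed.
Lemma cl_inj g g' (Hg : good g) (Hg' : good g') : cl g Hg = cl g' Hg' -> sim g g'.
Proof. by move=> /(f_equal (@proj1_sig _ _)) /= E; rewrite E; apply: sim_refl. Qed.
Lemma rp_cl g Hg : sim (rp (cl g Hg)) g.
Proof. exact: (cl_inj _ _ (rp_good (cl g Hg)) Hg (cl_rp _)). Qed.
Definition vadd u v := cl _ (goodD _ _ (rp_good u) (rp_good v)).
Definition vopp u := cl _ (goodN _ (rp_good u)).
Definition v0 := cl _ (good_k 0 inP0).
Lemma vaddE g g' Hg Hg' H : vadd (cl g Hg) (cl g' Hg') = cl (fun t => g t + g' t) H.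
Proof. by apply: cl_eq; apply: simD; apply: rp_cl. Qed.
Lemma vaddA : associative vadd.
Proof.
move=> u v w; apply: cl_eq; apply: sim_tr (simD _ _ _ _ (sim_refl _) (rp_cl _ _)) _; apply: sim_sym.
apply: sim_tr (simD _ _ _ _ (rp_cl _ _) (sim_refl _)) _.
by apply: sim_ev; apply: ev_imp evB => t _ _; olra.
Qed.
Lemma vaddC : commutative vadd.
Proof. by move=> u v; apply: cl_eq; apply: sim_ev; apply: ev_imp evB => t _ _; olra. Qed.
Lemma vadd0 : left_id v0 vadd.
Proof.
move=> u; rewrite -[RHS]cl_rp; apply: cl_eq; apply: sim_tr (simD _ _ _ _ (rp_cl _ _) (sim_refl _)) _.
by apply: sim_ev; apply: ev_imp evB => t _ _; rewrite sl0; olra.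
Qed.
Lemma vaddN : left_inverse v0 vopp vadd.
Proof.
move=> u; apply: cl_eq; apply: sim_tr (simD _ _ _ _ (rp_cl _ _) (sim_refl _)) _.
by apply: sim_ev; apply: ev_imp evB => t _ _; rewrite sl0; olra.
Qed.
HB.instance Definition _ := gen_eqMixin germ.
HB.instance Definition _ := gen_choiceMixin germ.
HB.instance Definition _ := GRing.isZmodule.Build germ vaddA vaddC vadd0 vaddN.
Definition V : zmodType := germ.

Definition J := {x | inP x}.
Local Notation sv := (@proj1_sig _ _).
Lemma J_eq (x y : J) : sv x = sv y -> x = y.
Proof. by case: x y => [p Hp] [q Hq] /= E; subst q; congr exist; apply: Prop_irrelevance. Qed.
Definition act (x : J) (v : V) : V := cl _ (good_rho (rp v) (sv x) (proj2_sig x) (rp_good v)).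
Definition j0 : J := exist _ 0 inP0.
Definition j1 : J := exist _ C inPC.
Definition jmid (x y : J) : J := exist _ (mid (sv x) (sv y)) (proj1 (midP _ _ (proj2_sig x) (proj2_sig y))).
Definition jmul (x y : J) : J := exist _ (pmul (sv x) (sv y)) (proj1 (pmulP _ _ (proj2_sig x) (proj2_sig y))).
Definition one : V := cl _ (good_k C inPC).
Definition kk (x : J) : V := cl _ (good_k (sv x) (proj2_sig x)).

Lemma actE x g Hg : act x (cl g Hg) = cl _ (good_rho g (sv x) (proj2_sig x) Hg).
Proof.
apply: cl_eq; apply: (sim_rho _ _ _ (proj2_sig x)); [by case: (rp_good (cl g Hg))|by case: Hg|apply: rp_cl].
Qed.
Lemma act_one x : act x one = kk x.
Proof.
rewrite actE; apply: cl_eq; apply: sim_ev; apply: ev_imp evB => t _ Ht.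
by have [_ ->] := rhoP (sv x) t (proj2_sig x) Ht.
Qed.
Lemma clD g g' Hg Hg' : (cl g Hg + cl g' Hg')%R = cl _ (goodD g g' Hg Hg') :> V.
Proof. exact: vaddE. Qed.
Lemma clN g Hg : (- cl g Hg)%R = cl _ (goodN g Hg) :> V.
Proof. by apply: cl_eq; apply: simN; apply: rp_cl. Qed.
Lemma actD x (u v : V) : act x (u + v)%R = (act x u + act x v)%R.
Proof. by rewrite -(cl_rp u) -(cl_rp v) clD !actE clD; apply: cl_eq; apply: sim_refl. Qed.
Lemma act0 v : act j0 v = 0%R.
Proof.
apply: cl_eq; apply: sim_ev; apply: ev_imp evB => t _ Ht /=.
by rewrite rho0 // sl0; case: (rp_good v).
Qed.
Lemma act1 v : act j1 v = v.
Proof. by rewrite -[RHS]cl_rp; apply: cl_eq; apply: sim_ev; apply: ev_imp evB => t _ Ht /=; rewrite rhoC. Qed.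
Lemma act_mid x y v : (act (jmid x y) v *+ 2 = act x v + act y v)%R.
Proof.
rewrite mulr2n -(cl_rp v) !actE !clD; apply: cl_eq.
exact: (good_mid _ _ _ (rp_good v) (proj2_sig x) (proj2_sig y)).
Qed.
Lemma act_mul x y v : act (jmul x y) v = act y (act x v).
Proof.
by rewrite -(cl_rp v) !actE; apply: cl_eq; apply: good_mul; [apply: rp_good|apply: proj2_sig|apply: proj2_sig].
Qed.
Lemma act_inj x y : act x one = act y one -> x = y.
Proof. by rewrite !act_one => /cl_inj H; apply: J_eq; apply: (eq_k _ _ (proj2_sig x) (proj2_sig y)). Qed.
Lemma germ_dbl_eq0 (v : V) : (v *+ 2 = 0 -> v = 0)%R.
Proof.
rewrite mulr2n -(cl_rp v) clD => /cl_inj H; apply: cl_eq.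
by apply: sim_ext (sim_hf _ _ H) => t _; rewrite ?sl0; olra.
Qed.
Lemma cl_dbl n g Hg : exists H, (cl g Hg *+ (2 ^ n) = cl (fun t => dbl n (g t)) H :> V)%R.
Proof.
elim: n => [|n [H IH]]; first by exists Hg; rewrite mulr1n; apply: cl_eq; apply: sim_refl.
exists (goodD _ _ H H); rewrite expnS mulrnA mulrnAC IH mulr2n clD.
by apply: cl_eq; apply: sim_refl.
Qed.
Lemma germ_span (v : V) : exists n x y, (v = (act x one - act y one) *+ 2 ^ n)%R.
Proof.
have [g0 [n [x [y [Hx [Hy S]]]]]] := rp_good v.
exists n, (exist _ x Hx), (exist _ y Hy); rewrite !act_one clN clD -(cl_rp v).
have [H ->] := cl_dbl n _ (goodD _ _ (good_k x Hx) (goodN _ (good_k y Hy))).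
by apply: cl_eq; apply: sim_tr S _; apply: sim_refl.
Qed.
Lemma jmulC x y : jmul x y = jmul y x.
Proof. by apply: J_eq; apply: pmulC; apply: proj2_sig. Qed.
Lemma germ_one_neq0 : one <> 0%R.
Proof. by move=> /cl_inj /(eq_k _ _ inPC inP0) E; move: C0; rewrite E => /lt_irr. Qed.
Definition jlt (x y : J) := sv x < sv y.
Lemma jlt_irr x : ~ jlt x x. Proof. exact: lt_irr. Qed.
Lemma jlt_tot x y : jlt x y \/ x = y \/ jlt y x.
Proof. by case: (lt_tot (sv x) (sv y)) => [|[/J_eq|]]; auto. Qed.
Lemma jlt_sub x y : jlt y x -> exists2 z, jlt j0 z & (act z one = act x one - act y one)%R.
Proof.
rewrite /jlt; case: x y => [x Hx] [y Hy] /= L; have dk := df_sl.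
have [|||z [Hz S]] := k_cut (fun t => k x t - k y t); first by ddef.
- apply: wle_ev; apply: ev_imp evB => t _ Ht; have := sl_le y x t (conj (proj1 Hy) (ltW _ _ L)) (proj2 Hx) Ht.
  by clear; olra.
- apply: wle_ev; apply: ev_imp evB => t _ Ht; have := sl_ge0 y t Hy Ht.
  by have := sl_le x C t Hx (leR _) Ht; clear; olra.
exists (exist _ z Hz).
  case: (le_eqlt _ _ (proj1 Hz)) => // E; exfalso; apply: (lt_irr x).
  rewrite -{1}(eq_k y x Hy Hx) //; rewrite -E in S; apply: sim_sym.
  by apply: sim_ext (simD _ _ _ _ S (sim_refl (k y))) => t _; rewrite ?sl0; clear; olra.
rewrite !act_one clN clD; apply: cl_eq => /=; exact: sim_sym S.
Qed.
Lemma jmid_pos x y : jlt j0 x -> (y = j0 \/ jlt j0 y) -> jlt j0 (jmid x y).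
Proof.
move=> x0 Hy; have Hy' := proj1 (proj2_sig y).
rewrite /jlt /=; have [Hm Sm] := midP _ _ (proj2_sig x) (proj2_sig y).
have Hh := half_pos _ (proj2_sig x) x0; have [Hh1 Sh] := halfP _ (proj2_sig x).
apply: lt_le_tr Hh _; apply: k_le => //.
apply: wle_tr (sim_wle _ _ Sh) (wle_tr _ _ _ _ (sim_wle _ _ (sim_sym _ _ Sm))).
apply: wle_ev; apply: ev_imp evB => t _ Ht; have := sl_ge0 _ t (proj2_sig y) Ht; clear; olra.
Qed.
Lemma jmul_pos x y : jlt j0 x -> jlt j0 y -> jlt j0 (jmul x y).
Proof. by move=> x0 y0; apply: pmul_pos => //; apply: proj2_sig. Qed.
Lemma jlt_min x : ~ jlt x j0. Proof. exact: (proj1 (proj2_sig x)). Qed.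
Lemma jlt_max x : ~ jlt j1 x. Proof. exact: (proj2 (proj2_sig x)). Qed.
Lemma jdivis x y : jlt j0 x -> jlt j0 y -> x = y \/ jlt x y -> exists z, jmul z y = x.
Proof.
move=> x0 y0 L; have [|z [Hz E]] := pdiv _ _ (proj2_sig x) (proj2_sig y).
  by case: L => [->|/ltW]; [apply: leR|].
by exists (exist _ z Hz); apply: J_eq.
Qed.

(** Definability concerns functions on the whole line; a map on [J] is read through this retraction
    of the line onto the interval from 0 to [C]. *)
Definition clamp (t : T) : T := epsilon (inhabits 0) (fun s => (inP t /\ s = t) \/ (~ inP t /\ s = 0)).
Lemma clamp_spec t : (inP t /\ clamp t = t) \/ (~ inP t /\ clamp t = 0).
Proof.
apply: (epsilon_spec (inhabits 0) (fun s => (inP t /\ s = t) \/ (~ inP t /\ s = 0))).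
by case: (Classical_Prop.classic (inP t)) => H; [exists t; left|exists 0; right].
Qed.
Lemma clampP t : inP (clamp t).
Proof. by case: (clamp_spec t) => [] [H ->] //; apply: inP0. Qed.
Lemma clampE t : inP t -> clamp t = t.
Proof. by move=> H; case: (clamp_spec t) => [] [H' ->]. Qed.
Lemma df_clamp : df1 clamp.
Proof.
apply: (Def_ext (fun e => (inP (e 1%nat) /\ e 0%nat = e 1%nat) \/ (~ inP (e 1%nat) /\ e 0%nat = 0))); last by rewrite /inP; ddef.
move=> e; case: (clamp_spec (e 1%nat)) => [] [H E]; rewrite E; split; try by [left|right|case=> [] []].
Qed.
Definition jcl (t : T) : J := exist _ (clamp t) (clampP t).
Definition DE (X : env -> J) := DT (fun e => sv (X e)).
Lemma DE_const x : DE (fun _ => x). Proof. by rewrite /DE; ddef. Qed.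
Lemma DE_var i : DE (fun e => jcl (e i)). Proof. by rewrite /DE /=; have dc := df_clamp; ddef. Qed.
Lemma DE_mid X Y : DE X -> DE Y -> DE (fun e => jmid (X e) (Y e)).
Proof. by move=> dX dY; exact (dt_f2 mid (fun e => sv (X e)) (fun e => sv (Y e)) df_mid dX dY). Qed.
Lemma DE_mul X Y : DE X -> DE Y -> DE (fun e => jmul (X e) (Y e)).
Proof. by move=> dX dY; exact (dt_f2 pmul (fun e => sv (X e)) (fun e => sv (Y e)) df_pmul dX dY). Qed.
Definition DJ (X : J -> J) := df1 (fun t => sv (X (jcl t))).
Lemma DJ_const x : DJ (fun _ => x). Proof. by rewrite /DJ; ddef. Qed.
Lemma DJ_id : DJ id. Proof. exact: df_clamp. Qed.
Lemma DJ_mid X Y : DJ X -> DJ Y -> DJ (fun e => jmid (X e) (Y e)).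
Proof. by move=> dX dY; exact (dt_f2 mid (fun e => sv (X (jcl (e 0%nat)))) (fun e => sv (Y (jcl (e 0%nat)))) df_mid dX dY). Qed.
Lemma DJ_mul X Y : DJ X -> DJ Y -> DJ (fun e => jmul (X e) (Y e)).
Proof. by move=> dX dY; exact (dt_f2 pmul (fun e => sv (X (jcl (e 0%nat)))) (fun e => sv (Y (jcl (e 0%nat)))) df_pmul dX dY). Qed.
Lemma jclE (x : J) : jcl (sv x) = x. Proof. by apply: J_eq => /=; apply: clampE; apply: proj2_sig. Qed.
Lemma jsup X Y : DJ X -> DJ Y -> ~ jlt (Y j0) (X j0) -> exists s, (forall t, ~ jlt (Y t) (X t) -> ~ jlt s t) /\
     forall t, jlt t s -> exists t', jlt t t' /\ ~ jlt (Y t') (X t').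
Proof.
move=> dX dY H0; rewrite /DJ in dX dY.
have [|||s [s1 s2]] := sup_ex (fun t => inP t /\ ~ jlt (Y (jcl t)) (X (jcl t))) 0 C.
- by rewrite /inP /jlt; ddef.
- by split; [apply: inP0|move: H0; rewrite -{1 2}(jclE j0)].
- by move=> u [[]].
have Hs : inP s.
  split; first by apply: s1; split; [apply: inP0|move: H0; rewrite -{1 2}(jclE j0)].
  by move=> /s2 [u [[[_ ?] _] ?]].
exists (exist _ s Hs); split=> [t Ht|t ts].
  by apply: s1; rewrite jclE; split=> //; apply: proj2_sig.
have [u [[Hu Ku] Lu]] := s2 _ ts; exists (jcl u); split=> //.
by rewrite /jlt /= clampE.
Qed.

Local Notation dm := (dmap act one DE).
Local Notation vmul := (rmul germ_span).
(** The difference of the two families is a scaled difference of elements of [J]; it vanishes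
    exactly when these are equal, by [germ_dbl_eq0] and [act_inj]. *)
Lemma dm_eq F F' : dm F -> dm F' -> Def (fun e => F e = F' e).
Proof.
move=> dF dF'; have [n [X [Y [dX dY E]]]] := dmapD act0 act_mid DE_const DE_mid dF (dmapN dF').
apply: (Def_ext (fun e => sv (X e) = sv (Y e))); last by apply: def_eq.
move=> e; split=> [/J_eq XY|FF].
  by apply/eqP; rewrite -subr_eq0 E XY subrr mul0rn.
congr (sv _); apply: act_inj; apply/eqP; rewrite -subr_eq0; apply/eqP; apply: (V2n germ_dbl_eq0 (n := n)).
by rewrite -E FF subrr.
Qed.
Lemma dm_var i : dm (fun e => act (jcl (e i)) one).
Proof. exact: (dmap_var one act0 DE_const (DE_var i)). Qed.
Lemma dm_mul F F' : dm F -> dm F' -> dm (fun e => vmul (F e) (F' e)).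
Proof. exact: (dmapM actD act0 act_mid act_mul act_inj germ_dbl_eq0 germ_span jmulC germ_one_neq0 DE_mid DE_mul). Qed.
Lemma dm_add F F' : dm F -> dm F' -> dm (fun e => (F e + F' e)%R).
Proof. exact: (dmapD act0 act_mid DE_const DE_mid). Qed.
Lemma dm_numer i : dm (fun e => numer act one (jcl (e i))).
Proof.
apply: dm_add; first by apply: dm_add; apply: dm_var.
exact: (dmap_const germ_span DE_const).
Qed.
Lemma dm_denom i : dm (fun e => denom germ_span (jcl (e i))).
Proof.
apply: dm_mul; first exact: dm_var.
apply: dm_add; first exact: (dmap_const germ_span DE_const).
by apply: dmapN; apply: dm_var.
Qed.
Lemma definable3 (P : T -> T -> T -> Prop) (Q : list T -> Prop) : dp3 P ->
  (forall l, Q l <-> exists x y z, l = [x; y; z] /\ P x y z) -> definable M 3 Q.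
Proof.
move=> dP E; have := Def_definable 3 (fun e => P (e 0%nat) (e 1%nat) (e 2%nat)) 0 dP; congr definable.
apply: functional_extensionality => l; apply: propositional_extensionality; rewrite E; split.
  case=> L; case: l L => [|x [|y [|z [|]]]] //= _ H; by exists x, y, z.
by move=> [x [y [z [-> H]]]].
Qed.
(** [scalar_interval] describes the transported field operations by equations between products of
    scalars, and [dm_eq] makes such equations definable. *)
Theorem short_slopes : short_interval G 0 C.
Proof.
have [K [h [h_inj h_im hA hM]]] := @scalar_interval V J act j0 j1 jmid jmul one actD act0 act1 act_mid act_mul act_inj germ_dbl_eq0 germ_span jmulC germ_one_neq0
  jlt jlt_irr jlt_tot jlt_sub jmid_pos jmul_pos jlt_min jlt_max jdivis DJ DJ_const DJ_id DJ_mid DJ_mul jsup.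
pose I x := 0 < x < C.
have II x : I x -> jlt j0 (jcl x) /\ jlt (jcl x) j1.
  move=> [H1 H2]; rewrite /jlt /= clampE //; split=> //; exact: ltW.
have Ih u : I (sv (h u)) by have /h_im [] : exists u', h u' = h u by exists u.
exists K, (fun u => sv (h u)); split; first by move=> u v /J_eq /h_inj.
split.
  move=> x; split=> [Hx|[u <-]]; last exact: Ih.
  have /h_im [u E] := II x Hx; exists u; rewrite E /= clampE //.
  by case: Hx => *; split; apply: ltW.
have W op (P : T -> T -> T -> Prop) : dp3 P ->
   (forall x y z, jlt j0 x /\ jlt x j1 -> jlt j0 y /\ jlt y j1 -> jlt j0 z /\ jlt z j1 ->
     (exists u v, [/\ x = h u, y = h v & z = h (op u v)]) <-> P (sv x) (sv y) (sv z)) ->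
   definable M 3 (fun l => exists u v, l = [sv (h u); sv (h v); sv (h (op u v))]).
  move=> dP HP; apply: (definable3 (fun x y z => I x /\ I y /\ I z /\ P x y z)).
    by rewrite /I; ddef.
  move=> l; split.
    move=> [u [v ->]]; exists (sv (h u)), (sv (h v)), (sv (h (op u v))); split=> //.
    do 3![split; first exact: Ih]; apply/HP; [exact: Ih|exact: Ih|exact: Ih|by exists u, v].
  move=> [x [y [z [-> [Ix [Iy [Iz H]]]]]]].
  have E t : I t -> sv (jcl t) = t by move=> [H1 H2] /=; apply: clampE; split; apply: ltW.
  have [|u [v [E1 E2 E3]]] := proj2 (HP (jcl x) (jcl y) (jcl z) (II x Ix) (II y Iy) (II z Iz)); first by rewrite !E.
  by exists u, v; rewrite -E1 -E2 -E3 !E.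
split.
- pose P x y z := (vmul (vmul (numer act one (jcl x)) (denom germ_span (jcl y))) (denom germ_span (jcl z)) +
     vmul (vmul (numer act one (jcl y)) (denom germ_span (jcl x))) (denom germ_span (jcl z)) =
     vmul (vmul (numer act one (jcl z)) (denom germ_span (jcl x))) (denom germ_span (jcl y)))%R.
  apply: (W _ P) => [|x y z Hx Hy Hz]; last by rewrite /P !jclE; apply: hA.
  apply: dm_eq; first apply: dm_add;
    by apply: dm_mul; first apply: dm_mul; try apply: dm_numer; try apply: dm_denom.
- pose P x y z := (vmul (vmul (numer act one (jcl x)) (numer act one (jcl y))) (denom germ_span (jcl z)) =
     vmul (vmul (numer act one (jcl z)) (denom germ_span (jcl x))) (denom germ_span (jcl y)))%R.
  apply: (W _ P) => [|x y z Hx Hy Hz]; last by rewrite /P !jclE; apply: hM.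
  apply: dm_eq;
    by apply: dm_mul; first apply: dm_mul; try apply: dm_numer; try apply: dm_denom.
Qed.
End Slopes.

(** * Short intervals *)

Section Short.
Import ssrfun ssrbool eqtype choice ssrnat order ssralg ssrnum poly boolp ring lra.
Import Order.TTheory GRing.Theory Num.Theory.
Lemma dp3_definable X : definable M 3 X -> dp3 (fun x y z => X [x; y; z]).
Proof. exact: definable_Def. Qed.

(** [Rl] is the graph of the bijection between the ranges of [h2] and [h]. Only this graph has to be
    definable; the field and the two maps live outside the structure. *)
Lemma short_transport (c d : T) (K : rcfType) (h h2 : K -> T) (Rl : T -> T -> Prop) : dp2 Rl ->
  definable M 3 (fun l => exists u v, l = [h u; h v; h (u + v)%R]) ->
  definable M 3 (fun l => exists u v, l = [h u; h v; h (u * v)%R]) ->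
  (forall u v, h u = h v -> u = v) ->
  (forall x y, Rl x y <-> exists u, y = h u /\ x = h2 u) ->
  (forall u v, h2 u = h2 v -> u = v) -> (forall x, c < x < d <-> exists u, h2 u = x) -> short_interval G c d.
Proof.
move=> dR /dp3_definable dA /dp3_definable dM hi RE h2i im; exists K, h2; split=> //; split=> //.
have W op : dp3 (fun x y z => exists u v, [x; y; z] = [h u; h v; h (op u v)]) ->
   definable M 3 (fun l => exists u v, l = [h2 u; h2 v; h2 (op u v)]).
  move=> dO; apply: (definable3 (fun x y z => exists x' y' z', Rl x x' /\ Rl y y' /\ Rl z z' /\ exists u v, [x'; y'; z'] = [h u; h v; h (op u v)])).
    pose O x y z := exists u v, [x; y; z] = [h u; h v; h (op u v)].
    have dO' : dp3 O by [].
    change (dp3 (fun x y z => exists x' y' z', Rl x x' /\ Rl y y' /\ Rl z z' /\ O x' y' z')); by ddef.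
  move=> l; split.
    move=> [u [v ->]]; exists (h2 u), (h2 v), (h2 (op u v)); split=> //; exists (h u), (h v), (h (op u v)).
    by rewrite !RE; split; [exists u|split; [exists v|split; [exists (op u v)|exists u, v]]].
  move=> [x [y [z [-> [x' [y' [z' [/RE [p [-> ->]] [/RE [q [-> ->]] [/RE [r [-> ->]] [u [v [E1 E2 E3]]]]]]]]]]]]].
  by exists u, v; rewrite (hi _ _ E1) (hi _ _ E2) (hi _ _ E3).
by split; apply: W.
Qed.

Lemma short_bij (a b c d : T) (phi : T -> T) : df1 phi -> (forall x, c < x < d -> a < phi x < b) ->
  (forall x y, c < x < d -> c < y < d -> phi x = phi y -> x = y) ->
  (forall y, a < y < b -> exists x, c < x < d /\ phi x = y) -> short_interval G a b -> short_interval G c d.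
Proof.
move=> dphi Hi Hinj Hs [K [h [hi [im [dA dM]]]]].
have ex u : exists x, c < x < d /\ phi x = h u by apply: Hs; apply/im; exists u.
pose h2 u := proj1_sig (ClassicalEpsilon.constructive_indefinite_description _ (ex u)).
have h2P u : c < h2 u < d /\ phi (h2 u) = h u by rewrite /h2; case: ClassicalEpsilon.constructive_indefinite_description.
apply: (short_transport c d K h h2 (fun x y => c < x < d /\ y = phi x)) => //.
- by ddef.
- move=> x y; split=> [[Hx ->]|[u [-> ->]]]; last by have [H1 H2] := h2P u; split.
  have /im [u E] := Hi x Hx; exists u; split=> //; have [H1 H2] := h2P u.
  by apply: Hinj => //; rewrite H2.
- by move=> u v E; have [_ H1] := h2P u; have [_ H2] := h2P v; apply: hi; rewrite -H1 -H2 E.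
- move=> x; split=> [Hx|[u <-]]; last by case: (h2P u).
  have /im [u E] := Hi x Hx; exists u; have [H1 H2] := h2P u.
  by apply: Hinj => //; rewrite H2.
Qed.

Lemma rcf_sq (K : rcfType) (u : K) : (0 <= u)%R <-> exists r, (r * r = u)%R.
Proof.
split=> [u0|[r <-]]; last by rewrite -expr2 sqr_ge0.
by exists (Num.sqrt u); rewrite -expr2 sqr_sqrtr.
Qed.
(** The positive solution is a root of [u^2 - w u - 1], available because square roots exist; the
    negative one comes from [- v]. *)
Lemma half_line (K : rcfType) (v : K) : (exists u, (0 < u)%R /\ (u - u^-1 = v)%R) /\ (exists u, (u < 0)%R /\ (u - u^-1 = v)%R).
Proof.
have H w : exists u : K, (0 < u)%R /\ (u - u^-1 = w)%R.
  pose s := Num.sqrt (w * w + 4)%R; have p : (0 < w * w + 4 :> K)%R by nra.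
  have s2 : (s * s = w * w + 4)%R by rewrite -expr2 sqr_sqrtr // ltW.
  have s0 : (0 < s)%R by rewrite sqrtr_gt0.
  pose u := ((w + s) / 2)%R.
  have u0 : (0 < u)%R by rewrite /u; nra.
  exists u; split=> //; have un : u != 0%R by rewrite gt_eqF.
  by apply: (mulIf un); rewrite mulrBl mulVf // /u; nra.
split; first exact: H.
have [u [u0 E]] := H (- v)%R; exists (- u)%R; rewrite oppr_lt0; split=> //.
by rewrite invrN -opprD E opprK.
Qed.
Lemma half_line_inj (K : rcfType) (u v : K) : (0 < u * v)%R -> (u - u^-1 = v - v^-1)%R -> u = v.
Proof.
move=> uv; have u0 : u != 0%R by apply/eqP => E; rewrite E mul0r ltxx in uv.
have v0 : v != 0%R by apply/eqP => E; rewrite E mulr0 ltxx in uv.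
move=> E; apply/eqP; rewrite -subr_eq0; apply/eqP.
have : ((u - v) * (u * v + 1) = (u - u^-1 - (v - v^-1)) * (u * v))%R by field; rewrite u0 v0.
rewrite E subrr mul0r => /eqP; rewrite mulf_eq0 => /orP[/eqP //|/eqP]; nra.
Qed.

(* The two halves of (0, t + t) are identified with the two half lines through u |-> u - 1/u. *)
Lemma short_double t : short_interval G 0 t -> short_interval G 0 (t + t).
Proof.
move=> [K [h [hi [im [dA dM]]]]].
have hr u : 0 < h u < t by apply/im; exists u.
have t0 : 0 < t by have [H1 H2] := hr 0%R; apply: lt_tr H1 H2.
pose A x y z := exists u v, [x; y; z] = [h u; h v; h (u + v)%R].
pose Mu x y z := exists u v, [x; y; z] = [h u; h v; h (u * v)%R].
have dA' : dp3 A := dp3_definable _ dA.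
have dM' : dp3 Mu := dp3_definable _ dM.
have AE u v w : A (h u) (h v) (h w) <-> w = (u + v)%R.
  by split=> [[p [q [/hi -> /hi -> /hi ->]]]|->] //; exists u, v.
have ME u v w : Mu (h u) (h v) (h w) <-> w = (u * v)%R.
  by split=> [[p [q [/hi -> /hi -> /hi ->]]]|->] //; exists u, v.
pose g u := h (u - u^-1)%R.
pose h2 (u : K) := if u == 0%R then t else if (0 < u)%R then t + g u else g u.
pose Pos x := exists r, Mu r r x.
have PosE u : Pos (h u) <-> (0 <= u)%R.
  rewrite rcf_sq; split=> [[r [p [q [-> /hi -> /hi ->]]]]|[r E]]; first by exists q.
  by exists (h r); rewrite ME.
(* This is [z = u - 1/u] with the denominator cleared, that is, [u z + 1 = u^2]. *)
pose Gr x z := 0 < z < t /\ exists w s, Mu x z w /\ Mu x x s /\ A w (h 1%R) s.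
have GrE u z : u != 0%R -> Gr (h u) z <-> z = g u.
  move=> u0; split.
    move=> [/im [v <-] [w [s [[p [q [/hi <- /hi <- ->]]] [[p' [q' [/hi <- /hi <- ->]]] /AE E]]]]].
    congr h; apply: (mulIf u0); rewrite mulrBl mulVf // E; ring.
  move=> ->; split; first exact: hr.
  exists (h (u * (u - u^-1))%R), (h (u * u)%R); rewrite /g !ME AE; split=> //; split=> //.
  by rewrite mulrBr mulfV // subrK.
(* Zero goes to the middle point [t], positive elements to the right half and negative ones to the
   left half. Signs are expressed by squares, and the product with [h 1] only says that [x] belongs
   to the field. *)
pose Rl y x := (x = h 0%R /\ y = t) \/ (x <> h 0%R /\ ((Pos x /\ exists z, Gr x z /\ y = t + z) \/ (~ Pos x /\ (exists z, Mu x (h 1%R) z) /\ Gr x y))).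
have h2c u : (u = 0%R /\ h2 u = t) \/ ((0 < u)%R /\ h2 u = t + g u) \/ ((u < 0)%R /\ h2 u = g u).
  rewrite /h2; case: (eqVneq u 0%R) => [->|u0]; first by left.
  by right; case: (ltP 0%R u) => L; [left|right]; rewrite // lt_neqAle u0.
apply: (short_transport 0 (t + t) K h h2 Rl) => //.
- by rewrite /Rl /Pos /Gr; ddef.
- move=> y x; split.
    case=> [[-> ->]|[x0 [[Px [z [Gz ->]]]|[NP [Mx Gy]]]]].
    + by exists 0%R; rewrite /h2 eqxx.
    + case: Px => r [p [q [E1 E2 E3]]]; subst x.
      have pq0 : (p * q)%R != 0%R by apply/eqP => E; apply: x0; rewrite E.
      have pp : (0 <= p * q)%R by apply/PosE; exists r, p, q; rewrite -E1 -E2.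
      exists (p * q)%R; split=> //; rewrite /h2 (negbTE pq0) lt_neqAle eq_sym pq0 pp /=.
      by move/GrE: Gz => /(_ pq0) ->.
    + case: Mx => z [p [q [E1 _ _]]]; subst x.
      have p0 : p != 0%R by apply/eqP => E; apply: x0; rewrite E.
      exists p; split=> //; rewrite /h2 (negbTE p0); case: ifP => [L|_]; last by apply/GrE.
      by case: NP; apply/PosE; apply: Order.POrderTheory.ltW.
  move=> [u [-> ->]]; rewrite /Rl /h2; case: (eqVneq u 0%R) => [->|u0]; first by left.
  right; split; first by move=> /hi E; rewrite E eqxx in u0.
  case: (ltP 0%R u) => L; [left|right]; split.
  + by apply/PosE; apply: Order.POrderTheory.ltW.
  + by exists (g u); split=> //; apply/GrE.
  + move=> /PosE K'; case/negP: u0; apply/eqP/Order.POrderTheory.le_anti; by rewrite L K'.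
  + by split; [exists (h (u * 1)%R); apply/ME|apply/GrE].
- move=> u v; have [gu1 gu2] := hr (u - u^-1)%R; have [gv1 gv2] := hr (v - v^-1)%R.
  rewrite -/(g u) in gu1 gu2; rewrite -/(g v) in gv1 gv2.
  case: (h2c u) => [[-> ->]|[[Lu ->]|[Lu ->]]]; case: (h2c v) => [[-> ->]|[[Lv ->]|[Lv ->]]] // E.
  + by exfalso; clear -E gv1 gv2; olra.
  + by exfalso; clear -E gv1 gv2; olra.
  + by exfalso; clear -E gu1 gu2; olra.
  + by apply: half_line_inj; [nra|apply: hi; rewrite -/(g u) -/(g v); clear -E gu1 gu2; olra].
  + by exfalso; clear -E gu1 gu2 gv1 gv2; olra.
  + by exfalso; clear -E gu1 gu2 gv1 gv2; olra.
  + by exfalso; clear -E gu1 gu2 gv1 gv2; olra.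
  + by apply: half_line_inj; [nra|apply: hi].
- move=> x; split=> [[x0 x1]|[u <-]].
    case: (lt_tot x t) => [L|[->|L]].
    + have /im [v E] : 0 < x < t by [].
      have [_ [u [u0 Eu]]] := half_line K v; exists u; rewrite /h2 lt_eqF // ifN ?/g ?Eu //.
      by rewrite -leNgt; apply: Order.POrderTheory.ltW.
    + by exists 0%R; rewrite /h2 eqxx.
    + have /im [v E] : 0 < x - t < t by clear -L x1; olra.
      have [[u [u0 Eu]] _] := half_line K v; exists u; rewrite /h2 gt_eqF // u0 /g Eu E; clear; olra.
  have [g1 g2] := hr (u - u^-1)%R; rewrite -/(g u) in g1 g2.
  by case: (h2c u) => [[_ ->]|[[_ ->]|[_ ->]]]; clear -t0 g1 g2; olra.
Qed.
End Short.

Definition tall (e : T) := 0 < e /\ ~ short_interval G 0 e.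
Lemma tall_hf e : tall e -> tall (hf e).
Proof.
move=> [e0 N]; split; first by olra.
by move=> /short_double; rewrite hfE.
Qed.
Lemma tall_hfn n e : tall e -> tall (hfn n e).
Proof. by move=> H; elim: n => //= n IH; apply: tall_hf. Qed.

(** A convex or concave piece of tall length would contain a tame piece of tall length, and the
    slopes of that piece would make half of its length short. *)
Lemma tall_affine f a e : df1 f -> tall e -> exists n a', a <= a' /\ a' + hfn n e <= a + e /\ affine_on f a' (a' + hfn n e).
Proof.
move=> df te; have [e0 _] := te.
have W g x d : df1 g -> tall d -> ~ convex_on g x (x + d).
  move=> dg td cg; have [n [a' [L1 [L2 tm]]]] := convex_tame g x d dg (proj1 td) cg.
  have tl := tall_hfn n d td; set L := hfn n d in tl tm *; have [l0 _] := tl.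
  have [_ N] := tall_hf _ tl; apply: N.
  (* The base point lies a quarter into the interval and the scalars use half of it, so a quarter
     remains for the increment. *)
  by apply: (short_slopes g a' (a' + L) (a' + hf (hf L)) (hf L)) => //; olra.
have [n [a' [L1 [L2 [A|[A|A]]]]]] := trichotomy f a e df e0; first by exists n, a'.
- by case: (W f a' (hfn n e)) => //; apply: tall_hfn.
- by case: (W (fun x => - f x) a' (hfn n e)) => //; [ddef|apply: tall_hfn].
Qed.

(** * Additive maps and affine selections on tall boxes *)

Definition bd (r t : T) := - r < t < r.
Definition addon (r : T) (l : T -> T) := forall s t, bd r s -> bd r t -> bd r (s + t) -> l (s + t) = l s + l t.

(** The analogue of [doubling_induction] for [hf]; again a supremum replaces repeated doubling. *)
Lemma doubling_all (U : T -> Prop) r : dp1 U -> ev U -> (forall x, 0 < x < r -> U (hf x) -> U x) -> forall x, 0 < x < r -> U x.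
Proof.
move=> dU [d [d0 Hd]] H z Hz; apply: NNPP => N.
pose W t := 0 < t < r /\ forall x, 0 < x <= t -> U x.
have dW : dp1 W by rewrite /W; ddef.
have m1 := omin_lel (hf d) (hf r); have m2 := omin_ler (hf d) (hf r); have m0 : 0 < omin (hf d) (hf r) by apply: omin_gt; olra.
have W0 : W (omin (hf d) (hf r)) by split; [olra|move=> x Hx; apply: Hd; olra].
have [|s [s1 s2]] := sup_ex W _ z dW W0.
  move=> u [Hu Wu]; case: (lt_le_dec z u) => // L; case: N; apply: Wu; olra.
have s0 := s1 _ W0.
have sz : s <= z.
  move=> /s2 [u [[Hu Wu] L]]; case: N; apply: Wu; olra.
have [t [[Ht Wt] tt]] := s2 (hf s + hf (hf s)) ltac:(olra).
have Wn : W (omin (t + t) z).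
  have n1 := omin_lel (t + t) z; have n2 := omin_ler (t + t) z; have n0 : 0 < omin (t + t) z by apply: omin_gt; olra.
  split; first by olra.
  by move=> x Hx; apply: H; [olra|apply: Wt; olra].
case: (ominP (t + t) z) => [] [L E]; rewrite E in Wn; first by have := s1 _ Wn; olra.
by apply: N; case: Wn => _; apply; olra.
Qed.

Section Additive.
Variables (r : T) (l : T -> T).
Hypotheses (r0 : 0 < r) (dl : df1 l) (al : addon r l).
Lemma ao0 : l 0 = 0.
Proof. by have := al 0 0; rewrite /bd add0 => H; have := H ltac:(olra) ltac:(olra) ltac:(olra); olra. Qed.
Lemma aoN t : bd r t -> l (- t) = - l t.
Proof.
rewrite /bd => Ht; have := al t (- t); rewrite /bd; (have -> : t + - t = 0 by olra); rewrite ao0 => H.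
by have := H ltac:(olra) ltac:(olra) ltac:(olra); olra.
Qed.
Lemma aoB s t : bd r s -> bd r t -> bd r (s - t) -> l (s - t) = l s - l t.
Proof. by move=> Hs Ht Hst; have := al (s - t) t Hst Ht; (have -> : s - t + t = s by olra) => /(_ Hs); olra. Qed.
Lemma ao_dbl t : bd r t -> l t = l (hf t) + l (hf t).
Proof. by rewrite /bd => Ht; rewrite -al ?hfE // /bd; olra. Qed.
(** The sign near 0 is constant by [ev_dich], and [l x = l (hf x) + l (hf x)] carries it
    outwards. *)
Lemma ao_sign : (forall t, bd r t -> l t = 0) \/ (forall t, 0 < t < r -> 0 < l t) \/ (forall t, 0 < t < r -> l t < 0).
Proof.
have D x : 0 < x < r -> l x = l (hf x) + l (hf x) by move=> Hx; apply: ao_dbl; rewrite /bd; olra.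
have [|E1|E1] := ev_dich (fun t => 0 < l t) r r0; first by ddef.
  by right; left; apply: doubling_all => //; [ddef|move=> x Hx; rewrite (D x Hx); olra].
have [|E2|E2] := ev_dich (fun t => l t < 0) r r0; first by ddef.
  by right; right; apply: doubling_all => //; [ddef|move=> x Hx; rewrite (D x Hx); olra].
have Z : forall t, 0 < t < r -> l t = 0.
  apply: doubling_all => //; [by ddef| |by move=> x Hx; rewrite (D x Hx); olra].
  by apply: ev_imp (ev_and _ _ E1 E2) => x _; olra.
left=> t Ht; case: (lt_tot t 0) => [L|[->|L]]; [|exact: ao0|apply: Z; rewrite /bd in Ht; olra].
have -> : t = - (- t) by olra.
by rewrite aoN ?Z; rewrite /bd in Ht *; olra.
Qed.
Lemma ao_zero t0 : bd r t0 -> t0 <> 0 -> l t0 = 0 -> forall t, bd r t -> l t = 0.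
Proof.
move=> Ht0 N E; case: ao_sign => [//|S]; exfalso.
have [u [Hu Eu]] : exists u, 0 < u < r /\ l u = 0.
  rewrite /bd in Ht0; case: (lt_tot t0 0) => [L|[//|L]]; [exists (- t0)|by exists t0; olra].
  by rewrite aoN ?E /bd; olra.
by case: S => /(_ u Hu); olra.
Qed.
Lemma ao_mono s t : (forall t, 0 < t < r -> 0 < l t) -> 0 <= s < t -> t < r -> l s < l t.
Proof.
move=> P Hs Ht; have -> : t = s + (t - s) by olra.
by rewrite al; [have := P (t - s) ltac:(olra); olra|rewrite /bd; olra..].
Qed.
(** Halving the argument halves the value, so the infimum of the values cannot be as large as
    [c]. *)
Lemma ao_small c : (forall t, 0 < t < r -> 0 < l t) -> 0 < c -> exists t, 0 < t < r /\ l t < c.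
Proof.
move=> P c0.
have [|||m [m1 m2]] := inf_ex (fun y => exists t, 0 < t < r /\ l t = y) (l (hf r)) 0.
- by ddef.
- by exists (hf r); split=> //; olra.
- by move=> y [t [Ht <-]]; have := P t Ht; olra.
case: (lt_le_dec m c) => L; first by have [y [[t [Ht Et]] Hy]] := m2 c L; exists t; split=> //; olra.
have [y [[t [Ht Et]] Hy]] := m2 (m + c) ltac:(olra).
exists (hf t); split; first by olra.
have M : m <= l (hf t) by apply: m1; exists (hf t); split=> //; olra.
by have := ao_dbl t ltac:(rewrite /bd; olra); olra.
Qed.
Lemma ao_ivt t c : (forall t, 0 < t < r -> 0 < l t) -> 0 < t < r -> 0 < c <= l t -> exists s, 0 < s <= t /\ l s = c.
Proof.
move=> P Ht Hc.
have [|||s [s1 s2]] := sup_ex (fun s => 0 <= s <= t /\ l s <= c) 0 t.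
- by ddef.
- by rewrite ao0; olra.
- by move=> u; olra.
have Hs : 0 <= s <= t.
  split; first by apply: s1; rewrite ao0; olra.
  by move=> /s2 [u]; olra.
have E : l s = c.
  case: (lt_tot (l s) c) => [L|[//|L]]; exfalso.
    have st : s < t by case: (le_eqlt _ _ (proj2 Hs)) => // E; subst s; olra.
    have [u [Hu Lu]] := ao_small (c - l s) P ltac:(olra).
    have m1 := omin_lel u (t - s); have m2 := omin_ler u (t - s); have m0 : 0 < omin u (t - s) by apply: omin_gt; olra.
    set v := omin u (t - s) in m1 m2 m0.
    have lv : l v <= l u by case: (le_eqlt _ _ m1) => [->|m1']; [olra|have := ao_mono v u P ltac:(olra) ltac:(olra); olra].
    have A : l (s + v) = l s + l v by apply: al; rewrite /bd; olra.
    by have := s1 (s + v) ltac:(olra); olra.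
  have sp : 0 < s by case: (le_eqlt _ _ (proj1 Hs)) => // E; subst s; rewrite ao0 in L; olra.
  have [u [Hu Lu]] := ao_small (l s - c) P ltac:(olra).
  have m1 := omin_lel u s; have m2 := omin_ler u s; have m0 : 0 < omin u s by apply: omin_gt; olra.
  set v := omin u s in m1 m2 m0.
  have lv : l v <= l u by case: (le_eqlt _ _ m1) => [->|m1']; [olra|have := ao_mono v u P ltac:(olra) ltac:(olra); olra].
  have A : l (s - v) = l s - l v by apply: aoB; rewrite /bd; olra.
  have [w [[Hw Kw] Lw]] := s2 (s - v) ltac:(olra).
  by have := ao_mono (s - v) w P ltac:(olra) ltac:(olra); olra.
exists s; split=> //; case: (le_eqlt _ _ (proj1 Hs)) => [E0|]; last by olra.
by move: E; rewrite -E0 ao0; olra.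
Qed.
(** A positive additive map is an increasing bijection from (0, t) onto (0, l t), by [ao_ivt], and a
    field structure can be pulled back along it. *)
Lemma ao_tall t : (forall t, 0 < t < r -> 0 < l t) -> 0 < t < r -> tall t -> tall (l t).
Proof.
move=> P Ht [t0 N]; split; first exact: P.
move=> K; apply: N; apply: (short_bij _ _ _ _ l dl _ _ _ K).
- by move=> x Hx; have := P x ltac:(olra); have := ao_mono x t P ltac:(olra) ltac:(olra); olra.
- move=> x y Hx Hy E; case: (lt_tot x y) => [L|[//|L]].
    by have := ao_mono x y P ltac:(olra) ltac:(olra); olra.
  by have := ao_mono y x P ltac:(olra) ltac:(olra); olra.
- move=> y Hy; have [s [Hs E]] := ao_ivt t y P Ht ltac:(olra); exists s; split=> //.
  by case: (le_eqlt _ _ (proj2 Hs)) => [E'|]; [subst s; olra|olra].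
Qed.
Lemma ao_tall_inv t : (forall t, 0 < t < r -> 0 < l t) -> 0 < t < r -> tall (l t) -> tall t.
Proof.
move=> P Ht [t0 N]; split; first by olra.
move=> K; apply: N.
have inj x y : 0 < x < r -> 0 < y < r -> l x = l y -> x = y.
  move=> Hx Hy E; case: (lt_tot x y) => [L|[//|L]].
    by have := ao_mono x y P ltac:(olra) ltac:(olra); olra.
  by have := ao_mono y x P ltac:(olra) ltac:(olra); olra.
have [||||F [dF HF]] := fun_of_rel2 (fun y _ => 0 < y < l t) (fun x y _ => 0 < x < t /\ l x = y).
- by ddef.
- by ddef.
- move=> y _ Hy; have [s [Hs E]] := ao_ivt t y P Ht ltac:(olra); exists s; split=> //.
  by case: (le_eqlt _ _ (proj2 Hs)) => [E'|]; [subst s; olra|olra].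
- by move=> y _ x x' _ [Hx <-] [Hx' E]; apply: inj; [olra|olra|].
apply: (short_bij _ _ _ _ (fun y => F y 0) _ _ _ _ K); first by ddef.
- by move=> y Hy; have [] := HF y 0 Hy.
- by move=> y y' Hy Hy' E; have [_ <-] := HF y 0 Hy; have [_ <-] := HF y' 0 Hy'; rewrite E.
- move=> x Hx; have Hl : 0 < l x < l t by have := P x ltac:(olra); have := ao_mono x t P ltac:(olra) ltac:(olra); olra.
  exists (l x); split=> //; have [H1 H2] := HF _ 0 Hl; apply: inj; [olra|olra|done].
Qed.
End Additive.

Lemma addonN r l : addon r l -> addon r (fun t => - l t).
Proof. by move=> A s t Hs Ht Hst; rewrite A //; olra. Qed.
Lemma addonB r l l' : addon r l -> addon r l' -> addon r (fun t => l t - l' t).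
Proof. by move=> A A' s t Hs Ht Hst; rewrite A // A' //; olra. Qed.
Lemma bd_le r r' t : r <= r' -> bd r t -> bd r' t. Proof. by rewrite /bd; olra. Qed.
Lemma addon_le r r' l : r <= r' -> addon r' l -> addon r l.
Proof. by move=> L A s t Hs Ht Hst; apply: A; apply: bd_le L _. Qed.

Lemma tall_pos e : tall e -> 0 < e. Proof. by case. Qed.
(** For positive [l]: if [l] stays below [c] on half of the interval, that half serves; otherwise
    the preimage of [c] serves, and it is tall because [c] is. *)
Lemma ao_shrink r l c : tall r -> tall c -> df1 l -> addon r l -> exists s, tall s /\ s <= r /\ forall t, bd s t -> bd c (l t).
Proof.
have W k : tall r -> tall c -> df1 k -> addon r k -> (forall t, 0 < t < r -> 0 < k t) -> exists s, tall s /\ s <= r /\ forall t, bd s t -> bd c (k t).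
  move=> tr tc dk ak P; have r0 := tall_pos r tr; have c0 := tall_pos c tc.
  have X s : 0 < s < r -> k s <= c -> forall t, bd s t -> bd c (k t).
    move=> Hs Ks t; rewrite /bd => Ht; case: (lt_tot t 0) => [L|[->|L]].
    - have := ao_mono r k r0 ak (- t) s P ltac:(olra) ltac:(olra); have := P (- t) ltac:(olra).
      by rewrite (aoN r k r0 ak) /bd; olra.
    - by rewrite (ao0 r k r0 ak); olra.
    - by have := ao_mono r k r0 ak t s P ltac:(olra) ltac:(olra); have := P t ltac:(olra); olra.
  case: (lt_le_dec c (k (hf r))) => L.
    have [s [Hs E]] := ao_ivt r k r0 dk ak (hf r) c P ltac:(olra) ltac:(olra).
    exists s; split; first by apply: (ao_tall_inv r k r0 dk ak s P ltac:(olra)); rewrite E.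
    by split; [olra|apply: X; [olra|rewrite E; olra]].
  exists (hf r); split; first exact: tall_hf.
  by split; [olra|apply: X; olra].
move=> tr tc dl al; have r0 := tall_pos r tr; have c0 := tall_pos c tc.
case: (ao_sign r l r0 dl al) => [Z|[P|N]].
- by exists r; split=> //; split; [olra|move=> t Ht; rewrite Z // /bd; olra].
- exact: W.
- have [|||s [ts [L H]]] := W (fun t => - l t) tr tc; [by ddef|exact: addonN|by move=> t Ht; have := N t Ht; olra|].
  by exists s; split=> //; split=> // t /H; rewrite /bd; olra.
Qed.
Lemma tall_min (e e' : T) : tall e -> tall e' -> tall (omin e e').
Proof. by move=> H H'; case: (ominP e e') => [] [_ ->]. Qed.

(* S u t - S 0 t is biadditive. Its diagonal is affine on a tall interval, so its polarisation vanishes. *)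
Lemma slope_rigid (S : T -> T -> T) r r' t0 : df2 S -> tall r -> tall r' -> (forall u, bd r u -> addon r' (S u)) ->
  bd r' t0 -> t0 <> 0 -> addon r (fun u => S u t0 - S 0 t0) -> forall u, bd r u -> S u t0 = S 0 t0.
Proof.
move=> dS tr tr' A Ht0 N A0; have p := tall_pos r tr; have p' := tall_pos r' tr'.
have z : bd r 0 by rewrite /bd; olra.
pose B u t := S u t - S 0 t.
have dB : df2 B by rewrite /B; ddef.
have B1 u : bd r u -> addon r' (B u) by move=> Hu; apply: addonB; apply: A.
have B2 u u' t : bd r u -> bd r u' -> bd r (u + u') -> bd r' t -> B (u + u') t = B u t + B u' t.
  move=> Hu Hu' Huu Ht.
  suff : B (u + u') t - B u t - B u' t = 0 by olra.
  have D : df1 (fun t => B (u + u') t - B u t - B u' t) by ddef.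
  have AA : addon r' (fun t => B (u + u') t - B u t - B u' t) by apply: addonB; first apply: addonB; apply: B1.
  apply: (ao_zero r' _ p' D AA t0) => //.
  by have := A0 u u' Hu Hu' Huu; rewrite /B; olra.
have tk := tall_min r r' tr tr'; have k1 := omin_lel r r'; have k2 := omin_ler r r'; set k := omin r r' in tk k1 k2.
have [|n [a [a0 [ak Af]]]] := tall_affine (fun t => B t t) 0 k _ tk; first by ddef.
have ts := tall_pos _ (tall_hfn n k tk); set s := hfn n k in ak Af ts.
pose x := a + hf (hf s); pose u := hf (hf (hf s)).
have Hu : 0 < u by rewrite /u; olra.
have Hx : 0 < x /\ x + u + u < a + s /\ a < x by rewrite /x /u; olra.
have E1 := Af (x + u) x u ltac:(olra) ltac:(olra) ltac:(olra) ltac:(olra).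
have R t : 0 < t < k -> bd r t by rewrite /bd; olra.
have R' t : 0 < t < k -> bd r' t by rewrite /bd; olra.
have Bl y z' t : 0 < y -> 0 < z' -> y + z' < k -> 0 < t < k -> B (y + z') t = B y t + B z' t.
  by move=> *; apply: B2; (apply: R || apply: R'); olra.
have Br y z' t : 0 < y -> 0 < z' -> y + z' < k -> 0 < t < k -> B t (y + z') = B t y + B t z'.
  by move=> *; apply: B1; (apply: R || apply: R'); olra.
(* The second difference of [B t t] with step [u] is twice [B u u], and it vanishes where the
   diagonal is affine. *)
have Buu : B u u = 0.
  move: E1; rewrite !(Bl (x + u) u) ?(Bl x u) ?(Br (x + u) u) ?(Br x u); try olra.
have Bu : B u t0 = 0.
  by apply: (ao_zero r' (B u) p' _ (B1 u _) u) => //; [ddef|apply: R; olra|apply: R'; olra|olra].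
move=> v Hv; suff : B v t0 = 0 by rewrite /B; olra.
by apply: (ao_zero r (fun u => B u t0) p _ A0 u) => //; [ddef|apply: R; olra|olra].
Qed.

(** All coordinates outside [Y] are frozen at [c], so that the box, the remaining variables and the
    parameters share one assignment. *)
Definition Box (Y : list nat) (c : env) (r : T) (e : env) :=
  (forall i, In i Y -> bd r (e i - c i)) /\ (forall i, ~ In i Y -> e i = c i).
Definition sumY (Y : list nat) (g : nat -> T) : T := fold_right (fun j s => g j + s) 0 Y.
Definition aff (Y : list nat) c r (F : env -> T) (w : nat -> T -> T) :=
  (forall j, In j Y -> df1 (w j) /\ addon r (w j)) /\
  forall e, Box Y c r e -> F e = F c + sumY Y (fun j => w j (e j - c j)).
Definition subbox Y (c' : env) r' c r := r' <= r /\ forall e, Box Y c' r' e -> Box Y c r e.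
Definition AFF Y := forall F c r, DT F -> tall r -> exists c' r' w, tall r' /\ subbox Y c' r' c r /\ aff Y c' r' F w.

Lemma box_center Y c r : 0 < r -> Box Y c r c.
Proof. by move=> r0; split=> // i _; rewrite /bd; olra. Qed.
Lemma subbox_trans Y c1 r1 c2 r2 c3 r3 : subbox Y c1 r1 c2 r2 -> subbox Y c2 r2 c3 r3 -> subbox Y c1 r1 c3 r3.
Proof. by move=> [L H] [L' H']; split; [olra|move=> e /H /H']. Qed.
Lemma subbox_le Y c r r' : r' <= r -> subbox Y c r' c r.
Proof. by move=> L; split=> // e [H1 H2]; split=> // i Hi; apply: bd_le L (H1 i Hi). Qed.
Lemma sumY_cons a Y g : sumY (a :: Y) g = g a + sumY Y g. Proof. by []. Qed.
Lemma sumY_ext Y g g' : (forall j, In j Y -> g j = g' j) -> sumY Y g = sumY Y g'.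
Proof. by elim: Y => [|a Y IH] //= H; rewrite H ?IH; auto. Qed.
Lemma sumYB Y g g' : sumY Y (fun j => g j - g' j) = sumY Y g - sumY Y g'.
Proof. by elim: Y => [|a Y IH] /=; rewrite ?IH; olra. Qed.
Lemma sumY0 Y g : (forall j, In j Y -> g j = 0) -> sumY Y g = 0.
Proof. by elim: Y => [|a Y IH] //= H; rewrite H ?IH ?add0; auto. Qed.
Lemma hfn_S n (e : T) : hfn (S n) e = hfn n (hf e).
Proof. by elim: n => //= n ->. Qed.
Lemma sumY_bd Y g q : 0 < q -> (forall j, In j Y -> bd (hfn (length Y) q) (g j)) -> bd q (sumY Y g).
Proof.
elim: Y q => [|a Y IH] q q0 H; first by rewrite /bd /=; olra.
have h0 : 0 < hf q by olra.
have := H a (or_introl eq_refl); have := IH (hf q) h0.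
rewrite sumY_cons [length (a :: Y)]/= hfn_S => K; have := K ltac:(move=> j Hj; rewrite -hfn_S; apply: H; right; done).
by rewrite /bd; have := hfn_le (length Y) (hf q) h0; olra.
Qed.

Lemma aff_sub Y c r c' r' F w : 0 < r' -> subbox Y c' r' c r -> aff Y c r F w -> aff Y c' r' F w.
Proof.
move=> r0 [L S] [D A]; split; first by move=> j /D [? ?]; split=> //; apply: addon_le L _.
have Hc := S c' (box_center Y c' r' r0).
move=> e He; have He' := S e He; rewrite (A e He') (A c' Hc).
suff -> : sumY Y (fun j => w j (e j - c' j)) = sumY Y (fun j => w j (e j - c j) - w j (c' j - c j)) by rewrite sumYB; olra.
apply: sumY_ext => j Hj; have [_ Aj] := D j Hj.
have B1 := proj1 He' j Hj; have B2 := proj1 Hc j Hj; have B3 := bd_le _ _ _ L (proj1 He j Hj).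
have rp : 0 < r by olra.
have E : e j - c' j = (e j - c j) - (c' j - c j) by olra.
by rewrite E; apply: (aoB r) => //; rewrite -E.
Qed.

Lemma shrink_family Y r c (w : nat -> T -> T) : tall r -> tall c -> (forall j, In j Y -> df1 (w j) /\ addon r (w j)) ->
  exists s, tall s /\ s <= r /\ forall j, In j Y -> forall t, bd s t -> bd c (w j t).
Proof.
move=> tr tc; elim: Y => [|a Y IH] H; first by exists r; split=> //; split=> //; olra.
have [|s [ts [sr Hs]]] := IH; first by move=> j Hj; apply: H; right.
have [da aa] := H a (or_introl eq_refl).
have [s' [ts' [sr' Hs']]] := ao_shrink r (w a) c tr tc da aa.
have m1 := omin_lel s s'; have m2 := omin_ler s s'.
exists (omin s s'); split; first exact: tall_min.
split; first by olra.
by move=> j [<-|Hj] t Ht; [apply: Hs'|apply: Hs => //]; apply: bd_le Ht; olra.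
Qed.

(** Each additive term is kept below [q] divided by [2^(length Y)]. In this way a chosen bound that
    depends on the point becomes nearly constant on a tall box. *)
Lemma aff_shrink Y c r F w q : tall r -> tall q -> aff Y c r F w ->
  exists s, tall s /\ s <= r /\ forall e, Box Y c s e -> bd q (F e - F c).
Proof.
move=> tr tq [D A]; have [s [ts [sr H]]] := shrink_family Y r _ w tr (tall_hfn (length Y) q tq) D.
exists s; split=> //; split=> // e He.
rewrite A; last by case: (subbox_le Y c r s sr) => _; apply.
have -> : F c + sumY Y (fun j => w j (e j - c j)) - F c = sumY Y (fun j => w j (e j - c j)) by olra.
apply: sumY_bd; first exact: tall_pos.
by move=> j Hj; apply: H => //; apply: (proj1 He).
Qed.

Lemma affine_on_sub f a b a' b' : a <= a' -> b' <= b -> affine_on f a b -> affine_on f a' b'.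
Proof. by move=> L L' H x y t *; apply: H; olra. Qed.

Lemma AFF_choice Y : AFF Y -> forall (W : env -> T -> Prop) c r, Def (fun e => W (eshift e) (e 0%nat)) -> tall r ->
  (forall e, Box Y c r e -> exists a, W e a) ->
  exists F c' r' w, DT F /\ tall r' /\ subbox Y c' r' c r /\ aff Y c' r' F w /\ forall e, Box Y c' r' e -> W e (F e).
Proof.
move=> AY W c r dW tr H; have [F [dF HF]] := def_choice _ dW.
have [c' [r' [w [tr' [S A]]]]] := AY F c r dF tr.
exists F, c', r', w; do 4!split=> //; move=> e He.
have [a Ha] := H e (proj2 S e He); exact: (HF e (ex_intro _ a Ha)).
Qed.

(** At each point of the box in the old coordinates, [F] is affine in the new coordinate on some
    tall interval. The work is to make first the interval and then the slope independent of the
    point. *)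
Lemma AFF_all Y : NoDup Y -> AFF Y.
Proof.
elim: Y => [|p Y IH] ND F c r dF tr.
  exists c, r, (fun _ _ => 0); split=> //; split; first by split=> //; olra.
  split=> // e [_ H] /=; have -> : e = c by apply: functional_extensionality => i; apply: H.
  by olra.
have [Np NDY] : ~ In p Y /\ NoDup Y by inversion ND.
have {IH}IH := IH NDY; have r0 := tall_pos r tr.
pose g (e : env) y := F (upd e p y).
have dg e : df1 (g e) by rewrite /g; ddef.
pose Q (e : env) d := 0 < d <= r /\ exists a, c p - r <= a /\ a + d <= c p + r /\ affine_on (g e) a (a + d).
have Q1 e : exists n, Q e (hfn n r).
  have [n [a [a1 [a2 A]]]] := tall_affine (g e) (c p - r) r (dg e) tr.
  exists n; split; first by have := hfn_pos n r r0; have := hfn_le n r r0; olra.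
  by exists a; split; [olra|split; [olra|]].
have Qle e d d' : 0 < d' <= d -> Q e d -> Q e d'.
  move=> Hd [H1 [a [H2 [H3 H4]]]]; split; first by olra.
  by exists a; split=> //; split; [olra|apply: affine_on_sub H4; olra].
(* A length that is at least half of every admissible one, so that the definable choice is not
   needlessly small. *)
pose W (e : env) d := Q e d /\ forall d', Q e d' -> hf d' <= d.
have dW : Def (fun e => W (eshift e) (e 0%nat)) by rewrite /W /Q /affine_on /g; ddef.
have HW e : exists d, W e d.
  have [n Hn] := Q1 e; have hp := hfn_pos n r r0.
  have [||s [s1 s2]] := sup_ex (Q e) _ r _ Hn; first by rewrite /Q /affine_on /g; ddef.
    by move=> u [? _]; olra.
  have := s1 _ Hn => L; have [d [Qd Ld]] := s2 (hf s) ltac:(olra).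
  by exists d; split=> // d' /s1; olra.
have [D [c1 [r1 [w1 [dD [tr1 [S1 [A1 H1]]]]]]]] := AFF_choice Y IH W c r dW tr (fun e _ => HW e).
(* At the centre the chosen length is at least half of some [r / 2^n], hence large enough. Being
   affine by the induction hypothesis, it stays above [d0] on a smaller box. *)
have [n Hn] := Q1 c1.
have tq := tall_hfn n r tr; have Dc := proj2 (H1 c1 (box_center Y c1 r1 (tall_pos _ tr1))) _ Hn.
set d0 := hf (hf (hfn n r)).
have td : tall d0 by apply: tall_hf; apply: tall_hf.
have [r2 [tr2 [r21 B2]]] := aff_shrink Y c1 r1 D w1 d0 tr1 td A1.
have Qd e : Box Y c1 r2 e -> Q e d0.
  move=> He; have := B2 e He; have [Qe _] := H1 e (proj2 (subbox_le Y c1 r1 r2 r21) e He).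
  rewrite /bd => Hd; apply: Qle Qe; have := tall_pos _ td; rewrite /d0 in Hd *; olra.
(* The left endpoint is treated in the same way. It will vary by less than a quarter of [d0], so all
   the intervals share the one of radius [d1 = d0 / 4] around [y0]. *)
pose W' (e : env) a := c p - r <= a /\ a + d0 <= c p + r /\ affine_on (g e) a (a + d0).
have dW' : Def (fun e => W' (eshift e) (e 0%nat)) by rewrite /W' /affine_on /g; ddef.
have [A [c2 [r3 [w3 [dA [tr3 [S3 [A3 H3]]]]]]]] := AFF_choice Y IH W' c1 r2 dW' tr2 (fun e He => proj2 (Qd e He)).
have tdd : tall (hf (hf d0)) by apply: tall_hf; apply: tall_hf.
have [r4 [tr4 [r43 B4]]] := aff_shrink Y c2 r3 A w3 (hf (hf d0)) tr3 tdd A3.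
set y0 := A c2 + hf d0; set d1 := hf (hf d0) in tdd B4.
have d1p := tall_pos _ tdd.
have y0r : c p - r <= y0 - d1 /\ y0 + d1 <= c p + r.
  by have [? [? _]] := H3 c2 (box_center Y c2 r3 (tall_pos _ tr3)); have := tall_pos _ td; rewrite /y0 /d1 => *; olra.
have Lg e : Box Y c2 r4 e -> affine_on (g e) (y0 - d1) (y0 + d1).
  move=> He; have := B4 e He; have [_ [_]] := H3 e (proj2 (subbox_le Y c2 r3 r4 r43) e He).
  by move=> K Hb; apply: affine_on_sub K; rewrite /bd /y0 /d1 in Hb *; olra.
pose Sf (e : env) t := g e (y0 + t) - g e y0.
have dS e : df1 (Sf e) by rewrite /Sf /g; ddef.
have aS e : Box Y c2 r4 e -> addon d1 (Sf e).
  move=> /Lg K s t; rewrite /bd => Hs Ht Hst.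
  have := K (y0 + s) y0 t ltac:(olra) ltac:(olra) ltac:(olra) ltac:(olra); rewrite /Sf.
  by (have -> : y0 + (s + t) = y0 + s + t by olra); olra.
have [c3 [r5 [w5 [tr5 [S5 A5]]]]] : exists c3 r5 w5, tall r5 /\ subbox Y c3 r5 c2 r4 /\ aff Y c3 r5 (fun e => g e y0) w5.
  by apply: IH => //; rewrite /g; ddef.
(* One nonzero argument is enough: additive maps that agree at [t0] agree everywhere, by
   [ao_zero]. *)
set t0 := hf d1.
have Ht0 : bd d1 t0 by rewrite /bd /t0; olra.
have t00 : t0 <> 0 by rewrite /t0; olra.
have [c4 [r6 [w6 [tr6 [S6 A6]]]]] : exists c4 r6 w6, tall r6 /\ subbox Y c4 r6 c3 r5 /\ aff Y c4 r6 (fun e => Sf e t0) w6.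
  by apply: IH => //; rewrite /Sf /g; ddef.
have r6p := tall_pos _ tr6.
have A5' := aff_sub Y _ _ _ _ _ _ r6p S6 A5.
have S64 := subbox_trans _ _ _ _ _ _ _ S6 S5.
(* The increment at [t0] is affine in each coordinate [j] of the box, and then [slope_rigid] forces
   it to be constant in that coordinate. *)
have w0 j t : In j Y -> bd r6 t -> w6 j t = 0.
  move=> Hj.
  have HB u : bd r6 u -> Box Y c4 r6 (upd c4 j (c4 j + u)).
    move=> Hu; split=> i Hi; last by rewrite upd_ne // => E; subst i.
    case: (Nat.eq_dec i j) => [->|Nij]; first by rewrite upd_eq; (have -> : c4 j + u - c4 j = u by olra).
    by rewrite upd_ne //; rewrite /bd; olra.
  have E u : bd r6 u -> w6 j u = Sf (upd c4 j (c4 j + u)) t0 - Sf c4 t0.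
    move=> Hu; rewrite (proj2 A6 _ (HB u Hu)).
    suff -> : sumY Y (fun i => w6 i (upd c4 j (c4 j + u) i - c4 i)) = w6 j u by olra.
    have Z i : In i Y -> w6 i (c4 i - c4 i) = 0.
      move=> Hi; (have -> : c4 i - c4 i = 0 by olra); apply: (ao0 r6) => //; by case: (proj1 A6 i Hi).
    elim: Y NDY Hj Z {IH ND Np A1 S1 H1 A3 S3 H3 A5 A6 S5 S6 A5' S64 HB B2 B4 Qd Lg aS} => [|i Y IHY] //= NDY Hj Z.
    have [Ni NDY'] : ~ In i Y /\ NoDup Y by inversion NDY.
    case: Hj => [Ei|Hj].
      subst i; rewrite upd_eq (_ : c4 j + u - c4 j = u); last by olra.
      rewrite sumY0 ?add0 // => i Hi; rewrite upd_ne; [by apply: Z; right|by move=> Eij; subst i].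
    by rewrite upd_ne ?Z ?add0l; [apply: IHY => //; move=> x Hx; apply: Z; right|left|move=> Eij; subst i].
  have := slope_rigid (fun u t => Sf (upd c4 j (c4 j + u)) t) r6 d1 t0.
  have -> : c4 j + 0 = c4 j by olra.
  rewrite upd_id => K Ht; rewrite (E t Ht); suff -> : Sf (upd c4 j (c4 j + t)) t0 = Sf c4 t0 by olra.
  apply: K => //; first by rewrite /Sf /g; ddef.
  - by move=> u Hu; apply: aS; apply: (proj2 S64); apply: HB.
  - have [_ aw] := proj1 A6 j Hj; move=> s s' Hs Hs' Hss; rewrite -!E //; exact: aw.
have Sc e : Box Y c4 r6 e -> forall t, bd d1 t -> Sf e t = Sf c4 t.
  move=> He t Ht; suff : Sf e t - Sf c4 t = 0 by olra.
  have HcB := proj2 S64 _ (box_center Y c4 r6 r6p).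
  apply: (ao_zero d1 (fun t => Sf e t - Sf c4 t) d1p _ _ t0) => //.
  - by have h1 := dS e; have h2 := dS c4; ddef.
  - by apply: addonB; apply: aS => //; apply: (proj2 S64).
  - rewrite (proj2 A6 e He) sumY0; first by olra.
    by move=> j Hj; apply: w0 => //; apply: (proj1 He).
have m1 := omin_lel r6 d1; have m2 := omin_ler r6 d1; set r7 := omin r6 d1 in m1 m2.
have tr7 : tall r7 by apply: tall_min.
have r7p := tall_pos _ tr7.
have Bp e : Box (p :: Y) (upd c4 p y0) r7 e -> Box Y c4 r6 (upd e p (c4 p)) /\ bd d1 (e p - y0).
  move=> [K1 K2]; split.
    split=> i Hi; first by have := K1 i (or_intror Hi); rewrite !upd_ne; try (by move=> E; subst i); rewrite /bd; olra.
    case: (Nat.eq_dec i p) => [->|Nip]; first by rewrite upd_eq.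
    by rewrite upd_ne // K2 ?upd_ne // => -[E|//]; subst i.
  by have := K1 p (or_introl eq_refl); rewrite upd_eq /bd; olra.
have FE e : Box (p :: Y) (upd c4 p y0) r7 e -> F e = g (upd e p (c4 p)) y0 + Sf c4 (e p - y0).
  move=> /Bp [K1 K2]; rewrite -(Sc _ K1 _ K2) /Sf /g !upd_upd.
  have -> : y0 + (e p - y0) = e p by olra.
  by rewrite upd_id; olra.
exists (upd c4 p y0), r7, (fun j => if Nat.eqb j p then Sf c4 else w5 j).
have S4 : subbox Y c4 r6 c r.
  apply: subbox_trans S64 _; apply: subbox_trans (subbox_le _ _ _ _ r43) _; apply: subbox_trans S3 _.
  by apply: subbox_trans (subbox_le _ _ _ _ r21) _.
split=> //; split.
  split; first by have := proj1 S4; olra.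
  move=> e He; have [K1 K2] := Bp e He; have [L1 L2] := proj2 S4 _ K1; split=> i.
    case=> [<-|Hi]; first by rewrite /bd in K2 *; olra.
    by have := L1 i Hi; rewrite upd_ne // => E; subst i.
  move=> Hi; have Nip : i <> p by move=> E; apply: Hi; left.
  by have := L2 i (fun K => Hi (or_intror K)); rewrite upd_ne.
split.
  move=> j [<-|Hj].
    rewrite Nat.eqb_refl; split; first exact: dS.
    apply: (addon_le r7 d1) => //; apply: aS; apply: (proj2 S64); exact: box_center.
  have Njp : j <> p by move=> E; subst j.
  have -> : Nat.eqb j p = false by apply/Nat.eqb_neq.
  by have [? ?] := proj1 A5' j Hj; split=> //; apply: (addon_le r7 r6).
move=> e He; have [K1 K2] := Bp e He; rewrite (FE e He) (FE _ (box_center _ _ _ r7p)) /= Nat.eqb_refl !upd_eq upd_upd upd_id.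
have Z : Sf c4 (y0 - y0) = 0 by (have -> : y0 - y0 = 0 by olra); apply: (ao0 d1) => //; apply: aS; apply: (proj2 S64); exact: box_center.
rewrite Z (proj2 A5' _ K1).
suff -> : sumY Y (fun j => (if Nat.eqb j p then Sf c4 else w5 j) (e j - upd c4 p y0 j)) = sumY Y (fun j => w5 j (upd e p (c4 p) j - c4 j)) by olra.
apply: sumY_ext => j Hj; have Njp : j <> p by move=> E; subst j.
by rewrite !upd_ne //; have -> : Nat.eqb j p = false by apply/Nat.eqb_neq.
Qed.

Lemma box_cons p Y c y0 r e : ~ In p Y -> Box (p :: Y) (upd c p y0) r e ->
  Box Y c r (upd e p (c p)) /\ bd r (e p - y0).
Proof.
move=> Np [K1 K2]; split.
  split=> i Hi; first by have := K1 i (or_intror Hi); rewrite !upd_ne //; move=> E; subst i.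
  case: (Nat.eq_dec i p) => [->|Nip]; first by rewrite upd_eq.
  by rewrite upd_ne // K2 ?upd_ne // => -[E|//]; subst i.
by have := K1 p (or_introl eq_refl); rewrite upd_eq.
Qed.
Lemma box_upd Y c r e j v : Box Y c r e -> In j Y -> bd r (v - c j) -> Box Y c r (upd e j v).
Proof.
move=> [H1 H2] Hj Hv; split=> i Hi.
  by case: (Nat.eq_dec i j) => [->|N]; [rewrite upd_eq|rewrite upd_ne //; apply: H1].
by rewrite upd_ne; [apply: H2|move=> E; subst i].
Qed.

(** The left endpoint of the interval is chosen definably and is affine, so on a smaller box it
    moves by less than a quarter of [q], and a common interval in the coordinate [l] remains. *)
Lemma tall_box Y l c r q (W : env -> Prop) : NoDup Y -> ~ In l Y -> Def W -> tall r -> tall q ->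
  (forall e, Box Y c r e -> exists a, forall z, a < z < a + q -> W (upd e l z)) ->
  exists c' r', tall r' /\ forall e, Box (l :: Y) c' r' e -> W e /\ Box Y c r (upd e l (c l)).
Proof.
move=> ND Nl dW tr tq H.
pose W' (e : env) a := forall z, a < z < a + q -> W (upd e l z).
have dW' : Def (fun e => W' (eshift e) (e 0%nat)) by rewrite /W'; ddef.
have [A [c1 [r1 [w [dA [tr1 [S1 [A1 H1]]]]]]]] := AFF_choice Y (AFF_all Y ND) W' c r dW' tr H.
have tqq : tall (hf (hf q)) by apply: tall_hf; apply: tall_hf.
have [r2 [tr2 [r21 B2]]] := aff_shrink Y c1 r1 A w _ tr1 tqq A1.
have m1 := omin_lel r2 (hf (hf q)); have m2 := omin_ler r2 (hf (hf q)).
exists (upd c1 l (A c1 + hf q)), (omin r2 (hf (hf q))); split; first exact: tall_min.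
move=> e /(box_cons _ _ _ _ _ _ Nl) [K1 K2].
have K1' : Box Y c1 r2 (upd e l (c1 l)) := proj2 (subbox_le _ _ _ _ m1) _ K1.
have K1'' := proj2 (subbox_le _ _ _ _ r21) _ K1'.
have cl : c1 l = c l by have := proj2 (proj2 S1 _ K1'') l Nl; rewrite upd_eq.
split; last by rewrite -cl; apply: (proj2 S1).
rewrite -(upd_id e l) -(upd_upd e l (c1 l)); apply: (H1 _ K1'').
by have := B2 _ K1'; have := tall_pos q tq; rewrite /bd in K2 *; olra.
Qed.

(** The truth value is coded by the numbers 0 and [r]. On a smaller tall box this function is affine
    and varies by less than [r], so it is constant. *)
Lemma dich_box Y c r (W : env -> Prop) : NoDup Y -> Def W -> tall r ->
  exists c' r', tall r' /\ subbox Y c' r' c r /\ ((forall e, Box Y c' r' e -> W e) \/ (forall e, Box Y c' r' e -> ~ W e)).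
Proof.
move=> ND dW tr; have r0 := tall_pos r tr.
pose W' (e : env) a := (W e /\ a = 0) \/ (~ W e /\ a = r).
have dW' : Def (fun e => W' (eshift e) (e 0%nat)) by rewrite /W'; ddef.
have [|A [c1 [r1 [w [dA [tr1 [S1 [A1 H1]]]]]]]] := AFF_choice Y (AFF_all Y ND) W' c r dW' tr.
  by move=> e _; case: (classic (W e)) => H; [exists 0; left|exists r; right].
have [r2 [tr2 [r21 B2]]] := aff_shrink Y c1 r1 A w _ tr1 tr A1.
exists c1, r2; split=> //; split; first exact: subbox_trans (subbox_le _ _ _ _ r21) S1.
have Hc := H1 c1 (box_center _ _ _ (tall_pos _ tr1)).
case: Hc => [] [Wc Ec]; [left|right] => e He; have := B2 e He; rewrite Ec;
  case: (H1 e (proj2 (subbox_le _ _ _ _ r21) e He)) => [] [We ->] //; rewrite /bd; olra.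
Qed.

Lemma list_box Y B (W : nat -> env -> Prop) : NoDup Y -> (forall l, In l B -> Def (W l)) -> forall c r, tall r ->
  (forall e, Box Y c r e -> exists l, In l B /\ W l e) ->
  exists l c' r', In l B /\ tall r' /\ subbox Y c' r' c r /\ forall e, Box Y c' r' e -> W l e.
Proof.
move=> ND; elim: B => [|l B IH] dW c r tr H.
  by have [l []] := H c (box_center _ _ _ (tall_pos _ tr)).
have [c1 [r1 [tr1 [S1 [K|K]]]]] := dich_box Y c r (W l) ND (dW l (or_introl eq_refl)) tr.
  by exists l, c1, r1; split; [left|].
have [||l' [c2 [r2 [Hl [tr2 [S2 K2]]]]]] := IH _ c1 r1 tr1.
- by move=> l' Hl'; apply: dW; right.
- move=> e He; have [l' [[<-|Hl'] We]] := H e (proj2 S1 e He); first by case: (K e He).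
  by exists l'.
by exists l', c2, r2; split; [right|split=> //; split=> //; apply: subbox_trans S2 S1].
Qed.

Definition agree (B : list nat) (e x : env) := forall i, ~ In i B -> x i = e i.
(** The coordinate [z] is quantified away, the others are chosen by induction, and [z] is chosen
    last. *)
Lemma choice_list Z : forall S : env -> Prop, Def S -> exists Phi : env -> env, (forall i, DT (fun e => Phi e i)) /\
  (forall e, agree Z e (Phi e)) /\ forall e, (exists x, agree Z e x /\ S x) -> S (Phi e).
Proof.
elim: Z => [|z Z IH] S dS.
  exists (fun e => e); split; first by move=> i; apply: dt_var.
  split=> // e [x [H Sx]]; suff <- : x = e by [].
  by apply: functional_extensionality => i; apply: H.
have [F [dF HF]] := def_choice (fun e => S (upd (eshift e) z (e 0%nat))) ltac:(ddef).
have [|Phi [dP [P1 P2]]] := IH (fun e => exists v, S (upd e z v)); first by ddef.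
exists (fun e => upd (Phi e) z (F (Phi e))); split.
  by apply: dt_upd => //; apply: (dt_comp F).
split=> [e i Hi|e [x [Hx Sx]]].
  by rewrite upd_ne; [apply: P1 => K; apply: Hi; right|move=> E; apply: Hi; left].
apply: (HF (Phi e)); apply: P2; exists (upd x z (e z)); split; last by exists (x z); rewrite upd_upd upd_id.
move=> i Hi; case: (Nat.eq_dec i z) => [->|N]; first by rewrite upd_eq.
by rewrite upd_ne //; apply: Hx => -[E|//]; apply: N.
Qed.

Lemma def_exl Z (S : env -> Prop) : Def S -> Def (fun e => exists x, agree Z e x /\ S x).
Proof.
move=> dS; have [Phi [dP [P1 P2]]] := choice_list Z S dS.
apply: (Def_ext (fun e => S (Phi e))); last by apply: def_comp.
by move=> e; split=> [H|]; [exists (Phi e)|apply: P2].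
Qed.

(* An affine sheet in S, parametrised by its pivot coordinates Y; Z lists the other coordinates. *)
Definition Sheet (Y Z : list nat) (c : env) (r : T) (Phi : env -> env) (w : nat -> nat -> T -> T) (S : env -> Prop) :=
  tall r /\ (forall i, DT (fun e => Phi e i)) /\ (forall e, agree Z e (Phi e)) /\
  (forall l, In l Z -> aff Y c r (fun e => Phi e l) (w l)) /\ forall e, Box Y c r e -> S (Phi e).

Lemma aff_list Y Z (Phi : env -> env) : NoDup Y -> (forall i, DT (fun e => Phi e i)) -> forall c r, tall r ->
  exists c' r' w, tall r' /\ subbox Y c' r' c r /\ forall l, In l Z -> aff Y c' r' (fun e => Phi e l) (w l).
Proof.
move=> ND dP; elim: Z => [|z Z IH] c r tr.
  by exists c, r, (fun _ _ _ => 0); split=> //; split; [apply: subbox_le; olra|].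
have [c1 [r1 [w1 [tr1 [S1 A1]]]]] := AFF_all Y ND _ c r (dP z) tr.
have [c2 [r2 [w2 [tr2 [S2 A2]]]]] := IH c1 r1 tr1.
exists c2, r2, (fun l => if Nat.eqb l z then w1 else w2 l); split=> //; split; first exact: subbox_trans S2 S1.
have Az := aff_sub _ _ _ _ _ _ _ (tall_pos _ tr2) S2 A1.
move=> l Hl; case: (Nat.eqb_spec l z) => [->//|N]; apply: A2.
by case: Hl => // E; case: N.
Qed.

Lemma sheet_ex Y Z c r (S : env -> Prop) : NoDup Y -> Def S -> tall r ->
  (forall e, Box Y c r e -> exists x, agree Z e x /\ S x) ->
  exists c' r' Phi w, subbox Y c' r' c r /\ Sheet Y Z c' r' Phi w S.
Proof.
move=> ND dS tr H; have [Phi [dP [P1 P2]]] := choice_list Z S dS.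
have [c1 [r1 [w [tr1 [S1 A1]]]]] := aff_list Y Z Phi ND dP c r tr.
exists c1, r1, Phi, w; split=> //; split=> //; split=> //; split=> //; split=> // e He.
by apply: P2; apply: H; apply: (proj2 S1).
Qed.

(** * From rich fibers to tall grids *)

Lemma oabsE (x : T) : (x < 0 /\ oabs G x = - x) \/ (0 <= x /\ oabs G x = x).
Proof.
have [||] := epsilon_spec (inhabits x) (fun b => (x < 0 /\ b = - x) \/ (~ x < 0 /\ b = x)).
- by case: (lt_le_dec x 0) => L; [exists (- x); left|exists x; right].
- by left.
- by right.
Qed.
Lemma oabs_ge0 x : 0 <= oabs G x. Proof. by case: (oabsE x) => [] [? ->]; olra. Qed.
Lemma oabsN x : oabs G (- x) = oabs G x.
Proof. by case: (oabsE x) => [] [? ->]; case: (oabsE (- x)) => [] [? ->]; olra. Qed.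

Lemma sumY_upd Y j g g' : NoDup Y -> In j Y -> (forall i, In i Y -> i <> j -> g' i = g i) ->
  sumY Y g' = sumY Y g + (g' j - g j).
Proof.
elim: Y => [|i Y IH] //= ND Hj H; have [Ni NDY] : ~ In i Y /\ NoDup Y by inversion ND.
case: (Nat.eq_dec i j) => [E|N].
  subst i; rewrite -!/(sumY _ _); suff -> : sumY Y g' = sumY Y g by olra.
  by apply: sumY_ext => i Hi; apply: H; [right|move=> E; subst i].
rewrite -!/(sumY _ _) IH //; first by rewrite H //; [olra|left].
- by case: Hj.
- by move=> x Hx; apply: H; right.
Qed.
Lemma aff_dir Y c r F w e j t : NoDup Y -> In j Y -> 0 < r -> aff Y c r F w -> Box Y c r e -> bd r t -> bd r (e j - c j + t) ->
  F (upd e j (e j + t)) = F e + w j t.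
Proof.
move=> ND Hj r0 [D A] He Ht Het.
have He' : Box Y c r (upd e j (e j + t)).
  by apply: box_upd => //; have -> : e j + t - c j = e j - c j + t by olra.
rewrite (A _ He') (A _ He) (sumY_upd Y j (fun j => w j (e j - c j))) // ; last by move=> i _ N; rewrite upd_ne.
rewrite upd_eq; have -> : e j + t - c j = e j - c j + t by olra.
by rewrite (proj2 (D j Hj)) //; [olra|apply: (proj1 He)].
Qed.

(** Each additive map has a constant sign on positive arguments, so there its absolute value is
    additive as well. *)
Lemma sum_abs_add B r (lam : nat -> T -> T) : 0 < r -> (forall i, In i B -> df1 (lam i) /\ addon r (lam i)) ->
  exists psi, df1 psi /\ addon r psi /\ forall t, 0 < t < r -> psi t = sumY B (fun i => oabs G (lam i t)).
Proof.
move=> r0; elim: B => [|i B IH] H.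
  by exists (fun _ => 0); split; [ddef|split=> // s t _ _ _; olra].
have [|psi [dp [ap Hp]]] := IH; first by move=> x Hx; apply: H; right.
have [di ai] := H i (or_introl eq_refl).
have W l : df1 l -> addon r l -> (forall t, 0 < t < r -> oabs G (lam i t) = l t) ->
  exists psi, df1 psi /\ addon r psi /\ forall t, 0 < t < r -> psi t = sumY (i :: B) (fun i => oabs G (lam i t)).
  move=> dl al E; exists (fun t => l t + psi t); split; first by ddef.
  split; first by move=> s t Hs Ht Hst; rewrite al // ap //; olra.
  by move=> t Ht; rewrite Hp // sumY_cons E.
case: (ao_sign r (lam i) r0 di ai) => [Z|[Z|Z]].
- apply: (W (lam i)) => // t Ht; rewrite Z; last by rewrite /bd; olra.
  by case: (oabsE 0) => [] [? ->]; olra.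
- by apply: (W (lam i)) => // t Ht; have := Z t Ht; case: (oabsE (lam i t)) => [] [? ->]; olra.
- apply: (W (fun t => - lam i t)); [by ddef|exact: addonN|].
  by move=> t Ht; have := Z t Ht; case: (oabsE (lam i t)) => [] [? ->]; olra.
Qed.

Lemma dbl_hfn n (e : T) : dbl n (hfn n e) = e.
Proof. by elim: n e => //= n IH e; rewrite -dblD hfE. Qed.
Lemma df_dbl n : df1 (dbl n).
Proof. by elim: n => [|n IH] /=; ddef. Qed.
Lemma dbl_ge n t : 0 < t -> t <= dbl n t.
Proof. by move=> t0; elim: n => [|n IH] /=; olra. Qed.
(** With [x = e / 2^(k+1)] the difference is [2^(k+1) x - x], a positive additive function of the
    tall element [x]. *)
Lemma tall_diff k e : tall e -> tall (e - hfn (S k) e).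
Proof.
move=> te; have tx := tall_hfn (S k) e te; set x := hfn (S k) e in tx *; have x0 := tall_pos _ tx.
have E : e = dbl (S k) x by rewrite /x dbl_hfn.
rewrite E; have dd := df_dbl (S k).
apply: (ao_tall (x + x) (fun t => dbl (S k) t - t)); rewrite //; try olra.
- by ddef.
- by move=> s t _ _ _; rewrite dblD; olra.
- by move=> t Ht /=; have := dbl_ge k t (proj1 Ht); olra.
Qed.
Lemma tall_hfn_diff n n' e : (n < n')%nat -> tall e -> tall (hfn n e - hfn n' e).
Proof.
move=> L te; have -> : n' = (S (n' - n - 1) + n)%nat by lia.
by rewrite -hfn_add; apply: tall_diff; apply: tall_hfn.
Qed.

Lemma def_list {A} (L : list A) (P : A -> env -> Prop) : (forall i, In i L -> Def (P i)) -> Def (fun e => forall i, In i L -> P i e).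
Proof.
elim: L => [|a L IH] H; first by apply: (Def_ext (fun _ => True)); [move=> e; split|apply: def_const].
apply: (Def_ext (fun e => P a e /\ forall i, In i L -> P i e)).
  move=> e; split=> [[H1 H2] i [<-|]|K] //; first exact: H2.
  by split=> [|i Hi]; apply: K; [left|right].
by apply: def_and; [apply: H; left|apply: IH => i Hi; apply: H; right].
Qed.
Lemma def_list_ex L (P : nat -> env -> Prop) : (forall i, In i L -> Def (P i)) -> Def (fun e => exists i, In i L /\ P i e).
Proof.
move=> H; apply: (Def_ext (fun e => ~ forall i, In i L -> ~ P i e)).
  move=> e; split=> [N|[i [Hi K]] N]; last exact: N i Hi K.
  by apply: NNPP => K; apply: N => i Hi Pi; apply: K; exists i.
by apply: def_not; apply: def_list => i Hi; apply: def_not; apply: H.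
Qed.

Notation rem j L := (List.remove Nat.eq_dec j L).
Lemma rem_in i j L : In i (rem j L) <-> In i L /\ i <> j.
Proof. by split=> [H|[? ?]]; [apply: in_remove H|apply: in_in_remove]. Qed.
Lemma rem_nodup j L : NoDup L -> NoDup (rem j L).
Proof.
elim: L => [|a L IH] //= H; have [Na NL] : ~ In a L /\ NoDup L by inversion H.
case: Nat.eq_dec => // N; first exact: IH.
by constructor; [rewrite rem_in => -[]|apply: IH].
Qed.
Lemma rem_length j L : NoDup L -> In j L -> S (length (rem j L)) = length L.
Proof.
elim: L => [|a L IH] //= H Hj; have [Na NL] : ~ In a L /\ NoDup L by inversion H.
case: Nat.eq_dec => [E|N] /=.
  by subst a; rewrite notin_remove.
by rewrite IH //; case: Hj => // E; case: N.
Qed.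

(** * Affine sheets and directions inside blocks *)

Section Core.
Variables (P : env -> Prop) (Bks : list (list nat)) (m qv : nat).
Hypotheses (dP : Def P) (HB : concat Bks = seq 0 m) (Hq : (m <= qv)%nat).
Let Cs := seq 0 m.
Let qC : ~ In qv Cs. Proof. by rewrite /Cs in_seq; lia. Qed.
Let BC B i : In B Bks -> In i B -> In i Cs.
Proof. by move=> H1 H2; rewrite /Cs -HB; apply/in_concat; exists B. Qed.

(** In the fiber over a block only the coordinates of [B] vary. Keeping [l] fixed as well expresses
    that [e l] lies in the projection of this fiber to [l]. *)
Definition Proj (S : env -> Prop) (B : list nat) (l : nat) (e : env) := exists x, agree (rem l B) e x /\ S x.
Definition Rich (S : env -> Prop) B l (e : env) := exists a, forall z, a < z < a + e qv -> Proj S B l (upd e l z).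
(* St (n + 1) discards from St n the points having a block over which no coordinate projection of the
   fiber contains an interval of length e qv; the variable qv holds the length q. *)
Fixpoint St (n : nat) (e : env) : Prop :=
  match n with O => P e | S n => St n e /\ forall B, In B Bks -> exists l, In l B /\ Rich (St n) B l e end.
Lemma def_Proj S B l : Def S -> Def (Proj S B l). Proof. exact: def_exl. Qed.
Lemma def_Rich S B l : Def S -> Def (Rich S B l).
Proof. by move=> /(def_Proj S B l) dS; rewrite /Rich; ddef. Qed.
Lemma def_St n : Def (St n).
Proof.
elim: n => [|n IH] //=; apply: def_and => //; apply: def_list => B _.
by apply: def_list_ex => l _; apply: def_Rich.
Qed.
Lemma St_P n e : St n e -> P e. Proof. by elim: n => //= n IH [] /IH. Qed.

Definition part (Y Z : list nat) := NoDup Y /\ (forall i, In i Y -> ~ In i Z) /\ forall i, In i Cs <-> In i Y \/ In i Z.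
Definition SheetIn (c0 : env) (S : env -> Prop) p := exists Y Z c r Phi w,
  part Y Z /\ length Y = p /\ agree Cs c0 c /\ Sheet Y Z c r Phi w S.

(** Richness of [B] at the points of the sheet gives a tall interval of values of some coordinate
    [l] in [B], attained by points of [St n]. No pivot lies in [B], so moving inside the fiber
    leaves the pivots alone and [l] becomes a new one. *)
Lemma sheet_extend c0 Y Z c r Phi w n B : part Y Z -> agree Cs c0 c -> tall (c0 qv) -> Sheet Y Z c r Phi w (St (S n)) ->
  In B Bks -> (forall j, In j Y -> ~ In j B) -> SheetIn c0 (St n) (S (length Y)).
Proof.
move=> [ND [YZ CYZ]] Hc tq [tr [dPhi [aPhi [AP SP]]]] HBk YB.
(* The coordinate [l] depends on the point of the sheet; a smaller tall box makes it constant. *)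
have [||l [c1 [r1 [Hl [tr1 [S1 H1]]]]]] := list_box Y B (fun l e => Rich (St n) B l (Phi e)) ND _ c r tr.
- by move=> l _; apply: def_comp => //; apply: def_Rich; apply: def_St.
- by move=> e /SP [_ /(_ B HBk)].
have lY : ~ In l Y by move=> K; apply: (YB l K).
have lZ : In l Z by have /CYZ [] := BC B l HBk Hl.
have qZ : ~ In qv Z by move=> K; apply: qC; apply/CYZ; right.
have qY : ~ In qv Y by move=> K; apply: qC; apply/CYZ; left.
have Hc1 : Box Y c r c1 by apply: (proj2 S1); apply: box_center; apply: tall_pos.
pose W e := Proj (St n) B l (upd (Phi (upd e l (c1 l))) l (e l)).
have dW : Def W.
  have dR := def_Proj (St n) B l (def_St n); rewrite /W; apply: (def_comp _ _ dR).
  apply: dt_upd; last by apply: dt_var.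
  by move=> i; have dPi := dPhi i; apply: (dt_comp (fun e => Phi e i)) => //; apply: dt_upd; [move=> *; apply: dt_var|apply: dt_const].
have [|c2 [r2 [tr2 H2]]] := tall_box Y l c1 r1 (c0 qv) W ND lY dW tr1 tq.
  move=> e He; have [a Ha] := H1 e He; exists a => z Hz; rewrite /W upd_upd upd_eq.
  have -> : upd e l (c1 l) = e by rewrite -(proj2 He l lY) upd_id.
  apply: Ha; suff -> : Phi e qv = c0 qv by [].
  by rewrite aPhi // (proj2 He) // (proj2 Hc1) // Hc.
have [||c3 [r3 [Phi3 [w3 [S3 Sh]]]]] := sheet_ex (l :: Y) (rem l Z) c2 r2 (St n) _ (def_St n) tr2; first by constructor.
  move=> e He; have [[x [Hx Sx]] He0] := H2 e He; exists x; split=> // i Hi.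
  case: (Nat.eq_dec i l) => [->|N]; first by rewrite Hx ?upd_eq // rem_in => -[].
  have iZ : ~ In i Z by move=> K; apply: Hi; rewrite rem_in.
  rewrite Hx; first by rewrite upd_ne // aPhi // upd_ne.
  rewrite rem_in => -[Hi' _]; have /CYZ [K|//] := BC B i HBk Hi'; exact: YB K Hi'.
exists (l :: Y), (rem l Z), c3, r3, Phi3, w3; split.
  split; first by constructor.
  split=> [i [<-|Hi]|i]; first by rewrite rem_in => -[].
    by rewrite rem_in => -[K _]; apply: YZ K.
  rewrite CYZ /= rem_in; case: (Nat.eq_dec i l) => [->|N]; first by split=> _; [left; left|right].
  by split=> [[?|?]|[[?|?]|[? ?]]]; auto; subst i.
split=> //; split=> // i Hi.
have iY : ~ In i Y by move=> K; apply: Hi; apply/CYZ; left.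
have il : i <> l by move=> E; apply: Hi; apply/CYZ; right; rewrite E.
have [_ /(_ i)] := proj2 S3 c3 (box_center _ _ _ (tall_pos _ (proj1 Sh))).
move=> ->; last by case=> // E; apply: il.
have [_ [_ /(_ i iY)]] := H2 c2 (box_center _ _ _ (tall_pos _ tr2)).
by rewrite upd_ne // => ->; rewrite (proj2 Hc1) // Hc.
Qed.

Definition zr (Z : list nat) (c x : env) : env := fun i => match in_dec Nat.eq_dec i Z with left _ => c i | right _ => x i end.
(* membership in the graph of Phi over Box Y c r, read off the pivot coordinates of x *)
Definition onsheet (Y Z : list nat) (c : env) r (Phi : env -> env) (x : env) :=
  (forall i, In i Y -> bd r (x i - c i)) /\ forall i, In i Z -> x i = Phi (zr Z c x) i.
Lemma def_onsheet Y Z c r Phi : (forall i, DT (fun e => Phi e i)) -> Def (onsheet Y Z c r Phi).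
Proof.
move=> dPhi; apply: def_and; apply: def_list => i _; first by rewrite /bd; ddef.
apply: def_eq; first exact: dt_var.
apply: (dt_comp (fun e => Phi e i)) => // j; rewrite /zr; case: in_dec => _; [exact: dt_const|exact: dt_var].
Qed.
Lemma onsheet_pt Y Z c r Phi e : part Y Z -> (forall e, agree Z e (Phi e)) -> Box Y c r e -> onsheet Y Z c r Phi (Phi e).
Proof.
move=> [ND [YZ CYZ]] aPhi He; have E : zr Z c (Phi e) = e.
  apply: functional_extensionality => i; rewrite /zr; case: in_dec => Hi; last exact: aPhi.
  by rewrite (proj2 He) // => /YZ.
split=> i Hi; last by rewrite E.
by rewrite aPhi; [apply: (proj1 He)|apply: YZ].
Qed.
Lemma onsheetP Y Z c r Phi x : part Y Z -> (forall e, agree Z e (Phi e)) -> agree Cs c x -> onsheet Y Z c r Phi x ->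
  exists e, Box Y c r e /\ Phi e = x.
Proof.
move=> [ND [YZ CYZ]] aPhi Hx [H1 H2]; exists (zr Z c x); split.
  split=> i Hi; rewrite /zr; case: in_dec => Hz //; [by case: (YZ i Hi)|by apply: H1|].
  by apply: Hx => /CYZ [].
apply: functional_extensionality => i; case: (in_dec Nat.eq_dec i Z) => Hi; first by rewrite -H2.
by rewrite aPhi // /zr; case: in_dec.
Qed.

(** The coordinate [l] is a nonzero, hence invertible, additive function of the pivot [j], so on a
    tall interval the two can be exchanged without leaving the sheet. *)
Lemma repivot Y Z c r Phi w S j l t1 : part Y Z -> Sheet Y Z c r Phi w S -> In j Y -> In l Z -> bd r t1 -> w l j t1 <> 0 ->
  exists Z' c' r' Phi' w', part (l :: rem j Y) Z' /\ agree Cs c c' /\ Sheet (l :: rem j Y) Z' c' r' Phi' w' (onsheet Y Z c r Phi).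
Proof.
move=> pt [tr [dPhi [aPhi [AP SP]]]] Hj Hl Ht1 Nz; have [ND [YZ CYZ]] := pt; have r0 := tall_pos r tr.
have lY : ~ In l Y by move=> /YZ.
have [dl al] := proj1 (AP l Hl) j Hj.
have jY0 : ~ In j (rem j Y) by rewrite rem_in => -[].
have lY0 : ~ In l (rem j Y) by rewrite rem_in => -[].
have jl : j <> l by move=> E; apply: lY; rewrite -E.
have NDY0 : NoDup (rem j Y) by apply: rem_nodup.
have BY e t : Box (rem j Y) c r e -> bd r t -> Box Y c r (upd e j (c j + t)).
  move=> [K1 K2] Ht; split=> i Hi; case: (Nat.eq_dec i j) => [E|N].
  - by subst i; rewrite upd_eq; have -> : c j + t - c j = t by olra.
  - by rewrite upd_ne //; apply: K1; rewrite rem_in.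
  - by subst i.
  - by rewrite upd_ne //; apply: K2; rewrite rem_in => -[].
have Be e : Box (rem j Y) c r e -> Box Y c r e.
  move=> He; have -> : e = upd e j (c j + 0); last by apply: BY => //; rewrite /bd; olra.
  by rewrite add0 -(proj2 He j jY0) upd_id.
have D e t : Box (rem j Y) c r e -> bd r t -> Phi (upd e j (c j + t)) l = Phi e l + w l j t.
  move=> He Ht; have ej := proj2 He j jY0; rewrite -{1}ej.
  apply: (aff_dir Y c r (fun e => Phi e l) (w l)) => //; [exact: AP|exact: Be|].
  by rewrite ej; have -> : c j - c j + t = t by olra.
pose W e := exists t, bd r t /\ e l = Phi (upd (upd e l (c l)) j (c j + t)) l.
have dW : Def W by have dPl := dPhi l; rewrite /W /bd; ddef; apply: (dt_comp (fun e => Phi e l)) => //; apply: dt_upd; [apply: dt_upd; [move=> i; apply: dt_var|apply: dt_const]|ddef].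
have [q [tq Hq']] : exists q, tall q /\ forall e, Box (rem j Y) c r e -> exists a, forall z, a < z < a + q -> W (upd e l z).
  have th := tall_hf r tr.
  have X e z t : Box (rem j Y) c r e -> bd r t -> z = Phi e l + w l j t -> W (upd e l z).
    move=> He Ht E; exists t; split=> //; rewrite upd_eq upd_upd E.
    by rewrite -(proj2 He l lY0) upd_id D.
  case: (ao_sign r (w l j) r0 dl al) => [K|[K|K]]; first by case: Nz; apply: K.
    exists (w l j (hf r)); split; first by apply: (ao_tall r (w l j)) => //; olra.
    move=> e He; exists (Phi e l) => z Hz.
    have [s [Hs Es]] := ao_ivt r (w l j) r0 dl al (hf r) (z - Phi e l) K ltac:(olra) ltac:(olra).
    by apply: (X e z s) => //; [rewrite /bd; olra|rewrite Es; olra].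
  have K' t : 0 < t < r -> 0 < - w l j t by move=> /K; olra.
  have dl' : df1 (fun t => - w l j t) by ddef.
  have al' := addonN _ _ al.
  exists (- w l j (hf r)); split; first by apply: (ao_tall r (fun t => - w l j t)) => //; olra.
  move=> e He; exists (Phi e l - - w l j (hf r)) => z Hz.
  have [s [Hs Es]] := ao_ivt r _ r0 dl' al' (hf r) (Phi e l - z) K' ltac:(olra) ltac:(olra).
  by apply: (X e z s) => //; [rewrite /bd; olra|olra].
have [c2 [r2 [tr2 H2]]] := tall_box (rem j Y) l c r q W NDY0 lY0 dW tr tq Hq'.
have [||c3 [r3 [Phi3 [w3 [S3 Sh]]]]] := sheet_ex (l :: rem j Y) (j :: rem l Z) c2 r2 (onsheet Y Z c r Phi) _ (def_onsheet _ _ _ _ _ dPhi) tr2.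
- by constructor.
- move=> e He; have [[t [Ht Et]] He0] := H2 e He.
  have He1 := BY _ t He0 Ht.
  exists (Phi (upd (upd e l (c l)) j (c j + t))); split; last exact: onsheet_pt.
  move=> i Hi; case: (Nat.eq_dec i l) => [->|il]; first by rewrite -Et.
  have ij : i <> j by move=> E; apply: Hi; left.
  by rewrite aPhi; [rewrite !upd_ne|move=> K; apply: Hi; right; rewrite rem_in].
exists (j :: rem l Z), c3, r3, Phi3, w3; split.
  split; first by constructor.
  split=> [i [<-|/rem_in [Hi ij]]|i]; first by case=> [E|/rem_in []].
    by case=> [E|/rem_in [K _]]; [case: ij|apply: YZ K].
  rewrite CYZ /= !rem_in; case: (Nat.eq_dec i l) => [->|N]; first by split=> _; [left; left|right].
  case: (Nat.eq_dec i j) => [->|N']; first by split=> _; [right; left|left].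
  by split=> [[?|?]|[[?|[? ?]]|[?|[? ?]]]]; auto; subst i.
split=> // i Hi.
have iY : ~ In i Y by move=> K; apply: Hi; apply/CYZ; left.
have il : i <> l by move=> E; apply: Hi; apply/CYZ; right; rewrite E.
have [_ /(_ i)] := proj2 S3 c3 (box_center _ _ _ (tall_pos _ (proj1 Sh))).
move=> ->; last by case=> [E|/rem_in []] //; apply: il.
have [_ [_ /(_ i)]] := H2 c2 (box_center _ _ _ (tall_pos _ tr2)).
by rewrite upd_ne // => -> //; rewrite rem_in => -[].
Qed.

Definition sabs (B : list nat) (u : nat -> T) := sumY B (fun i => oabs G (u i)).
(** Displacements that move only the block and are pairwise at tall distance; added to one point
    they produce an infinite tall set. *)
Definition tall_dirs (B : list nat) (v : nat -> env) := (forall n i, ~ In i B -> v n i = 0) /\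
  forall n n', n <> n' -> tall (sabs B (fun i => v n i - v n' i)).

Lemma sabs_sym B u u' : sabs B (fun i => u i - u' i) = sabs B (fun i => u' i - u i).
Proof. by apply: sumY_ext => i _; rewrite -oabsN; congr oabs; olra. Qed.
Lemma sabs_ge B u j : In j B -> oabs G (u j) <= sabs B u.
Proof.
elim: B => [|i B IH] //; rewrite /sabs sumY_cons -/(sabs B u) => -[<-|/IH].
  suff : 0 <= sabs B u by olra.
  elim: B {IH} => [|k B IH]; first by rewrite /sabs /=; olra.
  by rewrite /sabs sumY_cons -/(sabs B u); have := oabs_ge0 (u k); olra.
by have := oabs_ge0 (u i); olra.
Qed.

(* Either a pivot inside B gives a direction of the sheet contained in B, or it can be exchanged for a
   coordinate outside B. *)
Lemma block_direction c0 B S p : In B Bks -> ~ (exists Y Z c r Phi w, part Y Z /\ length Y = p /\ agree Cs c0 c /\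
    Sheet Y Z c r Phi w S /\ forall j, In j Y -> ~ In j B) ->
  forall k Y Z c r Phi w, length (filter (fun j => match in_dec Nat.eq_dec j B with left _ => true | right _ => false end) Y) = k ->
    part Y Z -> length Y = p -> agree Cs c0 c -> Sheet Y Z c r Phi w S ->
  exists Y' Z' c' r' Phi' w' v, part Y' Z' /\ length Y' = p /\ agree Cs c0 c' /\ Sheet Y' Z' c' r' Phi' w' S /\ tall_dirs B v /\
    forall e', Box Y' c' r' e' -> forall n, exists e, Box Y c r e /\ forall i, Phi e i = Phi' e' i + v n i.
Proof.
(* Induction on the number of pivots in [B]: each exchange lowers it, and it cannot reach 0 because
   by [NE] some pivot lies in [B]. *)
move=> HBk NE; elim/(well_founded_induction lt_wf) => k IH Y Z c r Phi w Hk pt Hp Hc Sh.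
have [ND [YZ CYZ]] := pt; have [tr [dPhi [aPhi [AP SP]]]] := Sh; have r0 := tall_pos r tr.
have [j [Hj HjB]] : exists j, In j Y /\ In j B.
  apply: NNPP => K; apply: NE; exists Y, Z, c, r, Phi, w; split=> //; split=> //; split=> //; split=> // j H1 H2.
  by apply: K; exists j.
case: (classic (exists l t, In l Z /\ ~ In l B /\ bd r t /\ w l j t <> 0)) => [[l [t [Hl [lB [Ht Nz]]]]]|Nl].
  have [Z1 [c1 [r1 [Phi1 [w1 [pt1 [Hc1 Sh1]]]]]]] := repivot Y Z c r Phi w S j l t pt Sh Hj Hl Ht Nz.
  have Hc01 : agree Cs c0 c1 by move=> i Hi; rewrite Hc1 // Hc.
  have on e1 : Box (l :: rem j Y) c1 r1 e1 -> exists e, Box Y c r e /\ Phi e = Phi1 e1.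
    move=> He1; have [_ [_ [aP1 [_ SP1]]]] := Sh1; apply: (onsheetP Y Z) => //; last exact: SP1.
    have [_ [_ CYZ1]] := pt1.
    move=> i Hi; rewrite aP1; last by move=> K; apply: Hi; apply/CYZ1; right.
    by rewrite (proj2 He1) ?Hc1 // => K; apply: Hi; apply/CYZ1; left.
  have Sh1' : Sheet (l :: rem j Y) Z1 c1 r1 Phi1 w1 S.
    have [? [? [? [? SP1]]]] := Sh1; split=> //; split=> //; split=> //; split=> // e1 He1.
    by have [e [He <-]] := on e1 He1; apply: SP.
  have L1 : length (l :: rem j Y) = p by rewrite /= rem_length.
  have [|Y2 [Z2 [c2 [r2 [Phi2 [w2 [v [? [? [? [? [? H2]]]]]]]]]]]] := IH _ _ (l :: rem j Y) Z1 c1 r1 Phi1 w1 Logic.eq_refl pt1 L1 Hc01 Sh1'.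
    rewrite -Hk /=; case: in_dec => [K|_] //.
    elim: Y ND Hj {Hk pt Hp Sh CYZ AP SP YZ Sh1 on Sh1' L1 pt1} => [|y Y IHY] //= ND Hj.
    have [Ny NDY] : ~ In y Y /\ NoDup Y by inversion ND.
    case: Nat.eq_dec => [E|N] /=; first by subst y; rewrite notin_remove //; case: in_dec => //= _; lia.
    have Hj' : In j Y by case: Hj => // E; case: N.
    by have := IHY NDY Hj'; case: in_dec => /= _; lia.
  exists Y2, Z2, c2, r2, Phi2, w2, v; do 5!split=> //; move=> e' He' n.
  have [e1 [He1 E1]] := H2 e' He' n; have [e [He E]] := on e1 He1.
  by exists e; split=> // i; rewrite E E1.
(* Coordinates outside [B] do not react to the pivot [j], so moving [j] by [t] displaces the point
   by [lam i t] inside the block. *)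
pose lam i t := match Nat.eq_dec i j with left _ => t | right _ => match in_dec Nat.eq_dec i Z with left _ => w i j t | right _ => 0 end end.
have jZ : ~ In j Z by apply: YZ.
have hl i : df1 (lam i) /\ addon r (lam i).
  rewrite /lam; case: Nat.eq_dec => _; first by split; [ddef|].
  case: in_dec => Hi; first exact: (proj1 (AP i Hi)).
  by split; [ddef|move=> s t _ _ _; olra].
(* The pivot is moved by [r / 2^(n+1)]; these lengths are pairwise at tall distance by
   [tall_hfn_diff]. *)
pose tn n := hfn (Datatypes.S n) r; have tnt n : tall (tn n) by apply: tall_hfn.
have tnr n : 0 < tn n <= hf r.
  by have := tall_pos _ (tnt n); rewrite /tn hfn_S; have := hfn_le n (hf r) ltac:(olra); olra.
have lamB i t : ~ In i B -> bd r t -> lam i t = 0.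
  move=> Hi Ht; rewrite /lam; case: Nat.eq_dec => [E|_]; first by subst i.
  by case: in_dec => // HZ; apply: NNPP => K; apply: Nl; exists i, t.
have hr : hf r <= r by olra.
have Hs := subbox_le Y c r (hf r) hr.
(* The box is halved so that a move of at most [hf r] along [j] stays in the original one. *)
exists Y, Z, c, (hf r), Phi, w, (fun n i => lam i (tn n)).
split=> //; split=> //; split=> //; split.
  split; first exact: tall_hf.
  split=> //; split=> //; split=> [l Hl|e He]; first by apply: aff_sub Hs (AP l Hl); olra.
  by apply: SP; apply: (proj2 Hs).
split.
  split; first by move=> n i Hi; apply: lamB => //; have := tnr n; rewrite /bd; olra.
  have [psi [dpsi [apsi Hpsi]]] := sum_abs_add B r lam r0 (fun i _ => hl i).
  have Pp t : 0 < t < r -> 0 < psi t.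
    move=> Ht; rewrite Hpsi //; have := sabs_ge B (fun i => lam i t) j HjB.
    by rewrite /sabs /lam; case: Nat.eq_dec => // _; case: (oabsE t) => [] [? ->]; olra.
  have W n n' : (n < n')%nat -> tall (sabs B (fun i => lam i (tn n) - lam i (tn n'))).
    move=> L; have td : tall (tn n - tn n') by apply: tall_hfn_diff => //; lia.
    have d0 := tall_pos _ td; have h1 := tnr n; have h2 := tnr n'.
    have -> : sabs B (fun i => lam i (tn n) - lam i (tn n')) = psi (tn n - tn n').
      rewrite Hpsi; last by olra.
      by apply: sumY_ext => i _; rewrite (aoB r (lam i)) //; [exact: (proj2 (hl i))|rewrite /bd; olra..].
    by apply: (ao_tall r psi) => //; olra.
  move=> n n' N; have [L|L] : (n < n' \/ n' < n)%nat by lia.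
    exact: W.
  by rewrite sabs_sym; apply: W.
move=> e' He' n; have h1 := tnr n; have He := proj2 Hs _ He'.
have bj := proj1 He' j Hj.
have b1 : bd r (tn n) by rewrite /bd; olra.
have b2 : bd r (e' j - c j + tn n) by rewrite /bd in bj *; olra.
exists (upd e' j (e' j + tn n)); split.
  by apply: box_upd => //; have -> : e' j + tn n - c j = e' j - c j + tn n by olra.
move=> i; rewrite /lam; case: Nat.eq_dec => [E|N]; first by subst i; rewrite !aPhi // upd_eq.
case: in_dec => Hi; last by rewrite !aPhi // upd_ne // add0.
exact: (aff_dir Y c r (fun e => Phi e i) (w i) e' j (tn n) ND Hj r0 (AP i Hi) He b1 b2).
Qed.

(** Blocks are treated one at a time, each passing to a sheet with the same number of pivots whose
    translates by the displacements of that block stay in the previous sheet. *)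
Lemma grid_in_sheet c0 S p : (forall B, In B Bks -> ~ (exists Y Z c r Phi w, part Y Z /\ length Y = p /\ agree Cs c0 c /\
    Sheet Y Z c r Phi w S /\ forall j, In j Y -> ~ In j B)) ->
  forall Bs, incl Bs Bks -> forall Y Z c r Phi w, part Y Z -> length Y = p -> agree Cs c0 c -> Sheet Y Z c r Phi w S ->
  exists x vs, Forall2 tall_dirs Bs vs /\ forall ns, length ns = length vs ->
    exists e, Box Y c r e /\ forall i, Phi e i = x i + fold_right (fun vn s => fst vn (snd vn) i + s) 0 (combine vs ns).
Proof.
move=> NE; elim=> [|B Bs IH] Hi Y Z c r Phi w pt Hp Hc Sh.
  exists (Phi c), []; split=> // -[|//] _; exists c; split; first by apply: box_center; apply: tall_pos; apply: (proj1 Sh).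
  by move=> i /=; rewrite add0.
have HBk : In B Bks by apply: Hi; left.
have [Y1 [Z1 [c1 [r1 [Phi1 [w1 [v [pt1 [Hp1 [Hc1 [Sh1 [tv H1]]]]]]]]]]]] := block_direction c0 B S p HBk (NE B HBk) _ Y Z c r Phi w Logic.eq_refl pt Hp Hc Sh.
have [x [vs [F2 H2]]] := IH (fun B' H => Hi B' (or_intror H)) Y1 Z1 c1 r1 Phi1 w1 pt1 Hp1 Hc1 Sh1.
exists x, (v :: vs); split; first by constructor.
case=> [|n ns] //= -[L]; have [e1 [He1 E1]] := H2 ns L; have [e [He E]] := H1 e1 He1 n.
by exists e; split=> // i; rewrite E E1 -addA (addC _ (v n i)).
Qed.

Theorem rich_grid c0 : tall (c0 qv) -> St (S m) c0 -> exists x vs, Forall2 tall_dirs Bks vs /\ agree Cs c0 x /\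
  forall ns, length ns = length vs -> P (fun i => x i + fold_right (fun vn s => fst vn (snd vn) i + s) 0 (combine vs ns)).
Proof.
move=> tq H0.
have S0 : SheetIn c0 (St (S m)) 0.
  exists [], Cs, c0, (c0 qv), (fun e => e), (fun _ _ _ => 0); split.
    by split; [constructor|split=> // i; split=> [|[]] //; right].
  split=> //; split=> //; split=> //; split; first by move=> i; apply: dt_var.
  have E e : Box [] c0 (c0 qv) e -> e = c0 by move=> [_ H]; apply: functional_extensionality => i; apply: H.
  split=> //; split=> [l _|e /E ->] //; split=> // e /E -> /=; by rewrite add0.
have Sle q S : SheetIn c0 S q -> (q <= m)%nat.
  move=> [Y [Z [c [r [Phi [w [[ND [_ CYZ]] [<- _]]]]]]]].
  have <- : length Cs = m by rewrite /Cs length_seq.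
  by apply: NoDup_incl_length => // i Hi; apply/CYZ; left.
(* Raising the number of pivots costs one stage. It is 0 in stage [m + 1] and never exceeds [m], so
   it stops at some [p]; then by [sheet_extend] every sheet with [p] pivots in that stage has a
   pivot in each block. *)
have [p [Hp [Sp Np]]] : exists p, (p <= m)%nat /\ SheetIn c0 (St (S (m - p))) p /\ ~ SheetIn c0 (St (m - p)) (S p).
  apply: NNPP => K.
  have A p : (p <= m)%nat -> SheetIn c0 (St (S (m - p))) p.
    elim: p => [|p IH] L; first by rewrite Nat.sub_0_r.
    have Hp := IH ltac:(lia); apply: NNPP => N; apply: K; exists p; split; first by lia.
    by split=> //; have <- : S (m - S p) = (m - p)%nat by lia.
  apply: K; exists m; split=> //; split; first exact: A.
  by move=> /Sle; lia.
have [Y [Z [c [r [Phi [w [pt [Lp [Hc Sh]]]]]]]]] := Sp.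
have [|x [vs [F2 H2]]] := grid_in_sheet c0 (St (S (m - p))) p _ Bks (incl_refl _) Y Z c r Phi w pt Lp Hc Sh.
  move=> B HBk [Y' [Z' [c' [r' [Phi' [w' [pt' [Lp' [Hc' [Sh' K]]]]]]]]]]; apply: Np.
  by have := sheet_extend c0 Y' Z' c' r' Phi' w' (m - p) B pt' Hc' tq Sh' HBk K; rewrite Lp'.
exists x, vs; split=> //.
have PT ns : length ns = length vs -> P (fun i => x i + fold_right (fun vn s => fst vn (snd vn) i + s) 0 (combine vs ns)).
  move=> L; have [e [He E]] := H2 ns L; have [_ [_ [_ [_ SP]]]] := Sh.
  have -> : (fun i => x i + fold_right (fun vn s => fst vn (snd vn) i + s) 0 (combine vs ns)) = Phi e.
    by apply: functional_extensionality => i; rewrite E.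
  exact: St_P (SP e He).
split=> // i Hi; have [e [He E]] := H2 (repeat 0%nat (length vs)) (repeat_length _ _).
have [ND [YZ CYZ]] := pt; have [_ [_ [aPhi _]]] := Sh.
move: (E i); rewrite aPhi; last by move=> K; apply: Hi; apply/CYZ; right.
rewrite (proj2 He); last by move=> K; apply: Hi; apply/CYZ; left.
rewrite Hc //; move=> ->; suff -> : fold_right (fun vn s => fst vn (snd vn) i + s) 0 (combine vs (repeat 0%nat (length vs))) = 0 by rewrite add0.
have iB B : In B Bks -> ~ In i B by move=> HBk K; apply: Hi; apply: BC K.
elim: F2 iB {H2 PT E} => [|B v Bs vs' tv F2 IH] iB //=.
by rewrite IH; [rewrite (proj1 tv) ?add0 //; apply: iB; left|move=> B' HB'; apply: iB; right].
Qed.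
End Core.

(** * Counting points with poor fibers *)

Lemma split_count {A} (Q : A -> Prop) (L : list A) : NoDup L -> exists L1 L2, NoDup L1 /\ NoDup L2 /\
  length L = (length L1 + length L2)%nat /\ (forall a, In a L1 <-> In a L /\ Q a) /\ (forall a, In a L2 <-> In a L /\ ~ Q a).
Proof.
elim: L => [|a L IH] ND; first by exists [], []; do 3!split=> //; split=> a; split=> // -[].
have [Na NL] : ~ In a L /\ NoDup L by inversion ND.
have [L1 [L2 [N1 [N2 [E [H1 H2]]]]]] := IH NL.
case: (classic (Q a)) => Qa.
  exists (a :: L1), L2; split; first by constructor=> //; rewrite H1 => -[].
  split=> //; split; first by rewrite /= E.
  split=> x; rewrite ?H1 ?H2 /=; first by rewrite H1; intuition; subst.
  by intuition; subst.
exists L1, (a :: L2); split=> //; split; first by constructor=> //; rewrite H2 => -[].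
split; first by rewrite /= E; lia.
split=> x; rewrite ?H1 ?H2 /=; first by intuition; subst.
by rewrite H2; intuition; subst.
Qed.
Lemma fiber_count {A B} (g : A -> B) K (D : list B) : forall L : list A, NoDup L -> (forall a, In a L -> In (g a) D) ->
  (forall c L', NoDup L' -> incl L' L -> (forall a, In a L' -> g a = c) -> (length L' <= K)%nat) ->
  (length L <= K * length D)%nat.
Proof.
elim: D => [|d D IH] L ND H HK; first by case: L ND H {HK} => [|a L] ND H; [simpl; lia|case: (H a); left].
have [L1 [L2 [N1 [N2 [E [H1 H2]]]]]] := split_count (fun a => g a = d) L ND.
have K1 : (length L1 <= K)%nat by apply: (HK d) => // a /H1 [].
have K2 : (length L2 <= K * length D)%nat.
  apply: IH => //; first by move=> a /H2 [/H [] // E' N]; case: N.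
  by move=> c L' N' I' E'; apply: (HK c) => // a /I' /H2 [].
by rewrite E /=; lia.
Qed.
Lemma cover_count {A I} (Q : I -> A -> Prop) (bound : I -> nat) (idx : list I) : forall L : list A, NoDup L ->
  (forall a, In a L -> exists i, In i idx /\ Q i a) ->
  (forall i L', In i idx -> NoDup L' -> incl L' L -> (forall a, In a L' -> Q i a) -> (length L' <= bound i)%nat) ->
  (length L <= list_sum (map bound idx))%nat.
Proof.
elim: idx => [|d D IH] L ND H HK; first by case: L ND H {HK} => [|a L] ND H; [simpl; lia|case: (H a (or_introl eq_refl)) => x []].
have [L1 [L2 [N1 [N2 [E [H1 H2]]]]]] := split_count (Q d) L ND.
have K1 : (length L1 <= bound d)%nat by apply: HK => //; [left|move=> a /H1 []|move=> a /H1 []].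
have K2 : (length L2 <= list_sum (map bound D))%nat.
  apply: IH => //; first by move=> a /H2 [/H [i [[<-|Hi] Qi]] N] //; exists i.
  by move=> i L' Hi N' I' E'; apply: HK => //; [right|move=> a /I' /H2 []].
by rewrite E /=; lia.
Qed.
Lemma in_choices {A} (ls : list (list A)) xs : In xs (choices ls) <-> Forall2 (fun l x => In x l) ls xs.
Proof.
elim: ls xs => [|l ls IH] xs /=.
  by split=> [[<-|//]|H]; [constructor|inversion H; left].
rewrite in_flat_map; split.
  by move=> [x [Hx]]; rewrite in_map_iff => -[ys [<- /IH Hy]]; constructor.
by move=> H; inversion H; subst; exists y; split=> //; apply: in_map; apply/IH.
Qed.
Lemma length_choices {A} (ls : list (list A)) : length (choices ls) = prod_nat (map (@length _) ls).
Proof.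
elim: ls => [|l ls IH] //=; rewrite -IH; elim: l => [|x l IHl] //=.
by rewrite length_app IHl length_map.
Qed.
Fixpoint rm {A} (i : nat) (l : list A) : list A :=
  match l, i with [], _ => [] | _ :: l, O => l | a :: l, S i => a :: rm i l end.
Lemma rm_nth {A} i (l l' : list A) d : length l = length l' -> rm i l = rm i l' -> forall j, j <> i -> nth j l d = nth j l' d.
Proof.
elim: i l l' => [|i IH] [|a l] [|a' l'] //= -[L] E [|j] N //=; [by rewrite E|by case: E|].
by case: E => _ E; apply: IH => // K; apply: N; rewrite K.
Qed.
Lemma rm_inj {A} i (l l' : list A) d : length l = length l' -> rm i l = rm i l' -> nth i l d = nth i l' d -> l = l'.
Proof.
elim: i l l' => [|i IH] [|a l] [|a' l'] //= -[L] E E'; first by rewrite E E'.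
by case: E => -> E; rewrite (IH l l').
Qed.
Lemma rm_Forall2 {A B} (R : A -> B -> Prop) i l l' : Forall2 R l l' -> Forall2 R (rm i l) (rm i l').
Proof. by move=> H; elim: H i => [|a b l1 l2 Hab H IH] [|i] //=; constructor. Qed.
Lemma map_rm {A B} (f : A -> B) i l : map f (rm i l) = rm i (map f l).
Proof. by elim: l i => [|a l IH] [|i] //=; rewrite IH. Qed.
Lemma delta_rm l : delta l = list_sum (map (fun i => prod_nat (rm i l)) (seq 0 (length l))).
Proof.
have H pre : delta_aux pre l = list_sum (map (fun i => prod_nat (pre ++ rm i l)) (seq 0 (length l))).
  elim: l pre => [|n l IH] pre //=; rewrite IH -seq_shift map_map; congr (_ + list_sum _)%nat.
  by apply: map_ext => i /=; rewrite -app_assoc.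
exact: (H []).
Qed.
Lemma map_eq_in {A B} (f g : A -> B) l : map f l = map g l -> forall x, In x l -> f x = g x.
Proof. by elim: l => [|a l IH] //= [E1 E2] x [<-|]; [|apply: IH]. Qed.
Lemma list_sum_mul c l : list_sum (map (Nat.mul c) l) = (c * list_sum l)%nat.
Proof. by elim: l => [|a l IH] //=; rewrite ?IH; lia. Qed.

(** Encodes the position of [z] among the listed points, telling apart being at a point and being
    beyond it, with at most [2 * length Ls + 1] values. *)
Fixpoint rank (Ls : list T) (z : T) : nat :=
  match Ls with
  | [] => 0
  | p :: Ls => (match excluded_middle_informative (olt G p z) with left _ => 2 | right _ =>
      match excluded_middle_informative (p = z) with left _ => 1 | right _ => 0 end end + rank Ls z)%nat
  end.
Lemma rank_le Ls z : (rank Ls z <= 2 * length Ls)%nat.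
Proof. by elim: Ls => [|p Ls IH] //=; case: excluded_middle_informative => _; [|case: excluded_middle_informative => _]; lia. Qed.
(** Every summand is monotone in [z] and changes when [z] reaches or passes its point, so equal
    ranks leave no listed point in between. *)
Lemma rank_mono Ls z z' : z < z' -> (rank Ls z <= rank Ls z')%nat /\
  (rank Ls z = rank Ls z' -> forall p, In p Ls -> p < z \/ z' < p).
Proof.
move=> L; elim: Ls => [|p Ls [IH1 IH2]] //=.
have C : (p < z /\ p < z') \/ (~ p < z /\ p < z') \/ (~ p < z /\ ~ p = z /\ ~ p < z' /\ p = z') \/ (~ p < z /\ ~ p = z /\ ~ p < z' /\ ~ p = z').
  case: (lt_tot p z) => [?|[E|?]]; first by left; split=> //; olra.
    by right; left; subst p; split=> //; apply: lt_irr.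
  have N1 : ~ p < z by olra.
  have N2 : p <> z by move=> E; subst p; olra.
  case: (lt_tot p z') => [?|[E|?]]; first by right; left.
    by right; right; left; subst p; do 3!split=> //; apply: lt_irr.
  right; right; right; split=> //; split=> //; split; first by olra.
  by move=> E; subst p; olra.
case: (excluded_middle_informative (olt G p z)) => A; case: (excluded_middle_informative (olt G p z')) => B;
  try (case: (excluded_middle_informative (p = z)) => A'); try (case: (excluded_middle_informative (p = z')) => B').
all: split; [by lia || by exfalso; intuition|].
all: move=> E q [<-|Hq]; try (by apply: IH2 => //; lia).
all: try (by left); try (by exfalso; lia); try (by exfalso; intuition).
all: by right; case: (lt_tot p z') => [?|[?|?]].
Qed.

Lemma finite_bound {I} (Q : I -> nat -> Prop) (L : list I) : (forall i N N', (N <= N')%nat -> Q i N -> Q i N') ->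
  (forall i, In i L -> exists N, Q i N) -> exists N, forall i, In i L -> Q i N.
Proof.
move=> mono; elim: L => [|a L IH] H; first by exists 0%nat.
have [|N HN] := IH; first by move=> i Hi; apply: H; right.
have [N' HN'] := H a (or_introl eq_refl); exists (Nat.max N N') => i [<-|Hi].
  by apply: mono HN'; lia.
by apply: mono (HN i Hi); lia.
Qed.

(** The length [q] is stored in the coordinate [qv] of the assignment, so the bound is uniform in
    [q] as well as in the parameters of the family. *)
Lemma uniform_proj (P : env -> Prop) Bks qv K c : Def P -> 0 < c -> exists N, forall n, (n <= K)%nat -> forall B l, In B Bks -> In l B ->
  forall e, exists Ls, (length Ls <= N)%nat /\ bps (fun z => Proj (St P Bks qv n) B l (upd e l z)) Ls.
Proof.
move=> dP c0.
pose Q n B l N := forall e, exists Ls, (length Ls <= N)%nat /\ bps (fun z => Proj (St P Bks qv n) B l (upd e l z)) Ls.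
have mono n B l N N' : (N <= N')%nat -> Q n B l N -> Q n B l N'.
  by move=> L H e; have [Ls [L1 H1]] := H e; exists Ls; split=> //; lia.
have [|i|N HN] := finite_bound (fun n N => forall B l, In B Bks -> In l B -> Q n B l N) (seq 0 (S K)).
- by move=> i N N' L H B l HB Hl; apply: mono L (H B l HB Hl).
- move=> _; have [|B|N HN] := finite_bound (fun B N => forall l, In l B -> Q i B l N) Bks.
  + by move=> B N N' L H l Hl; apply: mono L (H l Hl).
  + move=> HB; have [|l|N HN] := finite_bound (fun l N => Q i B l N) B; [by move=> l N N'; apply: mono| |by exists N].
    move=> Hl; have dR := def_Proj _ B l (def_St P Bks qv dP i).
    pose W e := Proj (St P Bks qv i) B l (upd (eshift e) l (e 0%nat)).
    have dW : Def W by rewrite /W; ddef.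
    by have [N HN] := uniform_bps W dW c c0; exists N.
  by exists N => B l HB Hl; apply: HN.
by exists N => n Ln B l HB Hl; apply: HN => //; apply/in_seq; lia.
Qed.

Lemma bounded_choice {I} (g : I -> nat) K B : (forall l, In l B -> (g l < K)%nat) ->
  Forall2 (fun l x => In x l) (repeat (seq 0 K) (length B)) (map g B).
Proof.
elim: B => [|l B IH] R /=; first by constructor.
constructor; last by apply: IH => x Hx; apply: R; right.
by apply/in_seq; have := R l (or_introl eq_refl); lia.
Qed.
(** The vector of ranks of the coordinates in [B] determines the point. For equal ranks, two values
    of a coordinate span an interval inside the projection, which is shorter than [q] because the
    fiber is poor; if this holds for all coordinates, the points are not separated. *)
Lemma poor_count {A} (f : A -> env) (L : list A) (e0 : env) (X : env -> Prop) B qv N : NoDup L ->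
  (forall l, In l B -> exists Ls, (length Ls <= N)%nat /\ bps (fun z => Proj X B l (upd e0 l z)) Ls) ->
  (forall a, In a L -> agree B e0 (f a) /\ X (f a)) ->
  (forall a a', In a L -> In a' L -> a <> a' -> exists l, In l B /\ ~ bd (e0 qv) (f a l - f a' l)) ->
  (forall l, In l B -> ~ Rich qv X B l e0) -> 0 < e0 qv ->
  (length L <= (2 * N + 1) ^ length B)%nat.
Proof.
move=> ND HLs HL Hsep Hpoor q0.
pose Lsf l := epsilon (inhabits []) (fun Ls => (length Ls <= N)%nat /\ bps (fun z => Proj X B l (upd e0 l z)) Ls).
have HLsf l : In l B -> (length (Lsf l) <= N)%nat /\ bps (fun z => Proj X B l (upd e0 l z)) (Lsf l).
  by move=> Hl; apply: (epsilon_spec (inhabits []) (fun Ls => (length Ls <= N)%nat /\ bps (fun z => Proj X B l (upd e0 l z)) Ls)); apply: HLs.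
pose kap a := map (fun l => rank (Lsf l) (f a l)) B.
have PX a l : In a L -> In l B -> Proj X B l (upd e0 l (f a l)).
  move=> Ha Hl; have [Hag Xa] := HL a Ha; exists (f a); split=> // i Hi.
  case: (Nat.eq_dec i l) => [->|N']; first by rewrite upd_eq.
  by rewrite upd_ne //; apply: Hag => K; apply: Hi; rewrite rem_in.
have near a a' l : In a L -> In a' L -> In l B -> rank (Lsf l) (f a l) = rank (Lsf l) (f a' l) -> f a l < f a' l -> f a' l - f a l < e0 qv.
  move=> Ha Ha' Hl E Lt; apply: NNPP => K; apply: (Hpoor l Hl).
  have [_ H2] := rank_mono (Lsf l) _ _ Lt; have {}H2 := H2 E.
  exists (f a l) => z Hz; have [_ Hb] := HLsf l Hl.
  apply/(Hb (f a l) z); [olra| |exact: PX].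
  by move=> p Hp; case: (H2 p Hp) => ?; olra.
have inj a a' : In a L -> In a' L -> kap a = kap a' -> a = a'.
  move=> Ha Ha' E; apply: NNPP => Ne; have [l [Hl Nb]] := Hsep a a' Ha Ha' Ne; apply: Nb.
  have El := map_eq_in _ _ _ E l Hl.
  case: (lt_tot (f a l) (f a' l)) => [Lt|[Eq|Lt]].
  - by have := near a a' l Ha Ha' Hl El Lt; rewrite /bd; olra.
  - by rewrite Eq /bd; olra.
  - by have := near a' a l Ha' Ha Hl (Logic.eq_sym El) Lt; rewrite /bd; olra.
have NDk : NoDup (map kap L).
  elim: L ND inj {HL Hsep PX near} => [|a L IH] ND inj /=; first by constructor.
  have [Na NL] : ~ In a L /\ NoDup L by inversion ND.
  constructor; last by apply: IH => // x y Hx Hy; apply: inj; right.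
  rewrite in_map_iff => -[x [E Hx]]; apply: Na; suff -> : a = x by [].
  by apply: inj; [left|right|].
rewrite -(length_map kap L).
have <- : length (choices (repeat (seq 0 (2 * N + 1)) (length B))) = ((2 * N + 1) ^ length B)%nat.
  by rewrite length_choices; elim: (length B) => [|n IH] //=; rewrite IH length_seq.
apply: NoDup_incl_length => // ks; rewrite in_map_iff => -[a [<- Ha]]; apply/in_choices.
have R l : In l B -> (rank (Lsf l) (f a l) < 2 * N + 1)%nat.
  by move=> Hl; have := rank_le (Lsf l) (f a l); have [] := HLsf l Hl; lia.
exact: bounded_choice R.
Qed.

Fixpoint blocks (o : nat) (ds : list nat) : list (list nat) :=
  match ds with [] => [] | d :: ds => seq o d :: blocks (o + d) ds end.
Lemma concat_blocks o ds : concat (blocks o ds) = seq o (fold_right Nat.add 0%nat ds).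
Proof. by elim: ds o => [|d ds IH] o //=; rewrite IH seq_app. Qed.
Lemma blocks_length o ds : Forall2 (fun B d => length B = d) (blocks o ds) ds.
Proof. by elim: ds o => [|d ds IH] o /=; constructor=> //; apply: length_seq. Qed.
Lemma concat_inj {A} (xs ys : list (list A)) : Forall2 (fun x y => length x = length y) xs ys -> concat xs = concat ys -> xs = ys.
Proof.
elim=> [|x y xs' ys' L _ IH] //= E.
have [-> E'] : x = y /\ concat xs' = concat ys'.
  elim: x y L E {IH} => [|a x IHx] [|b y] //= [L] [-> E]; have [-> ->] := IHx y L E; by [].
by rewrite IH.
Qed.
Lemma Forall2_len {A B} (R : A -> B -> Prop) l l' : Forall2 R l l' -> length l = length l'.
Proof. by elim=> //= ? ? ? ? _ _ ->. Qed.
Lemma Forall2_nth {A B} (R : A -> B -> Prop) l l' d d' i : Forall2 R l l' -> (i < length l)%nat -> R (nth i l d) (nth i l' d').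
Proof. by move=> H; elim: H i => [|a b l1 l2 Hab _ IH] [|i] //= Li; [lia|lia|apply: IH; lia]. Qed.
Lemma map_nth_seq {A} (l : list A) d : map (fun i => nth i l d) (seq 0 (length l)) = l.
Proof. by elim: l => [|a l IH] //=; rewrite -seq_shift map_map IH. Qed.
Lemma min_over {A} (h : A -> T) (Q : A -> Prop) (L : list A) : (exists a, In a L /\ Q a) ->
  exists a, In a L /\ Q a /\ forall a', In a' L -> Q a' -> h a <= h a'.
Proof.
elim: L => [|a L IH]; first by move=> [a [[]]].
move=> H; case: (classic (exists x, In x L /\ Q x)) => [/IH [x [Hx [Qx Mx]]]|N].
  case: (classic (Q a /\ h a < h x)) => [[Qa La]|Na].
    by exists a; split; [left|split=> // y [<-|Hy] Qy; [olra|have := Mx y Hy Qy; olra]].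
  exists x; split; [by right|split=> // y [<-|Hy] Qy; last exact: Mx].
  by move=> L'; apply: Na.
case: H => x [[<-|Hx] Qx]; last by case: N; exists x.
by exists a; split; [left|split=> // y [<-|Hy] Qy; [olra|case: N; exists y]].
Qed.

Lemma sum_abs_ge0 x : 0 <= sum_abs G x.
Proof. by elim: x => [|a x IH] /=; [olra|have := oabs_ge0 a; olra]. Qed.
Lemma tall_tupleE x : tall_tuple G x <-> tall (sum_abs G x).
Proof.
have s0 := sum_abs_ge0 x; rewrite /tall_tuple /short_tuple /short_elt; set s := sum_abs G x in s0 *.
have -> : oabs G s = s by case: (oabsE s) => [] [? ->]; olra.
split=> [N|[p N] [E|//]]; last by rewrite E in p; case: (lt_irr 0).
split; last by move=> K; apply: N; right.
by case: (le_eqlt _ _ s0) => // E; case: N; left.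
Qed.
Lemma sum_abs_sub B (f g : nat -> T) : sum_abs G (tsub G (map f B) (map g B)) = sabs B (fun i => f i - g i).
Proof. by elim: B => [|b B IH] //=; rewrite /sabs /= -/(sabs B _) -IH. Qed.

Lemma dirs_off Bs vs ns i : Forall2 tall_dirs Bs vs -> (forall B, In B Bs -> ~ In i B) ->
  fold_right (fun vn s => fst vn (snd vn) i + s) 0 (combine vs ns) = 0.
Proof.
move=> F; elim: F ns => [|B v Bs' vs' tv F IH] [|n ns] //= iB.
by rewrite IH; [rewrite (proj1 tv) ?add0 //; apply: iB; left|move=> B' HB'; apply: iB; right].
Qed.

Definition gset (x : nat -> T) (p : list nat * (nat -> nat -> T)) : list T -> Prop :=
  fun l => exists n, l = map (fun i => x i + snd p n i) (fst p).
Lemma gset_infinite x B v : tall_dirs B v -> ~ finite_set (gset x (B, v)) /\ tall_set G (gset x (B, v)).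
Proof.
move=> [v0 tv].
have SE n n' : sum_abs G (tsub G (map (fun i => x i + v n i) B) (map (fun i => x i + v n' i) B)) = sabs B (fun i => v n i - v n' i).
  by rewrite sum_abs_sub; apply: sumY_ext => i _; congr oabs; olra.
have inj n n' : map (fun i => x i + v n i) B = map (fun i => x i + v n' i) B -> n = n'.
  move=> E; apply: NNPP => N; have := tv n n' N; rewrite -SE E sum_abs_sub.
  suff -> : sabs B (fun i => x i + v n' i - (x i + v n' i)) = 0 by case=> /lt_irr.
  apply: sumY0 => i _; have -> : x i + v n' i - (x i + v n' i) = 0 by olra.
  by case: (oabsE 0) => [] [? ->]; olra.
split.
  move=> [l Hl].
  pose ff n := map (fun i => x i + v n i) B.
  have : (length (map ff (seq 0 (S (length l)))) <= length l)%nat.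
    apply: NoDup_incl_length; last by move=> y /in_map_iff [n [<- _]]; apply: Hl; exists n.
    by apply: Injective_map_NoDup; [move=> n n' /inj|apply: seq_NoDup].
  by rewrite length_map length_seq; lia.
move=> y z [n ->] [n' ->] N; apply/tall_tupleE; rewrite /= SE; apply: tv => E; apply: N; by rewrite E.
Qed.
Lemma nodup_app {A} (l l' : list A) : NoDup (l ++ l') -> NoDup l' /\ forall i, In i l -> ~ In i l'.
Proof.
elim: l => [|a l IH] //= H; have [Na /IH [H1 H2]] : ~ In a (l ++ l') /\ NoDup (l ++ l') by inversion H.
by split=> // i [<-|] //; [move=> K; apply: Na; apply/in_app_iff; right|apply: H2].
Qed.
Lemma gset_product x Bs vs xs : NoDup (concat Bs) -> Forall2 tall_dirs Bs vs ->
  Forall2 (fun (B : list T -> Prop) y => B y) (map (gset x) (combine Bs vs)) xs ->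
  exists ns, length ns = length vs /\
    concat xs = map (fun i => x i + fold_right (fun vn s => fst vn (snd vn) i + s) 0 (combine vs ns)) (concat Bs).
Proof.
move=> ND F; elim: F xs ND => [|B v Bs' vs' tv F IH] xs /= ND H.
  by inversion H; exists [].
have [ND' Dis] := nodup_app _ _ ND.
case: xs H => [|y xs'] H; first by inversion H.
have [[n Hy] H'] : gset x (B, v) y /\ Forall2 (fun (B : list T -> Prop) y => B y) (map (gset x) (combine Bs' vs')) xs' by inversion H.
have [ns [L E]] := IH xs' ND' H'.
exists (n :: ns); split; first by rewrite /= L.
rewrite /= Hy E map_app; congr app; apply: map_ext_in => i Hi /=.
  rewrite (dirs_off Bs') ?add0 // => B' HB' K; apply: (Dis i Hi); apply/in_concat; by exists B'.
by rewrite (proj1 tv) ?add0l // => K; apply: (Dis i K).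
Qed.

Lemma seq_plus o n : seq o n = map (Nat.add o) (seq 0 n).
Proof.
elim: o => [|o IH]; first by rewrite map_id.
by rewrite -seq_shift IH map_map; apply: map_ext => i; lia.
Qed.

(** * The bound for the definable family *)

Section Assembly.
Variables (ds : list nat) (k : nat) (E : list T -> Prop).
Let m := fold_right Nat.add 0%nat ds.
Hypothesis HE : definable M (k + m) E.
Let Bks := blocks 0 ds.
(** Layout of an assignment: the grid coordinates come first, then the [k] parameters of the family,
    and last the length [q]. *)
Let qv := (m + k)%nat.
Let P (e : env) := E (map e (seq m k) ++ map e (seq 0 m)).
Let HB : concat Bks = seq 0 m. Proof. exact: concat_blocks. Qed.

Lemma def_fiber : Def P.
Proof.
have dE := definable_Def _ _ HE.
apply: (Def_ext _ _ _ (def_comp _ (fun e i => if Nat.ltb i k then e (m + i)%nat else e (i - k)%nat) dE _)); last first.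
  by move=> i; case: Nat.ltb; apply: dt_var.
move=> e; suff -> : map (fun i => if Nat.ltb i k then e (m + i)%nat else e (i - k)%nat) (seq 0 (k + m)) = map e (seq m k) ++ map e (seq 0 m) by [].
rewrite seq_app map_app; congr app.
  rewrite (seq_plus m k) map_map; apply: map_ext_in => i /in_seq [_ Hi].
  by case: (Nat.ltb_spec i k) => //; lia.
rewrite (seq_plus (0 + k) m) map_map; apply: map_ext_in => i _.
case: (Nat.ltb_spec (0 + k + i) k) => //; first by lia.
by move=> _; congr e; lia.
Qed.

Definition envx (b : list T) (q : T) (l : list T) : env :=
  fun i => if Nat.ltb i m then nth i l 0 else if Nat.ltb i (m + k) then nth (i - m) b 0 else q.
Lemma envx_l b q l : length l = m -> map (envx b q l) (seq 0 m) = l.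
Proof.
move=> L; rewrite -{2}(map_nth_seq l 0) L; apply: map_ext_in => i /in_seq [_ Hi].
by rewrite /envx; case: (Nat.ltb_spec i m) => //; lia.
Qed.
Lemma envx_b b q l : length b = k -> map (envx b q l) (seq m k) = b.
Proof.
move=> L; rewrite -{2}(map_nth_seq b 0) L (seq_plus m k) map_map; apply: map_ext_in => i /in_seq [_ Hi].
rewrite /envx; case: (Nat.ltb_spec (m + i) m) => [|_]; first by lia.
case: (Nat.ltb_spec (m + i) (m + k)) => [_|]; last by lia.
by congr nth; lia.
Qed.
Lemma envx_q b q l : envx b q l qv = q.
Proof.
rewrite /envx /qv; case: (Nat.ltb_spec (m + k) m) => [|_]; first by lia.
by case: (Nat.ltb_spec (m + k) (m + k)) => [|_]; first by lia.
Qed.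
Lemma envx_P b q l : length b = k -> length l = m -> P (envx b q l) <-> E (b ++ l).
Proof. by move=> Lb Ll; rewrite /P envx_l // envx_b. Qed.

Definition tall_grid_in (b : list T) := exists Bs : list (list T -> Prop),
  Forall2 (fun B d => forall x, B x -> length x = d) Bs ds /\
  Forall (fun B => ~ finite_set B /\ tall_set G B) Bs /\
  forall xs, Forall2 (fun B x => B x) Bs xs -> E (b ++ concat xs).

Lemma rich_tall_grid b q l : length b = k -> tall q -> St P Bks qv (S m) (envx b q l) -> tall_grid_in b.
Proof.
move=> Lb tq H; have qm : (m <= qv)%nat by rewrite /qv; lia.
have [|x [vs [F [Hx HP]]]] := rich_grid P Bks m qv def_fiber HB qm (envx b q l) _ H; first by rewrite envx_q.
have L2 := blocks_length 0 ds; rewrite -/Bks in L2.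
exists (map (gset x) (combine Bks vs)); split.
  move: L2 F; clear; move: Bks => Bk L2; elim: L2 vs => [|B d Bk' ds' LB _ IH] vs F /=; first by constructor.
  case: vs F => [|v vs] F; first by inversion F.
  have F' : Forall2 tall_dirs Bk' vs by inversion F.
  by constructor; [move=> y [n ->]; rewrite length_map|apply: IH].
split.
  move: F; clear; elim=> [|B v Bs' vs' tv F IH] /=; first by constructor.
  by constructor=> //; apply: gset_infinite.
move=> xs Hxs; have [|ns [Ln ->]] := gset_product x Bks vs xs _ F Hxs; first by rewrite HB; apply: seq_NoDup.
have := HP ns Ln; rewrite /P HB; set pt := fun i => _.
suff -> : map pt (seq m k) = b by [].
rewrite -[RHS](envx_b b q l Lb); apply: map_ext_in => i /in_seq [Hi _].
have iC : ~ In i (seq 0 m) by rewrite in_seq; lia.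
rewrite /pt (dirs_off Bks) // ?add0; first exact: Hx.
by move=> B HBk K; apply: iC; rewrite -HB; apply/in_concat; exists B.
Qed.

Section Counting.
Variables (b : list T) (Bl : list (list (list T))).
Hypotheses (Lb : length b = k) (ng : ~ tall_grid_in b).
Hypothesis HBl : Forall2 (fun l d => NoDup l /\ forall x, In x l -> length x = d) Bl ds.
Let sizes := map (@length _) Bl.

Lemma choice_lengths xs : In xs (choices Bl) -> Forall2 (fun (x : list T) d => length x = d) xs ds.
Proof.
move=> /in_choices H; elim: H ds HBl => [|l x Bl' xs' Hx _ IH] ds' F; first by inversion F; constructor.
case: ds' F => [|d ds'] F; first by inversion F.
have [[_ H1] F'] : (NoDup l /\ forall x, In x l -> length x = d) /\ Forall2 (fun l d => NoDup l /\ forall x, In x l -> length x = d) Bl' ds' by inversion F.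
by constructor; [apply: H1|apply: IH].
Qed.
Lemma choice_concat xs : In xs (choices Bl) -> length (concat xs) = m.
Proof. by move=> /choice_lengths; rewrite /m; elim=> [|x d xs' ds' <- _ IH] //=; rewrite length_app IH. Qed.
Lemma choice_blocks q xs : In xs (choices Bl) -> map (map (envx b q (concat xs))) Bks = xs.
Proof.
move=> Hxs; apply: concat_inj; last by rewrite -concat_map HB envx_l //; apply: choice_concat.
have F1 := choice_lengths xs Hxs; have F2 := blocks_length 0 ds; rewrite -/Bks in F2.
move: (envx b q (concat xs)) => g.
elim: F2 xs F1 {Hxs} => [|B d Bk ds' LB _ IH] xs F1; first by inversion F1; constructor.
case: xs F1 => [|x xs] F1; first by inversion F1.
have [Lx F1'] : length x = d /\ Forall2 (fun (x : list T) d => length x = d) xs ds' by inversion F1.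
by constructor; [rewrite length_map LB Lx|apply: IH].
Qed.
Lemma choice_block q xs i : In xs (choices Bl) -> nth i xs [] = map (envx b q (concat xs)) (nth i Bks []).
Proof. by move=> Hxs; rewrite -{1}(choice_blocks q xs Hxs) (map_nth (map (envx b q (concat xs))) Bks []). Qed.

Variable (q : T).
Let f (xs : list (list T)) := envx b q (concat xs).
Lemma block_agree xs xs' i : In xs (choices Bl) -> In xs' (choices Bl) -> rm i xs = rm i xs' ->
  agree (nth i Bks []) (f xs) (f xs').
Proof.
move=> Hxs Hxs' Er l Hl; case: (Nat.lt_ge_cases l m) => Lm; last first.
  by rewrite /f /envx; case: (Nat.ltb_spec l m) => //; lia.
have : In l (concat Bks) by rewrite HB; apply/in_seq; lia.
move=> /in_concat [B [HBk HlB]]; have [j [Lj Ej]] := In_nth _ _ [] HBk.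
have ji : j <> i by move=> K; subst j; apply: Hl; rewrite Ej.
have LL : length xs = length xs' by rewrite (Forall2_len _ _ _ (choice_lengths xs Hxs)) (Forall2_len _ _ _ (choice_lengths xs' Hxs')).
have := rm_nth i xs xs' [] LL Er j ji; rewrite (choice_block q xs j Hxs) (choice_block q xs' j Hxs') Ej => K.
exact: Logic.eq_sym (map_eq_in _ _ _ K l HlB).
Qed.

Variables (N : nat) (eps : T).
Hypothesis HN : forall n, (n <= m)%nat -> forall B l, In B Bks -> In l B ->
  forall e, exists Ls, (length Ls <= N)%nat /\ bps (fun z => Proj (St P Bks qv n) B l (upd e l z)) Ls.
(** [eps] bounds the distances inside the blocks of the grid from below. A block has at most [m]
    coordinates, so if all of them differed by less than [eps / 2^m], the distance would be below
    [eps]. *)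
Hypotheses (te : tall eps) (qE : q = hfn m eps).
Hypothesis sep : forall l x y, In l Bl -> In x l -> In y l -> x <> y -> eps <= sum_abs G (tsub G x y).

Lemma hfn_anti n n' : (n <= n')%nat -> hfn n' eps <= hfn n eps.
Proof.
move=> L; have -> : n' = (n' - n + n)%nat by lia.
by rewrite -hfn_add; apply: hfn_le; apply: hfn_pos; apply: tall_pos.
Qed.
Lemma block_size i : (length (nth i Bks []) <= m)%nat.
Proof.
rewrite -(length_seq m 0) -HB; move: Bks i; elim=> [|B Bk IH] [|i] //=; rewrite ?length_app; try lia.
by have := IH i; lia.
Qed.
(** Points that agree in all blocks but [i] lie in one fiber over the block [i], and the choice of
    [q] separates them in some coordinate, as [poor_count] requires. *)
Lemma fiber_bound n i L : (n <= m)%nat -> (i < length Bks)%nat -> NoDup L ->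
  (forall xs, In xs L -> In xs (choices Bl) /\ St P Bks qv n (f xs) /\ forall l, In l (nth i Bks []) -> ~ Rich qv (St P Bks qv n) (nth i Bks []) l (f xs)) ->
  (forall xs xs', In xs L -> In xs' L -> rm i xs = rm i xs') -> (length L <= (2 * N + 1) ^ m)%nat.
Proof.
move=> Ln Li ND HL Er; case: L ND HL Er => [|x0 L0] ND HL Er; first by simpl; lia.
set L := x0 :: L0 in ND HL Er *.
have H0 : In x0 L by left.
have [C0 [S0 P0]] := HL x0 H0.
set B := nth i Bks [] in HL P0 *; have HBk : In B Bks by apply: nth_In.
have ep := tall_pos _ te.
apply: Nat.le_trans (_ : ((2 * N + 1) ^ length B <= _)%nat); last by apply: Nat.pow_le_mono_r; [lia|apply: block_size].
apply: (poor_count f L (f x0) (St P Bks qv n) B qv N ND) => //.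
- by move=> l Hl; apply: HN.
- by move=> a Ha; have [Ca [Sa _]] := HL a Ha; split=> //; apply: block_agree => //; apply: Er.
- move=> a a' Ha Ha' Ne; have [Ca _] := HL a Ha; have [Ca' _] := HL a' Ha'.
  apply: NNPP => K.
  have LL : length a = length a' by rewrite (Forall2_len _ _ _ (choice_lengths a Ca)) (Forall2_len _ _ _ (choice_lengths a' Ca')).
  have Nx : nth i a [] <> nth i a' [] by move=> En; apply: Ne; apply: (rm_inj i _ _ []) => //; apply: Er.
  have La : (i < length Bl)%nat.
    by rewrite (Forall2_len _ _ _ HBl) -(Forall2_len _ _ _ (blocks_length 0 ds)).
  have I1 := Forall2_nth _ Bl a [] [] i (proj1 (in_choices Bl a) Ca) La.
  have I2 := Forall2_nth _ Bl a' [] [] i (proj1 (in_choices Bl a') Ca') La.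
  have := sep _ _ _ (nth_In Bl [] La) I1 I2 Nx.
  rewrite (choice_block q a i Ca) (choice_block q a' i Ca') -/B -/(f a) -/(f a') sum_abs_sub.
  have := sumY_bd B (fun l => oabs G (f a l - f a' l)) eps ep; rewrite -/(sabs B _) => Hb.
  have {}Hb := Hb ltac:(move=> l Hl; apply: NNPP => K'; apply: K; exists l; split=> // K2; apply: K'; move: K2; rewrite /f envx_q -/(f a) -/(f a') qE /bd; have := hfn_anti _ _ (block_size i); rewrite -/B; case: (oabsE (f a l - f a' l)) => [] [? ->]; olra).
  by rewrite /bd in Hb; olra.
- by rewrite /f envx_q qE; apply: hfn_pos.
Qed.

(** Without an infinite tall grid no point survives to stage [m + 1], so each is discarded at one of
    [m + 1] steps because of some block [i]. For a given step and block at most [(2N + 1)^m] points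
    lie over each choice of the other blocks, and summing these choices over [i] gives [delta]. *)
Lemma count_bound L : NoDup L -> (forall xs, In xs L -> In xs (choices Bl) /\ E (b ++ concat xs)) ->
  (length L <= S m * ((2 * N + 1) ^ m * delta sizes))%nat.
Proof.
move=> ND HL; set K := ((2 * N + 1) ^ m)%nat.
have tq : tall q by rewrite qE; apply: tall_hfn.
pose poor n i xs := forall l, In l (nth i Bks []) -> ~ Rich qv (St P Bks qv n) (nth i Bks []) l (f xs).
have Lr : length Bks = length sizes by rewrite (Forall2_len _ _ _ (blocks_length 0 ds)) /sizes length_map (Forall2_len _ _ _ HBl).
have X xs : In xs L -> exists n, In n (seq 0 (S m)) /\ (St P Bks qv n (f xs) /\ exists i, In i (seq 0 (length sizes)) /\ poor n i xs).
  move=> Hxs; have [Cx Ex] := HL xs Hxs.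
  have P0 : St P Bks qv 0 (f xs) by apply/envx_P => //; apply: choice_concat.
  have PN : ~ St P Bks qv (S m) (f xs) by move=> H; apply: ng; apply: rich_tall_grid H.
  have [n [Ln [Sn NS]]] : exists n, (n <= m)%nat /\ St P Bks qv n (f xs) /\ ~ St P Bks qv (S n) (f xs).
    apply: NNPP => Nn.
    have A n : (n <= S m)%nat -> St P Bks qv n (f xs).
      elim: n => [|n IH] Hn; first exact: P0.
      by apply: NNPP => K'; apply: Nn; exists n; split; [lia|split=> //; apply: IH; lia].
    by apply: PN; apply: A.
  exists n; split; first by apply/in_seq; lia.
  split=> //; apply: NNPP => Ni; apply: NS; split=> // B HBk; apply: NNPP => Nl; apply: Ni.
  have [i [Li Ei]] := In_nth _ _ [] HBk; exists i; split; first by apply/in_seq; rewrite -Lr; lia.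
  by rewrite /poor Ei => l Hl R; apply: Nl; exists l.
have := cover_count (fun n xs => St P Bks qv n (f xs) /\ exists i, In i (seq 0 (length sizes)) /\ poor n i xs)
  (fun _ => K * delta sizes)%nat (seq 0 (S m)) L ND X.
have -> : list_sum (map (fun _ : nat => (K * delta sizes)%nat) (seq 0 (S m))) = (S m * (K * delta sizes))%nat.
  by elim: (S m) 0%nat => [|n IH] o //=; rewrite IH.
apply=> n L' Hn ND' I' Q'; rewrite delta_rm -list_sum_mul map_map.
apply: (cover_count (fun i xs => St P Bks qv n (f xs) /\ poor n i xs)) => //.
  by move=> xs /Q' [Sx [i [Hi Pi]]]; exists i.
move=> i L2 Hi ND2 I2 Q2.
have -> : prod_nat (rm i sizes) = length (choices (rm i Bl)) by rewrite length_choices map_rm.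
apply: (fiber_count (rm i)) => //.
  by move=> xs /I2 /I' /HL [/in_choices H _]; apply/in_choices; apply: rm_Forall2.
move=> c L3 ND3 I3 E3; apply: (fiber_bound n i) => //.
- by move/in_seq: Hn; lia.
- by rewrite Lr; move/in_seq: Hi; lia.
- by move=> xs H3; have [? ?] := Q2 xs (I3 xs H3); split=> //; case: (HL xs (I' _ (I2 _ (I3 _ H3)))).
- by move=> xs xs' H H'; rewrite !E3.
Qed.
End Counting.

(** Without two distinct points in a block there is no distance from which to derive [q]. The first
    block has at most one point, so the product of all sizes is at most the term of [delta] that
    omits it. *)
Lemma trivial_bound b Bl L : ~ tall_grid_in b -> Forall2 (fun l d => NoDup l /\ forall x : list T, In x l -> length x = d) Bl ds ->
  (forall l x y, In l Bl -> In x l -> In y l -> x = y) -> NoDup L ->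
  (forall xs, In xs L -> In xs (choices Bl) /\ E (b ++ concat xs)) -> (length L <= delta (map (@length _) Bl))%nat.
Proof.
move=> ng HBl triv ND HL.
have L1 : (length L <= prod_nat (map (@length _) Bl))%nat.
  by rewrite -length_choices; apply: NoDup_incl_length => // xs /HL [].
case: Bl HBl triv HL L1 => [|l Bl] HBl triv HL L1.
  (* With no blocks at all [delta] is 0, but then the empty family of sets is an infinite tall grid
     as soon as [E] has a point over [b]. *)
  case: L HL ND {L1} => [|xs L] HL ND //; exfalso; apply: ng; exists []; split; first by inversion HBl; constructor.
  split; first by constructor.
  move=> ys Hys; have [[<-|[]] Ex] := HL xs (or_introl eq_refl).
  by inversion Hys.
have Ll : (length l <= 1)%nat.
  have [NDl _] : NoDup l /\ True by inversion HBl as [|? ? ? ? [H _] _].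
  case: l NDl triv {HBl HL L1} => [|x [|y l]] //= NDl triv; first by lia.
  exfalso; inversion NDl as [|? ? Nx _]; apply: Nx; left.
  by apply: (triv (x :: y :: l)); [left|right; left|left].
by rewrite delta_rm /=; move: L1 => /=; set p := prod_nat _; nia.
Qed.

Theorem zarankiewicz_bound : exists K, (0 < K)%nat /\ forall b, length b = k -> ~ tall_grid_in b ->
  forall Bl, Forall2 (fun l d => NoDup l /\ forall x, In x l -> length x = d) Bl ds ->
  Forall (fun l => tall_set G (fun x => In x l)) Bl ->
  forall L, NoDup L -> (forall xs, In xs L -> In xs (choices Bl) /\ E (b ++ concat xs)) ->
  (length L <= K * delta (map (@length _) Bl))%nat.
Proof.
have [N HN] : exists N, (exists c : T, 0 < c) -> forall n, (n <= m)%nat -> forall B l, In B Bks -> In l B ->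
  forall e, exists Ls, (length Ls <= N)%nat /\ bps (fun z => Proj (St P Bks qv n) B l (upd e l z)) Ls.
  (* The trivial group has no positive [c] for [uniform_proj]; any [N] will do there, since [N] is
     used only next to a tall element. *)
  case: (classic (exists c : T, 0 < c)) => [[c c0]|Nc]; last by exists 0%nat.
  by have [N HN] := uniform_proj P Bks qv m c def_fiber c0; exists N.
(* The factor [S m] counts the steps; the final 1 covers grids in which no block has two points. *)
exists (S m * (2 * N + 1) ^ m + 1)%nat; split; first by lia.
move=> b Lb ng Bl HBl HT L ND HL.
case: (classic (exists p, In p (flat_map (fun l => list_prod l l) Bl) /\ fst p <> snd p)) => [|Np].
  (* The least distance between distinct points of a block is tall because the grid is; it serves as
     [eps]. *)
  move=> /(min_over (fun p => sum_abs G (tsub G (fst p) (snd p)))) [[x y] [/in_flat_map [l [Hl /in_prod_iff [Hx Hy]]] [/= Nxy Mn]]].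
  have te : tall (sum_abs G (tsub G x y)).
    by apply/tall_tupleE; move/Forall_forall: HT => /(_ l Hl); apply.
  have sp l' x' y' : In l' Bl -> In x' l' -> In y' l' -> x' <> y' -> sum_abs G (tsub G x y) <= sum_abs G (tsub G x' y').
    move=> Hl' Hx' Hy' N'; apply: (Mn (x', y')) => //; apply/in_flat_map; exists l'; split=> //.
    by apply/in_prod_iff.
  have H := count_bound b Bl Lb ng HBl _ N _ (HN (ex_intro _ _ (tall_pos _ te))) te Logic.eq_refl sp L ND HL.
  apply: Nat.le_trans H _; set A := ((2 * N + 1) ^ m)%nat; set D := delta _; move: A D => A D; clear; nia.
have := trivial_bound b Bl L ng HBl _ ND HL => H; apply: Nat.le_trans (H _) _; last by set A := ((2 * N + 1) ^ m)%nat; set D := delta _; move: A D => A D; clear; nia.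
move=> l x y Hl Hx Hy; apply: NNPP => Nxy; apply: Np; exists (x, y); split=> //.
by apply/in_flat_map; exists l; split=> //; apply/in_prod_iff.
Qed.
End Assembly.

End Ominimal.

From Stdlib Require Import Reals.

Theorem theorem8p12
  (M : structure) (G : ogroup_data M)
  (HG : is_ogroup_expansion M G)
  (Hsat : saturated M)
  (Homin : o_minimal M G)
  (Hsb : semibounded M G)
  (ds : list nat)            (* r = length ds, d_i = nth i ds *)
  (k : nat) (I : list (carrier M) -> Prop) (E : list (carrier M) -> Prop)
  (HI : definable M k I)
  (HE : definable M (k + fold_right Nat.add 0 ds) E) :
  (* E_b = { x | b ++ x_1 ++ ... ++ x_r ∈ E } *)
  exists alpha : R, (0 < alpha)%R /\
    forall b, I b ->
      (* E_b contains no infinite tall grid *)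
      ~ (exists Bs : list (list (carrier M) -> Prop),
           Forall2 (fun B d => forall x, B x -> length x = d) Bs ds /\
           Forall (fun B => ~ finite_set B /\ tall_set G B) Bs /\
           forall xs, Forall2 (fun B x => B x) Bs xs -> E (b ++ concat xs)) ->
      (* then |E_b ∩ B| <= alpha * δ(B) for every finite tall grid B *)
      forall Bl : list (list (list (carrier M))),
        Forall2 (fun l d => NoDup l /\ forall x, In x l -> length x = d) Bl ds ->
        Forall (fun l => tall_set G (fun x => In x l)) Bl ->
        forall L : list (list (list (carrier M))),
          NoDup L ->
          (forall xs, In xs L -> In xs (choices Bl) /\ E (b ++ concat xs)) ->
          (INR (length L) <= alpha * INR (delta (map (@length _) Bl)))%R.
Proof.
pose OS := Omg M G HG Homin Hsat.
have [K [K0 HK]] := zarankiewicz_bound (OS := OS) ds k E HE.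
exists (INR K); split; first by apply: lt_0_INR.
move=> b Ib ng Bl HBl HT L ND HL; rewrite -mult_INR; apply: le_INR.
by apply: HK HL => //; apply: (proj1 HI).
Qed.
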